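(* Let $\mathcal{C}$ be a quasianalytic IF-system and let $\Sigma,\eta,\rho$ be as in the standing data. If $\mathcal{C}$ contains the IF-system of all computably analytic functions, then $\mathrm{Comp}_{\mathcal{C}}(\rho)\cap\mathrm{Gen}_{\mathcal{C}}(\rho)$ is dense in $\mathrm{Comp}_{\mathcal{C}}(\rho)$. In fact, there is an algorithm which acts as follows: given a $C^\infty$ approximation algorithm for some $\mathcal{S}\in\mathrm{Comp}_{\mathcal{C}}(\rho)$ and a computable map $\epsilon:\Delta(\rho)\to\mathbb{Q}_+$, the algorithm returns a $C^\infty$ approximation algorithm for some $\mathcal{T}\in\mathrm{Gen}_{\mathcal{C}}(\rho)\cap\mathrm{Ball}_{\mathcal{C}}(\mathcal{S},\epsilon)$.
   Context: Conventions. $\mathbb{N}=\{0,1,2,\dots\}$, $\mathbb{N}_+=\{1,2,\dots\}$, $\mathbb{Q}_+$ is the set of positive rationals. For $r\in\mathbb{Q}_+^n$, $[-r,r]=\prod_{i=1}^n[-r_i,r_i]$. For a map $\xi:\{1,\dots,k\}\to\{1,\dots,m\}$, $\Pi_\xi(x)=(x_{\xi(1)},\dots,x_{\xi(k)})$. ''Computable'' means Turing computable on standard codes (''names'') of finite objects; algorithms and computable maps are given to other algorithms via codes. A rational box is a product of nonempty (possibly degenerate) intervals with endpoints in $\mathbb{Q}\cup\{\pm\infty\}$. $\mathrm{td}_K L$ is transcendence degree. Quasianalytic IF-system. A family $\mathcal{C}=\bigcup_{n\in\mathbb{N},r\in\mathbb{Q}_+^n}\mathcal{C}_r$, where each $\mathcal{C}_r$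 is a ring of real-valued functions on $[-r,r]$ containing the restrictions of all polynomials in $\mathbb{Q}[x_1,\dots,x_n]$, such that: (i) every $f\in\mathcal{C}_r$ is $C^\infty$ and is the restriction of some member of $\mathcal{C}_{r'}$ with $r'_i>r_i$ for all $i$; (ii) (composition) if $f\in\mathcal{C}_s$, $s\in\mathbb{Q}_+^k$, $g_1,\dots,g_k\in\mathcal{C}_r$ and $(g_1,\dots,g_k)([-r,r])\subseteq[-s,s]$, then $f\circ(g_1,\dots,g_k)\in\mathcal{C}_r$; (iii) (division by variables) if $f\in\mathcal{C}_r$ vanishes wherever $x_i=0$, then $f=x_ig$ for some $g\in\mathcal{C}_r$; (iv) (implicit functions) if $f\in(\mathcal{C}_{(r,s)})^k$ with $r\in\mathbb{Q}_+^m$, $s\in\mathbb{Q}_+^k$, and $\{(x,y)\in[-r,r]\times[-s,s]:f(x,y)=0\}$ is the graph of a function $g:[-r,r]\to\prod_i(-s_i,s_i)$ on which $\det\frac{\partial f}{\partial y}\neq0$, then the components of $g$ are in $\mathcal{C}_r$; (v) (quasianalyticity) if $f\in\mathcal{C}_r$ and all partial derivatives of $f$ of all orders vanish at some point of $[-r,r]$, then $f=0$. Computably analytic functions. For open $U\subseteq\mathbb{R}^n$, a $C^\infty$ function $f:U\to\mathbb{R}$ is computably $C^\infty$ if there is an algorithm which, given $\alpha\in\mathbb{N}^n$, a compact rational box $B\subseteq\mathbb{R}^n$ and an open rational interval $I$, stops if and only if $B\subseteq U$ and $\frac{\partial^{|\alpha|}f}{\partial x^\alpha}(B)\subseteq I$.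 $\mathcal{A}_r$ is the set of all real-valued functions on $[-r,r]$ which extend to a function on a neighborhood of $[-r,r]$ that is both analytic and computably $C^\infty$; $\mathcal{A}=\bigcup_r\mathcal{A}_r$ is the IF-system of all computably analytic functions. ''$\mathcal{C}$ contains $\mathcal{A}$'' means $\mathcal{A}_r\subseteq\mathcal{C}_r$ for all $r$. Standing data. $\Sigma$ is a computable index set, $\eta:\Sigma\to\mathbb{N}$ and $\rho:\Sigma\to\bigcup_n\mathbb{Q}_+^n$ are computable with $\rho(\sigma)\in\mathbb{Q}_+^{\eta(\sigma)}$. A family of functions in $\mathcal{C}$ with domain map $\rho$ is $\mathcal{S}=\{S_\sigma\}_{\sigma\in\Sigma}$ with $S_\sigma\in\mathcal{C}_{\rho(\sigma)}$ for all $\sigma$. Computably $C^\infty$ families. A $C^\infty$ approximation algorithm for $\mathcal{S}$ is an algorithm which, given $\sigma\in\Sigma$, $\alpha\in\mathbb{N}^{\eta(\sigma)}$, a compact rational box $B\subseteq[-\rho(\sigma),\rho(\sigma)]$ and an open rational interval $I$, stops if and only if $\frac{\partial^{|\alpha|}S_\sigma}{\partial x^\alpha}(B)\subseteq I$. $\mathrm{Comp}_{\mathcal{C}}(\rho)$ is the set of families of functions in $\mathcal{C}$ with domain map $\rho$ that have such an algorithm. Put $\Delta(\rho)=\{(\sigma,\alpha):\sigma\in\Sigma,\alpha\in\mathbb{N}^{\eta(\sigma)}\}$. For $\mathcal{S}\in\mathrm{Comp}_{\mathcal{C}}(\rho)$ and computable $\epsilon:\Delta(\rho)\to\mathbb{Q}_+$,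 $\mathrm{Ball}_{\mathcal{C}}(\mathcal{S},\epsilon)$ is the set of $\mathcal{T}\in\mathrm{Comp}_{\mathcal{C}}(\rho)$ such that $\left|\frac{\partial^{|\alpha|}T_\sigma}{\partial x^\alpha}(x)-\frac{\partial^{|\alpha|}S_\sigma}{\partial x^\alpha}(x)\right|<\epsilon(\sigma,\alpha)$ for all $(\sigma,\alpha)\in\Delta(\rho)$ and $x\in[-\rho(\sigma),\rho(\sigma)]$. $\mathrm{Comp}_{\mathcal{C}}(\rho)$ is topologized by taking all these balls as a base. Rational box manifolds and stratifications. A rational box manifold in $\mathbb{R}^m$ is a set $D=U\times\{u\}$ with $E\subseteq\{1,\dots,m\}$, $U\subseteq\mathbb{R}^E$ a nonempty open rational box, $u\in\mathbb{Q}^{E^c}$, $E^c=\{1,\dots,m\}\setminus E$; $\dim D=|E|$. The natural stratification of a nonempty interval $I$ consists of $\mathrm{int}(I)$ (if $I$ is nondegenerate) and $\{e\}$ for each endpoint $e$ of $I$ lying in $I$; the natural stratification of a box $\prod B_i$ consists of all products $\prod C_i$ with $C_i$ in the natural stratification of $B_i$. Names. For $m\in\mathbb{N}_+$, $n\in\mathbb{N}$, $\Delta^0_{m,n}(\rho)$ is the set of tuples $(p(x,y),\sigma,\alpha,\xi,\mathrm{name}(D))$ where: $\sigma,\alpha,\xi$ are maps on $\{1,\dots,n\}$ with $\sigma(i)\in\Sigma$, $\alpha(i)\in\mathbb{N}^{\eta(\sigma(i))}$, $\xi(i)$ an increasing map $\{1,\dots,\eta(\sigma(i))\}\to\{1,\dots,m\}$,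 the images of $\xi(1),\dots,\xi(n)$ being disjoint; $D$ is a rational box manifold with $\dim D>0$, open in some member of the natural stratification of $\left(\prod_{i=1}^n[-\rho(\sigma(i)),\rho(\sigma(i))]\right)\times\mathbb{R}^{\mathrm{im}(\xi)^c}$, where $\mathrm{im}(\xi)=\bigcup_i\mathrm{im}(\xi(i))$ and the $i$th factor is placed in $\mathbb{R}^{\mathrm{im}(\xi(i))}$; and $p\in\mathbb{Q}[x,y]^{\dim D}$ with $x=(x_1,\dots,x_m)$, $y=(y_1,\dots,y_n)$. For a family $\mathcal{S}$, such a tuple names the map $P=p\circ F:D\to\mathbb{R}^{\dim D}$, where $F(x)=(x,f_1(x),\dots,f_n(x))$ and $f_i(x)=\frac{\partial^{|\alpha(i)|}S_{\sigma(i)}}{\partial x^{\alpha(i)}}(\Pi_{\xi(i)}(x))$. Writing $D=U\times\{u\}$ with $U\subseteq\mathbb{R}^E$, a nonsingular zero of $P$ is $a\in D$ with $P(a)=0$ and $\det\frac{\partial P}{\partial x_E}(a)\neq0$. Distinctness. A point $a\in\mathbb{R}^m$ satisfies the $(\sigma,\alpha,\xi)$-distinctness condition if $\Pi_{\xi(j_1)}(a)\neq\Pi_{\xi(j_2)}(a)$ for all $j_1\neq j_2$ in $\{1,\dots,n\}$ with $\sigma(j_1)=\sigma(j_2)$ and $\alpha(j_1)=\alpha(j_2)$. Generic. $\mathcal{S}$ is generic if for all $m\in\mathbb{N}_+$, $n\in\mathbb{N}$, every name $(p(x,y),\sigma,\alpha,\xi,\mathrm{name}(D))\in\Delta^0_{m,n}(\rho)$,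 with named map $P=p\circ F:D\to\mathbb{R}^{\dim D}$, and every nonsingular zero $a$ of the named map $P$ that satisfies the $(\sigma,\alpha,\xi)$-distinctness condition, $\mathrm{td}_{\mathbb{Q}}\mathbb{Q}(F(a))=n$, where $\mathbb{Q}(F(a))$ is the field generated by the coordinates of $F(a)$. $\mathrm{Gen}_{\mathcal{C}}(\rho)$ is the set of generic families of functions in $\mathcal{C}$ with domain map $\rho$. *)

(* Defs.v *)
From HB Require Import structures.
From mathcomp Require Import all_boot all_order all_algebra.
From mathcomp Require Import all_classical all_reals all_analysis.
From mathcomp Require Import (canonicals) mpoly.

Set Implicit Arguments.
Unset Strict Implicit.
Unset Printing Implicit Defensive.

Import Order.TTheory GRing.Theory Num.Theory.
Import numFieldNormedType.Exports.

Local Open Scope classical_set_scope.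
Local Open Scope ring_scope.

(** * Computability

    The model is that of Kleene's partial recursive functions, presented by
    unary programs on nat through the Cantor pairing (a bijection, so that
    [Pair Fst Snd] is the identity). *)

Definition cpair (x y : nat) : nat := ('C((x + y).+1, 2) + y)%N.

Inductive prog : Type :=
  | Zero | Succ | Fst | Snd
  | Pair of prog & prog
  | Comp of prog & prog
  | Prec of prog & prog
  | Mu of prog.

Inductive evaluates : prog -> nat -> nat -> Prop :=
  | evaluates_Zero x : evaluates Zero x 0%N
  | evaluates_Succ x : evaluates Succ x x.+1
  | evaluates_Fst x y : evaluates Fst (cpair x y) x
  | evaluates_Snd x y : evaluates Snd (cpair x y) y
  | evaluates_Pair p q x u v :
      evaluates p x u -> evaluates q x v -> evaluates (Pair p q) x (cpair u v)
  | evaluates_Comp p q x u v :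
      evaluates q x u -> evaluates p u v -> evaluates (Comp p q) x v
  | evaluates_Prec0 p q x v :
      evaluates p x v -> evaluates (Prec p q) (cpair x 0%N) v
  | evaluates_PrecS p q x k u v :
      evaluates (Prec p q) (cpair x k) u -> evaluates q (cpair x (cpair k u)) v ->
      evaluates (Prec p q) (cpair x k.+1) v
  | evaluates_Mu p x k (w : nat -> nat) :
      (forall j, (j < k)%N -> evaluates p (cpair x j) (w j).+1) ->
      evaluates p (cpair x k) 0%N -> evaluates (Mu p) x k.

Definition halts (p : prog) (x : nat) : Prop := exists v, evaluates p x v.

Fixpoint code_prog (p : prog) : nat :=
  match p with
  | Zero => cpair 0 0
  | Succ => cpair 1 0
  | Fst => cpair 2 0
  | Snd => cpair 3 0
  | Pair p q => cpair 4 (cpair (code_prog p) (code_prog q))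
  | Comp p q => cpair 5 (cpair (code_prog p) (code_prog q))
  | Prec p q => cpair 6 (cpair (code_prog p) (code_prog q))
  | Mu p => cpair 7 (code_prog p)
  end.

Fixpoint code_seq (T : Type) (c : T -> nat) (s : seq T) : nat :=
  if s is x :: s' then (cpair (c x) (code_seq c s')).+1 else 0%N.

Definition code_pair (T U : Type) (c : T -> nat) (d : U -> nat) (z : T * U) :=
  cpair (c z.1) (d z.2).

Definition code_int (z : int) : nat :=
  match z with Posz n => n.*2 | Negz n => n.*2.+1 end.

Definition code_rat (q : rat) : nat :=
  cpair (code_int (numq q)) (code_int (denq q)).

Definition code_erat (q : \bar rat) : nat :=
  match q with -oo%E => 0%N | +oo%E => 1%N | (q%:E)%E => (code_rat q).+2 end.

(** * Boxes and intervals with rational data *)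

Definition posq n (r : n.-tuple rat) : Prop := forall i, 0 < tnth r i.

Definition cbox (R : realType) n (r : n.-tuple rat) : set 'rV[R]_n :=
  [set x | forall i, `|x 0 i| <= ratr (tnth r i)].

Definition obox (R : realType) n (r : n.-tuple rat) : set 'rV[R]_n :=
  [set x | forall i, `|x 0 i| < ratr (tnth r i)].

Definition open_itv (R : realType) (I : \bar rat * \bar rat) : set R :=
  [set x | (er_map ratr I.1 < x%:E < er_map ratr I.2)%E].

Definition compact_box (R : realType) n (B : n.-tuple (rat * rat)) :
    set 'rV[R]_n :=
  [set x | forall i, ratr (tnth B i).1 <= x 0 i <= ratr (tnth B i).2].

Definition nonempty_box n (B : n.-tuple (rat * rat)) : Prop :=
  forall i, (tnth B i).1 <= (tnth B i).2.

(** * Functions on subsets of R^n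

    A function on [A] is represented by a total function, of which only the
    restriction to [A] matters. The difference quotients below are taken along
    [A], so that the derivatives are one-sided on the faces of a closed box. *)

Definition dquot (R : realType) n (i : 'I_n) (f : 'rV[R]_n -> R)
    (x : 'rV[R]_n) (h : R) : R :=
  h^-1 * (f (x + h *: delta_mx 0 i) - f x).

Definition along (R : realType) n (A : set 'rV[R]_n) (i : 'I_n)
    (x : 'rV[R]_n) : set_system R :=
  within [set h | A (x + h *: delta_mx 0 i)] 0^'.

Definition pderivable (R : realType) n (A : set 'rV[R]_n) (i : 'I_n)
    (f : 'rV[R]_n -> R) (x : 'rV[R]_n) : Prop :=
  cvg (dquot i f x h @[h --> along A i x]).

Definition pderiv (R : realType) n (A : set 'rV[R]_n) (i : 'I_n)
    (f : 'rV[R]_n -> R) (x : 'rV[R]_n) : R :=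
  lim (dquot i f x h @[h --> along A i x]).

Definition pderivs (R : realType) n (A : set 'rV[R]_n) (s : seq 'I_n)
    (f : 'rV[R]_n -> R) : 'rV[R]_n -> R :=
  foldr (pderiv A) f s.

Definition mpderiv (R : realType) n (A : set 'rV[R]_n) (alpha : n.-tuple nat)
    (f : 'rV[R]_n -> R) : 'rV[R]_n -> R :=
  pderivs A (flatten [seq nseq (tnth alpha i) i | i <- enum 'I_n]) f.

Definition smooth_on (R : realType) n (A : set 'rV[R]_n)
    (f : 'rV[R]_n -> R) : Prop :=
  forall s : seq 'I_n,
    {within A, continuous (pderivs A s f)} /\
    forall i x, A x -> pderivable A i (pderivs A s f) x.

Definition monomial (R : realType) n (alpha : n.-tuple nat) (x : 'rV[R]_n) : R :=
  \prod_(i < n) x 0 i ^+ tnth alpha i.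

Definition analytic_on (R : realType) n (U : set 'rV[R]_n)
    (f : 'rV[R]_n -> R) : Prop :=
  forall a, U a -> exists c : n.-tuple nat -> R,
    \forall x \near a,
      summable [set: n.-tuple nat]
        (fun alpha => (c alpha * monomial alpha (x - a))%:E) /\
      (\sum_(beta : n.-tuple 'I_N)
         c (map_tuple val beta) * monomial (map_tuple val beta) (x - a))
        @[N --> \oo] --> f x.

Definition computably_smooth_on (R : realType) n (U : set 'rV[R]_n)
    (f : 'rV[R]_n -> R) : Prop :=
  smooth_on U f /\
  exists e : prog,
    forall (alpha : n.-tuple nat) (B : n.-tuple (rat * rat))
           (I : \bar rat * \bar rat),
      nonempty_box B -> (I.1 < I.2)%E ->
      halts e (cpair (code_seq id alpha)
                (cpair (code_seq (code_pair code_rat code_rat) B)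
                       (code_pair code_erat code_erat I))) <->
      compact_box B `<=` U /\
      mpderiv U alpha f @` compact_box B `<=` open_itv I.

(** * Systems of functions on the boxes [-r, r] *)

Definition func_system (R : realType) : Type :=
  forall n, n.-tuple rat -> set ('rV[R]_n -> R).

Definition comp_analytic (R : realType) : func_system R := fun n r =>
  [set f | exists (U : set 'rV[R]_n) (g : 'rV[R]_n -> R),
     [/\ open U, cbox r `<=` U, analytic_on U g, computably_smooth_on U g
       & forall x, cbox r x -> f x = g x]].

Definition qpoly_eval (R : realType) n (p : mpoly.mpoly n rat)
    (x : 'rV[R]_n) : R :=
  mpoly.mmap ratr (fun i => x 0 i) p.

Record quasianalytic_IF_system (R : realType) (C : func_system R) : Prop := {
  (* membership depends only on the restriction to the box *)
  ifs_restr : forall n (r : n.-tuple rat) f g, posq r ->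
    C n r f -> (forall x, cbox r x -> f x = g x) -> C n r g;
  ifs_sub : forall n (r : n.-tuple rat) f g, posq r ->
    C n r f -> C n r g -> C n r (fun x => f x - g x);
  ifs_mul : forall n (r : n.-tuple rat) f g, posq r ->
    C n r f -> C n r g -> C n r (fun x => f x * g x);
  ifs_poly : forall n (r : n.-tuple rat) (p : mpoly.mpoly n rat), posq r ->
    C n r (qpoly_eval p);
  ifs_smooth : forall n (r : n.-tuple rat) f, posq r ->
    C n r f -> smooth_on (cbox r) f;
  ifs_extend : forall n (r : n.-tuple rat) f, posq r -> C n r f ->
    exists (r' : n.-tuple rat) g,
      [/\ forall i, tnth r i < tnth r' i, C n r' g
        & forall x, cbox r x -> f x = g x];
  ifs_comp : forall n k (r : n.-tuple rat) (s : k.-tuple rat)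
      f (g : 'I_k -> 'rV[R]_n -> R), posq r -> posq s ->
    C k s f -> (forall j, C n r (g j)) ->
    (forall x, cbox r x -> cbox s (\row_j g j x)) ->
    C n r (fun x => f (\row_j g j x));
  ifs_div : forall n (r : n.-tuple rat) f (i : 'I_n), posq r -> C n r f ->
    (forall x, cbox r x -> x 0 i = 0 -> f x = 0) ->
    exists2 g, C n r g & forall x, cbox r x -> f x = x 0 i * g x;
  ifs_implicit : forall m k (r : m.-tuple rat) (s : k.-tuple rat)
      (f : 'I_k -> 'rV[R]_(m + k) -> R) (g : 'rV[R]_m -> 'rV[R]_k),
    posq r -> posq s ->
    (forall j, C (m + k)%N (cat_tuple r s) (f j)) ->
    (forall x, cbox r x -> obox s (g x)) ->
    (forall x y, cbox r x -> cbox s y ->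
       (forall j, f j (row_mx x y) = 0) <-> y = g x) ->
    (forall x, cbox r x ->
       \det (\matrix_(i < k, j < k)
               pderiv (cbox (cat_tuple r s)) (rshift m j) (f i)
                 (row_mx x (g x))) != 0) ->
    forall j, C m r (fun x => g x 0 j);
  ifs_quasi : forall n (r : n.-tuple rat) f, posq r -> C n r f ->
    (exists2 a, cbox r a & forall alpha, mpderiv (cbox r) alpha f a = 0) ->
    forall x, cbox r x -> f x = 0
}.

(** * Index data and families

    The index set is a computable subset of nat, its elements being identified
    with their codes. *)

Definition idx (Sigma : pred nat) : Type := {s : nat | Sigma s}.

Definition computable_index_data (Sigma : pred nat) (eta : idx Sigma -> nat)
    (rho : forall s, (eta s).-tuple rat) : Prop :=
  [/\ exists e, forall x, evaluates e x (Sigma x),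
      exists e, forall s : idx Sigma, evaluates e (val s) (eta s),
      exists e, forall s : idx Sigma, evaluates e (val s) (code_seq code_rat (rho s))
    & forall s, posq (rho s)].

Definition fun_family (R : realType) Sigma (eta : idx Sigma -> nat) : Type :=
  forall s : idx Sigma, 'rV[R]_(eta s) -> R.

Definition is_family (R : realType) (C : func_system R) Sigma
    (eta : idx Sigma -> nat) (rho : forall s, (eta s).-tuple rat)
    (S : fun_family R eta) : Prop :=
  forall s, C (eta s) (rho s) (S s).

Definition approx_algorithm (R : realType) Sigma
    (eta : idx Sigma -> nat) (rho : forall s, (eta s).-tuple rat)
    (S : fun_family R eta) (e : prog) : Prop :=
  forall (s : idx Sigma) (alpha : (eta s).-tuple nat)
         (B : (eta s).-tuple (rat * rat)) (I : \bar rat * \bar rat),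
    nonempty_box B -> compact_box B `<=` cbox (R := R) (rho s) ->
    (I.1 < I.2)%E ->
    halts e (cpair (val s) (cpair (code_seq id alpha)
               (cpair (code_seq (code_pair code_rat code_rat) B)
                      (code_pair code_erat code_erat I)))) <->
    mpderiv (cbox (rho s)) alpha (S s) @` compact_box B `<=` open_itv I.

Definition CompC (R : realType) (C : func_system R) Sigma
    (eta : idx Sigma -> nat) (rho : forall s, (eta s).-tuple rat) :
    set (fun_family R eta) :=
  [set S | is_family C rho S /\ exists e, approx_algorithm rho S e].

(** [tolerance eta] is the type of maps from Delta(rho) to the rationals. *)
Definition tolerance Sigma (eta : idx Sigma -> nat) : Type :=
  forall s : idx Sigma, (eta s).-tuple nat -> rat.

Definition tol_pos Sigma (eta : idx Sigma -> nat) (eps : tolerance eta) : Prop :=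
  forall s alpha, 0 < eps s alpha.

Definition tol_computed_by Sigma (eta : idx Sigma -> nat)
    (eps : tolerance eta) (e : prog) : Prop :=
  forall (s : idx Sigma) (alpha : (eta s).-tuple nat),
    evaluates e (cpair (val s) (code_seq id alpha)) (code_rat (eps s alpha)).

Definition BallC (R : realType) (C : func_system R) Sigma
    (eta : idx Sigma -> nat) (rho : forall s, (eta s).-tuple rat)
    (S : fun_family R eta) (eps : tolerance eta) : set (fun_family R eta) :=
  [set T | CompC C rho T /\
     forall s (alpha : (eta s).-tuple nat) x, cbox (rho s) x ->
       `|mpderiv (cbox (rho s)) alpha (T s) x
         - mpderiv (cbox (rho s)) alpha (S s) x| < ratr (eps s alpha)].

Definition CompC_balls (R : realType) (C : func_system R) Sigma
    (eta : idx Sigma -> nat) (rho : forall s, (eta s).-tuple rat) :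
    set (set (fun_family R eta)) :=
  [set O | exists S (eps : tolerance eta),
     [/\ CompC C rho S, tol_pos eps, exists e, tol_computed_by eps e
       & O = BallC C rho S eps]].

(** Open sets of the topology with the balls as a base. *)
Definition CompC_open (R : realType) (C : func_system R) Sigma
    (eta : idx Sigma -> nat) (rho : forall s, (eta s).-tuple rat)
    (O : set (fun_family R eta)) : Prop :=
  exists2 F : set (set (fun_family R eta)),
    F `<=` CompC_balls C rho & O = \bigcup_(V in F) V.

Definition CompC_dense (R : realType) (C : func_system R) Sigma
    (eta : idx Sigma -> nat) (rho : forall s, (eta s).-tuple rat)
    (G : set (fun_family R eta)) : Prop :=
  G `<=` CompC C rho /\
  forall O, O !=set0 -> CompC_open C rho O -> O `&` G !=set0.

(** * Rational box manifolds and stratifications *)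

(** [bm_itv i] is only meaningful for [i] in [bm_free], and [bm_pt i] only for
    [i] outside of [bm_free]. *)
Record box_manifold (m : nat) := BoxManifold {
  bm_free : {set 'I_m};
  bm_itv : 'I_m -> \bar rat * \bar rat;
  bm_pt : 'I_m -> rat;
  bm_nonempty : forall i, i \in bm_free -> ((bm_itv i).1 < (bm_itv i).2)%E
}.

Definition bm_dim m (D : box_manifold m) : nat := #|bm_free D|.

Definition bm_set (R : realType) m (D : box_manifold m) : set 'rV[R]_m :=
  [set x | forall i, if i \in bm_free D then open_itv (bm_itv D i) (x 0 i)
                     else x 0 i = ratr (bm_pt D i)].

Definition itv_strata (R : realType) (I : interval R) : set (set R) :=
  [set J | ([set` I]° !=set0 /\ J = [set` I]°) \/
           exists e : R, [/\ e \in I,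
             exists b, I.1 = BSide b e \/ I.2 = BSide b e
             & J = [set e]]].

Definition box_strata (R : realType) m (B : 'I_m -> interval R) :
    set (set 'rV[R]_m) :=
  [set Q | exists J : 'I_m -> set R,
     (forall i, itv_strata (B i) (J i)) /\
     Q = [set x : 'rV[R]_m | forall i, J i (x 0 i)]].

Definition open_in (R : realType) m (Q D : set 'rV[R]_m) : Prop :=
  exists2 O, open O & D = Q `&` O.

(** * Names and the maps they name *)

Record raw_name Sigma (eta : idx Sigma -> nat) (m n : nat) := RawName {
  nm_mfd : box_manifold m;
  nm_poly : 'I_(bm_dim nm_mfd) -> mpoly.mpoly (m + n) rat;
  nm_sigma : 'I_n -> idx Sigma;
  nm_alpha : forall i : 'I_n, (eta (nm_sigma i)).-tuple nat;
  nm_xi : forall i : 'I_n, 'I_(eta (nm_sigma i)) -> 'I_m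
}.

Arguments nm_poly {Sigma eta m n} r j.
Arguments nm_alpha {Sigma eta m n} r i.
Arguments nm_xi {Sigma eta m n} r i k : rename.

Definition is_name (R : realType) Sigma (eta : idx Sigma -> nat)
    (rho : forall s, (eta s).-tuple rat) m n (N : raw_name eta m n) : Prop :=
  [/\ (forall i (k l : 'I_(eta (nm_sigma N i))),
         (k < l)%N -> (nm_xi N i k < nm_xi N i l)%N),
      (forall i j (k : 'I_(eta (nm_sigma N i))) (l : 'I_(eta (nm_sigma N j))),
         i <> j -> nm_xi N i k <> nm_xi N j l),
      (0 < bm_dim (nm_mfd N))%N
    & exists B : 'I_m -> interval R,
      [/\ (forall i (k : 'I_(eta (nm_sigma N i))),
             B (nm_xi N i k) = `[- ratr (tnth (rho (nm_sigma N i)) k),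
                               ratr (tnth (rho (nm_sigma N i)) k)]),
          (forall l, (forall i (k : 'I_(eta (nm_sigma N i))), nm_xi N i k <> l) ->
             B l = `]-oo, +oo[)
        & exists2 Q, box_strata B Q & open_in Q (bm_set (nm_mfd N))]].

Definition name_proj (R : realType) Sigma (eta : idx Sigma -> nat) m n
    (N : raw_name eta m n) (i : 'I_n) (x : 'rV[R]_m) :
    'rV[R]_(eta (nm_sigma N i)) :=
  \row_k x 0 (nm_xi N i k).

Definition nameF (R : realType) Sigma (eta : idx Sigma -> nat)
    (rho : forall s, (eta s).-tuple rat) (S : fun_family R eta) m n
    (N : raw_name eta m n) (x : 'rV[R]_m) : 'rV[R]_(m + n) :=
  row_mx x (\row_(i < n)
    mpderiv (cbox (rho (nm_sigma N i))) (nm_alpha N i) (S (nm_sigma N i))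
      (name_proj N i x)).

Definition nameP (R : realType) Sigma (eta : idx Sigma -> nat)
    (rho : forall s, (eta s).-tuple rat) (S : fun_family R eta) m n
    (N : raw_name eta m n) (x : 'rV[R]_m) : 'rV[R]_(bm_dim (nm_mfd N)) :=
  \row_j qpoly_eval (nm_poly N j) (nameF rho S N x).

Definition nonsingular_zero (R : realType) Sigma (eta : idx Sigma -> nat)
    (rho : forall s, (eta s).-tuple rat) (S : fun_family R eta) m n
    (N : raw_name eta m n) (a : 'rV[R]_m) : Prop :=
  [/\ bm_set (nm_mfd N) a, nameP rho S N a = 0
    & \det (\matrix_(i < bm_dim (nm_mfd N), j < bm_dim (nm_mfd N))
              pderiv (bm_set (nm_mfd N)) (enum_val j)
                (fun x => nameP rho S N x 0 i) a) != 0].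

(** The projections are compared as sequences, as their types depend on the
    index of the factor. *)
Definition distinctness (R : realType) Sigma (eta : idx Sigma -> nat) m n
    (N : raw_name eta m n) (a : 'rV[R]_m) : Prop :=
  forall j1 j2 : 'I_n, j1 <> j2 -> nm_sigma N j1 = nm_sigma N j2 ->
    tval (nm_alpha N j1) = tval (nm_alpha N j2) ->
    codom (name_proj N j1 a 0) <> codom (name_proj N j2 a 0).

(** * Transcendence degree and genericity *)

Definition is_subfield (R : realType) (K : set R) : Prop :=
  [/\ K 1, forall x y, K x -> K y -> K (x - y)
    & forall x y, K x -> K y -> K (x / y)].

(** The prime field of [R] being Q, this is Q(X). *)
Definition field_gen (R : realType) (X : set R) : set R :=
  smallest (@is_subfield R) X.

Definition alg_indep (R : realType) d (b : 'I_d -> R) : Prop :=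
  forall p : mpoly.mpoly d rat, qpoly_eval p (\row_i b i) = 0 -> p = 0.

Definition alg_over (R : realType) (K : set R) (x : R) : Prop :=
  exists p : {poly R}, [/\ p != 0, forall i, K p`_i & root p x].

(** The field [K] has a transcendence basis over Q with [d] elements. *)
Definition trdeg (R : realType) (K : set R) (d : nat) : Prop :=
  exists b : 'I_d -> R,
    [/\ forall i, K (b i), alg_indep b
      & forall x, K x -> alg_over (field_gen (range b)) x].

Definition generic (R : realType) Sigma (eta : idx Sigma -> nat)
    (rho : forall s, (eta s).-tuple rat) (S : fun_family R eta) : Prop :=
  forall (m n : nat) (N : raw_name eta m n) (a : 'rV[R]_m),
    (0 < m)%N -> is_name R rho N -> nonsingular_zero rho S N a ->
    distinctness N a ->
    trdeg (field_gen (range (nameF rho S N a 0))) n.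

Definition GenC (R : realType) (C : func_system R) Sigma
    (eta : idx Sigma -> nat) (rho : forall s, (eta s).-tuple rat) :
    set (fun_family R eta) :=
  [set S | is_family C rho S /\ generic rho S].

(* Main.v *)
Require Import Defs.
From HB Require Import structures.
From mathcomp Require Import all_boot all_order all_algebra.
From mathcomp Require Import all_classical all_reals all_analysis.
From mathcomp Require Import (canonicals) mpoly.
From mathcomp Require Import ring lra zify.

Set Implicit Arguments.
Unset Strict Implicit.
Unset Printing Implicit Defensive.

Import Order.TTheory GRing.Theory Num.Theory.
Import numFieldNormedType.Exports.

Local Open Scope classical_set_scope.
Local Open Scope ring_scope.


(** The perturbed family is T = S + h, where h_s is a sum of monomials
    c x^beta added in finite batches, batch k being found by a search at
    stage k. The coefficients decrease so fast that h_s is entire, computable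
    and, with all its derivatives, within the tolerance.

    Stage k decodes k as a condition: n derivatives f_i of the T_s, composed
    with projections of a box K of R^m that are pairwise disjoint for equal
    (s, alpha), a box B of R^(m+n), and m+n rational polynomials Psi. If Psi
    expands distances on B, then some small batch makes F(K) = (x, f(x))(K)
    miss the part of B where the first m+1 members of Psi vanish. Indeed, by
    Hermite interpolation the n values f_i(x) can be moved independently; for
    N^n choices of the move on a grid of step tau/N, at most about N^(n-1) can
    hit the zero set over one small cell of K, since there Psi is controlled
    by its last n-1 members and hence, by expansion and the pigeonhole
    principle, two hits in a common bucket would be too close. Misses happen
    with a certifiable margin, which the later batches are required to respect.

    If F(a) had transcendence degree r < n, then the minimal polynomials of the
    m+n-r > m dependent coordinates, together with the r independent
    coordinates, would form an expanding Psi near F(a) whose first m+1 members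
    vanish at F(a). So the degree is at least n at every point with the
    distinctness condition. It is at most n at a nonsingular zero: derivations
    of Q(F(a)) yield r independent vectors of R^(m+n) annihilated by the m
    independent differentials of the components of p and of the constant
    coordinates. *)

(** * Computable functions between coded types *)

(** A condition mentions no value of T, only indices, boxes and rational polynomials, so all
    conditions can be listed in advance. The obstacle is effectiveness. Whether Psi expands
    distances is not decided: a stage searches for any of three kinds of evidence, namely that the
    condition is ill formed, that two rational points contradict the expansion, or that a finite
    grid of enclosures proves the avoidance. Some evidence always exists, so the search halts
    without knowing the case. Expansion compares differences, not derivatives, because its failure
    is strict and hence visible at rational points.

    A second obstacle is the tolerance, which bounds infinitely many orders of derivatives. A
    monomial has finitely many nonzero derivatives, and the exponents of a batch are fixed before
    the size of its coefficients is prescribed; so each batch faces finitely many bounds.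

    Finally h itself must be computably analytic. Its values are queried by the same program as
    those of T, with the algorithm for S replaced by one for the zero function, while the batches
    are still computed from S. *)

Definition cnext (p : nat * nat) : nat * nat :=
  if p.1 is x.+1 then (x, p.2.+1) else (p.2.+1, 0%N).

(** [cpair] numbers the pairs along antidiagonals and [cnext] moves to the next pair, so iteration
    from the origin inverts the pairing with no square root to extract. *)
Definition unpair (n : nat) : nat * nat := iter n cnext (0%N, 0%N).
Definition cfst n := (unpair n).1.
Definition csnd n := (unpair n).2.

Lemma cpair_next p : cpair (cnext p).1 (cnext p).2 = (cpair p.1 p.2).+1.
Proof.
case: p => [[|x] y] /=; rewrite /cpair.
  by rewrite add0n !addn0 binS bin1 addnS.
by rewrite !addSn !addnS.
Qed.

Lemma cpair_ge x y : (x + y <= cpair x y)%N.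
Proof.
rewrite /cpair binS bin1.
apply: leq_trans (leq_addr _ _); exact: leq_addl.
Qed.

Lemma unpairK n : cpair (cfst n) (csnd n) = n.
Proof. by elim: n => // n IH; rewrite /cfst /csnd /= cpair_next IH. Qed.

Lemma cpairK x y : unpair (cpair x y) = (x, y).
Proof.
have H n : forall u v, cpair u v = n -> unpair n = (u, v).
  elim: n => [|n IH] u v.
    by move=> h; have := cpair_ge u v; rewrite h leqn0 addn_eq0 => /andP[/eqP-> /eqP->].
  case: v => [|v].
    case: u => [|u] // h; have e := cpair_next (0%N, u).
    by rewrite /unpair iterS -/(unpair n) (IH 0%N u) //; apply/succn_inj; rewrite -e.
  move=> h; have e := cpair_next (u.+1, v).
  by rewrite /unpair iterS -/(unpair n) (IH u.+1 v) //; apply/succn_inj; rewrite -e.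
exact: H.
Qed.

Lemma cfstE x y : cfst (cpair x y) = x. Proof. by rewrite /cfst cpairK. Qed.
Lemma csndE x y : csnd (cpair x y) = y. Proof. by rewrite /csnd cpairK. Qed.

Lemma cpair_inj x y u v : cpair x y = cpair u v -> x = u /\ y = v.
Proof. by move=> /(congr1 unpair); rewrite !cpairK => -[]. Qed.

Lemma leq_cpair x y u v : (x <= u)%N -> (y <= v)%N -> (cpair x y <= cpair u v)%N.
Proof.
move=> h k; rewrite /cpair; apply: leq_add => //.
by apply: leq_bin2l; rewrite ltnS leq_add.
Qed.

(** A class, so that codes are found from types and computability is proved along the shape of a
    term. The instances are convertible to the codes of the statement. *)
Class coded (T : Type) := enc : T -> nat.
#[export] Instance coded_nat : coded nat := id.
#[export] Instance coded_bool : coded bool := nat_of_bool.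
#[export] Instance coded_prod T U (cT : coded T) (cU : coded U) :
  coded (T * U) := code_pair cT cU.
#[export] Instance coded_seq T (cT : coded T) : coded (seq T) := code_seq cT.
#[export] Instance coded_rat : coded rat := code_rat.
#[export] Instance coded_prog : coded prog := code_prog.

Lemma enc_pair T U (cT : coded T) (cU : coded U) (x : T * U) :
  enc x = cpair (enc x.1) (enc x.2).
Proof. by []. Qed.

Lemma enc_cons T (cT : coded T) (x : T) (s : seq T) :
  enc (x :: s) = (cpair (enc x) (enc s)).+1.
Proof. by []. Qed.

Definition cf T U (cT : coded T) (cU : coded U) (f : T -> U) :=
  exists e, forall x, evaluates e (enc x) (enc (f x)).
Arguments cf {T U cT cU} f.

Definition Id := Pair Fst Snd.

Lemma evaluates_Id x : evaluates Id x x.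
Proof.
rewrite -{2}(unpairK x); apply: evaluates_Pair; rewrite -{1}(unpairK x).
  exact: evaluates_Fst.
exact: evaluates_Snd.
Qed.

Fixpoint Const n := if n is k.+1 then Comp Succ (Const k) else Zero.

Lemma evaluates_Const n x : evaluates (Const n) x n.
Proof.
elim: n => [|n IH] /=; first exact: evaluates_Zero.
exact: evaluates_Comp IH (evaluates_Succ _).
Qed.

Ltac inv_eval H :=
  inversion H; subst;
  repeat match goal with e : cpair _ _ = cpair _ _ |- _ =>
    let e1 := fresh in let e2 := fresh in
    case: (cpair_inj e) => e1 e2; clear e; try discriminate e2 end; subst.

Lemma evaluates_fun p x u v : evaluates p x u -> evaluates p x v -> u = v.
Proof.
move=> H; elim: H v => {p x u}.
- by move=> x v H; inv_eval H.
- by move=> x v H; inv_eval H.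
- by move=> x y v H; inv_eval H.
- by move=> x y v H; inv_eval H.
- by move=> p q x u v _ IH1 _ IH2 w H; inv_eval H; f_equal; [exact: IH1|exact: IH2].
- move=> p q x u v _ IH1 _ IH2 w H; inv_eval H; apply: IH2.
  by match goal with h : evaluates q x _ |- _ => rewrite (IH1 _ h) end.
- by move=> p q x v _ IH w H; inv_eval H; exact: IH.
- move=> p q x k u v _ IH1 _ IH2 w H; inv_eval H.
  match goal with h : S _ = S _ |- _ => case: h => ? end; subst.
  apply: IH2.
  by match goal with h : evaluates (Prec p q) _ _ |- _ => rewrite (IH1 _ h) end.
- move=> p x k w H1 IH1 H2 IH2 v H; inv_eval H.
  case: (ltngtP k v) => // h.
    match goal with h' : forall j, is_true (leq (S j) v) -> @?P j |- _ => by have := IH2 _ (h' _ h) end.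
  match goal with h' : evaluates p (cpair x v) 0%N |- _ => by have := IH1 _ h _ h' end.
Qed.

Section Closure.
Context {G : Type} {cG : coded G}.

Lemma cf_ext T (cT : coded T) (f g : G -> T) : f =1 g -> cf f -> cf g.
Proof. by move=> h [e He]; exists e => x; rewrite -h. Qed.

Lemma cf_id : cf (fun x : G => x).
Proof. by exists Id => x; exact: evaluates_Id. Qed.

Lemma cf_const T (cT : coded T) (c : T) : cf (fun _ : G => c).
Proof. by exists (Const (enc c)) => x; exact: evaluates_Const. Qed.

Lemma cf_comp T U (cT : coded T) (cU : coded U) (g : T -> U) (f : G -> T) :
  cf g -> cf f -> cf (fun x => g (f x)).
Proof.
by move=> [e He] [d Hd]; exists (Comp e d) => x; exact: evaluates_Comp.
Qed.

Lemma cf_pair T U (cT : coded T) (cU : coded U) (f : G -> T) (g : G -> U) :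
  cf f -> cf g -> cf (fun x => (f x, g x)).
Proof.
by move=> [e He] [d Hd]; exists (Pair e d) => x; exact: evaluates_Pair.
Qed.

Lemma cf_fst T U (cT : coded T) (cU : coded U) (f : G -> T * U) :
  cf f -> cf (fun x => (f x).1).
Proof.
move=> [e He]; exists (Comp Fst e) => x.
exact: evaluates_Comp (He x) (evaluates_Fst _ _).
Qed.

Lemma cf_snd T U (cT : coded T) (cU : coded U) (f : G -> T * U) :
  cf f -> cf (fun x => (f x).2).
Proof.
move=> [e He]; exists (Comp Snd e) => x.
exact: evaluates_Comp (He x) (evaluates_Snd _ _).
Qed.

Lemma cf_enc T (cT : coded T) (f : G -> T) : cf f -> cf (fun x => enc (f x)).
Proof. by move=> [e He]; exists e. Qed.

Lemma cf_app2 T U V (cT : coded T) (cU : coded U) (cV : coded V)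
    (h : T -> U -> V) (f : G -> T) (g : G -> U) :
  cf (fun p => h p.1 p.2) -> cf f -> cf g -> cf (fun x => h (f x) (g x)).
Proof. by move=> Hh Hf Hg; exact: (cf_comp Hh (cf_pair Hf Hg)). Qed.

Lemma cf_app3 T U V W (cT : coded T) (cU : coded U) (cV : coded V) (cW : coded W)
    (h : T -> U -> V -> W) (f : G -> T) (g : G -> U) (k : G -> V) :
  cf (fun p => h p.1 p.2.1 p.2.2) -> cf f -> cf g -> cf k ->
  cf (fun x => h (f x) (g x) (k x)).
Proof. by move=> Hh Hf Hg Hk; exact: (cf_comp Hh (cf_pair Hf (cf_pair Hg Hk))). Qed.

Lemma cf_app4 T U V W X (cT : coded T) (cU : coded U) (cV : coded V)
    (cW : coded W) (cX : coded X)
    (h : T -> U -> V -> W -> X) (f : G -> T) (g : G -> U) (k : G -> V) (l : G -> W) :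
  cf (fun p => h p.1 p.2.1 p.2.2.1 p.2.2.2) -> cf f -> cf g -> cf k -> cf l ->
  cf (fun x => h (f x) (g x) (k x) (l x)).
Proof.
by move=> Hh Hf Hg Hk Hl; exact: (cf_comp Hh (cf_pair Hf (cf_pair Hg (cf_pair Hk Hl)))).
Qed.

Lemma cf_S (f : G -> nat) : cf f -> cf (fun x => (f x).+1).
Proof.
move=> [e He]; exists (Comp Succ e) => x.
exact: evaluates_Comp (He x) (evaluates_Succ _).
Qed.

Lemma cf_iteri A (cA : coded A) (n : G -> nat) (a : G -> A) (F : G -> nat -> A -> A) :
  cf n -> cf a -> cf (fun p : G * (nat * A) => F p.1 p.2.1 p.2.2) ->
  cf (fun x => iteri (n x) (F x) (a x)).
Proof.
move=> [en Hn] [ea Ha] [eF HF]; exists (Comp (Prec ea eF) (Pair Id en)) => x.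
apply: evaluates_Comp; first exact: evaluates_Pair (evaluates_Id _) (Hn x).
elim: (n x) => [|k IH] /=; first exact: evaluates_Prec0.
exact: evaluates_PrecS IH (HF (x, (k, iteri k (F x) (a x)))).
Qed.

(** A boolean is coded by 0 or 1, so branching is an iteration of at most one step that starts from
    [g x] and overwrites it by [f x]. *)
Lemma cf_if T (cT : coded T) (b : G -> bool) (f g : G -> T) :
  cf b -> cf f -> cf g -> cf (fun x => if b x then f x else g x).
Proof.
move=> Hb [ef Hf] Hg.
have H : cf (fun x => iteri (b x) (fun _ _ => f x) (g x)).
  apply: cf_iteri => //.
  exists (Comp ef Fst) => -[x p]; exact: evaluates_Comp (evaluates_Fst _ _) (Hf x).
by apply: cf_ext H => x; case: (b x).
Qed.

End Closure.

Lemma cf_fst0 T U (cT : coded T) (cU : coded U) : cf (@fst T U).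
Proof. exact: (cf_fst cf_id). Qed.

Lemma cf_snd0 T U (cT : coded T) (cU : coded U) : cf (@snd T U).
Proof. exact: (cf_snd cf_id). Qed.

(* The hooks cf_user, cf_user2, ... are redefined below to extend [cfa] with
   the closure lemmas proved so far. *)
Ltac cf_user := fail.
Ltac cf_hyp := match goal with
  | H : cf ?m |- cf (fun x => ?m (@?f x)) => refine (cf_comp (f := f) H _)
  | H : cf (fun p => ?m (fst p) (snd p)) |- cf (fun x => ?m (@?f x) (@?g x)) =>
      refine (cf_app2 (f := f) (g := g) H _ _)
  | H : cf (fun p => ?m (fst p) (fst (snd p)) (snd (snd p)))
      |- cf (fun x => ?m (@?f x) (@?g x) (@?h x)) =>
      refine (cf_app3 (f := f) (g := g) (k := h) H _ _ _)
  end.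
Ltac cf_step := cbv beta; lazymatch goal with
  | |- cf (fun _ => ?c) => exact: cf_const
  | |- cf (fun x => x) => exact: cf_id
  | |- cf fst => exact: cf_fst0
  | |- cf snd => exact: cf_snd0
  | |- cf (fun x => fst (@?f x)) => refine (cf_fst (f := f) _)
  | |- cf (fun x => snd (@?f x)) => refine (cf_snd (f := f) _)
  | |- cf (fun x => (@?f x, @?g x)) => refine (cf_pair (f := f) (g := g) _ _)
  | |- cf (fun x => S (@?f x)) => refine (cf_S (f := f) _)
  | |- cf (fun x => if _ then _ else _) => refine (cf_if _ _ _)
  | _ => first [cf_hyp | cf_user]
  end.
Ltac cfa := repeat first [assumption | cf_step].

Lemma cf_pred' : cf predn.
Proof.
have H : cf (fun n => iteri n (fun k _ => k) 0%N).
  by apply: cf_iteri; cfa.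
by apply: cf_ext H => -[].
Qed.

Lemma cf_add' : cf (fun p : nat * nat => p.1 + p.2)%N.
Proof.
have H : cf (fun p : nat * nat => iteri p.1 (fun _ => S) p.2).
  by apply: cf_iteri; cfa.
by apply: cf_ext H => -[n m] /=; elim: n => //= n ->.
Qed.

Lemma cf_sub' : cf (fun p : nat * nat => p.1 - p.2)%N.
Proof.
have H : cf (fun p : nat * nat => iteri p.2 (fun _ => predn) p.1).
  by apply: cf_iteri; cfa; apply: (cf_comp cf_pred'); cfa.
by apply: cf_ext H => -[n m] /=; elim: m => [|m /= ->]; rewrite ?subn0 ?subnS.
Qed.

Lemma cf_mul' : cf (fun p : nat * nat => p.1 * p.2)%N.
Proof.
have H : cf (fun p : nat * nat => iteri p.1 (fun _ y => p.2 + y)%N 0%N).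
  by apply: cf_iteri; cfa; apply: (cf_app2 cf_add'); cfa.
by apply: cf_ext H => -[n m] /=; elim: n => //= n ->; rewrite mulSn.
Qed.

Section Closure2.
Context {G : Type} {cG : coded G}.
Implicit Types f g : G -> nat.

Lemma cf_pred f : cf f -> cf (fun x => (f x).-1).
Proof. exact: (cf_comp cf_pred'). Qed.
Lemma cf_addn f g : cf f -> cf g -> cf (fun x => f x + g x)%N.
Proof. exact: (cf_app2 cf_add'). Qed.
Lemma cf_subn f g : cf f -> cf g -> cf (fun x => f x - g x)%N.
Proof. exact: (cf_app2 cf_sub'). Qed.
Lemma cf_muln f g : cf f -> cf g -> cf (fun x => f x * g x)%N.
Proof. exact: (cf_app2 cf_mul'). Qed.

Lemma cf_eq0 f : cf f -> cf (fun x => f x == 0%N).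
Proof.
move=> Hf; have H : cf (fun x => iteri (f x) (fun _ _ => false) true).
  by apply: cf_iteri; cfa.
by apply: cf_ext H => x /=; case: (f x).
Qed.

Lemma cf_leq f g : cf f -> cf g -> cf (fun x => f x <= g x)%N.
Proof. by move=> Hf Hg; apply: cf_eq0; apply: cf_subn. Qed.

Lemma cf_neg (b : G -> bool) : cf b -> cf (fun x => ~~ b x).
Proof. by move=> Hb; rewrite /negb; cfa. Qed.
Lemma cf_and (b c : G -> bool) : cf b -> cf c -> cf (fun x => b x && c x).
Proof. by move=> Hb Hc; rewrite /andb; cfa. Qed.
Lemma cf_or (b c : G -> bool) : cf b -> cf c -> cf (fun x => b x || c x).
Proof. by move=> Hb Hc; rewrite /orb; cfa. Qed.
Lemma cf_imp (b c : G -> bool) : cf b -> cf c -> cf (fun x => b x ==> c x).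
Proof. by move=> Hb Hc; rewrite /implb; cfa. Qed.

Lemma cf_eqn f g : cf f -> cf g -> cf (fun x => f x == g x).
Proof.
move=> Hf Hg; apply: (@cf_ext _ _ _ _ (fun x => (f x <= g x)%N && (g x <= f x)%N)).
  by move=> x; rewrite -eqn_leq.
by apply: cf_and; apply: cf_leq.
Qed.

Lemma cf_cfst f : cf f -> cf (fun x => cfst (f x)).
Proof.
move=> [e He]; exists (Comp Fst e) => x; apply: evaluates_Comp (He x) _.
rewrite -{1}[enc (f x)]unpairK; exact: evaluates_Fst.
Qed.

Lemma cf_csnd f : cf f -> cf (fun x => csnd (f x)).
Proof.
move=> [e He]; exists (Comp Snd e) => x; apply: evaluates_Comp (He x) _.
rewrite -{1}[enc (f x)]unpairK; exact: evaluates_Snd.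
Qed.

Lemma cf_cpair f g : cf f -> cf g -> cf (fun x => cpair (f x) (g x)).
Proof.
by move=> [e He] [d Hd]; exists (Pair e d) => x; exact: evaluates_Pair.
Qed.

Lemma cf_iter A (cA : coded A) (n : G -> nat) (a : G -> A) (F : G -> A -> A) :
  cf n -> cf a -> cf (fun p : G * A => F p.1 p.2) ->
  cf (fun x => iter (n x) (F x) (a x)).
Proof.
move=> Hn Ha HF.
have H : cf (fun x => iteri (n x) (fun _ => F x) (a x)).
  by apply: cf_iteri => //; apply: (cf_app2 HF); cfa.
by apply: cf_ext H => x; elim: (n x) => //= k ->.
Qed.

Lemma cf_cons T (cT : coded T) (f : G -> T) (g : G -> seq T) :
  cf f -> cf g -> cf (fun x => f x :: g x).
Proof.
move=> [e He] [d Hd]; exists (Comp Succ (Pair e d)) => x.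
by apply: evaluates_Comp (evaluates_Succ _); exact: evaluates_Pair.
Qed.

Lemma cf_case_seq T A (cT : coded T) (cA : coded A) (s : G -> seq T) (f : G -> A)
    (g : G -> T -> seq T -> A) :
  cf s -> cf f -> cf (fun p : G * (T * seq T) => g p.1 p.2.1 p.2.2) ->
  cf (fun x => match s x with [::] => f x | t :: s' => g x t s' end).
Proof.
move=> Hs [ef Hf] [eg Hg].
have [en Hn] : cf (fun x => nat_of_bool (enc (s x) != 0%N)).
  by apply: (@cf_enc _ _ _ coded_bool); apply: cf_neg; apply: cf_eq0; apply: cf_enc.
have [ep Hp] : cf (fun x => (enc (s x)).-1) by apply: cf_pred; apply: cf_enc.
exists (Comp (Prec ef (Comp eg (Comp (Pair Id ep) Fst))) (Pair Id en)) => x.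
apply: evaluates_Comp; first exact: evaluates_Pair (evaluates_Id _) (Hn x).
have := Hp x; case: (s x) => [|t s'] Hpx /=; first exact: evaluates_Prec0.
rewrite {2}/enc /coded_nat /=.
apply: evaluates_PrecS; first exact: evaluates_Prec0.
apply: evaluates_Comp; last exact: (Hg (x, (t, s'))).
apply: evaluates_Comp; first exact: evaluates_Fst.
exact: evaluates_Pair (evaluates_Id _) Hpx.
Qed.

End Closure2.

Ltac cf_user ::= lazymatch goal with
  | |- cf (fun x => predn (@?f x)) => refine (cf_pred (f := f) _)
  | |- cf (fun x => addn (@?f x) (@?g x)) => refine (cf_addn (f := f) (g := g) _ _)
  | |- cf (fun x => subn (@?f x) (@?g x)) => refine (cf_subn (f := f) (g := g) _ _)
  | |- cf (fun x => muln (@?f x) (@?g x)) => refine (cf_muln (f := f) (g := g) _ _)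
  | |- cf (fun x => (@?f x) == 0%N) => refine (cf_eq0 (f := f) _)
  | |- cf (fun x => leq (@?f x) (@?g x)) => refine (cf_leq (f := f) (g := g) _ _)
  | |- cf (fun x => negb (@?f x)) => refine (cf_neg (b := f) _)
  | |- cf (fun x => andb (@?f x) (@?g x)) => refine (cf_and (b := f) (c := g) _ _)
  | |- cf (fun x => orb (@?f x) (@?g x)) => refine (cf_or (b := f) (c := g) _ _)
  | |- cf (fun x => implb (@?f x) (@?g x)) => refine (cf_imp (b := f) (c := g) _ _)
  | |- cf (fun x => cfst (@?f x)) => refine (cf_cfst (f := f) _)
  | |- cf (fun x => csnd (@?f x)) => refine (cf_csnd (f := f) _)
  | |- cf (fun x => cpair (@?f x) (@?g x)) => refine (cf_cpair (f := f) (g := g) _ _)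
  | |- cf (fun x => cons (@?f x) (@?g x)) => refine (cf_cons (f := f) (g := g) _ _)
  | |- cf (fun x => @eq_op ?T (@?f x) (@?g x)) => refine (cf_eqn (f := f) (g := g) _ _)
  end.

Lemma size_enc T (cT : coded T) (s : seq T) : (size s <= enc s)%N.
Proof.
elim: s => //= x s IH; rewrite enc_cons ltnS.
exact: leq_trans IH (leq_trans (leq_addl _ _) (cpair_ge _ _)).
Qed.

Section Lists.
Context {G : Type} {cG : coded G}.

(** The code of a list bounds its length and so serves as the number of iterations; once the list is
    used up, further steps change nothing. *)
Lemma cf_foldl T A (cT : coded T) (cA : coded A) (s : G -> seq T) (a : G -> A)
    (F : G -> A -> T -> A) :
  cf s -> cf a -> cf (fun p : G * (A * T) => F p.1 p.2.1 p.2.2) ->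
  cf (fun x => foldl (F x) (a x) (s x)).
Proof.
move=> Hs Ha HF.
pose stp x (p : A * seq T) :=
  match p.2 with [::] => p | t :: s' => (F x p.1 t, s') end.
have Hst : cf (fun p : G * (A * seq T) => stp p.1 p.2).
  rewrite /stp; apply: cf_case_seq; cfa.
have H : cf (fun x => (iter (enc (s x)) (stp x) (a x, s x)).1).
  by apply: cf_fst; apply: cf_iter; cfa; apply: cf_enc.
apply: cf_ext H => x /=.
have := @size_enc _ cT (s x); move: (enc (s x)) => n.
elim: n (a x) (s x) => [|n IH] b l.
  by case: l.
by case: l => [|t l] h; rewrite iterSr IH.
Qed.

Lemma cf_rev T (cT : coded T) (s : G -> seq T) : cf s -> cf (fun x => rev (s x)).
Proof.
move=> Hs; have H : cf (fun x => foldl (fun a t => t :: a) [::] (s x)).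
  by apply: cf_foldl; cfa.
apply: cf_ext H => x; rewrite /rev; move: [::]; elim: (s x) => //= t l IH a.
Qed.

Lemma cf_foldr T A (cT : coded T) (cA : coded A) (s : G -> seq T) (a : G -> A)
    (F : G -> T -> A -> A) :
  cf s -> cf a -> cf (fun p : G * (T * A) => F p.1 p.2.1 p.2.2) ->
  cf (fun x => foldr (F x) (a x) (s x)).
Proof.
move=> Hs Ha HF.
have H : cf (fun x => foldl (fun z t => F x t z) (a x) (rev (s x))).
  by apply: cf_foldl; cfa; exact: cf_rev.
by apply: cf_ext H => x; rewrite foldl_rev.
Qed.

Lemma cf_map T U (cT : coded T) (cU : coded U) (s : G -> seq T) (F : G -> T -> U) :
  cf s -> cf (fun p : G * T => F p.1 p.2) ->
  cf (fun x => map (F x) (s x)).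
Proof.
move=> Hs HF.
have H : cf (fun x => foldr (fun t a => F x t :: a) [::] (s x)).
  by apply: cf_foldr; cfa.
by apply: cf_ext H.
Qed.

Lemma cf_all T (cT : coded T) (s : G -> seq T) (F : G -> T -> bool) :
  cf s -> cf (fun p : G * T => F p.1 p.2) -> cf (fun x => all (F x) (s x)).
Proof.
move=> Hs HF.
have H : cf (fun x => foldr (fun t a => F x t && a) true (s x)).
  by apply: cf_foldr; cfa.
by apply: cf_ext H.
Qed.

Lemma cf_has T (cT : coded T) (s : G -> seq T) (F : G -> T -> bool) :
  cf s -> cf (fun p : G * T => F p.1 p.2) -> cf (fun x => has (F x) (s x)).
Proof.
move=> Hs HF.
have H : cf (fun x => foldr (fun t a => F x t || a) false (s x)).
  by apply: cf_foldr; cfa.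
by apply: cf_ext H.
Qed.

Lemma cf_size T (cT : coded T) (s : G -> seq T) : cf s -> cf (fun x => size (s x)).
Proof.
move=> Hs.
have H : cf (fun x => foldr (fun t a => a.+1) 0%N (s x)) by apply: cf_foldr; cfa.
by apply: cf_ext H => x; elim: (s x) => //= t l ->.
Qed.

Lemma cf_cat T (cT : coded T) (s t : G -> seq T) :
  cf s -> cf t -> cf (fun x => s x ++ t x).
Proof.
move=> Hs Ht.
have H : cf (fun x => foldr cons (t x) (s x)) by apply: cf_foldr; cfa.
by apply: cf_ext H => x; elim: (s x) => //= u l ->.
Qed.

End Lists.

Section Lists2.
Context {G : Type} {cG : coded G}.

Lemma cf_flatten T (cT : coded T) (s : G -> seq (seq T)) :
  cf s -> cf (fun x => flatten (s x)).
Proof. by move=> Hs; apply: cf_foldr; cfa; apply: cf_cat; cfa. Qed.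

Lemma cf_behead T (cT : coded T) (s : G -> seq T) : cf s -> cf (fun x => behead (s x)).
Proof. by move=> Hs; rewrite /behead; apply: cf_case_seq; cfa. Qed.

Lemma cf_head T (cT : coded T) (d : T) (s : G -> seq T) :
  cf s -> cf (fun x => head d (s x)).
Proof. by move=> Hs; rewrite /head; apply: cf_case_seq; cfa. Qed.

End Lists2.

Section Lists4.
Context {G : Type} {cG : coded G}.

Lemma cf_drop T (cT : coded T) (s : G -> seq T) (n : G -> nat) :
  cf s -> cf n -> cf (fun x => drop (n x) (s x)).
Proof.
move=> Hs Hn.
have H : cf (fun x => iter (n x) behead (s x)).
  by apply: cf_iter; cfa; refine (cf_behead (s := snd) _); cfa.
apply: cf_ext H => x; elim: (n x) (s x) => [|k IH] l; first by rewrite drop0.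
by rewrite iterSr IH; case: l.
Qed.

End Lists4.

Section Lists3.
Context {G : Type} {cG : coded G}.

Lemma cf_nth T (cT : coded T) (d : T) (s : G -> seq T) (n : G -> nat) :
  cf s -> cf n -> cf (fun x => nth d (s x) (n x)).
Proof.
move=> Hs Hn; have H : cf (fun x => head d (drop (n x) (s x))).
  by apply: cf_head; apply: cf_drop.
by apply: cf_ext H => x; rewrite -nth0 nth_drop addn0.
Qed.

Lemma cf_iota (m n : G -> nat) : cf m -> cf n -> cf (fun x => iota (m x) (n x)).
Proof.
move=> Hm Hn.
have H : cf (fun x => rev (iteri (n x) (fun k a => (m x + k)%N :: a) [::])).
  by apply: cf_rev; apply: cf_iteri; cfa.
apply: cf_ext H => x; elim: (n x) => // k IH.
by rewrite -addn1 iotaD /= -IH addn1 /= rev_cons cats1.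
Qed.

Lemma cf_eqseq (s t : G -> seq nat) : cf s -> cf t -> cf (fun x => s x == t x).
Proof.
move=> Hs Ht; have H : cf (fun x => enc (s x) == enc (t x)).
  by apply: cf_eqn; apply: cf_enc.
apply: cf_ext H => x; elim: (s x) (t x) => [|a l IH] [|b k] //.
rewrite eqseq_cons -IH !enc_cons eqSS; apply/eqP/andP; last first.
  by move=> [/eqP -> /eqP ->].
move=> h; case: (cpair_inj h) => e1 ->; rewrite eqxx; split=> //; apply/eqP; exact: e1.
Qed.

End Lists3.

Ltac cf_user2 := fail.
Ltac cf_user ::= lazymatch goal with
  | |- cf (fun x => predn (@?f x)) => refine (cf_pred (f := f) _)
  | |- cf (fun x => addn (@?f x) (@?g x)) => refine (cf_addn (f := f) (g := g) _ _)
  | |- cf (fun x => subn (@?f x) (@?g x)) => refine (cf_subn (f := f) (g := g) _ _)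
  | |- cf (fun x => muln (@?f x) (@?g x)) => refine (cf_muln (f := f) (g := g) _ _)
  | |- cf (fun x => (@?f x) == 0%N) => refine (cf_eq0 (f := f) _)
  | |- cf (fun x => leq (@?f x) (@?g x)) => refine (cf_leq (f := f) (g := g) _ _)
  | |- cf (fun x => negb (@?f x)) => refine (cf_neg (b := f) _)
  | |- cf (fun x => andb (@?f x) (@?g x)) => refine (cf_and (b := f) (c := g) _ _)
  | |- cf (fun x => orb (@?f x) (@?g x)) => refine (cf_or (b := f) (c := g) _ _)
  | |- cf (fun x => implb (@?f x) (@?g x)) => refine (cf_imp (b := f) (c := g) _ _)
  | |- cf (fun x => cfst (@?f x)) => refine (cf_cfst (f := f) _)
  | |- cf (fun x => csnd (@?f x)) => refine (cf_csnd (f := f) _)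
  | |- cf (fun x => cpair (@?f x) (@?g x)) => refine (cf_cpair (f := f) (g := g) _ _)
  | |- cf (fun x => cons (@?f x) (@?g x)) => refine (cf_cons (f := f) (g := g) _ _)
  | |- cf (fun x => map (@?F x) (@?s x)) => refine (cf_map (s := s) (F := F) _ _)
  | |- cf (fun x => all (@?F x) (@?s x)) => refine (cf_all (s := s) (F := F) _ _)
  | |- cf (fun x => has (@?F x) (@?s x)) => refine (cf_has (s := s) (F := F) _ _)
  | |- cf (fun x => size (@?s x)) => refine (cf_size (s := s) _)
  | |- cf (fun x => cat (@?s x) (@?t x)) => refine (cf_cat (s := s) (t := t) _ _)
  | |- cf (fun x => flatten (@?s x)) => refine (cf_flatten (s := s) _)
  | |- cf (fun x => nth ?d (@?s x) (@?n x)) => refine (cf_nth d (s := s) (n := n) _ _)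
  | |- cf (fun x => iota (@?s x) (@?n x)) => refine (cf_iota (m := s) (n := n) _ _)
  | |- cf (fun x => iteri (@?n x) (@?F x) (@?a x)) => refine (cf_iteri (n := n) (F := F) (a := a) _ _ _)
  | |- cf (fun x => iter (@?n x) (@?F x) (@?a x)) => refine (cf_iter (n := n) (F := F) (a := a) _ _ _)
  | |- cf (fun x => foldr (@?F x) (@?a x) (@?s x)) => refine (cf_foldr (s := s) (F := F) (a := a) _ _ _)
  | |- cf (fun x => drop (@?n x) (@?s x)) => refine (cf_drop (s := s) (n := n) _ _)
  | |- cf (fun x => @eq_op ?T (@?f x) (@?g x)) =>
      first [refine (cf_eqn (f := f) (g := g) _ _) | refine (cf_eqseq (s := f) (t := g) _ _)]
  | _ => cf_user2
  end.

(** [Mu] searches through all natural numbers, so whatever is searched for must be decodable from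
    each of them. With a bijective code decoding is free: the same program computes it ([cf_dec]).
    The code of rationals is not onto, hence certificates carry fractions. *)
Class cbij T (cT : coded T) := {
  dec : nat -> T; decK : forall n, enc (dec n) = n;
  enc_inj : forall x y : T, enc x = enc y -> x = y }.
Arguments dec {T cT cbij} n.

Lemma encK T (cT : coded T) (bT : cbij cT) (x : T) : dec (enc x) = x.
Proof. by apply: enc_inj; rewrite decK. Qed.

#[export] Instance cbij_nat : cbij coded_nat.
Proof. by exists id. Defined.

#[export] Instance cbij_prod T U (cT : coded T) (cU : coded U) (bT : cbij cT)
  (bU : cbij cU) : cbij (coded_prod cT cU).
Proof.
exists (fun n => (dec (cfst n), dec (csnd n))).
  by move=> n; rewrite enc_pair /= !decK unpairK.
by move=> [x y] [u v] h; case: (cpair_inj h) => e1 e2; congr pair; exact: enc_inj.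
Defined.

Fixpoint dec_seq T (cT : coded T) (bT : cbij cT) (fuel n : nat) : seq T :=
  match fuel, n with
  | f.+1, k.+1 => dec (cfst k) :: dec_seq bT f (csnd k)
  | _, _ => [::]
  end.

Lemma dec_seqK T (cT : coded T) (bT : cbij cT) f k :
  (k <= f)%N -> enc (dec_seq bT f k) = k.
Proof.
elim: f k => [|f IH] [|k] //= h; rewrite ltnS in h.
rewrite enc_cons decK IH ?unpairK //.
by apply: leq_trans h; rewrite -{2}(unpairK k) (leq_trans _ (cpair_ge _ _)) ?leq_addl.
Qed.

Lemma enc_seq_inj T (cT : coded T) (bT : cbij cT) (s t : seq T) :
  enc s = enc t -> s = t.
Proof.
elim: s t => [|x s IH] [|y t] //.
by rewrite !enc_cons => -[] h; case: (cpair_inj h) => e1 /IH ->; congr cons; exact: enc_inj.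
Qed.

#[export] Instance cbij_seq T (cT : coded T) (bT : cbij cT) : cbij (coded_seq cT).
Proof.
exists (fun n => dec_seq bT n n); first by move=> n; exact: dec_seqK.
exact: enc_seq_inj.
Defined.

Lemma cf_dec G (cG : coded G) T (cT : coded T) (bT : cbij cT) (f : G -> nat) :
  cf f -> cf (fun x => dec (f x) : T).
Proof. by move=> [e He]; exists e => x; rewrite decK. Qed.

(** * A universal step machine *)

(** A state holds a mode ([true] while evaluating, [false] while returning), the current program,
    the current value and a stack. The tag of a frame is that of the constructor waiting for a
    value; tag 8 is a [Pair] whose first component is known. *)
Definition frame := (nat * (nat * (nat * nat)))%type.
Definition state := (bool * (nat * (nat * seq frame)))%type.

Definition mstep (st : state) : state :=
  let p := st.2.1 in let v := st.2.2.1 in let k := st.2.2.2 in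
  if st.1 then
    let t := cfst p in let a := csnd p in
    if t == 0%N then (false, (0%N, (0%N, k)))
    else if t == 1%N then (false, (0%N, (v.+1, k)))
    else if t == 2 then (false, (0%N, (cfst v, k)))
    else if t == 3 then (false, (0%N, (csnd v, k)))
    else if t == 4 then (true, (cfst a, (v, (4, (csnd a, (v, 0%N))) :: k)))
    else if t == 5 then (true, (csnd a, (v, (5, (cfst a, (0%N, 0%N))) :: k)))
    else if t == 6 then
      if csnd v == 0%N then (true, (cfst a, (cfst v, k)))
      else (true, (p, (cpair (cfst v) (csnd v).-1,
                       (6, (csnd a, (cfst v, (csnd v).-1))) :: k)))
    else (true, (a, (cpair v 0, (7, (a, (v, 0%N))) :: k)))
  else
    match k with
    | [::] => st
    | f :: k' =>
      let q := f.2.1 in let x := f.2.2.1 in let j := f.2.2.2 in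
      if f.1 == 4 then (true, (q, (x, (8, (0%N, (v, 0%N))) :: k')))
      else if f.1 == 5 then (true, (q, (v, k')))
      else if f.1 == 6 then (true, (q, (cpair x (cpair j v), k')))
      else if f.1 == 7 then
        if v == 0%N then (false, (0%N, (j, k')))
        else (true, (q, (cpair x j.+1, (7, (q, (x, j.+1))) :: k')))
      else (false, (0%N, (cpair x v, k')))
    end.

Lemma cf_mstep : cf mstep.
Proof. by rewrite /mstep /=; cfa; apply: cf_case_seq; cfa. Qed.

Definition ev c x k : state := (true, (c, (x, k))).
Definition rt v k : state := (false, (0%N, (v, k))).
Definition reaches s t := exists n, iter n mstep s = t.

Lemma reaches_refl s : reaches s s. Proof. by exists 0%N. Qed.

Lemma reaches_trans s t u : reaches s t -> reaches t u -> reaches s u.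
Proof. by move=> [n Hn] [m Hm]; exists (m + n)%N; rewrite iterD Hn. Qed.

Lemma reaches_step s u : reaches (mstep s) u -> reaches s u.
Proof. by apply: reaches_trans; exists 1%N. Qed.

Arguments cpair : simpl never.
Arguments cfst : simpl never.
Arguments csnd : simpl never.

Opaque cpair cfst csnd.

Ltac mstp := apply: reaches_step; rewrite /mstep /= ?cfstE ?csndE /= ?cfstE ?csndE /=.

Lemma evaluates_reaches p x v : evaluates p x v ->
  forall k, reaches (ev (code_prog p) x k) (rt v k).
Proof.
elim=> {p x v}.
- by move=> x k; mstp; exact: reaches_refl.
- by move=> x k; mstp; exact: reaches_refl.
- by move=> x y k; mstp; exact: reaches_refl.
- by move=> x y k; mstp; exact: reaches_refl.
- move=> p q x u v _ IH1 _ IH2 k; mstp; apply: reaches_trans (IH1 _) _; mstp.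
  by apply: reaches_trans (IH2 _) _; mstp; exact: reaches_refl.
- move=> p q x u v _ IH1 _ IH2 k; mstp; apply: reaches_trans (IH1 _) _; mstp.
  exact: IH2.
- by move=> p q x v _ IH k; mstp; exact: IH.
- move=> p q x k u v _ IH1 _ IH2 l; mstp; apply: reaches_trans (IH1 _) _; mstp.
  exact: IH2.
- move=> p x k w _ IH1 _ IH2 l; mstp.
  (* Induction on k - j, the number of tests of [Mu] that still fail. *)
  have H j : (j <= k)%N -> reaches
      (ev (code_prog p) (cpair x j) ((7, (code_prog p, (x, j))) :: l)) (rt k l).
    move=> hj; rewrite -(subKn hj); elim: (k - j)%N (leq_subr j k) => [_|i IH hi].
      by rewrite subn0; apply: reaches_trans (IH2 _) _; mstp; exact: reaches_refl.
    apply: reaches_trans (IH1 _ _ _) _; first by rewrite ltn_subrL; lia.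
    mstp; rewrite subnSK //; apply: IH; exact: ltnW.
  exact: H.
Qed.

(** Strong induction on the number of steps: before the stack can become empty, the evaluation must
    return to the stack [k] on which it started, and what remains is a strictly shorter run. *)
Lemma reaches_evaluates n : forall p x k v,
  iter n mstep (ev (code_prog p) x k) = rt v [::] ->
  exists u m, [/\ evaluates p x u, (m < n)%N & iter m mstep (rt u k) = rt v [::]].
Proof.
elim/ltn_ind: n => -[|n] IHn p x k v //.
rewrite iterSr; case: p => [||||p q|p q|p q|p].
- rewrite {2}/mstep /= cfstE /= => h; exists 0%N, n; split => //; exact: evaluates_Zero.
- rewrite {2}/mstep /= cfstE /= => h; exists x.+1, n; split => //; exact: evaluates_Succ.
- rewrite {2}/mstep /= cfstE /= => h; exists (cfst x), n; split => //.
  by rewrite -{1}(unpairK x); exact: evaluates_Fst.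
- rewrite {2}/mstep /= cfstE /= => h; exists (csnd x), n; split => //.
  by rewrite -{1}(unpairK x); exact: evaluates_Snd.
- rewrite {2}/mstep /= cfstE csndE /= cfstE csndE => h.
  have [u [[|m] [h1 h2 h3]]] := IHn _ (ltnSn n) _ _ _ _ h; first by [].
  move: h3; rewrite iterSr {2}/mstep /= => h3.
  have [u' [[|m'] [h4 h5 h6]]] := IHn m (ltac:(lia)) _ _ _ _ h3; first by [].
  move: h6; rewrite iterSr {2}/mstep /= => h6.
  by exists (cpair u u'), m'; split; [exact: evaluates_Pair|lia|].
- rewrite {2}/mstep /= cfstE csndE /= cfstE csndE => h.
  have [u [[|m] [h1 h2 h3]]] := IHn _ (ltnSn n) _ _ _ _ h; first by [].
  move: h3; rewrite iterSr {2}/mstep /= => h3.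
  have [u' [m' [h4 h5 h6]]] := IHn m (ltac:(lia)) _ _ _ _ h3.
  by exists u', m'; split; [exact: evaluates_Comp h1 h4|lia|].
- rewrite {2}/mstep /= cfstE csndE /= cfstE csndE.
  case: eqP => [e|ne] h.
    have [u [m [h1 h2 h3]]] := IHn _ (ltnSn n) _ _ _ _ h.
    exists u, m; split => //; last by lia.
    by rewrite -(unpairK x) e; exact: evaluates_Prec0.
  have [u [[|m] [h1 h2 h3]]] := IHn _ (ltnSn n) (Prec p q) _ _ _ h; first by [].
  move: h3; rewrite iterSr {2}/mstep /= => h3.
  have [u' [m' [h4 h5 h6]]] := IHn m (ltac:(lia)) _ _ _ _ h3.
  exists u', m'; split; [|lia|by []].
  rewrite -(unpairK x) -[csnd x]prednK; last by lia.
  exact: evaluates_PrecS h1 h4.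
- rewrite {2}/mstep /= cfstE csndE /= => h.
  (* The loop of [Mu] reenters [p], not [Mu p], so it has its own induction, on a bound i for the
     remaining steps; [w] collects the predecessors of the nonzero values found below j. *)
  have H i : forall j m w, (m <= i)%N -> (m <= n)%N ->
      (forall j', (j' < j)%N -> evaluates p (cpair x j') (w j').+1) ->
      iter m mstep (ev (code_prog p) (cpair x j)
                      ((7, (code_prog p, (x, j))) :: k)) = rt v [::] ->
      exists u m', [/\ evaluates (Mu p) x u, (m' < m)%N
                     & iter m' mstep (rt u k) = rt v [::]].
    elim: i => [|i IH] j m w hm hn hw.
      by move: hm; rewrite leqn0 => /eqP ->.
    move=> h'; have [u [[|m'] [h1 h2 h3]]] := IHn m (ltac:(lia)) _ _ _ _ h'; first by [].
    move: h3; rewrite iterSr {2}/mstep /=; case: eqP => [u0|un0] h3.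
      exists j, m'; split => //; last by lia.
      by apply: (evaluates_Mu hw); rewrite -u0.
    have hw' j' : (j' < j.+1)%N ->
        evaluates p (cpair x j') (if j' == j then u.-1 else w j').+1.
      rewrite ltnS leq_eqVlt; case: eqP => [-> _|_ /= hj']; last exact: hw.
      by rewrite prednK // lt0n; apply/eqP.
    have [u' [m2 [h4 h5 h6]]] := IH j.+1 m' _ (ltac:(lia)) (ltac:(lia)) hw' h3.
    by exists u', m2; split => //; lia.
  have [u [m [h1 h2 h3]]] := H n 0%N n (fun => 0%N) (leqnn _) (leqnn _) (fun _ h => ltac:(by [])) h.
  by exists u, m; split => //; lia.
Qed.

(** The result is shifted by one, so that 0 means that none is available after n steps. *)
Definition run (n c x : nat) : nat :=
  let st := iter n mstep (ev c x [::]) in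
  if ~~ st.1 && (size st.2.2.2 == 0%N) then st.2.2.1.+1 else 0%N.

Lemma cf_run G (cG : coded G) (n c x : G -> nat) :
  cf n -> cf c -> cf x -> cf (fun g => run (n g) (c g) (x g)).
Proof.
move=> Hn Hc Hx; rewrite /run /ev /=.
have H : cf (fun g => iter (n g) mstep (true, (c g, (x g, [::] : seq frame)))).
  by apply: cf_iter; cfa; apply: (cf_comp cf_mstep); cfa.
by cfa.
Qed.

Lemma run_mono n m c x v : (n <= m)%N -> run n c x = v.+1 -> run m c x = v.+1.
Proof.
move=> h; rewrite /run -(subnK h) iterD; set st := iter n _ _.
case E: (~~ st.1 && _) => // -[e].
have -> : iter (m - n) mstep st = st; last by rewrite E e.
elim: (m - n)%N => //= i ->; move: E; rewrite /mstep; case: (st.1) => //=.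
by case: (st.2.2.2).
Qed.

Lemma evaluates_run p x v : evaluates p x v -> exists n, run n (code_prog p) x = v.+1.
Proof. by move=> /evaluates_reaches /(_ [::]) [n Hn]; exists n; rewrite /run Hn. Qed.

Lemma run_evaluates n p x v : run n (code_prog p) x = v.+1 -> evaluates p x v.
Proof.
rewrite /run.
(* While returning, the program register is 0; a halted state is thus of the form [rt v [::]] and
   [reaches_evaluates] applies to it. *)
have Z i : (iter i mstep (ev (code_prog p) x [::])).1 = false ->
     (iter i mstep (ev (code_prog p) x [::])).2.1 = 0%N.
  elim: i => // i IH; rewrite iterS; move: (iter i _ _) IH => [b [c' [u' k']]] /= IH.
  rewrite /mstep /=; case: b IH => /= IH; last first.
    by case: k' => [|f k'] //=; do ![case: ifP => //=].
  by do ![case: ifP => //=].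
move: (Z n); case E: (iter n mstep _) => [b [c [u k]]] /=.
case: b E => //=; case: k => // E /(_ erefl) c0 [uv]; subst c u.
have Hm : exists m, iter m mstep (ev (code_prog p) x [::]) = rt v [::] by exists n.
case: Hm => m Hm.
have [w [m' [h1 h2 h3]]] := reaches_evaluates Hm.
suff e : w = v by rewrite -e.
have F i a : iter i mstep (rt a [::]) = rt a [::] by elim: i => //= i ->.
by move: h3; rewrite F => -[].
Qed.

Lemma halts_run p x : halts p x <-> exists n, run n (code_prog p) x != 0%N.
Proof.
split=> [[v /evaluates_run [n Hn]]|[n Hn]]; first by exists n; rewrite Hn.
by exists (run n (code_prog p) x).-1; apply: (@run_evaluates n); rewrite prednK ?lt0n.
Qed.

(** Allows an algorithm to write a program into which a number that it was given is compiled. *)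
Lemma cf_code_Const G (cG : coded G) (n : G -> nat) :
  cf n -> cf (fun x => code_prog (Const (n x))).
Proof.
move=> Hn.
have H : cf (fun x => iter (n x) (fun c => cpair 5 (cpair (cpair 1 0) c)) (cpair 0 0)).
  by cfa.
by apply: cf_ext H => x; elim: (n x) => //= k ->.
Qed.

(** * Computing with rational numbers *)

Definition fr := (nat * (nat * nat))%type.

(** Every triple of naturals denotes a rational, so [fr] has a bijective code and can be searched.
    Rational arithmetic is carried out on these unreduced fractions. *)
Definition q2 (f : fr) : rat := (f.1%:R - f.2.1%:R) / (f.2.2.+1)%:R.

Lemma cf_odd G (cG : coded G) (n : G -> nat) : cf n -> cf (fun x => odd (n x)).
Proof.
move=> Hn; have H : cf (fun x => iter (n x) negb false) by cfa.
by apply: cf_ext H => x; elim: (n x) => //= k ->.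
Qed.

Lemma cf_half G (cG : coded G) (n : G -> nat) : cf n -> cf (fun x => (n x)./2).
Proof.
move=> Hn.
have H : cf (fun x => iteri (n x) (fun k a => if odd k then a.+1 else a) 0%N).
  by cfa; apply: cf_odd; cfa.
by apply: cf_ext H => x; elim: (n x) => //= k ->; rewrite uphalf_half; case: odd.
Qed.

Ltac cf_user3 := fail.
Ltac cf_user2 ::= lazymatch goal with
  | |- cf (fun x => odd (@?n x)) => refine (cf_odd (n := n) _)
  | |- cf (fun x => half (@?n x)) => refine (cf_half (n := n) _)
  | |- cf (fun x => run (@?n x) (@?c x) (@?y x)) =>
      refine (cf_run (n := n) (c := c) (x := y) _ _ _)
  | |- cf (fun x => enc (@?f x)) => refine (cf_enc (f := f) _)
  | |- cf (fun x => dec (@?f x)) => refine (cf_dec _ (f := f) _)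
  | |- cf (fun x => foldl (@?F x) (@?a x) (@?s x)) =>
      refine (cf_foldl (s := s) (F := F) (a := a) _ _ _)
  | |- cf (fun x => head ?d (@?s x)) => refine (cf_head d (s := s) _)
  | |- cf (fun x => behead (@?s x)) => refine (cf_behead (s := s) _)
  | |- cf (fun x => code_prog (Const (@?n x))) => refine (cf_code_Const (n := n) _)
  | _ => cf_user3
  end.

Definition frc (n : nat) : fr :=
  let a := cfst n in
  (if odd a then 0%N else a./2, (if odd a then a./2.+1 else 0%N, ((csnd n)./2).-1)).

Lemma cf_frc : cf frc.
Proof. by rewrite /frc; cfa. Qed.

Lemma frcK q : q2 (frc (code_rat q)) = q.
Proof.
rewrite /q2 /frc /code_rat cfstE csndE /= -[in RHS](divq_num_den q); congr (_ / _).
  case: (numq q) => n /=; first by rewrite odd_double doubleK subr0.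
  rewrite odd_double /= uphalf_double sub0r NegzE.
  by rewrite mulrNz.
have := denq_gt0 q; case: (denq q) => [[|d]|d] //= _.
by rewrite doubleK.
Qed.

Lemma cf_mu_bool G (cG : coded G) (n : G -> nat) (P : G -> nat -> bool) :
  cf n -> cf (fun p => P p.1 p.2) -> cf (fun x => find (P x) (iota 0 (n x))).
Proof.
move=> Hn HP.
have H : cf (fun x => foldr (fun k a => if P x k then 0%N else a.+1) 0%N (iota 0 (n x))).
  by cfa.
apply: cf_ext H => x; elim: (iota 0 (n x)) => //= k l ->; by case: (P x k).
Qed.

Definition fr_abs (f : fr) : nat := (f.1 - f.2.1 + (f.2.1 - f.1))%N.

(** The denominator in lowest terms, as the least positive j such that j times the fraction is an
    integer. Reduction is needed since [code_rat] refers to [numq] and [denq]. *)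
Definition fr_den (f : fr) : nat :=
  (find (fun j => f.2.2.+1 %| j.+1 * fr_abs f)%N (iota 0 f.2.2.+1)).+1.

Lemma cf_dvdn G (cG : coded G) (m n : G -> nat) :
  cf m -> cf n -> cf (fun x => m x %| n x)%N.
Proof.
move=> Hm Hn.
have H : cf (fun x => has (fun k => k * m x == n x)%N (iota 0 (n x).+1)) by cfa.
apply: cf_ext H => x; apply/hasP/dvdnP => [[k _ /eqP <-]|[k E]]; first by exists k.
have [m0|m0] := posnP (m x).
  by exists 0%N; [rewrite mem_iota | rewrite E m0 !muln0].
exists k; last by rewrite E.
by rewrite mem_iota ltnS E /= leq_pmulr.
Qed.

Definition fr_num (f : fr) : nat :=
  find (fun k => k * f.2.2.+1 == fr_den f * fr_abs f)%N (iota 0 (fr_den f * fr_abs f).+1).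

(** A negative integer -k is [Negz (k - 1)], whose code is 2k - 1. *)
Definition fr_code (f : fr) : nat :=
  let k := fr_num f in
  cpair (if (f.2.1 <= f.1)%N then k.*2 else k.*2.-1) (fr_den f).*2.

Lemma cf_fr_code : cf fr_code.
Proof.
have cf_double (G : Type) (cG : coded G) (n : G -> nat) : cf n -> cf (fun x => (n x).*2).
  move=> Hn; have H : cf (fun x => n x + n x)%N by cfa.
  by apply: cf_ext H => x; rewrite addnn.
have H1 : cf fr_abs by rewrite /fr_abs; cfa.
have H2 : cf fr_den.
  rewrite /fr_den; cfa; refine (cf_mu_bool _ _); cfa.
  by refine (cf_dvdn _ _); cfa.
have H3 : cf fr_num by rewrite /fr_num; refine (cf_mu_bool _ _); cfa.
by rewrite /fr_code; cfa; refine (cf_double _ _ _ _); cfa.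
Qed.

Lemma fr_codeE f : code_rat (q2 f) = fr_code f.
Proof.
set q := q2 f; set n := `|numq q|%N; set d := `|denq q|%N.
have d0 : (0 < d)%N by rewrite absz_gt0 denq_neq0.
have dE : denq q = d by rewrite /d gez0_abs // ltW // denq_gt0.
have cop : coprime n d by exact: coprime_num_den.
have q0 : (0 <= q) = (f.2.1 <= f.1)%N.
  by rewrite /q /q2 pmulr_lge0 ?invr_gt0 ?ltr0Sn // subr_ge0 ler_nat.
have E : (n * f.2.2.+1 = d * fr_abs f)%N.
  apply/eqP; rewrite -(eqr_nat rat) !natrM.
  have -> : (n%:R : rat) = `|q| * d%:R.
    rewrite /n natr_absz intr_norm numqE normrM dE; congr (_ * _).
    by rewrite ger0_norm // ler0z.
  have -> : (fr_abs f)%:R = `|f.1%:R - f.2.1%:R| :> rat.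
    rewrite /fr_abs; case: (leqP f.2.1 f.1) => h.
      rewrite ger0_norm ?subr_ge0 ?ler_nat // -natrB //.
      by rewrite (_ : f.2.1 - f.1 = 0)%N ?addn0 //; lia.
    rewrite ler0_norm ?subr_le0 ?ler_nat ?(ltnW h) // opprB -natrB ?(ltnW h) //.
    by rewrite (_ : f.1 - f.2.1 = 0)%N ?add0n //; lia.
  rewrite /q /q2 normrM normfV [`|_.+1%:R|]ger0_norm ?ler0n //.
  have c0 : (f.2.2.+1)%:R != 0 :> rat by rewrite pnatr_eq0.
  by rewrite mulrAC divfK // mulrC.
have dvd j : (f.2.2.+1 %| j * fr_abs f)%N = (d %| j)%N.
  rewrite -(dvdn_pmul2l d0) mulnCA -E mulnA.
  by rewrite dvdn_pmul2r // Gauss_dvdl // coprime_sym.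
have dc : (d <= f.2.2.+1)%N.
  by apply: dvdn_leq => //; rewrite -dvd; exact: dvdn_mulr.
have den : fr_den f = d.
  rewrite /fr_den; set s := find _ _.
  have hs : has (fun j => f.2.2.+1 %| j.+1 * fr_abs f)%N (iota 0 f.2.2.+1).
    apply/hasP; exists d.-1; first by rewrite mem_iota /= add0n prednK.
    by rewrite prednK // dvd.
  have := nth_find 0%N hs; rewrite has_find size_iota in hs.
  rewrite -/s nth_iota // add0n dvd => h1.
  apply/eqP; rewrite eqn_leq (dvdn_leq _ h1) // andbT leqNgt; apply/negP => h2.
  have h3 : (d.-1 < s)%N by lia.
  have := @before_find _ 0%N (fun j => f.2.2.+1 %| j.+1 * fr_abs f)%N _ _ h3.
  by rewrite nth_iota ?add0n ?prednK // dvd dvdnn.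
have num : fr_num f = n.
  rewrite /fr_num den -E; set s := find _ _.
  have hs : has (fun k => k * f.2.2.+1 == n * f.2.2.+1)%N (iota 0 (n * f.2.2.+1).+1).
    by apply/hasP; exists n => //; rewrite mem_iota /= add0n ltnS leq_pmulr.
  have := nth_find 0%N hs; rewrite has_find size_iota in hs.
  by rewrite -/s nth_iota // add0n eqn_pmul2r // => /eqP.
rewrite /fr_code den num /code_rat dE -q0; congr cpair.
by rewrite -numq_ge0 /n; case: (numq q).
Qed.

Lemma cf_q2' : cf q2.
Proof. by have [e He] := cf_fr_code; exists e => f; have := He f; rewrite -fr_codeE. Qed.

Section RatClosure.
Context {G : Type} {cG : coded G}.
Implicit Types f g : G -> rat.

Definition frq (q : rat) : fr := frc (enc q).

Lemma frqK q : q2 (frq q) = q. Proof. exact: frcK. Qed.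

Lemma cf_frq f : cf f -> cf (fun x => frq (f x)).
Proof. by move=> Hf; exact: (cf_comp cf_frc (cf_enc Hf)). Qed.

Lemma cf_q2 (f : G -> fr) : cf f -> cf (fun x => q2 (f x)).
Proof. exact: (cf_comp cf_q2'). Qed.

Lemma cf_addq f g : cf f -> cf g -> cf (fun x => f x + g x).
Proof.
move=> Hf Hg.
have Kf := cf_frq Hf; have Kg := cf_frq Hg.
have H : cf (fun x => q2 ((frq (f x)).1 * (frq (g x)).2.2.+1
                             + (frq (g x)).1 * (frq (f x)).2.2.+1,
      ((frq (f x)).2.1 * (frq (g x)).2.2.+1 + (frq (g x)).2.1 * (frq (f x)).2.2.+1,
       ((frq (f x)).2.2.+1 * (frq (g x)).2.2.+1).-1))%N).
  by apply: cf_q2; cfa.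
apply: cf_ext H => x; rewrite -[X in _ = X + _]frqK -[X in _ = _ + X]frqK.
move: (frq (f x)) (frq (g x)) => [a [b c]] [a' [b' c']]; rewrite /q2 /fst /snd.
rewrite prednK ?muln_gt0 // !natrD !natrM.
have c0 : (c.+1)%:R != 0 :> rat by rewrite pnatr_eq0.
have c0' : (c'.+1)%:R != 0 :> rat by rewrite pnatr_eq0.
by move: (c.+1)%:R (c'.+1)%:R c0 c0' => u v u0 v0; field; rewrite u0 v0.
Qed.

Lemma cf_mulq f g : cf f -> cf g -> cf (fun x => f x * g x).
Proof.
move=> Hf Hg.
have Kf := cf_frq Hf; have Kg := cf_frq Hg.
have H : cf (fun x => q2 ((frq (f x)).1 * (frq (g x)).1
                             + (frq (f x)).2.1 * (frq (g x)).2.1,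
      ((frq (f x)).1 * (frq (g x)).2.1 + (frq (f x)).2.1 * (frq (g x)).1,
       ((frq (f x)).2.2.+1 * (frq (g x)).2.2.+1).-1))%N).
  by apply: cf_q2; cfa.
apply: cf_ext H => x; rewrite -[X in _ = X * _]frqK -[X in _ = _ * X]frqK.
move: (frq (f x)) (frq (g x)) => [a [b c]] [a' [b' c']]; rewrite /q2 /fst /snd.
rewrite prednK ?muln_gt0 // !natrD !natrM.
have c0 : (c.+1)%:R != 0 :> rat by rewrite pnatr_eq0.
have c0' : (c'.+1)%:R != 0 :> rat by rewrite pnatr_eq0.
by move: (c.+1)%:R (c'.+1)%:R c0 c0' => u v u0 v0; field; rewrite u0 v0.
Qed.

Lemma cf_oppq f : cf f -> cf (fun x => - f x).
Proof.
move=> Hf; have Kf := cf_frq Hf.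
have H : cf (fun x => q2 ((frq (f x)).2.1, ((frq (f x)).1, (frq (f x)).2.2))).
  by apply: cf_q2; cfa.
by apply: cf_ext H => x; rewrite -[X in _ = - X]frqK /q2 /= -mulNr opprB.
Qed.

Lemma cf_leq_rat f g : cf f -> cf g -> cf (fun x => f x <= g x).
Proof.
move=> Hf Hg.
have Kf := cf_frq Hf; have Kg := cf_frq Hg.
have H : cf (fun x => (frq (f x)).1 * (frq (g x)).2.2.+1
                             + (frq (g x)).2.1 * (frq (f x)).2.2.+1 <=
     (frq (g x)).1 * (frq (f x)).2.2.+1 + (frq (f x)).2.1 * (frq (g x)).2.2.+1)%N.
  by cfa.
apply: cf_ext H => x; rewrite -[X in _ = (X <= _)]frqK -[X in _ = (_ <= X)]frqK.
move: (frq (f x)) (frq (g x)) => [a [b c]] [a' [b' c']]; rewrite /q2 /fst /snd.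
rewrite ler_pdivrMr ?ltr0Sn // mulrAC ler_pdivlMr ?ltr0Sn //.
by rewrite -(ler_nat rat) !natrD !natrM; apply/idP/idP; lra.
Qed.

Lemma cf_natq (n : G -> nat) : cf n -> cf (fun x => (n x)%:R : rat).
Proof.
move=> Hn; have H : cf (fun x => q2 (n x, (0%N, 0%N))) by apply: cf_q2; cfa.
by apply: cf_ext H => x; rewrite /q2 /= divr1 subr0.
Qed.

Lemma cf_invq (n : G -> nat) : cf n -> cf (fun x => ((n x).+1)%:R^-1 : rat).
Proof.
move=> Hn; have H : cf (fun x => q2 (1%N, (0%N, n x))) by apply: cf_q2; cfa.
by apply: cf_ext H => x; rewrite /q2 /= subr0 div1r.
Qed.

End RatClosure.

Section RatClosure2.
Context {G : Type} {cG : coded G}.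
Implicit Types f g : G -> rat.

Lemma cf_ltq f g : cf f -> cf g -> cf (fun x => f x < g x).
Proof.
move=> Hf Hg; have H := cf_neg (cf_leq_rat Hg Hf).
by apply: cf_ext H => x; rewrite ltNge.
Qed.

Lemma cf_normq f : cf f -> cf (fun x => `|f x|).
Proof.
move=> Hf; have H := cf_if (cf_leq_rat (cf_const coded_rat 0) Hf) Hf (cf_oppq Hf).
by apply: cf_ext H => x; case: ifP => h; [rewrite ger0_norm|rewrite ltr0_norm // ltNge h].
Qed.

Lemma cf_expq f (n : G -> nat) : cf f -> cf n -> cf (fun x => f x ^+ n x).
Proof.
move=> Hf Hn.
have H : cf (fun x => iter (n x) (fun y => f x * y) 1).
  by apply: cf_iter; cfa; refine (cf_mulq (f := fun p => f p.1) (g := snd) _ _); cfa.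
by apply: cf_ext H => x; elim: (n x) => [|k IH] /=; rewrite ?expr0 // exprS IH.
Qed.

Definition sumq (s : seq rat) : rat := foldr +%R 0 s.
Definition prodq (s : seq rat) : rat := foldr *%R 1 s.

Lemma sumqE I (F : I -> rat) s : sumq (map F s) = \sum_(i <- s) F i.
Proof. by elim: s => [|x s IH] /=; rewrite ?big_nil // big_cons -IH. Qed.

Lemma prodqE I (F : I -> rat) s : prodq (map F s) = \prod_(i <- s) F i.
Proof. by elim: s => [|x s IH] /=; rewrite ?big_nil // big_cons -IH. Qed.

Lemma cf_sumq (s : G -> seq rat) : cf s -> cf (fun x => sumq (s x)).
Proof.
move=> Hs; apply: cf_foldr; cfa.
by refine (cf_addq (f := fun p => p.2.1) (g := fun p => p.2.2) _ _); cfa.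
Qed.

Lemma cf_prodq (s : G -> seq rat) : cf s -> cf (fun x => prodq (s x)).
Proof.
move=> Hs; apply: cf_foldr; cfa.
by refine (cf_mulq (f := fun p => p.2.1) (g := fun p => p.2.2) _ _); cfa.
Qed.

Lemma cf_fact (n : G -> nat) : cf n -> cf (fun x => (n x)`!).
Proof.
move=> Hn; have H : cf (fun x => iteri (n x) (fun k a => k.+1 * a)%N 1%N) by cfa.
by apply: cf_ext H => x; elim: (n x) => //= k ->.
Qed.

Lemma cf_ffact (n m : G -> nat) : cf n -> cf m -> cf (fun x => n x ^_ m x).
Proof.
move=> Hn Hm.
have H : cf (fun x => iteri (m x) (fun k a => a * (n x - k))%N 1%N) by cfa.
by apply: cf_ext H => x; elim: (m x) => //= k ->; rewrite ffactnSr.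
Qed.

Lemma cf_expn (n m : G -> nat) : cf n -> cf m -> cf (fun x => n x ^ m x)%N.
Proof.
move=> Hn Hm; have H : cf (fun x => iter (m x) (fun a => n x * a)%N 1%N) by cfa.
by apply: cf_ext H => x; elim: (m x) => //= k ->; rewrite expnS.
Qed.

End RatClosure2.

Ltac cf_user4 := fail.
Ltac cf_user3 ::= lazymatch goal with
  | |- cf (fun x => GRing.natmul (GRing.one _) (@?n x)) => refine (cf_natq (n := n) _)
  | |- cf (fun x => GRing.inv (GRing.natmul (GRing.one _) (S (@?n x)))) =>
      refine (cf_invq (n := n) _)
  | |- cf (fun x => GRing.add (@?f x) (@?g x)) => refine (cf_addq (f := f) (g := g) _ _)
  | |- cf (fun x => GRing.mul (@?f x) (@?g x)) => refine (cf_mulq (f := f) (g := g) _ _)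
  | |- cf (fun x => GRing.opp (@?f x)) => refine (cf_oppq (f := f) _)
  | |- cf (fun x => GRing.exp (@?f x) (@?n x)) => refine (cf_expq (f := f) (n := n) _ _)
  | |- cf (fun x => Order.le (@?f x) (@?g x)) => refine (cf_leq_rat (f := f) (g := g) _ _)
  | |- cf (fun x => Order.lt (@?f x) (@?g x)) => refine (cf_ltq (f := f) (g := g) _ _)
  | |- cf (fun x => Num.norm (@?f x)) => refine (cf_normq (f := f) _)
  | |- cf (fun x => q2 (@?f x)) => refine (cf_q2 (f := f) _)
  | |- cf (fun x => frq (@?f x)) => refine (cf_frq (f := f) _)
  | |- cf (fun x => sumq (@?f x)) => refine (cf_sumq (s := f) _)
  | |- cf (fun x => prodq (@?f x)) => refine (cf_prodq (s := f) _)
  | |- cf (fun x => factorial (@?n x)) => refine (cf_fact (n := n) _)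
  | |- cf (fun x => falling_factorial (@?n x) (@?m x)) =>
      refine (cf_ffact (n := n) (m := m) _ _)
  | |- cf (fun x => expn (@?n x) (@?m x)) => refine (cf_expn (n := n) (m := m) _ _)
  | _ => cf_user4
  end.


(** * The search procedures *)

Definition term := (nat * (seq nat * rat))%type.
Definition pterm := (nat * (seq nat * fr))%type.
Definition tq (t : pterm) : term := (t.1, (t.2.1, q2 t.2.2)).
Definition pq (p : fr * fr) : rat * rat := (q2 p.1, q2 p.2).

(** The derivative of order [al] of the monomial with exponents [be]. The falling factorial vanishes
    when an order exceeds the exponent, which makes the truncated subtraction harmless. *)
Definition dmono n (al be : seq nat) (x : seq rat) : rat :=
  prodq [seq (nth 0%N be i ^_ nth 0%N al i)%:R
             * nth 0 x i ^+ (nth 0%N be i - nth 0%N al i)%N | i <- iota 0 n].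

Definition deval n (al : seq nat) (L : seq term) (s : nat) (x : seq rat) : rat :=
  sumq [seq (if t.1 == s then t.2.2 * dmono n al t.2.1 x else 0) | t <- L].

Definition deg (be : seq nat) : nat := foldr addn 0%N be.

(** At V = 2R it bounds, up to the factor [al]!, every derivative of the sum on the box of radius R
    ([devalR_bound]); at V = 2(R + 1) it is a Lipschitz constant there in the same sense
    ([devalR_lip]). *)
Definition wsum (V : nat) (L : seq term) : rat :=
  sumq [seq `|t.2.2| * V%:R ^+ deg t.2.1 | t <- L].

Definition afact (al : seq nat) : nat := foldr (fun a r => a`! * r)%N 1%N al.

Definition cell (N i : nat) (p : rat * rat) : rat * rat :=
  (p.1 + (p.2 - p.1) * (i%:R * (N.+1)%:R^-1), p.1 + (p.2 - p.1) * (i.+1%:R * (N.+1)%:R^-1)).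

Definition grid (N : nat) (B : seq (rat * rat)) : seq (seq (rat * rat)) :=
  foldr (fun p acc => flatten [seq [seq cell N i p :: g | g <- acc] | i <- iota 0 N.+1])
    [:: [::]] B.

Definition corner (X : seq (rat * rat)) : seq rat := [seq p.1 | p <- X].
Definition wid (X : seq (rat * rat)) : rat := sumq [seq p.2 - p.1 | p <- X].
Definition bnd (W : nat) (X : seq (rat * rat)) : bool :=
  all (fun p => (- W%:R <= p.1) && (p.2 <= W%:R)) X.

(** The batches are evaluated exactly at one corner and added to the bounds [uv] of the given
    derivative. The widening e covers the variation of the batches over the cell and, through [th],
    the batches still to come; both are known up to the factor [al]!. *)
Definition encl n (s : nat) (al : seq nat) (L : seq term) (X : seq (rat * rat))
    (uv : rat * rat) (W : nat) (th : rat) : rat * rat :=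
  let v0 := deval n al L s (corner X) in
  let e := (afact al)%:R * (wsum (2 * W.+1) L * wid X + th) in
  (uv.1 + v0 - e, uv.2 + v0 + e).

(** A bounded simulation of the given approximation algorithm. The shift by 2 is that of [code_erat]
    for finite endpoints, and the first test excludes empty intervals, on which that algorithm is
    unspecified. *)
Definition qhalt (fuel ca s : nat) (al : seq nat) (X : seq (rat * rat)) (uv : rat * rat) :=
  (uv.1 < uv.2) &&
  (run fuel ca (enc (s, (al, (X, ((enc uv.1).+2, (enc uv.2).+2))))) != 0%N).

(* The components: the number m of variables, the derivatives (s, (alpha, xi)),
   a box in R^(m+n), and m+n polynomials. *)
Definition item := (nat * (seq nat * seq nat))%type.
Definition cond := (nat * (seq item * (seq (fr * fr) * seq (seq pterm))))%type.
Definition cnd_items (c : cond) : seq item := c.2.1.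
Definition cnd_n (c : cond) : nat := size c.2.1.
Definition cnd_box (c : cond) : seq (rat * rat) := map pq c.2.2.1.
Definition cnd_poly (c : cond) : seq (seq term) := map (map tq) c.2.2.2.
Definition cnd_item (c : cond) (i : nat) : item := nth (0%N, ([::], [::])) (cnd_items c) i.
Definition peval N (P : seq term) (z : seq rat) : rat := deval N [::] P 0 z.

Definition proj (xi : seq nat) (X : seq (rat * rat)) : seq (rat * rat) :=
  [seq nth (0, 0) X l | l <- xi].

Definition apart (I J : rat * rat) : bool := (I.2 < J.1) || (J.2 < I.1).

(** [i] is an endpoint coded as by [code_erat]: 0 is minus infinity, 1 is plus infinity, and
    otherwise i - 2 codes a rational. *)
Definition lo_ok (i : nat) (u : rat) : bool :=
  (i == 0%N) || ((2 <= i)%N && (q2 (frc (i - 2)) < u)).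
Definition hi_ok (i : nat) (v : rat) : bool :=
  (i == 1%N) || ((2 <= i)%N && (v < q2 (frc (i - 2)))).

Definition inbox (B : seq (rat * rat)) (z : seq rat) : bool :=
  all (fun l => ((nth (0, 0) B l).1 <= nth 0 z l) && (nth 0 z l <= (nth (0, 0) B l).2))
    (iota 0 (size B)).

Definition nonexpanding (c : cond) (z z' : seq rat) : bool :=
  [&& inbox (cnd_box c) z, inbox (cnd_box c) z' &
   has (fun i => all (fun P =>
       `|peval (c.1 + cnd_n c) P z - peval (c.1 + cnd_n c) P z'| < `|nth 0 z i - nth 0 z' i|)
     (cnd_poly c)) (iota 0 (c.1 + cnd_n c))].

(** The second alternative excludes zeros on all of Z from the value at one corner: the left side
    bounds the oscillation over Z of a polynomial, [wsum] being a Lipschitz constant on the box of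
    radius W. *)
Definition avoids (c : cond) (W : nat) (Z : seq (rat * rat)) : bool :=
  has (fun l => apart (nth (0, 0) Z l) (nth (0, 0) (cnd_box c) l)) (iota 0 (c.1 + cnd_n c))
  || (bnd W Z && has (fun l => wsum (2 * W.+1) (nth [::] (cnd_poly c) l) * wid Z
        < `|peval (c.1 + cnd_n c) (nth [::] (cnd_poly c) l) (corner Z)|) (iota 0 c.1.+1)).

Definition hist := seq (seq term * rat).
Definition allL (H : hist) : seq term := flatten [seq r.1 | r <- H].

Section Search.
Variables (Sg : nat -> bool) (et : nat -> nat) (rh : nat -> seq rat).

(** A decidable test of well-formedness. Its last clause separates the projections of the box for
    items with equal index and order, so that distinctness holds over the whole box, as
    interpolation requires. *)
Definition valid (c : cond) : bool :=
  let B := cnd_box c in let n := cnd_n c in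
  [&& size B == (c.1 + n)%N, size (cnd_poly c) == (c.1 + n)%N, (0 < n)%N,
   all (fun it : item => [&& Sg it.1, size it.2.1 == et it.1, size it.2.2 == et it.1,
     all (fun l => l < c.1)%N it.2.2 &
     all (fun j => let p := nth (0, 0) (proj it.2.2 B) j in
            (- nth 0 (rh it.1) j <= p.1) && (p.2 <= nth 0 (rh it.1) j)) (iota 0 (et it.1))])
     (cnd_items c),
   all (fun p => p.1 <= p.2) B &
   all (fun i => all (fun j =>
     let I := cnd_item c i in let J := cnd_item c j in
     [|| i == j, ~~ ((I.1 == J.1) && (I.2.1 == J.2.1)) |
      has (fun l => apart (nth (0, 0) (proj I.2.2 B) l) (nth (0, 0) (proj J.2.2 B) l))
        (iota 0 (et I.1))]) (iota 0 n)) (iota 0 n)].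

Definition cell_ok (fuel ca : nat) (c : cond) (L : seq term) (th : rat) (W : nat)
    (X : seq (rat * rat)) (uvs : seq (rat * rat)) : bool :=
  [&& bnd W X,
   all (fun i => let it := cnd_item c i in
     qhalt fuel ca it.1 it.2.1 (proj it.2.2 X) (nth (0, 0) uvs i)) (iota 0 (cnd_n c)) &
   avoids c W (X ++ [seq let it := cnd_item c i in
     encl (et it.1) it.1 it.2.1 L (proj it.2.2 X) (nth (0, 0) uvs i) W th
     | i <- iota 0 (cnd_n c)])].

Definition covered (fuel ca : nat) (c : cond) (L : seq term) (th : rat) (W N : nat)
    (cert : seq (seq (rat * rat))) : bool :=
  let g := grid N (take c.1 (cnd_box c)) in
  all (fun j => cell_ok fuel ca c L th W (nth [::] g j) (nth [::] cert j)) (iota 0 (size g)).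

(** Like [wsum], for a radius that grows with k, which makes the sum of the batches entire. The code
    of [rh s] exceeds its entries, so the domain of S_s is covered at every stage. *)
Definition wt (k : nat) (L : seq term) : rat :=
  sumq [seq `|t.2.2| * ((2 * (k.+1 + enc (rh t.1)))%N)%:R ^+ deg t.2.1 | t <- L].

(** Only orders below the exponents of a term give a nonzero derivative, and their codes do not
    exceed the code of the exponents ([deg_enc]); so testing finitely many codes covers all orders.
    The tolerance is read off a simulation of its program. *)
Definition small_eps (fuel cb k : nat) (L : seq term) : bool :=
  all (fun t : term => [&& Sg t.1, size t.2.1 == et t.1 &
    all (fun x => let al := dec x : seq nat in (size al == et t.1) ==>
      ((run fuel cb (cpair t.1 x) != 0%N) &&
       (wt k L * (afact al * 2 ^ k.+2)%N%:R <= q2 (frc (run fuel cb (cpair t.1 x)).-1))))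
     (iota 0 (enc t.2.1).+1)]) L.

(** In this order: the batch, the margin left to later batches, the fuel of the simulations, the
    radius W, the fineness N of the grid, the enclosures on its cells, and two points that may
    witness non-expansion. *)
Definition stage_cert :=
  (seq pterm * (fr * (nat * (nat * (nat * (seq (seq (fr * fr)) * (seq fr * seq fr)))))))%type.

Definition stage_rec (w : stage_cert) : seq term * rat := (map tq w.1, q2 w.2.1).

(** The powers of 2 turn the bounds into convergent series: the weights are summable, all batches
    after a stage together stay within its margin, and together they use at most half of the
    tolerance. *)
Definition stage_ok (ca cb k : nat) (H : hist) (w : stage_cert) : bool :=
  let L := map tq w.1 in let th := q2 w.2.1 in
  let fuel := w.2.2.1 in let W := w.2.2.2.1 in let N := w.2.2.2.2.1 in
  let cert := map (map pq) w.2.2.2.2.2.1 in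
  let c := dec k : cond in
  [&& 0 < th, wt k L * (2 ^ k)%N%:R <= 1,
   all (fun r : seq term * rat => wt k L * (2 ^ k.+1)%N%:R <= r.2) H,
   small_eps fuel cb k L &
   [|| ~~ valid c,
    nonexpanding c (map q2 w.2.2.2.2.2.2.1) (map q2 w.2.2.2.2.2.2.2) |
    covered fuel ca c (L ++ allL H) th W N cert]].

Definition query := (nat * (seq nat * (seq (rat * rat) * (nat * nat))))%type.
Definition query_cert := (nat * (nat * (nat * (nat * seq (fr * fr)))))%type.

(** H is the history after k0 stages; what follows contributes at most [al]! times 2 / 2^k0 on the
    radius to which W is limited. The power is written as a successor because [cf_invq] inverts
    successors. *)
Definition query_ok (ca : nat) (x : query) (w : query_cert) (H : hist) : bool :=
  let s := x.1 in let al := x.2.1 in let B := x.2.2.1 in let I := x.2.2.2 in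
  let k0 := w.1 in let fuel := w.2.1 in let N := w.2.2.1 in let W := w.2.2.2.1 in
  let cert := map pq w.2.2.2.2 in
  let g := grid N B in
  [&& bnd W B, (W <= k0.+1 + enc (rh s))%N &
   all (fun j => let X := nth [::] g j in let uv := nth (0, 0) cert j in
     let E := encl (et s) s al (allL H) X uv W (2 * ((2 ^ k0).-1.+1)%:R^-1) in
     [&& qhalt fuel ca s al X uv, lo_ok I.1 E.1 & hi_ok I.2 E.2]) (iota 0 (size g))].

End Search.

Lemma cf_dmono : cf (fun p : nat * (seq nat * (seq nat * seq rat)) =>
  dmono p.1 p.2.1 p.2.2.1 p.2.2.2).
Proof. by rewrite /dmono; cfa. Qed.

Lemma cf_deval : cf (fun p : nat * (seq nat * (seq term * (nat * seq rat))) =>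
  deval p.1 p.2.1 p.2.2.1 p.2.2.2.1 p.2.2.2.2).
Proof.
rewrite /deval; cfa.
by refine (cf_app4 (f := fun p => p.1.1) (g := fun p => p.1.2.1) (k := fun p => p.2.2.1)
   (l := fun p => p.1.2.2.2.2) cf_dmono _ _ _ _); cfa.
Qed.

Lemma cf_deg : cf deg. Proof. by rewrite /deg; cfa. Qed.

Lemma cf_wsum : cf (fun p : nat * seq term => wsum p.1 p.2).
Proof. by have H := cf_deg; rewrite /wsum; cfa. Qed.

Lemma cf_afact : cf afact. Proof. by rewrite /afact; cfa. Qed.

Lemma cf_grid : cf (fun p : nat * seq (rat * rat) => grid p.1 p.2).
Proof. by rewrite /grid /cell; cfa. Qed.

Lemma cf_corner : cf corner. Proof. by rewrite /corner; cfa. Qed.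
Lemma cf_wid : cf wid. Proof. by rewrite /wid; cfa. Qed.
Lemma cf_bnd : cf (fun p : nat * seq (rat * rat) => bnd p.1 p.2).
Proof. by rewrite /bnd; cfa. Qed.

Ltac cf_user5 := fail.
Ltac cf_user4 ::= lazymatch goal with
  | |- cf (fun x => deval (@?a x) (@?b x) (@?c x) (@?d x) (@?e x)) =>
      refine (cf_comp (f := fun x => (a x, (b x, (c x, (d x, e x))))) cf_deval _)
  | |- cf (fun x => deg (@?a x)) => refine (cf_comp (f := a) cf_deg _)
  | |- cf (fun x => afact (@?a x)) => refine (cf_comp (f := a) cf_afact _)
  | |- cf (fun x => corner (@?a x)) => refine (cf_comp (f := a) cf_corner _)
  | |- cf (fun x => wid (@?a x)) => refine (cf_comp (f := a) cf_wid _)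
  | |- cf (fun x => wsum (@?a x) (@?b x)) =>
      refine (cf_comp (f := fun x => (a x, b x)) cf_wsum _)
  | |- cf (fun x => grid (@?a x) (@?b x)) =>
      refine (cf_comp (f := fun x => (a x, b x)) cf_grid _)
  | |- cf (fun x => bnd (@?a x) (@?b x)) =>
      refine (cf_comp (f := fun x => (a x, b x)) cf_bnd _)
  | _ => cf_user5
  end.

Lemma cf_encl : cf (fun p : nat * (nat * (seq nat * (seq term * (seq (rat * rat)
    * ((rat * rat) * (nat * rat)))))) =>
  encl p.1 p.2.1 p.2.2.1 p.2.2.2.1 p.2.2.2.2.1 p.2.2.2.2.2.1 p.2.2.2.2.2.2.1
    p.2.2.2.2.2.2.2).
Proof. by rewrite /encl; cfa. Qed.

Lemma cf_qhalt : cf (fun p : nat * (nat * (nat * (seq nat * (seq (rat * rat)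
    * (rat * rat))))) =>
  qhalt p.1 p.2.1 p.2.2.1 p.2.2.2.1 p.2.2.2.2.1 p.2.2.2.2.2).
Proof. by rewrite /qhalt; cfa. Qed.

Lemma cf_tq : cf tq. Proof. by rewrite /tq; cfa. Qed.
Lemma cf_pq : cf pq. Proof. by rewrite /pq; cfa. Qed.
Lemma cf_box : cf cnd_box.
Proof. by have H := cf_pq; rewrite /cnd_box; cfa. Qed.
Lemma cf_poly : cf cnd_poly.
Proof. by have H := cf_tq; rewrite /cnd_poly; cfa. Qed.
Lemma cf_cn : cf cnd_n. Proof. by rewrite /cnd_n; cfa. Qed.
Lemma cf_item : cf (fun p : cond * nat => cnd_item p.1 p.2).
Proof. by rewrite /cnd_item /cnd_items; cfa. Qed.
Lemma cf_peval : cf (fun p : nat * (seq term * seq rat) => peval p.1 p.2.1 p.2.2).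
Proof. by rewrite /peval; cfa. Qed.
Lemma cf_proj : cf (fun p : seq nat * seq (rat * rat) => proj p.1 p.2).
Proof. by rewrite /proj; cfa. Qed.
Lemma cf_apart : cf (fun p : (rat * rat) * (rat * rat) => apart p.1 p.2).
Proof. by rewrite /apart; cfa. Qed.
Lemma cf_inbox : cf (fun p : seq (rat * rat) * seq rat => inbox p.1 p.2).
Proof. by rewrite /inbox; cfa. Qed.

Lemma cf_take G (cG : coded G) T (cT : coded T) (n : G -> nat) (s : G -> seq T) :
  cf n -> cf s -> cf (fun x => take (n x) (s x)).
Proof.
move=> Hn Hs.
have H : cf (fun x => rev (drop (size (s x) - n x) (rev (s x)))).
  refine (cf_rev (s := fun x => drop (size (s x) - n x) (rev (s x))) _); cfa.
  by refine (cf_rev (s := s) _); cfa.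
apply: cf_ext H => x; rewrite drop_rev revK; case: (leqP (n x) (size (s x))) => h.
  by rewrite subKn.
by rewrite (_ : size (s x) - n x = 0)%N ?subn0 ?take_size ?take_oversize //; lia.
Qed.

Ltac cf_user6 := fail.
Ltac cf_user5 ::= lazymatch goal with
  | |- cf (fun x => encl (@?a x) (@?b x) (@?c x) (@?d x) (@?e x) (@?f x) (@?g x) (@?h x)) =>
      refine (cf_comp (f := fun x => (a x, (b x, (c x, (d x, (e x, (f x, (g x, h x)))))))) cf_encl _)
  | |- cf (fun x => qhalt (@?a x) (@?b x) (@?c x) (@?d x) (@?e x) (@?f x)) =>
      refine (cf_comp (f := fun x => (a x, (b x, (c x, (d x, (e x, f x)))))) cf_qhalt _)
  | |- cf (fun x => cnd_box (@?a x)) => refine (cf_comp (f := a) cf_box _)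
  | |- cf (fun x => cnd_poly (@?a x)) => refine (cf_comp (f := a) cf_poly _)
  | |- cf (fun x => cnd_n (@?a x)) => refine (cf_comp (f := a) cf_cn _)
  | |- cf (fun x => cnd_items (@?a x)) => refine (cf_fst (f := fun x => (a x).2) _)
  | |- cf (fun x => tq (@?a x)) => refine (cf_comp (f := a) cf_tq _)
  | |- cf (fun x => pq (@?a x)) => refine (cf_comp (f := a) cf_pq _)
  | |- cf (fun x => map tq (@?a x)) => refine (cf_map (s := a) (F := fun _ => tq) _ _)
  | |- cf (fun x => cnd_item (@?a x) (@?b x)) =>
      refine (cf_comp (f := fun x => (a x, b x)) cf_item _)
  | |- cf (fun x => proj (@?a x) (@?b x)) =>
      refine (cf_comp (f := fun x => (a x, b x)) cf_proj _)
  | |- cf (fun x => apart (@?a x) (@?b x)) =>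
      refine (cf_comp (f := fun x => (a x, b x)) cf_apart _)
  | |- cf (fun x => inbox (@?a x) (@?b x)) =>
      refine (cf_comp (f := fun x => (a x, b x)) cf_inbox _)
  | |- cf (fun x => peval (@?a x) (@?b x) (@?c x)) =>
      refine (cf_comp (f := fun x => (a x, (b x, c x))) cf_peval _)
  | |- cf (fun x => take (@?a x) (@?b x)) => refine (cf_take (n := a) (s := b) _ _)
  | _ => cf_user6
  end.

Lemma cf_lo_ok : cf (fun p : nat * rat => lo_ok p.1 p.2).
Proof. by have H := cf_frc; rewrite /lo_ok; cfa. Qed.
Lemma cf_hi_ok : cf (fun p : nat * rat => hi_ok p.1 p.2).
Proof. by have H := cf_frc; rewrite /hi_ok; cfa. Qed.

Lemma cf_nonexpanding : cf (fun p : cond * (seq rat * seq rat) =>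
  nonexpanding p.1 p.2.1 p.2.2).
Proof. by rewrite /nonexpanding; cfa. Qed.

Lemma cf_avoids : cf (fun p : cond * (nat * seq (rat * rat)) => avoids p.1 p.2.1 p.2.2).
Proof. by rewrite /avoids; cfa. Qed.

Lemma cf_allL : cf allL. Proof. by rewrite /allL; cfa. Qed.

Section SearchComputable.
Variables (Sg : nat -> bool) (et : nat -> nat) (rh : nat -> seq rat).
Hypotheses (HSg : cf Sg) (Het : cf et) (Hrh : cf rh).

Lemma cf_valid : cf (valid Sg et rh).
Proof. by rewrite /valid; cfa. Qed.

Lemma cf_cell_ok : cf (fun p : nat * (nat * (cond * (seq term * (rat * (nat
    * (seq (rat * rat) * seq (rat * rat))))))) =>
  cell_ok et p.1 p.2.1 p.2.2.1 p.2.2.2.1 p.2.2.2.2.1 p.2.2.2.2.2.1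
    p.2.2.2.2.2.2.1 p.2.2.2.2.2.2.2).
Proof.
rewrite /cell_ok; cfa.
refine (cf_comp (f := fun p => (p.2.2.1, (p.2.2.2.2.2.1, _))) cf_avoids _); cfa.
Qed.

Lemma cf_covered : cf (fun p : nat * (nat * (cond * (seq term * (rat * (nat
    * (nat * seq (seq (rat * rat)))))))) =>
  covered et p.1 p.2.1 p.2.2.1 p.2.2.2.1 p.2.2.2.2.1 p.2.2.2.2.2.1
    p.2.2.2.2.2.2.1 p.2.2.2.2.2.2.2).
Proof.
rewrite /covered; cfa.
refine (cf_comp (f := fun q => (q.1.1, (q.1.2.1, (q.1.2.2.1, (q.1.2.2.2.1,
  (q.1.2.2.2.2.1, (q.1.2.2.2.2.2.1, (_, _)))))))) cf_cell_ok _); cfa.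
Qed.

Lemma cf_wt : cf (fun p : nat * seq term => wt rh p.1 p.2).
Proof. by rewrite /wt; cfa. Qed.

Lemma cf_small_eps : cf (fun p : nat * (nat * (nat * seq term)) =>
  small_eps Sg et rh p.1 p.2.1 p.2.2.1 p.2.2.2).
Proof.
have H := cf_frc; have H' := cf_wt; rewrite /small_eps; cfa.
Qed.

Lemma cf_stage_ok : cf (fun p : nat * (nat * (nat * (hist * stage_cert))) =>
  stage_ok Sg et rh p.1 p.2.1 p.2.2.1 p.2.2.2.1 p.2.2.2.2).
Proof.
have H1 := cf_valid; have H2 := cf_wt.
rewrite /stage_ok; cbv zeta; cfa.
- lazymatch goal with |- cf (fun x => small_eps _ _ _ (@?a x) (@?b x) (@?c x) (@?d x)) =>
    refine (cf_comp (f := fun x => (a x, (b x, (c x, d x)))) cf_small_eps _) end.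
  by cfa.
- lazymatch goal with |- cf (fun x => nonexpanding (@?a x) (@?b x) (@?c x)) =>
    refine (cf_comp (f := fun x => (a x, (b x, c x))) cf_nonexpanding _) end.
  by cfa.
- lazymatch goal with |- cf (fun x => covered _ (@?a x) (@?b x) (@?c x) (@?d x) (@?e x)
      (@?f x) (@?g x) (@?h x)) =>
    refine (cf_comp (f := fun x => (a x, (b x, (c x, (d x, (e x, (f x, (g x, h x)))))))) cf_covered _) end.
  by have H3 := cf_allL; cfa.
Qed.

Lemma cf_query_ok : cf (fun p : nat * (query * (query_cert * hist)) =>
  query_ok et rh p.1 p.2.1 p.2.2.1 p.2.2.2).
Proof.
have H1 := cf_lo_ok; have H2 := cf_hi_ok; have H3 := cf_allL.
rewrite /query_ok; cfa.
Qed.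

End SearchComputable.

Section Programs.
Variables (Sg : nat -> bool) (et : nat -> nat) (rh : nat -> seq rat).
Hypotheses (HSg : cf Sg) (Het : cf et) (Hrh : cf rh).

(** The least certificate is the one that [Mu] finds. The other branch only makes the recursion
    total; under [search_total] it does not occur. *)
Definition next_hist ca cb k (H : hist) : hist :=
  match pselect (exists w, stage_ok Sg et rh ca cb k H (dec w)) with
  | left ex => stage_rec (dec (ex_minn ex)) :: H
  | right _ => H
  end.

Fixpoint hseq ca cb k : hist :=
  if k is j.+1 then next_hist ca cb j (hseq ca cb j) else [::].

Definition search_total ca cb :=
  forall k, exists w, stage_ok Sg et rh ca cb k (hseq ca cb k) (dec w).

Lemma cf_stage_rec : cf stage_rec.
Proof. by rewrite /stage_rec; cfa. Qed.

(** The codes of the two given programs are part of the input, so that one program serves all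
    families and tolerances; the algorithm of the theorem must be uniform in them. *)
Lemma hist_program : exists HP, forall ca cb, search_total ca cb ->
  forall k, evaluates HP (cpair (cpair ca cb) k) (enc (hseq ca cb k)).
Proof.
have [e He] : cf (fun p : ((nat * nat) * (nat * hist)) * nat =>
    nat_of_bool (~~ stage_ok Sg et rh p.1.1.1 p.1.1.2 p.1.2.1 p.1.2.2 (dec p.2))).
  apply: (@cf_enc _ _ _ coded_bool); cfa.
  refine (cf_comp (f := fun p => (p.1.1.1, (p.1.1.2, (p.1.2.1, (p.1.2.2, dec p.2)))))
            (cf_stage_ok HSg Het Hrh) _).
  by cfa.
have [d Hd] : cf (fun p : ((nat * nat) * (nat * hist)) * nat =>
    stage_rec (dec p.2) :: p.1.2.2).
  by have H := cf_stage_rec; cfa.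
exists (Prec Zero (Comp d (Pair Id (Mu e)))) => ca cb tot.
elim=> [|k IH]; first by apply: evaluates_Prec0; exact: evaluates_Zero.
apply: evaluates_PrecS IH _.
pose x := ((ca, cb), (k, hseq ca cb k)).
rewrite /= /next_hist; case: pselect => [ex|]; last by have := tot k.
case: ex_minnP => m m1 m2.
apply: evaluates_Comp (Hd (x, m)).
apply: evaluates_Pair; first exact: evaluates_Id.
apply: (@evaluates_Mu e (enc x) m (fun => 0%N)) => [j hj|].
  have -> : 1%N = nat_of_bool (~~ stage_ok Sg et rh ca cb k (hseq ca cb k) (dec j)).
    by case: (boolP (stage_ok _ _ _ _ _ _ _ _)) => // /m2; rewrite leqNgt hj.
  exact: (He (x, j)).
by have := He (x, m); rewrite /= m1.
Qed.

(** [ca] and [cb] determine the history, while [ca'] answers the queries on the unperturbed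
    function. With [ca' = ca] the program approximates T; with [ca'] deciding for the zero function
    it approximates the perturbation alone. *)
Lemma query_program : exists TP : nat -> nat -> nat -> prog,
  cf (fun p : nat * nat => code_prog (TP p.1 p.1 p.2)) /\
  forall ca' ca cb, search_total ca cb -> forall x : query,
    halts (TP ca' ca cb) (enc x) <->
    exists w : query_cert, query_ok et rh ca' x w (hseq ca cb w.1).
Proof.
have [HP HHP] := hist_program.
have [e He] : cf (fun p : (query * nat) * (hist * nat) =>
    nat_of_bool (~~ query_ok et rh p.2.2 p.1.1 (dec p.1.2) p.2.1)).
  apply: (@cf_enc _ _ _ coded_bool); cfa.
  refine (cf_comp (f := fun p => (p.2.2, (p.1.1, (dec p.1.2, p.2.1))))
            (cf_query_ok Het Hrh) _).
  by cfa.
have [d Hd] : cf (fun p : query * nat => (dec p.2 : query_cert).1) by cfa.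
pose tp ca' ca cb := Comp e (Pair Id (Pair
  (Comp HP (Pair (Const (cpair ca cb)) d)) (Const ca'))).
exists (fun ca' ca cb => Mu (tp ca' ca cb)); split.
  by rewrite /tp; cbn [code_prog]; cfa.
move=> ca' ca cb tot x.
have E j : evaluates (tp ca' ca cb) (cpair (enc x) j)
    (~~ query_ok et rh ca' x (dec j) (hseq ca cb (dec j : query_cert).1)).
  apply: evaluates_Comp; last exact: (He ((x, j), (hseq ca cb (dec j : query_cert).1, ca'))).
  apply: evaluates_Pair; first exact: evaluates_Id.
  apply: evaluates_Pair; last exact: evaluates_Const.
  apply: evaluates_Comp; last exact: HHP.
  by apply: evaluates_Pair; [exact: evaluates_Const|exact: (Hd (x, j))].
split=> [[v H]|[w Hw]].
  exists (dec v); apply/negPn/negP => h.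
  have := E v; rewrite h /=.
  inv_eval H; match goal with h' : evaluates _ (cpair (enc x) v) 0%N |- _ =>
    by move/(evaluates_fun h') end.
have ex : exists j, query_ok et rh ca' x (dec j) (hseq ca cb (dec j : query_cert).1).
  by exists (enc w); rewrite encK.
exists (ex_minn ex); case: ex_minnP => m m1 m2.
apply: (@evaluates_Mu _ (enc x) m (fun => 0%N)) => [j hj|].
  have -> : 1%N = nat_of_bool (~~ query_ok et rh ca' x (dec j)
      (hseq ca cb (dec j : query_cert).1)).
    by case: (boolP (query_ok _ _ _ _ _ _)) => // /m2; rewrite leqNgt hj.
  exact: E.
by have := E m; rewrite m1.
Qed.

End Programs.

(** The programs for [eta] and [rho] are known to halt on [Sigma] only; the guard keeps them from
    being run elsewhere. *)
Lemma cf_guard (P : nat -> bool) (f : nat -> nat) e :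
  cf P -> (forall x, P x -> evaluates e x (f x)) ->
  cf (fun x => if P x then f x else 0%N).
Proof.
move=> [d Hd] He; exists (Comp (Prec Zero (Comp e Fst)) (Pair Id d)) => x.
apply: evaluates_Comp; first exact: evaluates_Pair (evaluates_Id _) (Hd x).
have := He x; case: (P x) => h; last by apply: evaluates_Prec0; exact: evaluates_Zero.
apply: evaluates_PrecS; first by apply: evaluates_Prec0; exact: evaluates_Zero.
exact: evaluates_Comp (evaluates_Fst _ _) (h isT).
Qed.

(** * Real evaluation of terms *)

Section RealEval.
Variable R : realType.
Implicit Types (x y : nat -> R) (al be : seq nat) (L : seq term).

Definition monoR n al be x : R :=
  \prod_(0 <= i < n) ((nth 0%N be i ^_ nth 0%N al i)%:R
                      * x i ^+ (nth 0%N be i - nth 0%N al i)%N).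

Definition devalR n al L s x : R :=
  \sum_(t <- L) (if t.1 == s then ratr t.2.2 * monoR n al t.2.1 x else 0).

Definition rpt (z : seq rat) : nat -> R := fun i => ratr (nth 0 z i).

Lemma ratr_monoR n al be z : monoR n al be (rpt z) = ratr (dmono n al be z).
Proof.
rewrite /dmono prodqE rmorph_prod /monoR /index_iota subn0; apply: eq_bigr => i _.
by rewrite rmorphM rmorphXn /= ratr_nat.
Qed.

Lemma ratr_devalR n al L s z : devalR n al L s (rpt z) = ratr (deval n al L s z).
Proof.
rewrite /deval sumqE rmorph_sum; apply: eq_bigr => t _.
by case: ifP => _; rewrite ?rmorph0 // rmorphM /= ratr_monoR.
Qed.

Lemma devalR_cat n al L L' s x :
  devalR n al (L ++ L') s x = devalR n al L s x + devalR n al L' s x.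
Proof. exact: big_cat. Qed.

Lemma ratr_natr_mul (n : nat) (q : rat) : ratr (n%:R * q) = n%:R * ratr q :> R.
Proof. by rewrite rmorphM /= ratr_nat. Qed.

Lemma wsumE V L : wsum V L = \sum_(t <- L) `|t.2.2| * V%:R ^+ deg t.2.1.
Proof. exact: sumqE. Qed.

Lemma wsum_ge0 V L : 0 <= wsum V L.
Proof. by rewrite wsumE sumr_ge0 // => t _; rewrite mulr_ge0 ?exprn_ge0. Qed.

Lemma ratr_wsum V L :
  ratr (wsum V L) = \sum_(t <- L) `|ratr t.2.2| * V%:R ^+ deg t.2.1 :> R.
Proof.
rewrite wsumE rmorph_sum; apply: eq_bigr => t _.
by rewrite rmorphM rmorphXn /= ratr_norm ratr_nat.
Qed.

Lemma deg_ge n be : (\sum_(0 <= i < n) nth 0 be i <= deg be)%N.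
Proof.
elim: be n => [|b be IH] n.
  by rewrite big1 // => i _; rewrite nth_nil.
case: n => [|n]; first by rewrite big_geq.
by rewrite big_nat_recl //= leq_add2l.
Qed.

Lemma afactE n al : (size al <= n)%N ->
  afact al = (\prod_(0 <= i < n) (nth 0 al i)`!)%N.
Proof.
elim: al n => [|a al IH] n; first by rewrite big1 // => i _; rewrite nth_nil.
by case: n => // n h; rewrite big_nat_recl //= (IH n).
Qed.

Lemma afact_gt0 al : (0 < afact al)%N.
Proof. by elim: al => //= a al IH; rewrite muln_gt0 fact_gt0. Qed.

(** A binomial coefficient of b is at most 2^b. This is the origin of the factor 2 in all radii and
    of the factor [al]! in all bounds. *)
Lemma ffact_le b a : (b ^_ a <= a`! * 2 ^ b)%N.
Proof.
rewrite -bin_ffact mulnC leq_mul2l; apply/orP; right.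
have [h|h] := leqP a b; last by rewrite bin_small.
rewrite -[2%N]/(1 + 1)%N expnDn (bigD1 (inord a)) //= inordK // !exp1n !muln1.
exact: leq_addr.
Qed.

Lemma mono_bound n al be (V : nat) : (0 < V)%N -> (size al <= n)%N ->
  \prod_(0 <= i < n) ((nth 0%N be i ^_ nth 0%N al i)%:R
                      * V%:R ^+ (nth 0%N be i - nth 0%N al i)%N)
  <= (afact al)%:R * (2 * V)%:R ^+ deg be :> R.
Proof.
move=> V0 sal.
have V1 : 1 <= V%:R :> R by rewrite ler1n.
apply: (@le_trans _ _ (\prod_(0 <= i < n) ((nth 0%N al i)`!%:R
                      * (2 * V)%:R ^+ nth 0%N be i))).
  apply: ler_prod => i _; rewrite mulr_ge0 ?exprn_ge0 //=.
  rewrite natrM exprMn mulrA; apply: ler_pM => //; rewrite ?exprn_ge0 //.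
    by rewrite -natrX -natrM ler_nat ffact_le.
  by apply: ler_weXn2l => //; rewrite leq_subr.
rewrite big_split /= -natr_prod -(afactE sal) ler_wpM2l //.
rewrite prodrXr; apply: ler_weXn2l; last exact: deg_ge.
by rewrite ler1n muln_gt0.
Qed.

Lemma monoR_bound n al be x (V : nat) : (0 < V)%N -> (size al <= n)%N ->
  (forall i, (i < n)%N -> `|x i| <= V%:R) ->
  `|monoR n al be x| <= (afact al)%:R * (2 * V)%:R ^+ deg be.
Proof.
move=> V0 sal hx; apply: le_trans (mono_bound be V0 sal).
rewrite /monoR normr_prod !big_mkord; apply: ler_prod => i _.
rewrite normr_ge0 /= normrM normrX ger0_norm // ler_wpM2l //.
by apply: lerXn2r; rewrite ?nnegrE // hx.
Qed.

(** A bound by d(M - A) is stable under products, since A(M' - A') + (M - A)A' is at most MM' - AA'.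
    Monomials thus get a Lipschitz constant from a radius enlarged by 1, with no factor for the
    degree or the number of variables. *)
Lemma prod_lip (I : Type) (r : seq I) (u v A M : I -> R) (d : R) : 0 <= d ->
  (forall i, [/\ `|u i| <= A i, `|v i| <= A i, A i <= M i & `|u i - v i| <= d * (M i - A i)]) ->
  [/\ `|\prod_(i <- r) u i| <= \prod_(i <- r) A i,
      `|\prod_(i <- r) v i| <= \prod_(i <- r) A i,
      \prod_(i <- r) A i <= \prod_(i <- r) M i &
      `|\prod_(i <- r) u i - \prod_(i <- r) v i|
        <= d * (\prod_(i <- r) M i - \prod_(i <- r) A i)].
Proof.
move=> d0 h; elim: r => [|i r [h1 h2 h3 h4]].
  by rewrite !big_nil normr1 !subrr normr0 mulr0.
have [k1 k2 k3 k4] := h i; rewrite !big_cons !normrM.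
have A0 := le_trans (normr_ge0 _) k1.
have A0' := le_trans (normr_ge0 _) h1.
split; first exact: ler_pM.
- exact: ler_pM.
- exact: ler_pM.
move: (\prod_(j <- r) u j) (\prod_(j <- r) v j) (\prod_(j <- r) A j) (\prod_(j <- r) M j)
  h1 h2 h3 h4 A0' => pu pv pA pM h1 h2 h3 h4 A0'.
have -> : u i * pu - v i * pv = u i * (pu - pv) + (u i - v i) * pv by ring.
apply: (le_trans (ler_normD _ _)); rewrite !normrM.
apply: (@le_trans _ _ (A i * (d * (pM - pA)) + d * (M i - A i) * pA)).
  by apply: lerD; apply: ler_pM => //.
have : 0 <= d * ((M i - A i) * (pM - pA)) by rewrite !mulr_ge0 ?subr_ge0.
by lra.
Qed.

Lemma exp_lip (W d a b : R) g : 0 <= W -> 0 <= d -> `|a| <= W -> `|b| <= W ->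
  `|a - b| <= d ->
  [/\ `|a ^+ g| <= W ^+ g, `|b ^+ g| <= W ^+ g, W ^+ g <= (W + 1) ^+ g &
     `|a ^+ g - b ^+ g| <= d * ((W + 1) ^+ g - W ^+ g)].
Proof.
move=> W0 d0 ha hb hab.
have := @prod_lip nat (iota 0 g) (fun=> a) (fun=> b) (fun=> W) (fun=> W + 1) d d0.
rewrite !big_const_seq !count_predT size_iota -!Monoid.iteropE /= => H.
apply: H => _; split => //; first by lra.
by rewrite addrAC subrr add0r mulr1.
Qed.

Lemma monoR_lip n al be x y (W : nat) (d : R) : (size al <= n)%N -> 0 <= d ->
  (forall i, (i < n)%N -> `|x i| <= W%:R) -> (forall i, (i < n)%N -> `|y i| <= W%:R) ->
  (forall i, (i < n)%N -> `|x i - y i| <= d) ->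
  `|monoR n al be x - monoR n al be y|
    <= (afact al)%:R * (2 * W.+1)%:R ^+ deg be * d.
Proof.
move=> sal d0 hx hy hd; have W0 : 0 <= W%:R :> R by [].
pose K i : R := (nth 0%N be i ^_ nth 0%N al i)%:R.
pose g i := (nth 0%N be i - nth 0%N al i)%N.
have [//|_ _ hAM h] := @prod_lip 'I_n (index_enum 'I_n) (fun i => K i * x i ^+ g i)
  (fun i => K i * y i ^+ g i) (fun i => K i * W%:R ^+ g i)
  (fun i => K i * (W%:R + 1) ^+ g i) d d0.
  move=> i; have [h1 h2 h3 h4] := exp_lip (g i) W0 d0 (hx i (ltn_ord i))
    (hy i (ltn_ord i)) (hd i (ltn_ord i)).
  have K0 : 0 <= K i by [].
  rewrite !normrM (ger0_norm K0); split; try exact: ler_wpM2l.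
  by rewrite -!mulrBr normrM (ger0_norm K0) mulrCA ler_wpM2l.
have A0 : 0 <= \prod_(i < n) (K i * W%:R ^+ g i) by apply: prodr_ge0 => i _; rewrite mulr_ge0.
rewrite /monoR !big_mkord; apply: (le_trans h).
rewrite mulrC ler_wpM2r //.
apply: (@le_trans _ _ (\prod_(i < n) (K i * (W%:R + 1) ^+ g i))); first by lra.
have := @mono_bound n al be W.+1 isT sal.
by rewrite big_mkord -natr1.
Qed.

Lemma devalR_bound n al L s x (V : nat) : (0 < V)%N -> (size al <= n)%N ->
  (forall i, (i < n)%N -> `|x i| <= V%:R) ->
  `|devalR n al L s x| <= (afact al)%:R * ratr (wsum (2 * V) L).
Proof.
move=> V0 sal hx; rewrite ratr_wsum mulr_sumr; apply: (le_trans (ler_norm_sum _ _ _)).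
apply: ler_sum => t _; case: ifP => _; last first.
  by rewrite normr0 !mulr_ge0.
by rewrite normrM mulrCA ler_wpM2l // monoR_bound.
Qed.

Lemma devalR_lip n al L s x y (W : nat) (d : R) : (size al <= n)%N -> 0 <= d ->
  (forall i, (i < n)%N -> `|x i| <= W%:R) -> (forall i, (i < n)%N -> `|y i| <= W%:R) ->
  (forall i, (i < n)%N -> `|x i - y i| <= d) ->
  `|devalR n al L s x - devalR n al L s y|
    <= (afact al)%:R * ratr (wsum (2 * W.+1) L) * d.
Proof.
move=> sal d0 hx hy hd; rewrite ratr_wsum -sumrB mulr_sumr mulr_suml.
apply: (le_trans (ler_norm_sum _ _ _)).
apply: ler_sum => t _; case: ifP => _; last first.
  by rewrite subrr normr0 !mulr_ge0.
rewrite -mulrBr normrM.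
have := ler_wpM2l (normr_ge0 (ratr t.2.2 : R)) (monoR_lip t.2.1 sal d0 hx hy hd).
by move=> /le_trans; apply; rewrite le_eqVlt; apply/orP; left; apply/eqP; ring.
Qed.

Lemma devalR_wt n al L s x k (rh : nat -> seq rat) : (size al <= n)%N ->
  (forall i, (i < n)%N -> `|x i| <= (k.+1 + enc (rh s))%:R) ->
  `|devalR n al L s x| <= (afact al)%:R * ratr (wt rh k L).
Proof.
move=> sal hx; rewrite /wt sumqE rmorph_sum mulr_sumr.
apply: (le_trans (ler_norm_sum _ _ _)); apply: ler_sum => t _.
rewrite rmorphM rmorphXn /= ratr_norm ratr_nat.
case: eqP => ts; last by rewrite normr0 !mulr_ge0.
by rewrite normrM mulrCA ler_wpM2l // ts monoR_bound // addSn.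
Qed.

End RealEval.

(** * Boxes, compactness and grids *)

Section Boxes.
Variable R : realType.
Implicit Types (x y : nat -> R) (X B : seq (rat * rat)).

Definition inR X x : Prop :=
  forall i, (i < size X)%N -> ratr (nth (0, 0) X i).1 <= x i <= ratr (nth (0, 0) X i).2.

Definition near_pt n (r : R) x y : Prop := forall i, (i < n)%N -> `|y i - x i| < r.

(** Points are functions on nat in every dimension, which lets them be combined with untyped lists
    of exponents and intervals; a row vector is extended by 0. *)
Definition vf n (v : 'rV[R]_n) : nat -> R :=
  fun i => if insub i is Some j then v 0 j else 0.

Lemma vfE n (v : 'rV[R]_n) (i : 'I_n) : vf v i = v 0 i.
Proof. by rewrite /vf insubT //= => h; congr (v 0 _); apply: val_inj. Qed.

(** Compactness of the box, in the form of a finite list over which one can argue by induction. *)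
Lemma box_cover B (P : (nat -> R) -> R -> Prop) :
  (forall a, inR B a -> exists2 r, 0 < r & P a r) ->
  exists l : seq ('rV[R]_(size B) * R),
    (forall p, p \in l -> [/\ inR B (vf p.1), 0 < p.2 & P (vf p.1) p.2]) /\
    forall x, inR B x -> exists2 p, p \in l & near_pt (size B) p.2 (vf p.1) x.
Proof.
move=> H; set n := size B.
pose K := [set v : 'rV[R]_n | forall i : 'I_n,
  `[ratr (nth (0, 0) B i).1, ratr (nth (0, 0) B i).2]%classic (v ord0 i)].
have cK : compact K.
  by apply: (@rV_compact R n (fun i => `[ratr (nth (0, 0) B i).1, ratr (nth (0, 0) B i).2]%classic))
    => i; exact: segment_compact.
rewrite compact_cover in cK.
pose Dm := [set p : 'rV[R]_n * R | [/\ inR B (vf p.1), 0 < p.2 & P (vf p.1) p.2]].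
have KB v : K v -> inR B (vf v).
  move=> Kv i hi; have := Kv (Ordinal hi).
  by rewrite -(vfE v (Ordinal hi)) /= in_itv.
have [|v Kv|D' D'D cov] := cK _ Dm (fun p => ball p.1 p.2).
- by move=> p _; exact: ball_open.
- have [r r0 Pr] := H _ (KB v Kv).
  exists (v, r); last exact: ballxx.
  by split => //; exact: KB.
exists (finmap.enum_fset D'); split.
  by move=> p pD; have := D'D p pD; rewrite inE.
move=> x Bx; pose v : 'rV[R]_n := \row_i x i.
have vx : forall i, (i < n)%N -> vf v i = x i.
  by move=> i hi; rewrite (vfE v (Ordinal hi)) mxE.
have Kv : K v by move=> i /=; rewrite mxE in_itv /=; exact: Bx.
have [p /= pD' pv] := cov v Kv.
exists p => // i hi; rewrite (vfE p.1 (Ordinal hi)).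
have := pv; rewrite -ball_normE /= /ball_ /= => h.
rewrite distrC; apply: le_lt_trans h; rewrite -(vx i hi) (vfE v (Ordinal hi)).
have -> : p.1 0 (Ordinal hi) - v 0 (Ordinal hi) = (p.1 - v) 0 (Ordinal hi) by rewrite !mxE.
rewrite [leRHS]/Num.norm /= mx_normrE.
exact: (le_bigmax _ (fun ij : 'I_1 * 'I_n => `|(p.1 - v) ij.1 ij.2|) (0, Ordinal hi)).
Qed.

Lemma box_min B (g : (nat -> R) -> R) :
  (forall a, inR B a -> exists r e, [/\ 0 < r, 0 < e &
     forall x, inR B x -> near_pt (size B) r a x -> e <= g x]) ->
  exists2 e, 0 < e & forall x, inR B x -> e <= g x.
Proof.
move=> H.
have [|l [l1 l2]] := @box_cover B (fun a r => exists2 e, 0 < e &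
   forall x, inR B x -> near_pt (size B) r a x -> e <= g x).
  by move=> a /H [r [e [r0 e0 h]]]; exists r => //; exists e.
have [e e0 he] : exists2 e : R, 0 < e & forall p, p \in l -> forall x, inR B x ->
    near_pt (size B) p.2 (vf p.1) x -> e <= g x.
  elim: l l1 {l2} => [|p l IH] l1; first by exists 1.
  have [q ql|e e0 he] := IH; first by apply: l1; rewrite inE ql orbT.
  have [_ _ [e' e'0 he']] := l1 p (mem_head _ _).
  exists (Num.min e e'); first by rewrite lt_min e0 e'0.
  move=> q; rewrite inE => /predU1P [->|ql] x Bx hx.
    by rewrite ge_min (he' x Bx hx) orbT.
  by rewrite ge_min (he q ql x Bx hx).
by exists e => // x Bx; have [p pl hp] := l2 x Bx; exact: (he p pl).
Qed.

Definition ordered X : bool := all (fun p => p.1 <= p.2) X.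

Lemma inR_corner X : ordered X -> inR X (rpt R (corner X)).
Proof.
move=> h i hi; rewrite /rpt /corner (nth_map (0, 0)) // lexx /= ler_rat.
exact: (allP h _ (mem_nth _ hi)).
Qed.

Lemma bnd_le W X x i : bnd W X -> inR X x -> (i < size X)%N -> `|x i| <= W%:R.
Proof.
move=> hW hx hi; have /andP[h1 h2] := allP hW _ (mem_nth (0, 0) hi).
have /andP[k1 k2] := hx i hi; rewrite ler_norml -(ratr_nat R) -rmorphN.
by rewrite (le_trans _ k1) ?ler_rat //= (le_trans k2) ?ler_rat.
Qed.

Lemma wid_cons p X : wid (p :: X) = p.2 - p.1 + wid X.
Proof. by []. Qed.

Lemma wid_ge X i : ordered X -> (i < size X)%N ->
  (nth (0, 0) X i).2 - (nth (0, 0) X i).1 <= wid X.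
Proof.
rewrite /wid; elim: X i => [|p X IH] [|i] //= /andP[h1 h2] hi.
  rewrite lerDl sumqE big_seq sumr_ge0 // => q qX; rewrite subr_ge0.
  exact: (allP h2).
by apply: le_trans (IH i h2 hi) _; rewrite lerDr subr_ge0.
Qed.

Lemma wid_ge0 X : ordered X -> 0 <= wid X.
Proof.
by move=> h; rewrite /wid sumqE big_seq sumr_ge0 // => q qX; rewrite subr_ge0 (allP h).
Qed.

Lemma inR_dist X x y i : ordered X -> inR X x -> inR X y -> (i < size X)%N ->
  `|x i - y i| <= ratr (wid X).
Proof.
move=> h hx hy hi; have /andP[h1 h2] := hx i hi; have /andP[k1 k2] := hy i hi.
have := wid_ge h hi; rewrite -(ler_rat R) rmorphB /= => hw.
by rewrite ler_norml; apply/andP; split; lra.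
Qed.

Lemma cell_le N i p : p.1 <= p.2 -> (i < N.+1)%N ->
  [/\ p.1 <= (cell N i p).1, (cell N i p).1 <= (cell N i p).2, (cell N i p).2 <= p.2
    & (cell N i p).2 - (cell N i p).1 = (p.2 - p.1) / N.+1%:R].
Proof.
move=> h hi; have N0 : 0 < N.+1%:R :> rat by [].
have h' : 0 <= p.2 - p.1 by rewrite subr_ge0.
split; rewrite /cell /=.
- by rewrite lerDl !mulr_ge0.
- by rewrite lerD2l ler_wpM2l // ler_wpM2r // ler_nat.
- rewrite -lerBrDl -[leRHS]mulr1 ler_wpM2l //.
  by rewrite ler_pdivrMr // mul1r ler_nat.
by move: (N.+1%:R^-1) => c; rewrite -natr1; ring.
Qed.

Lemma gridP N p B X : reflect
  (exists i g, [/\ (i < N.+1)%N, g \in grid N B & X = cell N i p :: g]) (X \in grid N (p :: B)).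
Proof.
have -> : grid N (p :: B) = [seq cell N i p :: g | i <- iota 0 N.+1, g <- grid N B] by [].
apply: (iffP allpairsPdep) => -[i [g [hi hg ->]]]; exists i, g; split => //.
  by move: hi; rewrite mem_iota.
by rewrite mem_iota.
Qed.

Lemma grid_cell N B X : ordered B -> X \in grid N B ->
  [/\ size X = size B, ordered X,
   forall i, (i < size B)%N -> (nth (0, 0) B i).1 <= (nth (0, 0) X i).1 /\
                               (nth (0, 0) X i).2 <= (nth (0, 0) B i).2
   & wid X = wid B / N.+1%:R].
Proof.
elim: B X => [|p B IH] X.
  by move=> _; rewrite inE => /eqP ->; split => //; rewrite /wid /= mul0r.
move=> /andP[hp hB] /gridP [i [g [hi hg ->]]].
have [h1 h2 h3 h4] := IH g hB hg; have [k1 k2 k3 k4] := cell_le hp hi.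
split; first by rewrite /= h1.
- by rewrite /ordered /= k2.
- by move=> [|j] //= hj; exact: h3.
by rewrite !wid_cons h4 k4 [RHS]mulrDl.
Qed.

Lemma grid_cover N B x : ordered B -> inR B x -> exists2 X, X \in grid N B & inR X x.
Proof.
elim: B x => [|p B IH] x; first by move=> _ _; exists [::].
move=> /andP[hp hB] hx.
have [i|g hg gx] := IH (fun i => x i.+1) hB; first exact: (hx i.+1).
have /andP[h1 h2] := hx 0%N isT; rewrite /= in h1 h2.
have [j hj jx] : exists2 j, (j < N.+1)%N &
    ratr (cell N j p).1 <= x 0%N <= ratr (cell N j p).2.
  suff H m : (m <= N)%N -> x 0%N <= ratr (cell N m p).2 -> exists2 j, (j < N.+1)%N &
      ratr (cell N j p).1 <= x 0%N <= ratr (cell N j p).2.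
    apply: (H N) => //; rewrite /cell /= divff ?pnatr_eq0 // mulr1.
    by rewrite (_ : p.1 + _ = p.2) //; lra.
  elim: m => [|m IHm] hm hx'.
    by exists 0%N => //; rewrite hx' andbT /cell /= mul0r mulr0 addr0.
  have [le|/ltW lt] := leP (x 0%N) (ratr (cell N m p).2); first by apply: IHm => //; exact: ltnW.
  by exists m.+1 => //; rewrite hx' andbT.
exists (cell N j p :: g).
  by apply/gridP; exists j, g.
by move=> [|i] //= hi; exact: gx.
Qed.

Lemma inR_sub X B x : size X = size B ->
  (forall i, (i < size B)%N -> (nth (0, 0) B i).1 <= (nth (0, 0) X i).1 /\
                               (nth (0, 0) X i).2 <= (nth (0, 0) B i).2) ->
  inR X x -> inR B x.
Proof.
move=> sz h hx i hi; have [h1 h2] := h i hi; have := hx i; rewrite sz => /(_ hi) /andP[k1 k2].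
by rewrite (le_trans _ k1) ?ler_rat //= (le_trans k2) ?ler_rat.
Qed.

Lemma pow2_small (e : R) : 0 < e -> exists k, ((2 ^ k)%N%:R)^-1 < e.
Proof.
move=> e0; have e1 : 0 <= e^-1 by rewrite invr_ge0 ltW.
exists (Num.bound e^-1); rewrite invf_plt ?posrE ?ltr0n ?expn_gt0 //.
apply: lt_le_trans (archi_boundP e1) _.
by rewrite ler_nat ltnW // ltn_expl.
Qed.

Lemma natV_small (e : R) : 0 < e -> exists k, (k.+1%:R)^-1 < e.
Proof.
move=> e0; have [k hk] := pow2_small e0; exists (2 ^ k)%N.
apply: le_lt_trans hk; rewrite lef_pV2 ?posrE ?ltr0n ?expn_gt0 //.
by rewrite ler_nat.
Qed.

End Boxes.

(** * Correctness of the approximation queries *)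

Section Query.
Variables (R : realType) (Sg : nat -> bool) (et : nat -> nat) (rh : nat -> seq rat).
Variables (D : nat -> seq nat -> (nat -> R) -> R) (Dom : nat -> (nat -> R) -> Prop).
Variable ca : nat.

(** [D s al] stands for the derivative of order [al] of an unperturbed function on [Dom s]. It is
    instantiated by the derivatives of S on its boxes and by the zero function on the whole
    space. *)
Definition lipschitz_family := forall s al, Sg s -> size al = et s ->
  exists2 C : R, 0 <= C & forall x y (d : R), Dom s x -> Dom s y -> 0 <= d ->
    (forall i, (i < et s)%N -> `|x i - y i| <= d) -> `|D s al x - D s al y| <= C * d.

Definition queries_decide := forall s al X (uv : rat * rat), Sg s -> size al = et s ->
  size X = et s -> ordered X -> (forall x, inR X x -> Dom s x) -> uv.1 < uv.2 ->
  (exists fuel, qhalt fuel ca s al X uv) <->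
  forall x, inR X x -> ratr uv.1 < D s al x < ratr uv.2.

Hypothesis Dlip : lipschitz_family.
Hypothesis Dalg : queries_decide.

Lemma qhalt_sound fuel s al X uv x : Sg s -> size al = et s ->
  size X = et s -> ordered X -> (forall x, inR X x -> Dom s x) ->
  qhalt fuel ca s al X uv -> inR X x -> ratr uv.1 < D s al x < ratr uv.2.
Proof.
move=> h1 h2 h3 h4 h5 h6; have uv0 : uv.1 < uv.2 by case/andP: h6.
by apply: (iffLR (Dalg h1 h2 h3 h4 h5 uv0)); exists fuel.
Qed.

Lemma qhalt_mono f f' s al X uv : (f <= f')%N ->
  qhalt f ca s al X uv -> qhalt f' ca s al X uv.
Proof.
move=> h /andP[uv0 h']; rewrite /qhalt uv0 /=; apply/eqP => e.
case E: (run f _ _) h' => [|v] // _.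
by have := run_mono h E; rewrite e.
Qed.

(** E plays the value of the limit; only its distance to the partial sum enters, so the enclosure is
    valid whatever the later batches are, as long as they respect [th]. *)
Lemma encl_sound fuel s al L X uv W th (E : R) x : Sg s -> size al = et s ->
  size X = et s -> ordered X -> (forall x, inR X x -> Dom s x) ->
  bnd W X -> inR X x -> qhalt fuel ca s al X uv ->
  `|E - devalR (et s) al L s x| <= (afact al)%:R * ratr th ->
  ratr (encl (et s) s al L X uv W th).1 < D s al x + E
    < ratr (encl (et s) s al L X uv W th).2.
Proof.
move=> sS sal sX oX dX bX Xx q hE.
have /andP[q1 q2] := qhalt_sound sS sal sX oX dX q Xx.
have c := @inR_corner R X oX.
have := @devalR_lip R (et s) al L s x (rpt R (corner X)) W (ratr (wid X)).
have w0 : 0 <= ratr (wid X) :> R by rewrite ler0q wid_ge0.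
rewrite -{1 2 3 4 5}sX => /(_ _ w0) H.
have {}H := H _ (fun i hi => bnd_le bX Xx hi) (fun i hi => bnd_le bX c hi)
  (fun i hi => inR_dist oX Xx c hi).
rewrite sX in H; have {H} := H (ltac:(by rewrite sal)); rewrite ratr_devalR => H.
have EE : ratr ((afact al)%:R * (wsum (2 * W.+1) L * wid X + th)) =
  (afact al)%:R * ratr (wsum (2 * W.+1) L) * ratr (wid X) + (afact al)%:R * ratr th :> R.
  by rewrite rmorphM rmorphD rmorphM /= ratr_nat mulrDr mulrA.
rewrite /encl /= !(rmorphB, rmorphD) /= -/(ratr _) EE.
move: H hE; rewrite !ler_norml => /andP[a1 a2] /andP[b1 b2].
by apply/andP; split; lra.
Qed.

Definition itv_mem (I : nat * nat) (y : R) : Prop :=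
  (I.1 = 0%N \/ ((2 <= I.1)%N /\ ratr (q2 (frc (I.1 - 2))) < y)) /\
  (I.2 = 1%N \/ ((2 <= I.2)%N /\ y < ratr (q2 (frc (I.2 - 2))))).

Variables (Hs : nat -> hist) (hd : nat -> seq nat -> (nat -> R) -> R).

(** Batch j weighs at most 1 / 2^j, and 2 / 2^k is the sum of these bounds over j >= k. *)
Definition tail_bound := forall s al x k, Sg s -> size al = et s ->
  (forall i, (i < et s)%N -> `|x i| <= (k.+1 + enc (rh s))%:R) ->
  `|hd s al x - devalR (et s) al (allL (Hs k)) s x| <=
    (afact al)%:R * (2 / (2 ^ k)%N%:R).

Hypothesis Htail : tail_bound.

Lemma query_sound s al B I w x : Sg s -> size al = et s -> size B = et s -> ordered B ->
  (forall x, inR B x -> Dom s x) ->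
  query_ok et rh ca (s, (al, (B, I))) w (Hs w.1) -> inR B x ->
  itv_mem I (D s al x + hd s al x).
Proof.
move=> sS sal sB oB dB /and3P[/= bB hW /allP hall] Bx.
have [X Xg Xx] := grid_cover w.2.2.1 oB Bx.
have [sX oX subX _] := grid_cell oB Xg.
have dX y : inR X y -> Dom s y by move=> /(inR_sub sX subX)/dB.
have /hall : index X (grid w.2.2.1 B) \in iota 0 (size (grid w.2.2.1 B)).
  by rewrite mem_iota /= add0n index_mem.
rewrite nth_index // => /and3P[hq hlo hhi].
have bX : bnd w.2.2.2.1 X.
  apply/allP => p /(nthP (0, 0)) [i hi <-]; rewrite sX in hi.
  have [k1 k2] := subX i hi; have /andP[k3 k4] := allP bB _ (mem_nth (0, 0) hi).
  by rewrite (le_trans k3 k1) (le_trans k2 k4).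
have hx i : (i < et s)%N -> `|x i| <= (w.1.+1 + enc (rh s))%:R.
  move=> hi; apply: (le_trans (bnd_le bB Bx _)); rewrite ?sB // ler_nat //.
have := Htail sS sal hx.
have -> : 2 / (2 ^ w.1)%N%:R = ratr (2 * (2 ^ w.1).-1.+1%:R^-1) :> R.
  by rewrite prednK ?expn_gt0 // rmorphM fmorphV /= !ratr_nat.
move=> /(encl_sound sS sal (etrans sX sB) oX dX bX Xx hq) /andP[e1 e2].
split.
  case/orP: hlo => [/eqP ->|/andP[h1 h2]]; [by left|right; split => //].
  by apply: lt_trans e1; rewrite ltr_rat.
case/orP: hhi => [/eqP ->|/andP[h1 h2]]; [by left|right; split => //].
by apply: (lt_trans e2); rewrite ltr_rat.
Qed.

Lemma rat_between (x y : R) : x < y -> exists2 q : rat, x < ratr q & ratr q < y.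
Proof. by move=> /rat_in_itvoo [q]; rewrite in_itv /= => /andP[h1 h2]; exists q. Qed.

(** The limit is replaced by a partial sum with an explicit Lipschitz constant: e / 4 for the tail
    at each of the two points, and e / 4 for [D] and the partial sum together. *)
Lemma total_cont s al B (e : R) : Sg s -> size al = et s -> size B = et s ->
  ordered B -> (forall x, inR B x -> Dom s x) -> 0 < e ->
  exists2 r, 0 < r & forall x y, inR B x -> inR B y -> near_pt (size B) r x y ->
   `|(D s al x + hd s al x) - (D s al y + hd s al y)| <= e.
Proof.
move=> sS sal sB oB dB e0.
pose A : R := (afact al)%:R; have A0 : 0 < A by rewrite ltr0n afact_gt0.
have [W bW] : exists W, bnd W B.
  exists (\sum_(p <- B) Num.bound (`|p.1| + `|p.2|))%N.
  apply/allP => p pB; have := @archi_boundP rat (`|p.1| + `|p.2|) (addr_ge0 (normr_ge0 _) (normr_ge0 _)).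
  have : ((Num.bound (`|p.1| + `|p.2|))%:R : rat) <=
     (\sum_(p <- B) Num.bound (`|p.1| + `|p.2|))%N%:R.
    by rewrite ler_nat (big_rem _ pB) leq_addr.
  move=> h1 h2; have := ler_norm (- p.1); have := ler_norm p.2.
  have := normr_ge0 p.1; have := normr_ge0 p.2; rewrite normrN.
  by move=> ? ? ? ?; apply/andP; split; lra.
have [k0 hk0] := @pow2_small R (e / 8 / A) (ltac:(by rewrite !divr_gt0)).
pose k := maxn k0 W.
have hk : A * (2 / (2 ^ k)%N%:R) <= e / 4.
  have : ((2 ^ k)%N%:R)^-1 <= ((2 ^ k0)%N%:R)^-1 :> R.
    rewrite lef_pV2 ?posrE ?ltr0n ?expn_gt0 // ler_nat leq_exp2l //; exact: leq_maxl.
  move: hk0; rewrite ltr_pdivlMr // => h1 h2.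
  have : A * ((2 ^ k)%N%:R)^-1 <= A * ((2 ^ k0)%N%:R)^-1 by rewrite ler_wpM2l // ltW.
  by lra.
have tb x : inR B x -> `|hd s al x - devalR (et s) al (allL (Hs k)) s x| <= e / 4.
  move=> Bx; apply: le_trans hk; apply: Htail => // i hi.
  apply: (le_trans (bnd_le bW Bx _)); first by rewrite sB.
  by rewrite ler_nat; have := leq_maxr k0 W; rewrite -/k; lia.
have [C C0 hC] := Dlip sS sal.
pose C' := A * ratr (wsum (2 * W.+1) (allL (Hs k))).
have C'0 : 0 <= C' by apply: mulr_ge0; [exact: ltW|rewrite ler0q wsum_ge0].
exists (e / 4 / (C + C' + 1)); first by rewrite !divr_gt0 //; lra.
move=> x y Bx By hxy; set r := e / 4 / _ in hxy.
have r0 : 0 <= r by rewrite !divr_ge0 //; lra.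
have hd' i : (i < et s)%N -> `|x i - y i| <= r.
  by rewrite -sB => hi; rewrite distrC; exact/ltW/hxy.
have h1 := hC x y r (dB _ Bx) (dB _ By) r0 hd'.
have bx i : (i < et s)%N -> `|x i| <= W%:R by rewrite -sB; exact: bnd_le bW Bx.
have by' i : (i < et s)%N -> `|y i| <= W%:R by rewrite -sB; exact: bnd_le bW By.
have h2 := @devalR_lip R (et s) al (allL (Hs k)) s x y W r (ltac:(by rewrite sal)) r0 bx by' hd'.
have h3 := tb x Bx; have h4 := tb y By.
have h5 : (C + C') * r <= e / 4.
  rewrite /r mulrCA -[leRHS]mulr1 ler_wpM2l //; first by lra.
  by rewrite ler_pdivrMr ?mul1r; lra.
rewrite -/A -/C' in h2.
move: h1 h2 h3 h4; rewrite !ler_norml => /andP[a1 a2] /andP[b1 b2] /andP[c1 c2] /andP[d1 d2].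
by apply/andP; split; nra.
Qed.

Lemma small_pow (A e : R) W : 0 < A -> 0 < e -> exists k, (W <= k)%N /\
  A * (2 / (2 ^ k)%N%:R) <= e.
Proof.
move=> A0 e0; have [k0 hk0] := @pow2_small R (e / 2 / A) (ltac:(by rewrite !divr_gt0)).
exists (maxn k0 W); split; first exact: leq_maxr.
have : ((2 ^ maxn k0 W)%N%:R)^-1 <= ((2 ^ k0)%N%:R)^-1 :> R.
  rewrite lef_pV2 ?posrE ?ltr0n ?expn_gt0 // ler_nat leq_exp2l //; exact: leq_maxl.
move: hk0; rewrite ltr_pdivlMr // => h1 h2.
have : A * ((2 ^ maxn k0 W)%N%:R)^-1 <= A * ((2 ^ k0)%N%:R)^-1 by rewrite ler_wpM2l // ltW.
by lra.
Qed.

Lemma bnd_exists B : exists W, bnd W B.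
Proof.
exists (\sum_(p <- B) Num.bound (`|p.1| + `|p.2|))%N.
apply/allP => p pB.
have := @archi_boundP rat (`|p.1| + `|p.2|) (addr_ge0 (normr_ge0 _) (normr_ge0 _)).
have : ((Num.bound (`|p.1| + `|p.2|))%:R : rat) <=
   (\sum_(p <- B) Num.bound (`|p.1| + `|p.2|))%N%:R.
  by rewrite ler_nat (big_rem _ pB) leq_addr.
move=> h1 h2; have := ler_norm (- p.1); have := ler_norm p.2.
have := normr_ge0 p.1; have := normr_ge0 p.2; rewrite normrN.
by move=> ? ? ? ?; apply/andP; split; lra.
Qed.

(** Strict inequalities for a continuous function on a compact box hold with a uniform margin; this
    is what lets enclosures of finite precision succeed. *)
Lemma query_margin s al B I : Sg s -> size al = et s -> size B = et s -> ordered B ->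
  (forall x, inR B x -> Dom s x) ->
  (forall x, inR B x -> itv_mem I (D s al x + hd s al x)) ->
  exists2 e : R, 0 < e & forall x, inR B x ->
    (I.1 = 0%N \/ ((2 <= I.1)%N /\ ratr (q2 (frc (I.1 - 2))) + e <= D s al x + hd s al x)) /\
    (I.2 = 1%N \/ ((2 <= I.2)%N /\ D s al x + hd s al x + e <= ratr (q2 (frc (I.2 - 2))))).
Proof.
move=> sS sal sB oB dB H; have c := @inR_corner R B oB.
have [c1 c2] := H _ c.
have M (g : (nat -> R) -> R) : (forall x, inR B x -> 0 < g x) ->
   (forall x y, g x - g y <= `|(D s al x + hd s al x) - (D s al y + hd s al y)|) ->
   exists2 e, 0 < e & forall x, inR B x -> e <= g x.
  move=> g0 gl; apply: box_min => a Ba.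
  have [|r r0 hr] := total_cont (e := g a / 2) sS sal sB oB dB; first by rewrite divr_gt0 ?g0.
  exists r, (g a / 2); split=> // [|x Bx hx]; first by rewrite divr_gt0 ?g0.
  by have := le_trans (gl a x) (hr a x Ba Bx hx); lra.
have [e1 e10 h1] : exists2 e : R, 0 < e & forall x, inR B x ->
    (I.1 = 0%N \/ ((2 <= I.1)%N /\ ratr (q2 (frc (I.1 - 2))) + e <= D s al x + hd s al x)).
  case: c1 => [->|[I2 _]]; first by exists 1 => // x _; left.
  have [x Bx|x y|e e0 he] := M (fun x => D s al x + hd s al x - ratr (q2 (frc (I.1 - 2)))).
  - by have [[I0|[_ h]] _] := H x Bx; [rewrite I0 in I2|rewrite subr_gt0].
  - by apply: le_trans (ler_norm _); lra.
  by exists e => // x Bx; right; split => //; have := he x Bx; lra.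
have [e2 e20 h2] : exists2 e : R, 0 < e & forall x, inR B x ->
    (I.2 = 1%N \/ ((2 <= I.2)%N /\ D s al x + hd s al x + e <= ratr (q2 (frc (I.2 - 2))))).
  case: c2 => [->|[I2 _]]; first by exists 1 => // x _; left.
  have [x Bx|x y|e e0 he] := M (fun x => ratr (q2 (frc (I.2 - 2))) - (D s al x + hd s al x)).
  - by have [_ [I0|[_ h]]] := H x Bx; [rewrite I0 in I2|rewrite subr_gt0].
  - by rewrite distrC; apply: le_trans (ler_norm _); lra.
  by exists e => // x Bx; right; split => //; have := he x Bx; lra.
exists (Num.min e1 e2); first by rewrite lt_min e10 e20.
have m1 : Num.min e1 e2 <= e1 by rewrite ge_min lexx.
have m2 : Num.min e1 e2 <= e2 by rewrite ge_min lexx orbT.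
move=> x Bx; split.
  by case: (h1 x Bx) => [->|[? ?]]; [left|right; split => //; lra].
by case: (h2 x Bx) => [->|[? ?]]; [left|right; split => //; lra].
Qed.

(** Over the cell [D] stays within e of its value at the corner, so the algorithm must halt on a
    rational interval whose endpoints are chosen at a distance between e and 2e from that value. *)
Lemma choose_uv s al X (e C : R) : Sg s -> size al = et s -> size X = et s -> ordered X ->
  (forall x, inR X x -> Dom s x) -> 0 < e ->
  (forall x y (d : R), Dom s x -> Dom s y -> 0 <= d ->
    (forall i, (i < et s)%N -> `|x i - y i| <= d) -> `|D s al x - D s al y| <= C * d) ->
  C * ratr (wid X) <= e ->
  exists uv fuel, [/\ qhalt fuel ca s al X uv,
    D s al (rpt R (corner X)) - 2 * e < ratr uv.1 &
    ratr uv.2 < D s al (rpt R (corner X)) + 2 * e].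
Proof.
move=> sS sal sX oX dX e0 hC hw; set c := rpt R (corner X).
have Xc := @inR_corner R X oX; rewrite -/c in Xc.
have [u u1 u2] := @rat_between (D s al c - 2 * e) (D s al c - e) (ltac:(lra)).
have [v v1 v2] := @rat_between (D s al c + e) (D s al c + 2 * e) (ltac:(lra)).
have uv0 : (u, v).1 < (u, v).2 by rewrite /= -(ltr_rat R); lra.
have [fuel hf] : exists fuel, qhalt fuel ca s al X (u, v).
  apply: (iffRL (Dalg sS sal sX oX dX uv0)) => x Xx /=.
  have di i : (i < et s)%N -> `|x i - c i| <= ratr (wid X).
    by rewrite -sX; exact: inR_dist.
  have w0 : 0 <= ratr (wid X) :> R by rewrite ler0q wid_ge0.
  have := hC x c (ratr (wid X)) (dX _ Xx) (dX _ Xc) w0 di.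
  by rewrite ler_norml => /andP[h1 h2]; apply/andP; split; lra.
by exists (u, v), fuel.
Qed.

Lemma query_complete s al B I : Sg s -> size al = et s -> size B = et s -> ordered B ->
  (forall x, inR B x -> Dom s x) ->
  (forall x, inR B x -> itv_mem I (D s al x + hd s al x)) ->
  exists w, query_ok et rh ca (s, (al, (B, I))) w (Hs w.1).
Proof.
move=> sS sal sB oB dB H.
have [e e0 he] := query_margin sS sal sB oB dB H.
pose A : R := (afact al)%:R; have A0 : 0 < A by rewrite ltr0n afact_gt0.
have [W bW] := bnd_exists B.
(* The margin e is spent as follows: at most e / 4 on the endpoints [uv], e / 4 on the widening in
   [encl], and e / 8 on the tail at the corner. *)
have [k [Wk hk]] := @small_pow A (e / 8) W A0 (ltac:(lra)).
set L := allL (Hs k).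
have [C C0 hC] := Dlip sS sal.
pose w0 : R := ratr (wsum (2 * W.+1) L); pose b : R := ratr (wid B).
have w00 : 0 <= w0 by rewrite ler0q wsum_ge0.
have b0 : 0 <= b by rewrite ler0q wid_ge0.
have Q0 : 0 < (C + A * w0) * b + 1.
  by rewrite ltr_wpDl // mulr_ge0 // addr_ge0 // mulr_ge0 // ltW.
have [N hN] := @natV_small R (e / 8 / ((C + A * w0) * b + 1)) (ltac:(by rewrite !divr_gt0)).
have hN' : (C + A * w0) * (b / N.+1%:R) <= e / 8.
  move: hN; rewrite ltr_pdivlMr // => hN.
  rewrite mulrA; apply: le_trans (ltW hN); rewrite mulrC ler_wpM2l //; lra.
pose g := grid N B.
have [bN bNE] : exists bN, bN = b / N.+1%:R by exists (b / N.+1%:R).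
have bN0 : 0 <= bN by rewrite bNE divr_ge0.
rewrite -bNE in hN'.
have cells j : exists p : (rat * rat) * nat, (j < size g)%N ->
    qhalt p.2 ca s al (nth [::] g j) p.1 /\
    (let E := encl (et s) s al L (nth [::] g j) p.1 W (2 * ((2 ^ k).-1.+1)%:R^-1) in
     lo_ok I.1 E.1 && hi_ok I.2 E.2).
  have [hj|hj] := ltnP j (size g); last by exists ((0, 0), 0%N).
  set X := nth [::] g j; have Xg : X \in grid N B by exact: mem_nth.
  have [sX oX subX wX] := grid_cell oB Xg; rewrite sB in sX.
  have BX x : inR X x -> inR B x by apply: inR_sub => //; rewrite sX.
  have dX x : inR X x -> Dom s x by move/BX/dB.
  have wXR : ratr (wid X) = bN :> R.
    by rewrite wX rmorphM fmorphV /= ratr_nat bNE.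
  have CA : C * (bN) + A * w0 * (bN) <= e / 8 by rewrite -mulrDl.
  have Cb0 : 0 <= C * (bN) by rewrite mulr_ge0.
  have Ab0 : 0 <= A * w0 * (bN) by rewrite mulr_ge0 // mulr_ge0 // ltW.
  have [|//|uv [fuel [q1 q2 q3]]] := @choose_uv s al X (e / 8) C sS sal sX oX dX _ hC.
  - by lra.
  - by rewrite wXR; lra.
  exists (uv, fuel) => _; split => //.
  set c := rpt R (corner X) in q2 q3.
  have Bc : inR B c by exact/BX/inR_corner.
  have := Htail (x := c) (k := k) sS sal.
  have tc i : (i < et s)%N -> `|c i| <= (k.+1 + enc (rh s))%:R.
    rewrite -sB => hi; apply: (le_trans (bnd_le bW Bc hi)).
    by rewrite ler_nat (leq_trans Wk) // (leq_trans (leqnSn k)) // leq_addr.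
  move=> /(_ tc); rewrite -/L -/A => t1; have {}t1 := le_trans t1 hk.
  have [he1 he2] := he c Bc; rewrite ratr_devalR in t1.
  have EE : ratr ((afact al)%:R * (wsum (2 * W.+1) L * wid X + 2 * (2 ^ k).-1.+1%:R^-1)) =
    A * w0 * (bN) + A * (2 / (2 ^ k)%N%:R) :> R.
    rewrite prednK ?expn_gt0 // rmorphM rmorphD !rmorphM /= wXR fmorphV /= !ratr_nat.
    by rewrite /A /w0; ring.
  move: t1; rewrite ler_norml => /andP[t1 t2].
  apply/andP; split.
    case: he1 => [->|[I2 he1]]; first by [].
    apply/orP; right; rewrite I2 /= -(ltr_rat R) /encl /= !(rmorphB, rmorphD) /= EE.
    by lra.
  case: he2 => [->|[I2 he2]]; first by [].
  apply/orP; right; rewrite I2 /= -(ltr_rat R) /encl /= !(rmorphB, rmorphD) /= EE.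
  by lra.
have [f hf] := choice cells.
pose cert := [seq (frq (f j).1.1, frq (f j).1.2) | j <- iota 0 (size g)].
(* One fuel for all cells, as [qhalt] is monotone in it. *)
pose fuel := (\sum_(j <- iota 0 (size g)) (f j).2)%N.
exists (k, (fuel, (N, (W, cert)))).
rewrite /query_ok /= bW (leq_trans Wk) //=; last by rewrite (leq_trans (leqnSn k)) // leq_addr.
apply/allP => j; rewrite mem_iota /= add0n => hj.
have -> : nth (0, 0) (map pq cert) j = (f j).1.
  rewrite -map_comp (nth_map 0%N) ?size_iota // nth_iota // add0n /= /pq /= !frqK.
  by case: (f j).1.
have [h1 h2] := hf j hj; apply/andP; split => //.
apply: qhalt_mono h1; rewrite /fuel (big_rem j) /= ?leq_addr //.
by rewrite mem_iota.
Qed.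

Lemma query_iff s al B I : Sg s -> size al = et s -> size B = et s -> ordered B ->
  (forall x, inR B x -> Dom s x) ->
  (exists w, query_ok et rh ca (s, (al, (B, I))) w (Hs w.1)) <->
  (forall x, inR B x -> itv_mem I (D s al x + hd s al x)).
Proof.
move=> sS sal sB oB dB; split; last exact: query_complete.
by move=> [w Hw] x; exact: (query_sound sS sal sB oB dB Hw).
Qed.

End Query.

(** * Interpolation *)

Section Hermite.
Variable R : realType.
Implicit Types (p q : {poly R}).

Lemma derivn_XsubC_exp (c : R) n a :
  (('X - c%:P) ^+ n)^`(a) = ('X - c%:P) ^+ (n - a) *+ (n ^_ a).
Proof.
elim: a => [|a IH]; first by rewrite derivn0 subn0 ffactn0.
rewrite derivnS IH derivMn deriv_exp derivXsubC mul1r -mulrnA subnS.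
by rewrite ffactnSr mulnC.
Qed.

Lemma derivn_dvd0 D (v : R) p a : ('X - v%:P) ^+ D %| p -> (a < D)%N -> p^`(a).[v] = 0.
Proof.
elim: a D p => [|a IH] D p /dvdpP [q ->] aD.
  by rewrite derivn0 hornerM horner_exp hornerXsubC subrr expr0n eqn0Ngt aD mulr0.
case: D aD => // D aD; rewrite derivSn; apply: (IH D) => //.
rewrite derivM deriv_exp derivXsubC mul1r /=; apply: dvdp_add.
  by rewrite exprS mulrA dvdp_mull.
by rewrite mulrnAr -mulrnAl dvdp_mull.
Qed.

(** Let u vanish to order D at the other nodes and w at [v0]. From A u + B w = 1, the product A u is
    1 modulo w, so A u (X - v0)^a0 / a0! has the jet of its last factor at [v0] and the zero jet
    elsewhere. *)
Lemma hermite (vs : seq R) (D : nat) (v0 : R) (a0 : nat) : (a0 < D)%N ->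
  exists p, forall v a, v \in vs -> (a < D)%N ->
    p^`(a).[v] = ((v == v0) && (a == a0))%:R.
Proof.
move=> a0D.
pose u := \prod_(v <- vs | v != v0) ('X - v%:P) ^+ D.
pose w := ('X - v0%:P) ^+ D.
have cop : coprimep u w.
  rewrite coprimep_sym /u; apply: (big_rec (fun q => coprimep w q)); first exact: coprimep1.
  move=> v q ne IH; rewrite coprimepMr IH andbT coprimep_expl // coprimep_expr //.
  by rewrite coprimep_XsubC root_XsubC.
have [[A B] /= AB] := Bezout_eq1_coprimepP _ _ cop.
pose t := (a0`!)%:R^-1 *: ('X - v0%:P) ^+ a0.
exists (A * u * t) => v a vvs aD; case: eqP => [->|/eqP ne] /=; last first.
  apply: derivn_dvd0 aD; rewrite /u -big_filter (big_rem v) /=; last by rewrite mem_filter ne.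
  by rewrite mulrCA -mulrA dvdp_mulr.
have -> : A * u * t = t - B * t * w by rewrite -[X in X - _]mul1r -AB; ring.
rewrite derivnB hornerD hornerN (@derivn_dvd0 D v0 (B * t * w)) ?dvdp_mull // subr0.
rewrite /t derivnZ hornerZ derivn_XsubC_exp hornerMn horner_exp hornerXsubC subrr.
have [->|ne] := eqVneq a a0.
  by rewrite subnn expr0 ffactnn mulVf // pnatr_eq0 -lt0n fact_gt0.
have [lt|le] := ltnP a a0; first by rewrite expr0n subn_eq0 leqNgt lt mul0rn mulr0.
by rewrite ffact_small ?mulr0n ?mulr0 // ltn_neqAle eq_sym ne.
Qed.

Lemma derivn_horner_coef p S a (x : R) : (size p <= S)%N ->
  p^`(a).[x] = \sum_(b < S) p`_b * ((b ^_ a)%:R * x ^+ (b - a)).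
Proof.
move=> h.
have E : p = \sum_(b < S) p`_b *: 'X^b.
  rewrite -poly_def; apply/polyP => i; rewrite coef_poly; case: ltnP => // hi.
  by rewrite nth_default // (leq_trans h).
rewrite {1}E linear_sum horner_sum; apply: eq_bigr => b _ /=.
by rewrite derivnZ hornerZ derivnXn hornerMn hornerXn mulr_natl.
Qed.

Lemma rat_approx (x e : R) : 0 < e -> exists q : rat, `|ratr q - x| <= e.
Proof.
move=> e0; have [|q] := @rat_in_itvoo R (x - e) (x + e); first by lra.
by rewrite in_itv /= => /andP[h1 h2]; exists q; rewrite ler_norml; apply/andP; split; lra.
Qed.

(* A product of univariate interpolants, expanded and with coefficients
   rounded to rationals. *)
Lemma interpolate n s (I : finType) (sg : I -> nat) (al : I -> seq nat)
    (pt : I -> nat -> R) (j : I) (e : R) : 0 < e -> s = sg j ->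
  (forall i, i != j -> sg i = s -> (exists2 l, (l < n)%N & nth 0%N (al i) l != nth 0%N (al j) l) \/
                     (exists2 l, (l < n)%N & pt i l != pt j l)) ->
  exists L : seq term, (forall t, t \in L -> t.1 = s /\ size t.2.1 = n) /\
    forall i, `|devalR (if sg i == s then n else 0%N) (al i) L (sg i) (pt i) - (i == j)%:R| <= e.
Proof.
move=> e0 sj hdist.
pose vs l := [seq pt i l | i <- enum I].
(* Larger than every order of differentiation that occurs. *)
pose D := (\sum_(i : I) \sum_(l < n) nth 0%N (al i) l).+1.
have aD i (l : 'I_n) : (nth 0%N (al i) l < D)%N.
  by rewrite ltnS (bigD1 i) //= (bigD1 l) //= -addnA leq_addr.
have H l : exists p, forall v a, v \in vs l -> (a < D)%N ->
    (l < n)%N -> p^`(a).[v] = ((v == pt j l) && (a == nth 0%N (al j) l))%:R.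
  have [hl|hl] := ltnP l n; last by exists 0.
  have [p hp] := hermite (vs l) (pt j l) (aD j (Ordinal hl)).
  by exists p => v a h1 h2 _; exact: hp.
have [g hg] := choice H.
pose S := (\sum_(l < n) size (g l)).+1.
have gS (l : 'I_n) : (size (g l) <= S)%N by rewrite leqW // (bigD1 l) //= leq_addr.
pose be (f : {ffun 'I_n -> 'I_S}) : seq nat := [seq f l : nat | l <- enum 'I_n].
pose cf0 (f : {ffun 'I_n -> 'I_S}) : R := \prod_(l < n) (g l)`_(f l).
have nbe f (l : 'I_n) : nth 0%N (be f) l = f l.
  by rewrite /be (nth_map l) ?size_enum_ord // nth_ord_enum.
have val i : sg i = s -> \sum_f cf0 f * monoR n (al i) (be f) (pt i) = (i == j)%:R.
  move=> si.
  have -> : \sum_f cf0 f * monoR n (al i) (be f) (pt i) =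
     \prod_(l < n) (g l)^`(nth 0%N (al i) l).[pt i l].
    under [RHS]eq_bigr => l _ do rewrite (derivn_horner_coef _ _ (gS l)).
    rewrite bigA_distr_bigA /=; apply: eq_bigr => f _.
    rewrite /cf0 /monoR big_mkord -big_split /=; apply: eq_bigr => l _.
    by rewrite nbe.
  have vsi l : pt i l \in vs l by apply: map_f; rewrite mem_enum.
  have [->|ne] := eqVneq i j.
    apply: big1 => l _; rewrite hg ?eqxx //.
    by apply: map_f; rewrite mem_enum.
  (* A single factor kills the product: in the first case its order is the wrong one, in the second
     its node is. *)
  have [[l hl hne]|[l hl hne]] := hdist i ne si.
    by rewrite (bigD1 (Ordinal hl)) //= (hg l _ _ (vsi l) (aD i (Ordinal hl)) hl) (negbTE hne) andbF mul0r.
  by rewrite (bigD1 (Ordinal hl)) //= (hg l _ _ (vsi l) (aD i (Ordinal hl)) hl) (negbTE hne) mul0r.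
(* Rounding every coefficient within e / Q changes the value at any node by at most e. *)
pose Q : R := 1 + \sum_(i : I) \sum_f `|monoR n (al i) (be f) (pt i)|.
have Q0 : 0 < Q by rewrite ltr_pwDl // sumr_ge0 // => i _; rewrite sumr_ge0.
have ap f : exists q : rat, `|ratr q - cf0 f| <= e / Q.
  by apply: rat_approx; rewrite divr_gt0.
have [q hq] := choice ap.
exists [seq (s, (be f, q f)) | f <- enum {ffun 'I_n -> 'I_S}]; split.
  by move=> t /mapP [f _ ->] /=; rewrite size_map size_enum_ord.
move=> i; rewrite /devalR big_map big_enum /=.
have [si|ne] := eqVneq (sg i) s; last first.
  rewrite big1 //; have -> : (i == j) = false by apply: contra_neqF ne => /eqP ->.
  by rewrite subrr normr0 ltW.
rewrite -(val i si) -sumrB; apply: (le_trans (ler_norm_sum _ _ _)).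
apply: (@le_trans _ _ (\sum_f e / Q * `|monoR n (al i) (be f) (pt i)|)).
  by apply: ler_sum => f _; rewrite -mulrBl normrM ler_wpM2r.
have h : \sum_f `|monoR n (al i) (be f) (pt i)| <= Q.
  rewrite /Q (bigD1 i) //= addrCA lerDl addr_ge0 // sumr_ge0 // => k _.
  by rewrite sumr_ge0.
by rewrite -mulr_sumr mulrAC ler_pdivrMr // ler_wpM2l // ltW.
Qed.

End Hermite.

(** * Avoiding a thin set by a small perturbation *)

Section Avoid.
Variables (R : realType) (Sg : nat -> bool) (et : nat -> nat) (rh : nat -> seq rat).
Variable D : nat -> seq nat -> (nat -> R) -> R.
Implicit Types (c : cond) (L : seq term) (x y z : nat -> R).

Definition px (xi : seq nat) x : nat -> R := fun l => x (nth 0%N xi l).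

Definition dbox (s : nat) x : Prop :=
  forall i, (i < et s)%N -> `|x i| <= ratr (nth 0 (rh s) i).

Definition fval c L i x : R :=
  D (cnd_item c i).1 (cnd_item c i).2.1 (px (cnd_item c i).2.2 x)
  + devalR (et (cnd_item c i).1) (cnd_item c i).2.1 L (cnd_item c i).1 (px (cnd_item c i).2.2 x).

Definition zpt c L x : nat -> R :=
  fun l => if (l < c.1)%N then x l else fval c L (l - c.1) x.

Definition pR c l z : R := devalR (c.1 + cnd_n c) [::] (nth [::] (cnd_poly c) l) 0 z.

Definition Kc c := take c.1 (cnd_box c).

(** A thickening of the event to be excluded, which is the case [kappa] = 0. Excluding it for a
    positive [kappa] leaves room for later batches and for rational certificates. *)
Definition bad c L (kappa : R) x : Prop :=
  (forall l, (l < c.1 + cnd_n c)%N ->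
     ratr (nth (0, 0) (cnd_box c) l).1 - kappa <= zpt c L x l
       <= ratr (nth (0, 0) (cnd_box c) l).2 + kappa) /\
  (forall l, (l <= c.1)%N -> `|pR c l (zpt c L x)| <= kappa).

(** The member l may depend on both points and on i. Hence a failure consists of finitely many
    strict inequalities at one pair of points. *)
Definition expanding c := forall z z', inR (cnd_box c) z -> inR (cnd_box c) z' ->
  forall i, (i < c.1 + cnd_n c)%N ->
  exists2 l, (l < c.1 + cnd_n c)%N & `|z i - z' i| <= `|pR c l z - pR c l z'|.

Lemma inR_proj xi X x : all (fun l => l < size X)%N xi -> inR X x -> inR (proj xi X) (px xi x).
Proof.
move=> h hx i; rewrite size_map => hi; rewrite /proj (nth_map 0%N) //.
exact: (hx _ (allP h _ (mem_nth _ hi))).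
Qed.

Lemma ordered_proj xi X : ordered X -> ordered (proj xi X).
Proof.
move=> h; apply/allP => p /mapP [l _ ->].
have [hl|hl] := ltnP l (size X); first exact: (allP h _ (mem_nth _ hl)).
by rewrite nth_default.
Qed.

Lemma bnd_proj W xi X : bnd W X -> bnd W (proj xi X).
Proof.
move=> h; apply/allP => p /mapP [l _ ->].
have [hl|hl] := ltnP l (size X); first exact: (allP h _ (mem_nth _ hl)).
by rewrite nth_default //= oppr_le0 ler0n.
Qed.

Section Valid.
Variable c : cond.
Hypothesis vc : valid Sg et rh c.
Let m := c.1.
Let n := cnd_n c.
Let sg i := (cnd_item c i).1.
Let al i := (cnd_item c i).2.1.
Let xi i := (cnd_item c i).2.2.

Lemma valid_sizes : [/\ size (cnd_box c) = (m + n)%N, size (cnd_poly c) = (m + n)%N,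
  (0 < n)%N & ordered (cnd_box c)].
Proof. by move: vc => /and5P[/eqP ? /eqP ? ? ? /andP[? ?]]. Qed.

Lemma size_Kc : size (Kc c) = m.
Proof. by have [sB _ _ _] := valid_sizes; rewrite /Kc size_take sB; case: ltnP => //; lia. Qed.

Lemma ordered_Kc : ordered (Kc c).
Proof.
have [_ _ _ oB] := valid_sizes; apply/allP => p /mem_take; exact: (allP oB).
Qed.

Lemma valid_item i : (i < n)%N ->
  [/\ Sg (sg i), size (al i) = et (sg i), size (xi i) = et (sg i),
   all (fun l => l < m)%N (xi i) &
   forall x, inR (Kc c) x -> dbox (sg i) (px (xi i) x)].
Proof.
move=> hi; move: (vc) => /and5P[_ _ _ h _].
have := allP h _ (mem_nth (0%N, ([::], [::])) hi).
rewrite -/(cnd_item c i) => /and5P[h1 /eqP h2 /eqP h3 h4 h5]; split => //.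
move=> x Kx l hl; have := allP h5 l; rewrite mem_iota /= add0n hl => /(_ isT).
rewrite (nth_map 0%N) ?h3 // => /andP[b1 b2].
have hm : (nth 0%N (xi i) l < m)%N by apply: (allP h4); rewrite mem_nth // h3.
have := Kx (nth 0%N (xi i) l); rewrite size_Kc hm nth_take // => /(_ isT) /andP[k1 k2].
rewrite ler_norml -rmorphN /px (le_trans _ k1) ?ler_rat //=.
by rewrite (le_trans k2) ?ler_rat.
Qed.

Lemma valid_apart i j x : (i < n)%N -> (j < n)%N -> i <> j -> sg i = sg j -> al i = al j ->
  inR (Kc c) x -> exists2 l, (l < et (sg i))%N & px (xi i) x l <> px (xi j) x l.
Proof.
move=> hi hj ne es ea Kx; move: (vc) => /and5P[_ _ _ _ /andP[_ h]].
have /(allP h) : i \in iota 0 n by rewrite mem_iota.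
move=> /allP /(_ j); rewrite mem_iota /= add0n hj => /(_ isT) /or3P[/eqP //|/negP[]|].
  by rewrite -/(sg i) -/(sg j) -/(al i) -/(al j) es ea !eqxx.
move=> /hasP [l]; rewrite mem_iota /= add0n => hl hap; exists l => // e.
have [_ _ sxi mi _] := valid_item hi; have [_ _ sxj mj _] := valid_item hj.
have hli : (nth 0%N (xi i) l < m)%N by apply: (allP mi); rewrite mem_nth // sxi.
have hlj : (nth 0%N (xi j) l < m)%N by apply: (allP mj); rewrite mem_nth // sxj -es.
have := Kx _ (ltac:(by rewrite size_Kc; exact: hli)); rewrite nth_take // => /andP[a1 a2].
have := Kx _ (ltac:(by rewrite size_Kc; exact: hlj)); rewrite nth_take // => /andP[b1 b2].
move: hap e; rewrite /proj !(nth_map 0%N) ?sxi ?sxj -?es // /px /apart.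
rewrite -!(ltr_rat R) => /orP[] h' e.
  by move: h'; rewrite ltNge (le_trans b1) // -e.
by move: h'; rewrite ltNge (le_trans a1) // e.
Qed.

End Valid.

Lemma pigeonhole n N Q (h : {ffun 'I_n -> 'I_N} -> {ffun 'I_n.-1 -> 'I_Q}) :
  (Q ^ n.-1 < N ^ n)%N -> exists f f', f <> f' /\ h f = h f'.
Proof.
move=> lt; apply: contrapT => H.
have inj : injective h.
  by move=> f f' e; apply: contrapT => ne; apply: H; exists f, f'.
by have := leq_card h inj; rewrite !card_ffun !card_ord leqNgt lt.
Qed.

Lemma truncn_close (u v : R) : 0 <= u -> 0 <= v -> Num.truncn u = Num.truncn v -> `|u - v| <= 1.
Proof.
move=> u0 v0 e; have /andP[h1 h2] := truncn_itv u0; have /andP[h3 h4] := truncn_itv v0.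
by rewrite e -natr1 in h1 h2; rewrite -natr1 in h4; rewrite ler_norml; apply/andP; split; lra.
Qed.

Definition lincomb n (q : 'I_n -> rat) (G : 'I_n -> seq term) : seq term :=
  flatten [seq [seq (t.1, (t.2.1, q j * t.2.2)) | t <- G j] | j <- enum 'I_n].

Lemma devalR_lincomb N al n (q : 'I_n -> rat) G s x :
  devalR N al (lincomb q G) s x = \sum_(j < n) ratr (q j) * devalR N al (G j) s x.
Proof.
rewrite /devalR /lincomb big_flatten /= big_map big_enum /=; apply: eq_bigr => j _.
rewrite big_map mulr_sumr; apply: eq_bigr => t _ /=.
by case: ifP => _; rewrite ?mulr0 // rmorphM mulrA.
Qed.

Lemma wt_lincomb k n (q : 'I_n -> rat) G :
  wt rh k (lincomb q G) = \sum_(j < n) `|q j| * wt rh k (G j).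
Proof.
rewrite /wt sumqE /lincomb big_flatten /= big_map big_enum /=; apply: eq_bigr => j _.
rewrite big_map sumqE mulr_sumr; apply: eq_bigr => t _ /=.
by rewrite normrM mulrA.
Qed.

Lemma wt_cat k L L' : wt rh k (L ++ L') = wt rh k L + wt rh k L'.
Proof. by rewrite /wt !sumqE big_cat. Qed.

Lemma wt_ge0 k L : 0 <= wt rh k L.
Proof. by rewrite /wt sumqE sumr_ge0 // => t _; rewrite mulr_ge0 ?exprn_ge0. Qed.

Lemma fval_lincomb c n (q : 'I_n -> rat) G L i x :
  fval c (lincomb q G ++ L) i x = fval c L i x + \sum_(j < n) ratr (q j) *
    devalR (et (cnd_item c i).1) (cnd_item c i).2.1 (G j) (cnd_item c i).1
      (px (cnd_item c i).2.2 x).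
Proof. by rewrite /fval devalR_cat devalR_lincomb addrA addrAC -addrA addrC -!addrA; congr (_ + _); rewrite addrC. Qed.

Definition supp (Ga : seq (nat * seq nat)) L := all (fun t : term => (t.1, t.2.1) \in Ga) L.
Definition good_supp (Ga : seq (nat * seq nat)) :=
  all (fun p : nat * seq nat => Sg p.1 && (size p.2 == et p.1)) Ga.

Hypothesis Dlip : lipschitz_family Sg et D dbox.

Lemma dbox_px c i x : valid Sg et rh c -> (i < cnd_n c)%N -> inR (Kc c) x ->
  dbox (cnd_item c i).1 (px (cnd_item c i).2.2 x).
Proof. by move=> vc hi; have [_ _ _ _] := valid_item vc hi; apply. Qed.

Lemma mterm_lip c : valid Sg et rh c -> forall L, exists2 C : R, 0 <= C &
  forall i x y d, (i < cnd_n c)%N -> inR (Kc c) x -> inR (Kc c) y -> 0 <= d ->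
  (forall l, (l < c.1)%N -> `|x l - y l| <= d) ->
  let I := cnd_item c i in
  `|devalR (et I.1) I.2.1 L I.1 (px I.2.2 x) - devalR (et I.1) I.2.1 L I.1 (px I.2.2 y)| <= C * d.
Proof.
move=> vc L; have [W bW] := bnd_exists (Kc c).
pose A i : R := (afact (cnd_item c i).2.1)%:R * ratr (wsum (2 * W.+1) L).
have A0 i : 0 <= A i by rewrite mulr_ge0 // ler0q wsum_ge0.
exists (\sum_(i < cnd_n c) A i); first by rewrite sumr_ge0.
move=> i x y d hi Kx Ky d0 hd /=.
have [_ sal sxi ml _] := valid_item vc hi.
apply: (@le_trans _ _ (A i * d)); last first.
  by rewrite ler_wpM2r // (bigD1 (Ordinal hi)) //= lerDl sumr_ge0.
have lm j : (j < et (cnd_item c i).1)%N -> (nth 0%N (cnd_item c i).2.2 j < size (Kc c))%N.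
  by move=> hj; rewrite (size_Kc vc); apply: (allP ml); rewrite mem_nth // sxi.
apply: devalR_lip => // [|j hj|j hj|j hj]; first by rewrite sal.
- exact: (bnd_le bW Kx (lm j hj)).
- exact: (bnd_le bW Ky (lm j hj)).
by apply: hd; rewrite -(size_Kc vc); exact: lm.
Qed.

Lemma fval_lip c : valid Sg et rh c -> forall L, exists2 C : R, 0 <= C &
  forall i x y d, (i < cnd_n c)%N -> inR (Kc c) x -> inR (Kc c) y -> 0 <= d ->
  (forall l, (l < c.1)%N -> `|x l - y l| <= d) -> `|fval c L i x - fval c L i y| <= C * d.
Proof.
move=> vc L; have [C1 C10 h1] := mterm_lip vc L.
have H i : exists C : R, 0 <= C /\ ((i < cnd_n c)%N ->
   forall x y (d : R), dbox (cnd_item c i).1 x -> dbox (cnd_item c i).1 y -> 0 <= d ->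
    (forall j, (j < et (cnd_item c i).1)%N -> `|x j - y j| <= d) ->
    `|D (cnd_item c i).1 (cnd_item c i).2.1 x - D (cnd_item c i).1 (cnd_item c i).2.1 y| <= C * d).
  have [hi|hi] := ltnP i (cnd_n c); last by exists 0.
  have [Si sal _ _ _] := valid_item vc hi.
  by have [C C0 hC] := Dlip Si sal; exists C.
have [C hC] := choice H.
exists (C1 + \sum_(i < cnd_n c) C i).
  by rewrite addr_ge0 // sumr_ge0 // => i _; have [] := hC i.
move=> i x y d hi Kx Ky d0 hd; have := h1 i x y d hi Kx Ky d0 hd => /= {}h1.
have [C0 /(_ hi) h2] := hC i.
have [_ sal sxi ml _] := valid_item vc hi.
have hd' j : (j < et (cnd_item c i).1)%N ->
    `|px (cnd_item c i).2.2 x j - px (cnd_item c i).2.2 y j| <= d.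
  by move=> hj; apply: hd; apply: (allP ml); rewrite mem_nth // sxi.
have {}h2 := h2 _ _ d (dbox_px vc hi Kx) (dbox_px vc hi Ky) d0 hd'.
have : C i <= \sum_(i < cnd_n c) C i.
  by rewrite (bigD1 (Ordinal hi)) //= lerDl sumr_ge0 // => j _; have [] := hC j.
move=> hCi; have := ler_wpM2r d0 hCi => hCi'.
rewrite /fval mulrDl opprD addrACA addrC.
by apply: le_trans (ler_normD _ _) _; apply: lerD => //; exact: le_trans h2 _.
Qed.

Lemma pR_lip c (V : nat) : exists2 C : R, 0 <= C & forall l z z' d, 0 <= d ->
  (l < c.1 + cnd_n c)%N ->
  (forall i, (i < c.1 + cnd_n c)%N -> `|z i| <= V%:R) ->
  (forall i, (i < c.1 + cnd_n c)%N -> `|z' i| <= V%:R) ->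
  (forall i, (i < c.1 + cnd_n c)%N -> `|z i - z' i| <= d) -> `|pR c l z - pR c l z'| <= C * d.
Proof.
pose A l : R := ratr (wsum (2 * V.+1) (nth [::] (cnd_poly c) l)).
have A0 l : 0 <= A l by rewrite ler0q wsum_ge0.
exists (\sum_(l < c.1 + cnd_n c) A l); first by rewrite sumr_ge0.
move=> l z z' d d0 hl hz hz' hd.
apply: (@le_trans _ _ (A l * d)); last first.
  by rewrite ler_wpM2r // (bigD1 (Ordinal hl)) //= lerDl sumr_ge0.
have := @devalR_lip R (c.1 + cnd_n c) [::] (nth [::] (cnd_poly c) l) 0 z z' V d isT d0 hz hz' hd.
by rewrite mul1r.
Qed.

Lemma pR_bound c (V : nat) : (0 < V)%N -> exists2 C : R, 0 <= C & forall l z,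
  (l < c.1 + cnd_n c)%N ->
  (forall i, (i < c.1 + cnd_n c)%N -> `|z i| <= V%:R) -> `|pR c l z| <= C.
Proof.
move=> V0; pose A l : R := ratr (wsum (2 * V) (nth [::] (cnd_poly c) l)).
have A0 l : 0 <= A l by rewrite ler0q wsum_ge0.
exists (\sum_(l < c.1 + cnd_n c) A l); first by rewrite sumr_ge0.
move=> l z hl hz; apply: (@le_trans _ _ (A l)).
  have := @devalR_bound R (c.1 + cnd_n c) [::] (nth [::] (cnd_poly c) l) 0 z V V0 isT hz.
  by rewrite mul1r.
by rewrite (bigD1 (Ordinal hl)) //= lerDl sumr_ge0.
Qed.

End Avoid.

Lemma ltn_shift (m n l : nat) : (l < n.-1)%N -> (m.+1 + l < m + n)%N.
Proof. lia. Qed.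

Lemma ltn_unshift (m n l : nat) : (m < l)%N -> (l < m + n)%N -> (l - m.+1 < n.-1)%N.
Proof. lia. Qed.

Lemma scale_back (F : realFieldType) (t u v : F) : u != 0 -> v != 0 ->
  t / u = 8 * v * (t / (8 * u * v)).
Proof. by move=> u0 v0; field; rewrite u0 v0. Qed.

(** * Avoidance near one point of the box *)

Section LocalDensity.
Variables (R : realType) (Sg : nat -> bool) (et : nat -> nat) (rh : nat -> seq rat).
Variable D : nat -> seq nat -> (nat -> R) -> R.
Implicit Types (L : seq term) (x y z : nat -> R).
Hypothesis Dlip : lipschitz_family Sg et D (dbox et rh).
Variable c : cond.
Hypothesis vc : valid Sg et rh c.
Hypothesis xc : expanding R c.
Let m := c.1.
Let n := cnd_n c.
Let B := cnd_box c.
Let sg (i : nat) := (cnd_item c i).1.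
Let al (i : nat) := (cnd_item c i).2.1.
Let xi (i : nat) := (cnd_item c i).2.2.

Lemma devalR_other N a L s (z : nat -> R) : (forall t, t \in L -> t.1 != s) ->
  devalR N a L s z = 0.
Proof. by move=> h; rewrite /devalR big_seq big1 // => t /h /negbTE ->. Qed.

(** [G j] moves the j-th value at [a] by about 1 and the others by about 0. Values with another
    index are not affected at all; those with the same index differ in the order or, by
    [valid_apart], in the point. *)
Lemma local_interpolants a (e : R) : 0 < e -> inR (Kc c) a ->
  exists G : 'I_n -> seq term,
   (forall j t, t \in G j -> t.1 = sg j /\ size t.2.1 = et (sg j)) /\
   forall i j : 'I_n,
     `|devalR (et (sg i)) (al i) (G j) (sg i) (px (xi i) a) - (i == j)%:R| <= e.
Proof.
move=> e0 Ka.
suff H (j : 'I_n) : exists L, (forall t, t \in L -> t.1 = sg j /\ size t.2.1 = et (sg j)) /\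
   forall i : 'I_n,
     `|devalR (et (sg i)) (al i) L (sg i) (px (xi i) a) - (i == j)%:R| <= e.
  by have [G HG] := choice H; exists G; split => [j|i j]; have [] := HG j.
have [|L [l1 l2]] := @interpolate R (et (sg j)) (sg j) 'I_n (fun i => sg i)
   (fun i => al i) (fun i => px (xi i) a) j e e0 erefl.
  move=> i ne es; have [ea|ea] := eqVneq (al i) (al j).
    right; have ne' : (i : nat) <> j by move=> /ord_inj /eqP; exact/negP.
    have [l hl h] := valid_apart vc (ltn_ord i) (ltn_ord j) ne' es ea Ka.
    by exists l; [rewrite -es|exact/eqP].
  left; apply: contrapT => H; case/eqP: ea.
  have [_ si _ _ _] := valid_item R vc (ltn_ord i).
  have [_ sj _ _ _] := valid_item R vc (ltn_ord j).
  apply: (@eq_from_nth _ 0%N) => [|l hl]; first by rewrite si sj -/(sg i) es.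
  apply: contrapT => h; apply: H; exists l; last exact/eqP.
  by move: hl; rewrite si -/(sg i) es.
exists L; split => // i; have := l2 i.
have [-> //|ne] := eqVneq (sg i) (sg j).
rewrite !devalR_other // => t /l1 [-> _]; by rewrite eq_sym.
Qed.

(** Expansion is assumed on the box only, while a bad point may leave it by [kappa]; it is moved
    back first. *)
Definition clamp (z : nat -> R) : nat -> R := fun l =>
  Num.max (ratr (nth (0, 0) B l).1) (Num.min (ratr (nth (0, 0) B l).2) (z l)).

Lemma clampP (kappa : R) z : 0 <= kappa ->
  (forall l, (l < m + n)%N ->
    ratr (nth (0, 0) B l).1 - kappa <= z l <= ratr (nth (0, 0) B l).2 + kappa) ->
  inR B (clamp z) /\ forall l, (l < m + n)%N -> `|clamp z l - z l| <= kappa.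
Proof.
have [sB _ _ oB] := valid_sizes vc; rewrite -/B -/n -/m in sB oB.
have ol l : (l < size B)%N -> ratr (nth (0, 0) B l).1 <= ratr (nth (0, 0) B l).2 :> R.
  by move=> hl; rewrite ler_rat; exact: (allP oB _ (mem_nth _ hl)).
move=> k0 h; split => l hl.
  by rewrite /clamp le_max lexx /= ge_max ge_min lexx /= ol.
have := h l hl; have := ol l; rewrite sB => /(_ hl).
rewrite /clamp; move: (ratr (nth (0, 0) B l).1) (ratr (nth (0, 0) B l).2) => u v uv /andP[h1 h2].
by case: (leP v (z l)) => hv; [case: (leP u v)|case: (leP u (z l))] => hu;
  rewrite ler_norml; apply/andP; split; lra.
Qed.

Lemma zpt_fval L x i : (i < n)%N -> zpt et D c L x (m + i) = fval et D c L i x.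
Proof. by move=> hi; rewrite /zpt ltnNge leq_addr /= addKn. Qed.

(** The radius and the support depend on [a] alone, not on k, [L0] or [om]: compactness needs the
    former, and the tolerance, which can only be tested once the exponents are known, needs the
    latter. *)
Lemma local_dense a : inR (Kc c) a -> exists2 r : R, 0 < r & exists2 Ga,
  good_supp Sg et Ga & forall k L0 (om : R), 0 < om -> exists L,
   [/\ supp Ga L, ratr (wt rh k L) <= om & exists2 kappa, 0 < kappa &
     forall x, inR (Kc c) x -> near_pt m r a x -> ~ bad et D c (L ++ L0) kappa x].
Proof.
move=> Ka; have [sB sP n0 oB] := valid_sizes vc; rewrite -/B -/n -/m in sB oB sP n0.
have nR0 : 0 < n%:R :> R by rewrite ltr0n.
(* The matrix of moves is within e0 of the identity at [a] and changes by at most e0 within the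
   radius r. Entries off by 1/(2n) give rows off by 1/2 in total. *)
pose e0 : R := (4 * n%:R)^-1.
have e00 : 0 < e0 by rewrite invr_gt0 mulr_gt0.
have [G [G1 G2]] := local_interpolants e00 Ka.
pose M i j x := devalR (et (sg i)) (al i) (G j) (sg i) (px (xi i) x).
have [LM LM0 hLM] : exists2 LM : R, 0 <= LM & forall i (j : 'I_n) x y d, (i < n)%N ->
    inR (Kc c) x -> inR (Kc c) y -> 0 <= d ->
    (forall l, (l < m)%N -> `|x l - y l| <= d) -> `|M i j x - M i j y| <= LM * d.
  have H (j : 'I_n) : exists C : R, 0 <= C /\ forall i x y d, (i < n)%N ->
    inR (Kc c) x -> inR (Kc c) y -> 0 <= d ->
    (forall l, (l < m)%N -> `|x l - y l| <= d) -> `|M i j x - M i j y| <= C * d.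
    by have [C C0 hC] := mterm_lip R vc (G j); exists C.
  have [C hC] := choice H; exists (\sum_j C j).
    by rewrite sumr_ge0 // => j _; have [] := hC j.
  move=> i j x y d hi Kx Ky d0 hd; have [_ h] := hC j.
  apply: le_trans (h i x y d hi Kx Ky d0 hd) _; rewrite ler_wpM2r //.
  by rewrite (bigD1 j) //= lerDl sumr_ge0 // => j' _; have [] := hC j'.
pose r := e0 / (LM + 1).
have r0 : 0 < r by rewrite divr_gt0 // ltr_wpDl.
have LMr : LM * r <= e0.
  by rewrite /r mulrCA -[leRHS]mulr1 ler_wpM2l ?(ltW e00) // ler_pdivrMr ?mul1r; lra.
exists r => //; pose Ga := flatten [seq [seq (t.1, t.2.1) | t <- G j] | j <- enum 'I_n].
exists Ga.
  apply/allP => p /flattenP [l /mapP [j _ ->] /mapP [t tG ->]] /=.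
  have [-> ->] := G1 j t tG; rewrite eqxx andbT.
  by have [] := valid_item R vc (ltn_ord j).
move=> k L0 om om0.
have Mx x i (j : 'I_n) : inR (Kc c) x -> near_pt m r a x -> forall hi : (i < n)%N,
    `|M i j x - (Ordinal hi == j)%:R| <= (2 * n%:R)^-1.
  move=> Kx nx hi; have h1 := hLM i j x a r hi Kx Ka (ltW r0) (fun l hl => ltW (nx l hl)).
  have h2 := G2 (Ordinal hi) j; rewrite -/(M i j a) /= in h2.
  have -> : M i j x - (Ordinal hi == j)%:R = (M i j x - M i j a) + (M i j a - (Ordinal hi == j)%:R).
    by ring.
  apply: (le_trans (ler_normD _ _)).
  have -> : (2 * n%:R)^-1 = e0 + e0.
    rewrite /e0 !invfM -mulrDl; congr (_ * _); lra.
  by apply: lerD => //; exact: le_trans h1 LMr.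
pose TG : R := \sum_(j < n) ratr (wt rh k (G j)).
have TG0 : 0 <= TG by rewrite sumr_ge0 // => j _; rewrite ler0q wt_ge0.
have [t ht] := @natV_small R (om / (TG + 1)) (ltac:(by rewrite divr_gt0 // ltr_wpDl)).
(* The coefficients of the [G j] will lie in [0, tau], which keeps the weight of every combination
   below [om]. *)
pose tau : rat := (t.+1%:R)^-1.
have tauE : ratr tau = (t.+1%:R)^-1 :> R by rewrite fmorphV /= ratr_nat.
have tau0 : 0 < ratr tau :> R by rewrite tauE invr_gt0.
have tau1 : ratr tau <= 1 :> R by rewrite tauE invf_le1 ?ler1n.
have tauTG : ratr tau * TG <= om.
  move: ht; rewrite -tauE ltr_pdivlMr ?ltr_wpDl // => /ltW; apply: le_trans.
  by rewrite ler_wpM2l ?(ltW tau0) //; lra.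
have [Cf Cf0 hCf] := fval_lip Dlip vc L0.
have [VB bVB] := bnd_exists B.
have [LP LP0 hLP] := @pR_lip R c VB.+1.
have [V' V'0 hV'] := @pR_bound R c VB.+1 isT.
(* Collects what a displacement of the base point does: Cf comes from the old values and n LM from
   the new batches, while 1 stands for the distance of the two hits themselves. *)
pose Lam := 1 + Cf + n%:R * LM.
have Lam0 : 1 <= Lam by rewrite /Lam -addrA lerDl addr_ge0 // mulr_ge0 // ltW.
pose C' := (Num.bound (16 * V' * Lam / ratr tau)).+2.
have hC' : 16 * V' * Lam / ratr tau + 1 <= C'%:R :> R.
  have /archi_boundP : 0 <= 16 * V' * Lam / ratr tau.
    by rewrite divr_ge0 ?(ltW tau0) // !mulr_ge0 //; lra.
  by rewrite /C' -!natr1 => /ltW; lra.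
(* This makes Q^(n-1) = C'^(n-1) N^(n-1) smaller than N^n. The choice of C' ensures that Q buckets
   of width [sig] cover [-V', V'], as 2V' / sig = 16 V' Lam N / tau. *)
pose N := (C' ^ n.-1).+1.
pose Q := (C' * N)%N.
pose sig : R := ratr tau / (8 * N%:R * Lam).
have NR0 : 0 < N%:R :> R by rewrite ltr0n.
have Lam00 : 0 < Lam by lra.
have sig0 : 0 < sig by rewrite divr_gt0 // !mulr_gt0.
(* So small that at two clamped hits the first m + 1 members of Psi differ by at most [sig], and
   that clamping two points costs at most [sig]. *)
pose kap := sig / (2 * (2 + LP)).
have kap0 : 0 < kap by rewrite divr_gt0 // mulr_gt0 // ltr_wpDr.
have sig1 : sig <= 1.
  rewrite /sig ler_pdivrMr ?mul1r ?mulr_gt0 //.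
  have : 1 <= N%:R :> R by rewrite ler1n.
  move=> N1; have : 1 * 1 <= N%:R * Lam by apply: ler_pM.
  by lra.
have kap1 : 2 * (1 + LP) * kap <= sig /\ 2 * kap <= sig /\ kap <= 1.
  have E : kap * (2 * (2 + LP)) = sig by rewrite /kap divfK // gt_eqF // mulr_gt0 // ltr_wpDr.
  have : 0 <= LP * kap by rewrite mulr_ge0 // ltW.
  by move=> h; split; [|split]; lra.
case: kap1 => kap1 [kap2 kap3].
pose q (f : {ffun 'I_n -> 'I_N}) : 'I_n -> rat := fun j => tau * ((f j)%:R / N%:R).
have qE f j : ratr (q f j) = ratr tau * ((f j)%:R / N%:R) :> R.
  by rewrite /q rmorphM; congr (_ * _); rewrite rmorphM fmorphV /= !ratr_nat.
have q0 f j : 0 <= q f j by rewrite /q mulr_ge0 // ?divr_ge0 // invr_ge0.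
have q1 f j : q f j <= tau.
  rewrite /q -[leRHS]mulr1 ler_wpM2l // ?invr_ge0 // ler_pdivrMr ?ltr0n // mul1r ler_nat.
  exact: ltnW.
case: (pselect (exists f : {ffun 'I_n -> 'I_N}, forall x, inR (Kc c) x -> near_pt m r a x ->
   ~ bad et D c (lincomb (q f) G ++ L0) kap x)) => [[f hf]|H].
  exists (lincomb (q f) G); split; last by exists kap.
  - apply/allP => u /flattenP [l /mapP [j _ ->] /mapP [t' tG ->]] /=.
    apply/flattenP; exists [seq (t.1, t.2.1) | t <- G j].
      by apply/mapP; exists j; rewrite ?mem_enum.
    by apply/mapP; exists t'.
  rewrite wt_lincomb rmorph_sum /=; apply: le_trans tauTG; rewrite mulr_sumr.
  apply: ler_sum => j _; rewrite rmorphM /= ler_wpM2r ?ler0q ?wt_ge0 // ler_rat.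
  by rewrite ger0_norm.
exfalso.
have {}H f : exists x, [/\ inR (Kc c) x, near_pt m r a x &
    bad et D c (lincomb (q f) G ++ L0) kap x].
  apply: contrapT => h; apply: H; exists f => x Kx nx b; apply: h; by exists x.
have [X hX] := choice H.
pose Z f := zpt et D c (lincomb (q f) G ++ L0) (X f).
have Zc f : inR B (clamp (Z f)) /\ forall l, (l < m + n)%N -> `|clamp (Z f) l - Z f l| <= kap.
  by have [_ _ [h _]] := hX f; apply: clampP => //; exact: ltW.
have VBle (l : nat) (u : R) : u <= VB%:R -> u <= VB.+1%:R by rewrite -natr1; lra.
have Zcb f l : (l < m + n)%N -> `|clamp (Z f) l| <= VB%:R.
  by move=> hl; have [h _] := Zc f; apply: (bnd_le bVB h); rewrite sB.
have Zb f l : (l < m + n)%N -> `|Z f l| <= VB.+1%:R.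
  move=> hl; have [_ /(_ l hl)] := Zc f; have := Zcb f l hl.
  by rewrite !ler_norml -natr1 => /andP[? ?] /andP[? ?]; apply/andP; split; lra.
have small f l : (l <= m)%N -> `|pR c l (clamp (Z f))| <= (1 + LP) * kap.
  move=> hl; have [_ _ [_ h]] := hX f; have {}h := h l hl; rewrite -/(Z f) in h.
  have hl' : (l < m + n)%N by rewrite (leq_ltn_trans hl) // -[ltnLHS]addn0 ltn_add2l.
  have [_ h2] := Zc f.
  have := hLP l _ _ kap (ltW kap0) hl' (fun i hi => VBle i _ (Zcb f i hi)) (Zb f) h2.
  move: h; rewrite !ler_norml => /andP[? ?] /andP[? ?]; apply/andP; split; lra.
(* Only the last n - 1 members are sorted into buckets, since the first m + 1 are already close to 0
   at a hit. *)
pose bk f l : nat := Num.truncn ((pR c (m.+1 + l) (clamp (Z f)) + V') / sig).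
have pRb f l : (l < m + n)%N -> `|pR c l (clamp (Z f))| <= V'.
  by move=> hl; apply: hV' => // i hi; exact/VBle/Zcb.
have mn l : (l < n.-1)%N -> (m.+1 + l < m + n)%N; first by exact: ltn_shift.
have bk0 f l : (l < n.-1)%N -> 0 <= (pR c (m.+1 + l) (clamp (Z f)) + V') / sig.
  move=> /mn hl; have := pRb f _ hl; rewrite ler_norml => /andP[h _].
  by rewrite divr_ge0 // ?(ltW sig0) //; lra.
have bkQ f l : (l < n.-1)%N -> (bk f l < Q)%N.
  move=> hl; have := truncn_itv (bk0 f l hl); rewrite -/(bk f l) => /andP[h _].
  rewrite -(ltr_nat R); apply: le_lt_trans h _.
  have := pRb f _ (mn l hl); rewrite ler_norml => /andP[_ h].
  rewrite /sig invf_div mulrA ltr_pdivrMr //.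
  apply: (@le_lt_trans _ _ (2 * V' * (8 * N%:R * Lam))).
    by rewrite ler_wpM2r ?mulr_ge0 ?(ltW Lam00) //; lra.
  rewrite /Q natrM; move: hC'; rewrite -lerBrDr ler_pdivrMr // => hC'.
  have := ler_wpM2r (ltW NR0) hC'; have : 0 < ratr tau * N%:R :> R by rewrite mulr_gt0.
  by lra.
have Q0 : (0 < Q)%N by rewrite /Q muln_gt0.
pose hb (f : {ffun 'I_n -> 'I_N}) : {ffun 'I_n.-1 -> 'I_Q} :=
  [ffun l : 'I_n.-1 => Ordinal (bkQ f l (ltn_ord l))].
have [|f [f' [ff' hff']]] := @pigeonhole n N Q hb.
  rewrite /Q expnMn -[in ltnRHS](prednK n0) expnS ltn_pmul2r ?expn_gt0 //.
have bkE (l : nat) : (l < n.-1)%N -> bk f l = bk f' l.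
  move=> hl; have e : hb f (Ordinal hl) = hb f' (Ordinal hl) by rewrite hff'.
  by move: (congr1 val e); rewrite !ffunE.
have PsiD l : (l < m + n)%N -> `|pR c l (clamp (Z f)) - pR c l (clamp (Z f'))| <= sig.
  move=> hl; have [le|gt] := leqP l m.
    have := small f l le; have := small f' l le.
    by rewrite !ler_norml => /andP[? ?] /andP[? ?]; apply/andP; split; lra.
  have hl' : (l - m.+1 < n.-1)%N by exact: ltn_unshift.
  have := truncn_close (bk0 f _ hl') (bk0 f' _ hl') (bkE _ hl').
  rewrite subnKC // -mulrBl opprD addrACA subrr addr0 normrM.
  by rewrite [`|sig^-1|]ger0_norm ?invr_ge0 ?(ltW sig0) // ler_pdivrMr // mul1r.
have ZD l : (l < m + n)%N -> `|Z f l - Z f' l| <= 2 * sig.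
  move=> hl; have [h1 h2] := Zc f; have [h3 h4] := Zc f'.
  have [l' hl' h5] := xc h1 h3 hl.
  have := le_trans h5 (PsiD l' hl'); have := h2 l hl; have := h4 l hl.
  rewrite !ler_norml => /andP[? ?] /andP[? ?] /andP[? ?]; apply/andP; split; lra.
have [Kx nx _] := hX f; have [Kx' nx' _] := hX f'.
have XD l : (l < m)%N -> `|X f l - X f' l| <= 2 * sig.
  move=> hl; have := ZD l (ltn_addr _ hl); by rewrite /Z /zpt hl.
have s20 : 0 <= 2 * sig by rewrite mulr_ge0 // ltW.
pose dl (i : 'I_n) : R := (f i)%:R - (f' i)%:R.
have [i0 di0] : exists i0, f i0 <> f' i0.
  apply: contrapT => h; apply: ff'; apply/ffunP => i; apply: contrapT => h'.
  by apply: h; exists i.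
(* Where the two combinations differ most, the diagonal term of the matrix of moves outweighs all
   others together. *)
pose i := [arg max_(i > i0) `|dl i|]%O.
have imax j : `|dl j| <= `|dl i|.
  by rewrite /i; case: arg_maxP => // k0 _; apply.
have dl1 : 1 <= `|dl i|.
  apply: le_trans (imax i0); rewrite /dl.
  case: (ltngtP (f i0) (f' i0)) => h; last by case: di0; exact: val_inj.
    by rewrite distrC ger0_norm ?subr_ge0 ?ler_nat ?(ltnW h) // -natrB ?(ltnW h) // ler1n subn_gt0.
  by rewrite ger0_norm ?subr_ge0 ?ler_nat ?(ltnW h) // -natrB ?(ltnW h) // ler1n subn_gt0.
have yD := ZD (m + i)%N (ltac:(by rewrite ltn_add2l)).
rewrite /Z !zpt_fval // !fval_lincomb in yD.
have fD := hCf i _ _ (2 * sig) (ltn_ord i) Kx Kx' s20 XD.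
have MD j := hLM i j _ _ (2 * sig) (ltn_ord i) Kx Kx' s20 XD.
set Sf := \sum_j _ in yD; set Sf' := \sum_j _ in yD.
(* The change of the combination at a fixed base point, plus the change of the base point for a
   fixed combination. *)
have SE : Sf - Sf' = \sum_(j < n) ratr tau / N%:R * dl j * M i j (X f)
     + \sum_(j < n) ratr (q f' j) * (M i j (X f) - M i j (X f')).
  rewrite /Sf /Sf' -sumrB -big_split /=; apply: eq_bigr => j _.
  by rewrite !qE /dl /M /sg /al /xi; ring.
have S1 : `|\sum_(j < n) ratr tau / N%:R * dl j * M i j (X f) - ratr tau / N%:R * dl i|
    <= ratr tau / N%:R * `|dl i| / 2.
  have -> : ratr tau / N%:R * dl i = \sum_(j < n) ratr tau / N%:R * dl j * (i == j)%:R.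
    rewrite (bigD1 i) //= eqxx mulr1 big1 ?addr0 // => j /negbTE.
    by rewrite eq_sym => ->; rewrite mulr0.
  rewrite -sumrB; apply: (le_trans (ler_norm_sum _ _ _)).
  apply: (@le_trans _ _ (\sum_(j < n) ratr tau / N%:R * `|dl i| * (2 * n%:R)^-1)).
    apply: ler_sum => j _; rewrite -mulrBr normrM.
    apply: ler_pM => //; last first.
      have := Mx (X f) i j Kx nx (ltn_ord i).
      by have -> : Ordinal (ltn_ord i) = i by exact: val_inj.
    rewrite normrM [`|_ / _|]ger0_norm; last by rewrite divr_ge0 // ltW.
    by rewrite ler_wpM2l // divr_ge0 // ltW.
  rewrite sumr_const card_ord.
  have -> : ratr tau / N%:R * `|dl i| / (2 * n%:R) *+ n = ratr tau / N%:R * `|dl i| / 2.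
    rewrite -[LHS]mulr_natr -mulrA; congr (_ * _).
    by rewrite invfM -mulrA mulVf ?mulr1 // gt_eqF.
  exact: lexx.
have S2 : `|\sum_(j < n) ratr (q f' j) * (M i j (X f) - M i j (X f'))| <= n%:R * LM * (2 * sig).
  apply: (le_trans (ler_norm_sum _ _ _)).
  apply: (@le_trans _ _ (\sum_(j < n) LM * (2 * sig))); last first.
    by rewrite sumr_const card_ord -[leLHS]mulr_natl mulrA.
  apply: ler_sum => j _; rewrite normrM -[leRHS]mul1r; apply: ler_pM => //; try exact: MD.
  by rewrite ger0_norm ?ler0q // (le_trans _ tau1) // ler_rat.
have big : ratr tau / N%:R <= ratr tau / N%:R * `|dl i|.
  by rewrite -[leLHS]mulr1 ler_wpM2l // divr_ge0 // ltW.
have sE : ratr tau / N%:R = 8 * Lam * sig.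
  by apply: scale_back; rewrite gt_eqF.
have fin : ratr tau / N%:R * `|dl i| / 2 <= 2 * sig * Lam.
  have -> : 2 * sig * Lam = 2 * sig + Cf * (2 * sig) + n%:R * LM * (2 * sig).
    by rewrite /Lam; ring.
  have tri : ratr tau / N%:R * `|dl i| <= ratr tau / N%:R * `|dl i| / 2
     + n%:R * LM * (2 * sig) + 2 * sig + Cf * (2 * sig).
    have E1 : ratr tau / N%:R * `|dl i| = `|ratr tau / N%:R * dl i|.
      by rewrite normrM [`|_ / _|]ger0_norm // divr_ge0 // ltW.
    set A1 := \sum_(j < n) ratr tau / N%:R * dl j * M i j (X f) in SE S1.
    set A2 := \sum_(j < n) ratr (q f' j) * (M i j (X f) - M i j (X f')) in SE S2.
    have E2 : ratr tau / N%:R * dl i = - (A1 - ratr tau / N%:R * dl i) - A2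
      + ((fval et D c L0 i (X f) + Sf) - (fval et D c L0 i (X f') + Sf'))
      - (fval et D c L0 i (X f) - fval et D c L0 i (X f')).
      have -> : A2 = Sf - Sf' - A1 by rewrite SE; ring.
      by ring.
    rewrite [leLHS]E1 [X in `|X| <= _]E2.
    apply: (le_trans (ler_normB _ _)); apply: lerD => //.
    apply: (le_trans (ler_normD _ _)); apply: lerD => //.
    apply: (le_trans (ler_normB _ _)); apply: lerD => //.
    by rewrite normrN.
  by lra.
(* As tau / N = 8 Lam sig and the largest difference is at least 1, [fin] reads 4 Lam sig <= 2 Lam
   sig. *)
have : 0 < Lam * sig by rewrite mulr_gt0.
by lra.
Qed.

End LocalDensity.

Lemma rat_le_code (q : rat) : q <= (enc q)%:R.
Proof.
have [q0|/ltW q0] := leP 0 q; last by apply: le_trans q0 _; exact: ler0n.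
apply: (@le_trans _ _ (numq q)%:~R).
  rewrite numqE -[leLHS]mulr1 ler_wpM2l // -[1]/(1%:~R) ler_int.
  by have := denq_gt0 q; case: (denq q) => [[|d]|d].
rewrite /enc /coded_rat /code_rat; case: (numq q) => k; last first.
  by rewrite (le_trans _ (ler0n _ _)) // NegzE mulrNz oppr_le0 ler0z.
rewrite [(_)%:~R]/(k%:R) ler_nat; apply: leq_trans (cpair_ge _ _).
by apply: leq_trans (leq_addr _ _); rewrite /= -addnn leq_addr.
Qed.

(** Pairing dominates both components, so the code of a list is a computable bound for its entries.
    It replaces the largest radius. *)
Lemma nth_le_enc (l : seq rat) i : nth 0 l i <= (enc l)%:R.
Proof.
elim: l i => [|q l IH] i; first by rewrite nth_nil.
have h : (enc q + enc l <= cpair (enc q) (enc l))%N by exact: cpair_ge.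
have h1 : (enc q <= (cpair (enc q) (enc l)).+1)%N by rewrite leqW // (leq_trans _ h) ?leq_addr.
have h2 : (enc l <= (cpair (enc q) (enc l)).+1)%N by rewrite leqW // (leq_trans _ h) ?leq_addl.
by case: i => [|i] /=; [apply: (le_trans (rat_le_code q))|apply: (le_trans (IH i))];
  rewrite ler_nat.
Qed.

Lemma rat_le_enc (R : realType) (l : seq rat) i : ratr (nth 0 l i) <= (enc l)%:R :> R.
Proof. by rewrite -(ratr_nat R) ler_rat nth_le_enc. Qed.

(** * From local to global avoidance *)

Section GlobalDensity.
Variables (R : realType) (Sg : nat -> bool) (et : nat -> nat) (rh : nat -> seq rat).
Variable D : nat -> seq nat -> (nat -> R) -> R.
Implicit Types (L : seq term) (x y z : nat -> R).
Hypothesis Dlip : lipschitz_family Sg et D (dbox et rh).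

Lemma fin_pos n (P : nat -> R -> Prop) :
  (forall l e e', P l e -> 0 < e' -> e' <= e -> P l e') ->
  (forall l, (l < n)%N -> exists2 e, 0 < e & P l e) ->
  exists2 e, 0 < e & forall l, (l < n)%N -> P l e.
Proof.
move=> mono; elim: n => [|n IH] h; first by exists 1.
have [l hl|e e0 he] := IH; first by apply: h; exact: ltnW.
have [e' e'0 he'] := h n (ltnSn n).
have m0 : 0 < Num.min e e' by rewrite lt_min e0 e'0.
exists (Num.min e e') => // l; rewrite ltnS leq_eqVlt => /predU1P [->|hl].
  by apply: mono he' m0 _; rewrite ge_min lexx orbT.
by apply: mono (he l hl) m0 _; rewrite ge_min lexx.
Qed.

Variable c : cond.
Hypothesis vc : valid Sg et rh c.
Let m := c.1.
Let n := cnd_n c.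
Let B := cnd_box c.

Definition badz (kappa : R) z : Prop :=
  (forall l, (l < m + n)%N ->
     ratr (nth (0, 0) B l).1 - kappa <= z l <= ratr (nth (0, 0) B l).2 + kappa) /\
  (forall l, (l <= m)%N -> `|pR c l z| <= kappa).

Lemma badE L kappa x : bad et D c L kappa x = badz kappa (zpt et D c L x).
Proof. by []. Qed.

Lemma badz_close (kappa : R) : 0 < kappa -> exists2 delta : R, 0 < delta &
  forall z z', (forall l, (l < m + n)%N -> `|z l - z' l| <= delta) ->
    badz (kappa / 2) z' -> badz kappa z.
Proof.
move=> k0; have [sB sP n0 oB] := valid_sizes vc; rewrite -/B -/n -/m in sB oB sP n0.
have [VB bVB] := bnd_exists B.
pose V := (VB + (Num.bound kappa).+1)%N.
have hV : VB%:R + kappa + 1 <= V%:R :> R.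
  by rewrite natrD -natr1; have := archi_boundP (ltW k0); lra.
have [LP LP0 hLP] := @pR_lip R c V.
pose delta := Num.min 1 (kappa / 2 / (1 + LP)).
have d0 : 0 < delta by rewrite lt_min ltr01 divr_gt0 ?divr_gt0 // ltr_wpDr.
have d1 : delta <= 1 by rewrite ge_min lexx.
have d2 : (1 + LP) * delta <= kappa / 2.
  by rewrite mulrC -ler_pdivlMr ?ltr_wpDr // ge_min lexx orbT.
have d3 : delta <= kappa / 2.
  by apply: le_trans d2; rewrite mulrDl mul1r lerDl mulr_ge0 // ltW.
exists delta => // z z' hz [h1 h2]; split=> l hl.
  have := h1 l hl; have := hz l hl; rewrite ler_norml => /andP[? ?] /andP[? ?].
  by apply/andP; split; lra.
have hl' : (l < m + n)%N by rewrite (leq_ltn_trans hl) // -[ltnLHS]addn0 ltn_add2l.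
have Bb i : (i < m + n)%N -> - VB%:R <= ratr (nth (0, 0) B i).1 :> R /\
     ratr (nth (0, 0) B i).2 <= VB%:R :> R.
  rewrite -sB => hi; have /andP[b1 b2] := allP bVB _ (mem_nth (0, 0) hi).
  by rewrite -(ratr_nat R) -rmorphN !ler_rat.
have z'b i : (i < m + n)%N -> `|z' i| <= V%:R.
  move=> hi; have [b1 b2] := Bb i hi; have /andP[? ?] := h1 i hi.
  by rewrite ler_norml; apply/andP; split; lra.
have zb i : (i < m + n)%N -> `|z i| <= V%:R.
  move=> hi; have [b1 b2] := Bb i hi; have /andP[? ?] := h1 i hi.
  have := hz i hi; rewrite !ler_norml => /andP[? ?].
  by apply/andP; split; lra.
have := hLP l z z' delta (ltW d0) hl' zb z'b hz; have := h2 l hl.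
rewrite !ler_norml => /andP[? ?] /andP[? ?]; apply/andP; split; lra.
Qed.

Lemma fval_cat_close k L2 L i x : (i < n)%N -> inR (Kc c) x ->
  `|fval et D c (L2 ++ L) i x - fval et D c L i x|
    <= (\sum_(j < n) (afact (cnd_item c j).2.1)%:R) * ratr (wt rh k L2).
Proof.
move=> hi Kx; have [_ sal _ _ db] := valid_item R vc hi.
have := db x Kx => {}db.
rewrite /fval devalR_cat.
have -> : forall u v w : R, u + (v + w) - (u + w) = v by move=> u v w; ring.
apply: (@le_trans _ _ ((afact (cnd_item c i).2.1)%:R * ratr (wt rh k L2))).
  apply: devalR_wt => [|j hj]; first by rewrite sal.
  apply: le_trans (db j hj) _; apply: (@le_trans _ _ (enc (rh (cnd_item c i).1))%:R); last first.
    by rewrite ler_nat leq_addl.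
  exact: rat_le_enc.
rewrite ler_wpM2r ?ler0q ?wt_ge0 //.
by rewrite (bigD1 (Ordinal hi)) //= lerDl sumr_ge0.
Qed.

(** The threshold depends on the condition and on [kappa] but not on the batches, so it can be
    imposed on a batch before that batch is chosen. *)
Lemma bad_stable (kappa : R) : 0 < kappa -> exists2 delta : R, 0 < delta &
  forall k L2 L x, ratr (wt rh k L2) <= delta -> inR (Kc c) x ->
    bad et D c (L2 ++ L) (kappa / 2) x -> bad et D c L kappa x.
Proof.
move=> k0; have [d d0 hd] := badz_close k0.
pose A : R := 1 + \sum_(j < n) (afact (cnd_item c j).2.1)%:R.
have A0 : 1 <= A by rewrite lerDl sumr_ge0.
exists (d / A) => [|k L2 L x hw Kx]; first by rewrite divr_gt0 //; lra.
rewrite !badE; apply: hd => l hl; rewrite /zpt; case: ltnP => hlm.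
  by rewrite subrr normr0 ltW.
have hi : (l - m < n)%N by rewrite ltn_subLR.
rewrite distrC; apply: le_trans (fval_cat_close k L2 L hi Kx) _.
move: hw; rewrite ler_pdivlMr; last by lra.
have w0 : 0 <= ratr (wt rh k L2) :> R by rewrite ler0q wt_ge0.
by rewrite /A mulrDr mulr1 mulrC => hw; lra.
Qed.

Hypothesis xc : expanding R c.

(** Induction along a finite cover of the box. The batch for a new neighbourhood is so small that
    the ones already treated stay free of bad points with half their margin. Supports are united, so
    the result is still independent of [om]. *)
Lemma dense_avoid : exists2 Ga, good_supp Sg et Ga & forall k L0 (om : R), 0 < om ->
  exists L, [/\ supp Ga L, ratr (wt rh k L) <= om & exists2 kappa : R, 0 < kappa &
     forall x, inR (Kc c) x -> ~ bad et D c (L ++ L0) kappa x].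
Proof.
pose Loc (a : nat -> R) r := exists2 Ga, good_supp Sg et Ga & forall k L0 (om : R), 0 < om ->
   exists L, [/\ supp Ga L, ratr (wt rh k L) <= om & exists2 kappa : R, 0 < kappa &
     forall x, inR (Kc c) x -> near_pt m r a x -> ~ bad et D c (L ++ L0) kappa x].
have [|l [l1 l2]] := @box_cover R (Kc c) Loc.
  by move=> a Ka; have [r r0 h] := local_dense Dlip vc xc Ka; exists r.
rewrite (size_Kc vc) -/m in l l1 l2.
have [Ga gG hGa] : exists2 Ga, good_supp Sg et Ga & forall k L0 (om : R), 0 < om ->
  exists L, [/\ supp Ga L, ratr (wt rh k L) <= om & exists2 kappa : R, 0 < kappa &
     forall x, inR (Kc c) x -> (exists2 p, p \in l & near_pt m p.2 (vf p.1) x) ->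
     ~ bad et D c (L ++ L0) kappa x].
  elim: l l1 {l2} => [|p l IH] l1.
    exists [::] => // k L0 om om0; exists [::]; split => //.
      by rewrite /wt /= /sumq /= rmorph0 ltW.
    by exists 1 => // x _ [].
  have [q ql|Ga gG hGa] := IH; first by apply: l1; rewrite inE ql orbT.
  have [_ _ [Ga' gG' hGa']] := l1 p (mem_head _ _).
  exists (Ga' ++ Ga); first by rewrite /good_supp all_cat; apply/andP; split.
  move=> k L0 om om0.
  (* Half of the weight is for the neighbourhoods already treated, half for the new one. *)
  have om20 : 0 < om / 2 by rewrite divr_gt0.
  have [L1 [s1 w1 [k1 k10 b1]]] := hGa k L0 _ om20.
  have [d d0 hd] := bad_stable k10.
  have md : 0 < Num.min d (om / 2) by rewrite lt_min d0 om20.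
  have [L2 [s2 w2 [k2 k20 b2]]] := hGa' k (L1 ++ L0) _ md.
  have w2d : ratr (wt rh k L2) <= d by apply: le_trans w2 _; rewrite ge_min lexx.
  have w2o : ratr (wt rh k L2) <= om / 2 by apply: le_trans w2 _; rewrite ge_min lexx orbT.
  exists (L2 ++ L1); split.
  - rewrite /supp all_cat; apply/andP; split.
      by apply: sub_all s2 => t h; rewrite mem_cat h.
    by apply: sub_all s1 => t h; rewrite mem_cat h orbT.
  - by rewrite wt_cat rmorphD /=; lra.
  exists (Num.min (k1 / 2) k2); first by rewrite lt_min k20 divr_gt0.
  have badmono L e e' x : e' <= e -> bad et D c L e' x -> bad et D c L e x.
    move=> he [h1 h2]; split=> i hi; last exact: le_trans (h2 i hi) he.
    by have /andP[? ?] := h1 i hi; apply/andP; split; lra.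
  move=> x Kx [q]; rewrite inE -catA => /predU1P [->|ql] nx b.
    by apply: (b2 x Kx nx); apply: badmono b; rewrite ge_min lexx orbT.
  apply: (b1 x Kx); first by exists q.
  apply: (hd k L2) => //; apply: badmono b; by rewrite ge_min lexx.
exists Ga => // k L0 om om0; have [L [h1 h2 [kap k0 h3]]] := hGa k L0 om om0.
exists L; split => //; exists kap => // x Kx; apply: h3 => //.
by have [p pl np] := l2 x Kx; exists p.
Qed.

End GlobalDensity.

(** * Rational witnesses of non-expansion *)

Section Nonexpanding.
Variables (R : realType) (Sg : nat -> bool) (et : nat -> nat) (rh : nat -> seq rat).
Variable c : cond.
Hypothesis vc : valid Sg et rh c.

Lemma rat_in_box (a b : rat) (x e : R) : a <= b -> ratr a <= x <= ratr b -> 0 < e ->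
  exists q : rat, [/\ a <= q, q <= b & `|ratr q - x| <= e].
Proof.
move=> ab /andP[ax xb] e0.
have [q hq] := rat_approx x e0.
exists (Num.max a (Num.min b q)); rewrite le_max lexx /= ge_max ab ge_min lexx /=; split => //.
move: hq; rewrite !ler_norml => /andP[h1 h2].
have [hbq|hqb] := leP b q; first have [hab|hba] := leP a b.
- have := ler_rat R b q; rewrite hbq => {}hbq; apply/andP; split; lra.
- by rewrite leNgt hba in ab.
have [haq|hqa] := leP a q; apply/andP; split; try lra.
by have := ltr_rat R q a; rewrite hqa => {}hqa; lra.
Qed.

(** A failure of expansion is finitely many strict inequalities between continuous quantities, so it
    persists at nearby rational points, which can be kept inside the box because its faces are
    rational. *)
Lemma nonexpanding_cert : ~ expanding R c -> exists z z', nonexpanding c z z'.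
Proof.
have [sB sP n0 oB] := valid_sizes vc.
set N := (c.1 + cnd_n c)%N in sB sP *.
move=> H; have {H} [x [x' [i [Bx Bx' hi hx]]]] : exists x x' i, [/\ inR (cnd_box c) x,
    inR (cnd_box c) x', (i < N)%N & forall l, (l < N)%N ->
      `|pR c l x - pR c l x'| < `|x i - x' i| :> R].
  apply: contrapT => h; apply: H => z z' Bz Bz' i hi; apply: contrapT => h'.
  apply: h; exists z, z', i; split => // l hl; rewrite ltNge; apply/negP => h2.
  by apply: h'; exists l.
have [g g0 hg] : exists2 g : R, 0 < g & forall l, (l < N)%N ->
    `|pR c l x - pR c l x'| + g <= `|x i - x' i|.
  apply: fin_pos => [l e e' h1 h2 h3|l hl]; first by lra.
  exists (`|x i - x' i| - `|pR c l x - pR c l x'|); first by rewrite subr_gt0 hx.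
  by lra.
have [V bV] := bnd_exists (cnd_box c).
have [LP LP0 hLP] := @pR_lip R c V.
(* Moving both points by d changes a difference of values by at most 2 LP d and a difference of
   coordinates by at most 2d, together less than the gap g. *)
pose d := g / (4 * (1 + LP)).
have d0 : 0 < d by rewrite divr_gt0 // mulr_gt0 // ltr_wpDr.
have dE : 4 * (1 + LP) * d = g by rewrite /d mulrC divfK // gt_eqF // mulr_gt0 // ltr_wpDr.
have ap y : inR (cnd_box c) y -> exists q : seq rat, [/\ size q = N, inbox (cnd_box c) q &
    forall l, (l < N)%N -> `|rpt R q l - y l| <= d].
  move=> By; have H l : exists q : rat, (l < N)%N -> [/\ (nth (0, 0) (cnd_box c) l).1 <= q,
      q <= (nth (0, 0) (cnd_box c) l).2 & `|ratr q - y l| <= d].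
    have [hl|hl] := ltnP l N; last by exists 0.
    rewrite -sB in hl.
    by have [q hq] := rat_in_box (allP oB _ (mem_nth _ hl)) (By l hl) d0; exists q.
  have [q hq] := choice H; exists (mkseq q N); rewrite size_mkseq; split => //.
    apply/allP => l; rewrite sB mem_iota /= add0n => hl.
    by rewrite nth_mkseq //; have [-> -> _] := hq l hl.
  by move=> l hl; rewrite /rpt nth_mkseq //; have [_ _] := hq l hl.
have [z [sz iz hz]] := ap x Bx; have [z' [sz' iz' hz']] := ap x' Bx'.
have inb q : inbox (cnd_box c) q -> inR (cnd_box c) (rpt R q).
  move=> h l hl; have := allP h l; rewrite mem_iota /= add0n hl => /(_ isT) /andP[h1 h2].
  by rewrite /rpt !ler_rat h1.
exists z, z'; apply/and3P; split => //.
apply/hasP; exists i; first by rewrite mem_iota.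
apply/allP => P /(nthP [::]) [l]; rewrite sP => hl <-.
rewrite -(ltr_rat R) !ratr_norm !rmorphB /= /peval -!ratr_devalR -!/(pR c l _).
have b (y : nat -> R) : inR (cnd_box c) y -> forall j, (j < N)%N -> `|y j| <= V%:R.
  by move=> By j hj; apply: (bnd_le bV By); rewrite sB.
have e1 := hLP l (rpt R z) x d (ltW d0) hl (b _ (inb _ iz)) (b _ Bx) hz.
have e2 := hLP l (rpt R z') x' d (ltW d0) hl (b _ (inb _ iz')) (b _ Bx') hz'.
have := hz i hi; have := hz' i hi; rewrite /rpt => f1 f2; have := hg l hl.
have tri (u u' v v' e : R) : `|u - v| <= e -> `|u' - v'| <= e ->
   `|u - u'| <= `|v - v'| + 2 * e.
  move=> h1 h2; have -> : u - u' = (u - v) + (v - v') - (u' - v') by ring.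
  apply: (le_trans (ler_normB _ _)).
  by have := ler_normD (u - v) (v - v'); lra.
have t1 := tri _ _ _ _ _ e1 e2.
have t2 : `|x i - x' i| <= `|ratr (nth 0 z i) - ratr (nth 0 z' i)| + 2 * d.
  by apply: tri; rewrite distrC.
by have : 0 <= LP * d by [rewrite mulr_ge0 // ltW|]; lra.
Qed.

End Nonexpanding.

Lemma add3_le (F : realFieldType) (b u w e : F) : 0 <= b -> 0 <= u -> 0 <= w ->
  b + u + w <= e -> u <= e /\ w <= e /\ b <= e.
Proof. by move=> *; split; [lra|split; lra]. Qed.

Lemma shift_le (F : realFieldType) (a b u : F) : a <= u -> a + b + 1 <= b + (u + 1).
Proof. by move=> *; lra. Qed.

Lemma encl_arith (F : realFieldType) (d v u w err eta : F) :
  d - 2 * (eta / 4) < u -> w < d + 2 * (eta / 4) -> err <= eta / 2 ->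
  d + v - eta <= u + v - err /\ w + v + err <= d + v + eta.
Proof. by move=> *; split; lra. Qed.

Ltac clra := clear; intros; lra.

(** * Finite certificates of avoidance *)

Section Certificates.
Variables (R : realType) (Sg : nat -> bool) (et : nat -> nat) (rh : nat -> seq rat).
Variable D : nat -> seq nat -> (nat -> R) -> R.
Variable ca : nat.
Implicit Types (L : seq term) (x y z : nat -> R).
Hypothesis Dlip : lipschitz_family Sg et D (dbox et rh).
Hypothesis Dalg : queries_decide Sg et D (dbox et rh) ca.

Lemma monoR_ext n al be x y : (forall i, (i < n)%N -> x i = y i) ->
  monoR n al be x = monoR n al be y.
Proof. by move=> h; rewrite /monoR !big_mkord; apply: eq_bigr => i _; rewrite h. Qed.

Lemma devalR_ext n al L s x y : (forall i, (i < n)%N -> x i = y i) ->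
  devalR n al L s x = devalR n al L s y.
Proof. by move=> h; apply: eq_bigr => t _; rewrite (monoR_ext _ _ h). Qed.

Lemma D_ext s al x y : Sg s -> size al = et s -> dbox et rh s x -> dbox et rh s y ->
  (forall i, (i < et s)%N -> x i = y i) -> D s al x = D s al y.
Proof.
move=> sS sal dx dy h; have [C C0 hC] := Dlip sS sal.
have := hC x y 0 dx dy (lexx _) (fun i hi => ltac:(by rewrite h // subrr normr0)).
by rewrite mulr0 normr_le0 subr_eq0 => /eqP.
Qed.

Lemma wid_le (X : seq (rat * rat)) (d : rat) : (forall p, p \in X -> p.2 - p.1 <= d) ->
  wid X <= (size X)%:R * d.
Proof.
elim: X => [|p X IH] h; first by rewrite /wid /= mul0r.
rewrite wid_cons /= -natr1 mulrDl mul1r addrC lerD // ?h ?mem_head //.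
by apply: IH => q qX; rewrite h // inE qX orbT.
Qed.

Lemma corner_proj xi (X : seq (rat * rat)) l : all (fun l => l < size X)%N xi ->
  (l < size xi)%N -> rpt R (corner (proj xi X)) l = px xi (rpt R (corner X)) l.
Proof.
move=> h hl; rewrite /rpt /px /corner (nth_map (0, 0)) ?size_map // /proj (nth_map 0%N) //.
by rewrite (nth_map (0, 0)) //; exact: (allP h _ (mem_nth _ hl)).
Qed.

Lemma bndW W W' X : (W <= W')%N -> bnd W X -> bnd W' X.
Proof.
move=> h /allP hX; apply/allP => p /hX /andP[h1 h2].
have : W%:R <= W'%:R :> rat by rewrite ler_nat.
by move=> h3; apply/andP; split; lra.
Qed.

Lemma proj_dbox c X i x : valid Sg et rh c -> (i < cnd_n c)%N -> size X = c.1 ->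
  (forall l, (l < c.1)%N -> (nth (0, 0) (Kc c) l).1 <= (nth (0, 0) X l).1 /\
                            (nth (0, 0) X l).2 <= (nth (0, 0) (Kc c) l).2) ->
  inR (proj (cnd_item c i).2.2 X) x -> dbox et rh (cnd_item c i).1 x.
Proof.
move=> vc hi sX subX hx j hj; have [Si sal sxi ml db] := valid_item R vc hi.
rewrite -sxi in hj.
have := hx j; rewrite size_map => /(_ hj); rewrite /proj (nth_map 0%N) //.
have hl := allP ml _ (mem_nth 0%N hj).
have [s1 s2] := subX _ hl => /andP[h1 h2].
move: (vc) => /and5P[_ _ _ h _].
have := allP h _ (mem_nth (0%N, ([::], [::])) hi).
rewrite -/(cnd_item c i) => /and5P[_ _ _ _ h5].
have := allP h5 j; rewrite mem_iota /= add0n -sxi hj => /(_ isT).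
rewrite (nth_map 0%N) // => /andP[b1 b2].
rewrite !nth_take // in s1 s2.
rewrite ler_norml -rmorphN (le_trans _ h1) ?ler_rat ?(le_trans b1 s1) //=.
by rewrite (le_trans h2) // ler_rat (le_trans s2 b2).
Qed.

Variable c : cond.
Hypothesis vc : valid Sg et rh c.
Let m := c.1.
Let n := cnd_n c.
Let B := cnd_box c.

Lemma cell_ok_mono f f' L th W X uvs : (f <= f')%N ->
  cell_ok et f ca c L th W X uvs -> cell_ok et f' ca c L th W X uvs.
Proof.
move=> h /and3P[h1 /allP h2 h3]; apply/and3P; split=> //; apply/allP => i /h2 /=.
exact: qhalt_mono.
Qed.

(** A point that is not bad misses the target by more than [kap] in a coordinate or in a member of
    Psi. A box Z that stays within [eta] of the point inherits this, in a form that exact arithmetic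
    at one corner detects. *)
Lemma avoids_of_close (z : nat -> R) (Z : seq (rat * rat)) (W : nat) (eta kap LP : R) :
  0 < eta -> eta <= kap / 2 -> 0 <= LP ->
  (forall l z z' (d : R), 0 <= d -> (l < m + n)%N ->
    (forall i, (i < m + n)%N -> `|z i| <= W%:R) ->
    (forall i, (i < m + n)%N -> `|z' i| <= W%:R) ->
    (forall i, (i < m + n)%N -> `|z i - z' i| <= d) -> `|pR c l z - pR c l z'| <= LP * d) ->
  (1 + LP + (\sum_(l < m.+1) ratr (wsum (2 * W.+1) (nth [::] (cnd_poly c) l)))
     * ((m + n)%:R * 2)) * eta <= kap / 2 ->
  size Z = (m + n)%N -> ordered Z -> bnd W Z ->
  (forall l, (l < m + n)%N -> [/\ z l - eta <= ratr (nth (0, 0) Z l).1,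
    ratr (nth (0, 0) Z l).2 <= z l + eta & (nth (0, 0) Z l).1 <= (nth (0, 0) Z l).2]) ->
  (forall l, (l < m + n)%N -> `|z l| <= W%:R) ->
  ~ badz c kap z -> avoids c W Z.
Proof.
move=> eta0 etak LP0 hLP etaQ sZ oZ bZ ZP zbW nbz.
have [sB sP n0 oB] := valid_sizes vc; rewrite -/B -/n -/m in sB oB sP n0.
set wsP := \sum_(l < m.+1) _ in etaQ.
pose mn : R := (m + n)%:R; have mn0 : 0 <= mn by [].
have wsP0 : 0 <= wsP by rewrite sumr_ge0 // => l _; rewrite ler0q wsum_ge0.
pose Q : R := 1 + LP + wsP * (mn * 2).
rewrite -/Q in etaQ.
rewrite /avoids.
case: (pselect (exists2 l, (l < m + n)%N & ~ (ratr (nth (0, 0) B l).1 - kap <= z l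
     <= ratr (nth (0, 0) B l).2 + kap))) => [[l hl hz]|h1].
  apply/orP; left; apply/hasP; exists l; first by rewrite mem_iota.
  have [z1 z2 _] := ZP l hl; rewrite /apart -!(ltr_rat R) -/B; apply/orP.
  have [lo|lo] := lerP (ratr (nth (0, 0) B l).1 - kap) (z l); last by left; lra.
  have [hi|hi] := lerP (z l) (ratr (nth (0, 0) B l).2 + kap); last by right; lra.
  by case: hz; rewrite lo hi.
have [l hl hz] : exists2 l, (l <= m)%N & kap < `|pR c l z|.
  apply: contrapT => h2; apply: nbz; split => l hl.
    by apply: contrapT => h; apply: h1; exists l.
  by rewrite leNgt; apply/negP => h; apply: h2; exists l.
apply/orP; right; rewrite bZ andTb; apply/hasP; exists l; first by rewrite mem_iota leq0n add0n ltnS.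
have hl' : (l < m + n)%N by rewrite (leq_ltn_trans hl) // -[ltnLHS]addn0 ltn_add2l.
have cZ := @inR_corner R Z oZ.
have cZb i : (i < m + n)%N -> `|rpt R (corner Z) i| <= W%:R.
  by rewrite -sZ => hi; exact: (bnd_le bZ cZ hi).
have cZz i : (i < m + n)%N -> `|rpt R (corner Z) i - z i| <= eta.
  move=> hi; have [z1 z2 z3] := ZP i hi; rewrite -(ler_rat R) in z3.
  rewrite /rpt /corner (nth_map (0, 0)) ?sZ // ler_norml; apply/andP; split; lra.
have := hLP l _ _ eta (ltW eta0) hl' cZb zbW cZz.
rewrite /peval -(ltr_rat R) ratr_norm -ratr_devalR -/(pR c l _) rmorphM /=.
have wZ : ratr (wid Z) <= mn * 2 * eta.
  have H (d : rat) : (forall p, p \in Z -> p.2 - p.1 <= d) -> wid Z <= (m + n)%:R * d.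
    by rewrite -sZ; exact: wid_le.
  have {}H : ratr (wid Z) <= \sum_(p <- Z) (2 * eta).
    rewrite /wid sumqE rmorph_sum /= big_seq [leRHS]big_seq; apply: ler_sum => p.
    move=> /(nthP (0, 0)) [j]; rewrite sZ => hj <-.
    by have [z1 z2 z3] := ZP j hj; rewrite rmorphB /=; lra.
  by apply: le_trans H _; rewrite big_const_seq count_predT sZ iter_addr addr0 -[leLHS]mulr_natl /mn mulrA.
have wl : ratr (wsum (2 * W.+1) (nth [::] (cnd_poly c) l)) <= wsP.
  rewrite /wsP (bigD1 (Ordinal (ltac:(rewrite ltnS; exact: hl) : (l < m.+1)%N))) //= lerDl sumr_ge0 //.
  by move=> j _; rewrite ler0q wsum_ge0.
have wwZ : ratr (wsum (2 * W.+1) (nth [::] (cnd_poly c) l)) * ratr (wid Z) <= wsP * (mn * 2 * eta).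
  by apply: ler_pM => //; rewrite ler0q ?wsum_ge0 ?wid_ge0.
have EQ : Q * eta = eta + LP * eta + wsP * (mn * 2 * eta) by rewrite /Q; ring.
rewrite EQ in etaQ => hd.
have tri := ler_normB (pR c l (rpt R (corner Z))) (pR c l (rpt R (corner Z)) - pR c l z).
have E' : pR c l (rpt R (corner Z)) - (pR c l (rpt R (corner Z)) - pR c l z) = pR c l z by ring.
rewrite E' in tri.
by lra.
Qed.

(** The order of the choices matters. W bounds F on the whole box with one unit to spare; the
    Lipschitz constants of Psi are taken at that radius; they and [kap] determine the precision
    [eta]; and [eta] determines the margin [th] and the fineness N. *)
Lemma cell_complete L (kap : R) : 0 < kap ->
  (forall x, inR (Kc c) x -> ~ bad et D c L kap x) ->
  exists th : rat, 0 < th /\ exists W N, forall X, X \in grid N (Kc c) ->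
    exists uvs fuel, cell_ok et fuel ca c L th W X uvs.
Proof.
move=> k0 nb; have [sB sP n0 oB] := valid_sizes vc; rewrite -/B -/n -/m in sB oB sP n0.
have sK := size_Kc vc; have oK := ordered_Kc vc; rewrite -/m in sK.
have cK := @inR_corner R _ oK; set c0 := rpt R (corner (Kc c)) in cK.
have [Cf Cf0 hCf] := fval_lip Dlip vc L.
have wK0 : 0 <= ratr (wid (Kc c)) :> R by rewrite ler0q wid_ge0.
pose F : R := \sum_(i < n) `|fval et D c L i c0| + Cf * ratr (wid (Kc c)).
have hF i x : (i < n)%N -> inR (Kc c) x -> `|fval et D c L i x| <= F.
  move=> hi Kx.
  have dK l : (l < m)%N -> `|x l - c0 l| <= ratr (wid (Kc c)) by rewrite -sK; exact: inR_dist.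
  have := hCf i x c0 _ hi Kx cK wK0 dK.
  have : `|fval et D c L i c0| <= \sum_(i < n) `|fval et D c L i c0|.
    by rewrite (bigD1 (Ordinal hi)) //= lerDl sumr_ge0.
  have := ler_distD 0 (fval et D c L i x) (fval et D c L i c0).
  have := ler_normD (fval et D c L i x - fval et D c L i c0) (fval et D c L i c0).
  by rewrite subrK /F => ? _ ? ?; lra.
have F0 : 0 <= F by apply: addr_ge0; [exact: sumr_ge0|exact: mulr_ge0].
have [W0 bW0] := bnd_exists (Kc c).
pose W := (W0 + (Num.bound F).+1)%N.
have hW1 : F + 1 <= W%:R.
  have := archi_boundP F0; rewrite /W natrD -natr1.
  by have : 0 <= W0%:R :> R by []; lra.
have [LP LP0 hLP] := @pR_lip R c W.
pose wsP : R := \sum_(l < m.+1) ratr (wsum (2 * W.+1) (nth [::] (cnd_poly c) l)).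
have wsP0 : 0 <= wsP by rewrite sumr_ge0 // => l _; rewrite ler0q wsum_ge0.
pose mn : R := (m + n)%:R; have mn0 : 0 <= mn by [].
pose Q : R := 1 + LP + wsP * (mn * 2).
have Q1 : 1 <= Q by rewrite /Q -addrA lerDl addr_ge0 // mulr_ge0 // mulr_ge0.
(* The bound 1 keeps the enclosures within the radius W, the other one is what [avoids_of_close]
   asks for. *)
pose eta := Num.min 1 (kap / 2 / Q).
have Q0 : 0 < Q by lra.
have eta0 : 0 < eta by rewrite lt_min ltr01 !divr_gt0.
have eta1 : eta <= 1 by rewrite ge_min lexx.
have etaQ : Q * eta <= kap / 2 by rewrite mulrC -ler_pdivlMr // ge_min lexx orbT.
have etak : eta <= kap / 2.
  by apply: le_trans etaQ; rewrite -[leLHS]mul1r ler_wpM2r // ltW.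
have CD i : exists C : R, 0 <= C /\ ((i < n)%N ->
   forall x y (d : R), dbox et rh (cnd_item c i).1 x -> dbox et rh (cnd_item c i).1 y -> 0 <= d ->
    (forall j, (j < et (cnd_item c i).1)%N -> `|x j - y j| <= d) ->
    `|D (cnd_item c i).1 (cnd_item c i).2.1 x - D (cnd_item c i).1 (cnd_item c i).2.1 y| <= C * d).
  have [hi|hi] := ltnP i n; last by exists 0.
  have [Si sal _ _ _] := valid_item R vc hi.
  by have [C C0 hC] := Dlip Si sal; exists C.
have [C hC] := choice CD.
pose Cs : R := \sum_(i < n) C i.
have Cs0 : 0 <= Cs by rewrite sumr_ge0 // => i _; have [] := hC i.
have CCs i : (i < n)%N -> C i <= Cs.
  by move=> hi; rewrite /Cs (bigD1 (Ordinal hi)) //= lerDl sumr_ge0 // => j _; have [] := hC j.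
pose A : R := 1 + \sum_(i < n) (afact (cnd_item c i).2.1)%:R.
have A1 : 1 <= A by rewrite lerDl sumr_ge0.
have A0 : 0 < A by lra.
have AA i : (i < n)%N -> (afact (cnd_item c i).2.1)%:R <= A.
  move=> hi; rewrite /A (bigD1 (Ordinal hi)) //= addrCA lerDl addr_ge0 // sumr_ge0 //.
pose S : R := 1 + \sum_(i < n) (size (cnd_item c i).2.2)%:R.
have S1 : 1 <= S by rewrite lerDl sumr_ge0.
have S0 : 0 <= S by apply: le_trans S1.
have SS i : (i < n)%N -> (size (cnd_item c i).2.2)%:R <= S.
  move=> hi; rewrite /S (bigD1 (Ordinal hi)) //= addrCA lerDl addr_ge0 // sumr_ge0 //.
pose wL : R := ratr (wsum (2 * W.+1) L).
have wL0 : 0 <= wL by rewrite ler0q wsum_ge0.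
have [t ht] := @natV_small R (eta / 4 / A) (ltac:(by rewrite !divr_gt0)).
pose th : rat := (t.+1%:R)^-1.
have thA : A * ratr th <= eta / 4.
  by rewrite fmorphV /= ratr_nat mulrC -ler_pdivlMr // ltW.
pose wK : R := ratr (wid (Kc c)).
(* All errors but [th] are proportional to the width of a cell: that of the base point, that of the
   given derivatives and that of the batches. S turns the width of a cell into the width of its
   projections. *)
pose U : R := wK * (1 + (Cs + A * wL) * S).
have U0 : 0 <= U.
  by rewrite mulr_ge0 // addr_ge0 // mulr_ge0 // addr_ge0 // mulr_ge0 // ltW.
have [N hN] := @natV_small R (eta / 4 / (U + 1)) (ltac:(by rewrite !divr_gt0 // ltr_wpDl)).
have hU : U / N.+1%:R <= eta / 4.
  move: hN; rewrite ltr_pdivlMr ?ltr_wpDl // mulrDr mulr1 => hN.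
  by apply: le_trans (ltW hN); rewrite [leLHS]mulrC lerDl invr_ge0.
exists th; split; first by rewrite invr_gt0.
exists W, N => X Xg.
have [sX oX subX wX] := grid_cell oK Xg; rewrite sK in sX.
have KX x : inR X x -> inR (Kc c) x by apply: inR_sub => //; rewrite sX sK.
pose b : R := ratr (wid X).
have b0 : 0 <= b by rewrite ler0q wid_ge0.
have bE : b * (1 + (Cs + A * wL) * S) <= eta / 4.
  by rewrite /b wX rmorphM fmorphV /= ratr_nat mulrAC.
have bCs : Cs * (S * b) <= eta / 4 /\ A * wL * (S * b) <= eta / 4 /\ b <= eta / 4.
  have Sb0 : 0 <= S * b by exact: mulr_ge0.
  have h1 : 0 <= Cs * (S * b) by exact: mulr_ge0.
  have h2 : 0 <= A * wL * (S * b) by rewrite mulr_ge0 // mulr_ge0 // ltW.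
  have E : b * (1 + (Cs + A * wL) * S) = b + Cs * (S * b) + A * wL * (S * b) by ring.
  by rewrite E in bE; exact: add3_le bE.
case: bCs => bC [bA bb].
set x0 := rpt R (corner X); have Xx0 : inR X x0 by exact: inR_corner.
have Kx0 := KX _ Xx0.
have bX : bnd W X.
  apply: (@bndW W0); first exact: leq_addr.
  apply/allP => p /(nthP (0, 0)) [i hi <-]; rewrite sX -sK in hi.
  have [k1 k2] := subX i hi; have /andP[k3 k4] := allP bW0 _ (mem_nth (0, 0) hi).
  by rewrite (le_trans k3 k1) (le_trans k2 k4).
have items i : exists p : (rat * rat) * nat, (i < n)%N ->
  [/\ qhalt p.2 ca (cnd_item c i).1 (cnd_item c i).2.1 (proj (cnd_item c i).2.2 X) p.1 &
   let E := encl (et (cnd_item c i).1) (cnd_item c i).1 (cnd_item c i).2.1 L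
      (proj (cnd_item c i).2.2 X) p.1 W th in
   [/\ fval et D c L i x0 - eta <= ratr E.1, ratr E.2 <= fval et D c L i x0 + eta & E.1 <= E.2]].
  have [hi|hi] := ltnP i n; last by exists ((0, 0), 0%N).
  have [Si sal sxi ml db] := valid_item R vc hi.
  have sp : size (proj (cnd_item c i).2.2 X) = et (cnd_item c i).1 by rewrite size_map sxi.
  have op : ordered (proj (cnd_item c i).2.2 X) by exact: ordered_proj.
  have mlX : all (fun l => l < size X)%N (cnd_item c i).2.2 by rewrite sX.
  have wp : ratr (wid (proj (cnd_item c i).2.2 X)) <= S * b.
    apply: (@le_trans _ _ ((size (cnd_item c i).2.2)%:R * b)); last by rewrite ler_wpM2r // SS.
    rewrite /b -ratr_natr_mul ler_rat -(size_map (fun l => nth (0, 0) X l)).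
    apply: wid_le => p /mapP [l hl ->]; apply: wid_ge => //; exact: (allP mlX).
  have pdb x : inR (proj (cnd_item c i).2.2 X) x -> dbox et rh (cnd_item c i).1 x.
    by apply: (proj_dbox vc hi sX) => l hl; apply: subX; rewrite sK.
  have hCi : C i * ratr (wid (proj (cnd_item c i).2.2 X)) <= eta / 4.
    have [Ci0 _] := hC i.
    apply: le_trans bC; apply: ler_pM => //; [by rewrite ler0q wid_ge0|exact: CCs].
  have [_ /(_ hi) hCl] := hC i.
  have e40 : 0 < eta / 4 by rewrite divr_gt0.
  have [uv [fuel [q1 q2 q3]]] := choose_uv Dalg Si sal sp op pdb e40 hCl hCi.
  exists (uv, fuel) => _; split => //=.
  have cp l : (l < et (cnd_item c i).1)%N ->
      rpt R (corner (proj (cnd_item c i).2.2 X)) l = px (cnd_item c i).2.2 x0 l.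
    by move=> hl; apply: corner_proj; rewrite ?sxi.
  have eD : D (cnd_item c i).1 (cnd_item c i).2.1 (rpt R (corner (proj (cnd_item c i).2.2 X)))
     = D (cnd_item c i).1 (cnd_item c i).2.1 (px (cnd_item c i).2.2 x0).
    apply: D_ext => //; last exact: db.
    by apply: pdb; exact: inR_corner.
  rewrite eD in q2 q3.
  pose err : rat := (afact (cnd_item c i).2.1)%:R *
     (wsum (2 * W.+1) L * wid (proj (cnd_item c i).2.2 X) + th).
  have err0 : 0 <= err.
    rewrite mulr_ge0 // addr_ge0 ?mulr_ge0 ?wsum_ge0 ?wid_ge0 // invr_ge0 //.
  have errE : ratr err <= eta / 2.
    rewrite /err rmorphM rmorphD rmorphM /= ratr_nat -/wL.
    apply: (@le_trans _ _ (A * (wL * (S * b) + ratr th))).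
      apply: ler_pM => //; last by rewrite lerD2r ler_wpM2l.
        apply: addr_ge0; [apply: mulr_ge0 => //; by rewrite ler0q wid_ge0|].
        by rewrite ler0q invr_ge0.
      exact: AA.
    rewrite mulrDr mulrA; apply: le_trans (lerD bA thA) _.
    by rewrite le_eqVlt; apply/orP; left; apply/eqP; field.
  have uv0 : uv.1 < uv.2 by case/andP: q1.
  have eV : ratr (deval (et (cnd_item c i).1) (cnd_item c i).2.1 L (cnd_item c i).1
     (corner (proj (cnd_item c i).2.2 X))) = devalR (et (cnd_item c i).1) (cnd_item c i).2.1 L
       (cnd_item c i).1 (px (cnd_item c i).2.2 x0).
    by rewrite -ratr_devalR; exact: devalR_ext.
  rewrite /encl /= -/err !(rmorphB, rmorphD) /= eV /fval.
  have [a1 a2] := encl_arith (devalR (et (cnd_item c i).1) (cnd_item c i).2.1 L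
    (cnd_item c i).1 (px (cnd_item c i).2.2 x0)) q2 q3 errE.
  split => //; move: uv0 err0; clear; set v0 := deval _ _ _ _ _; lra.
have [f hf] := choice items.
pose uvs := [seq (f i).1 | i <- iota 0 n].
pose fuel := (\sum_(i <- iota 0 n) (f i).2)%N.
have nuv i : (i < n)%N -> nth (0, 0) uvs i = (f i).1.
  by move=> hi; rewrite (nth_map 0%N) ?size_iota // nth_iota.
exists uvs, fuel; apply/and3P; split => //.
  apply/allP => i; rewrite mem_iota /= add0n -/n => hi; rewrite nuv //.
  have [h _] := hf i hi; apply: qhalt_mono h.
  by rewrite /fuel (big_rem i) /= ?leq_addr // mem_iota.
set Y := [seq _ | i <- iota 0 _].
pose Z := X ++ Y; rewrite -/Z.
pose z := zpt et D c L x0.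
have sY : size Y = n by rewrite size_map size_iota.
have sZ : size Z = (m + n)%N by rewrite size_cat sX sY.
have ZP l : (l < m + n)%N -> [/\ z l - eta <= ratr (nth (0, 0) Z l).1,
    ratr (nth (0, 0) Z l).2 <= z l + eta & (nth (0, 0) Z l).1 <= (nth (0, 0) Z l).2].
  move=> hl; rewrite /Z nth_cat sX /z /zpt -/m; case: ltnP => hlm.
    have hX : (l < size X)%N by rewrite sX.
    have o := allP oX _ (mem_nth (0, 0) hX).
    have E : x0 l = ratr (nth (0, 0) X l).1 by rewrite /x0 /rpt /corner (nth_map (0, 0)) // sX.
    have w := wid_ge oX hX; rewrite -(ler_rat R) rmorphB /= -/b in w.
    by rewrite E; split => //; move: w bb eta0; clra.
  have hi : (l - m < n)%N by rewrite ltn_subLR.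
  rewrite /Y (nth_map 0%N) ?size_iota // nth_iota // add0n nuv //.
  by have [_ [h1 h2 h3]] := hf _ hi.
have oZ : ordered Z.
  by apply/allP => p /(nthP (0, 0)) [l]; rewrite sZ => hl <-; have [] := ZP l hl.
have zb l : (l < m + n)%N -> `|z l| <= F + W0%:R.
  move=> hl; rewrite /z /zpt -/m; case: ltnP => hlm.
    have hK : (l < size (Kc c))%N by rewrite sK.
    by have := bnd_le bW0 Kx0 hK; move: F0; clra.
  have hi : (l - m < n)%N by rewrite ltn_subLR.
  by have := hF _ _ hi Kx0; have : 0 <= W0%:R :> R by []; clra.
have zW : F + W0%:R + 1 <= W%:R.
  by rewrite /W natrD -natr1; apply: shift_le; exact: ltW (archi_boundP F0).
have bZ : bnd W Z.
  apply/allP => p /(nthP (0, 0)) [l]; rewrite sZ => hl <-.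
  have [h1 h2 _] := ZP l hl; have := zb l hl; rewrite ler_norml => /andP[h3 h4].
  by rewrite -!(ler_rat R) rmorphN /= ratr_nat; apply/andP;
    split; move: h1 h2 h3 h4 zW eta1; clra.
have zbW l : (l < m + n)%N -> `|z l| <= W%:R.
  by move=> hl; have := zb l hl; move: zW; clra.
apply: (avoids_of_close eta0 etak LP0 hLP etaQ sZ oZ bZ ZP zbW).
by have := nb _ Kx0; rewrite badE.
Qed.

Lemma cert_complete L (kap : R) : 0 < kap ->
  (forall x, inR (Kc c) x -> ~ bad et D c L kap x) ->
  exists th : fr, 0 < q2 th /\ exists fuel W N cert,
    covered et fuel ca c L (q2 th) W N (map (map pq) cert).
Proof.
move=> k0 nb; have [th [th0 [W [N H]]]] := cell_complete k0 nb.
exists (frq th); rewrite frqK; split => //.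
pose g := grid N (Kc c).
have cells j : exists p : seq (rat * rat) * nat, (j < size g)%N ->
    cell_ok et p.2 ca c L th W (nth [::] g j) p.1.
  have [hj|hj] := ltnP j (size g); last by exists ([::], 0%N).
  by have [uvs [fuel h]] := H _ (mem_nth [::] hj); exists (uvs, fuel).
have [f hf] := choice cells.
exists (\sum_(j <- iota 0 (size g)) (f j).2)%N, W, N,
  [seq [seq (frq p.1, frq p.2) | p <- (f j).1] | j <- iota 0 (size g)].
apply/allP => j; rewrite mem_iota /= add0n => hj.
rewrite -map_comp (nth_map 0%N) ?size_iota // nth_iota // add0n /= -map_comp.
have -> : map (pq \o (fun p => (frq p.1, frq p.2))) (f j).1 = (f j).1.
  by rewrite -[RHS]map_id; apply: eq_map => p; rewrite /= /pq /= !frqK; case: p.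
apply: cell_ok_mono (hf j hj).
by rewrite (big_rem j) /= ?leq_addr // mem_iota.
Qed.

End Certificates.

(** * The stages and their limit *)

Lemma seq_pos (R : realType) (T : eqType) (l : seq T) (P : T -> R -> Prop) :
  (forall t e e', P t e -> 0 < e' -> e' <= e -> P t e') ->
  (forall t, t \in l -> exists2 e, 0 < e & P t e) ->
  exists2 e, 0 < e & forall t, t \in l -> P t e.
Proof.
move=> mono; elim: l => [|t l IH] h; first by exists 1.
have [q ql|e e0 he] := IH; first by apply: h; rewrite inE ql orbT.
have [e' e'0 he'] := h t (mem_head _ _).
have m0 : 0 < Num.min e e' by rewrite lt_min e0 e'0.
exists (Num.min e e') => // q; rewrite inE => /predU1P [->|ql].
  by apply: mono he' m0 _; rewrite ge_min lexx orbT.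
by apply: mono (he q ql) m0 _; rewrite ge_min lexx.
Qed.

Lemma seq_max (T : eqType) (l : seq T) (P : T -> nat -> Prop) :
  (forall t a b, P t a -> (a <= b)%N -> P t b) ->
  (forall t, t \in l -> exists a, P t a) -> exists a, forall t, t \in l -> P t a.
Proof.
move=> mono; elim: l => [|t l IH] h; first by exists 0%N.
have [q ql|a ha] := IH; first by apply: h; rewrite inE ql orbT.
have [b hb] := h t (mem_head _ _).
exists (maxn a b) => q; rewrite inE => /predU1P [->|ql].
  by apply: mono hb _; exact: leq_maxr.
by apply: mono (ha q ql) _; exact: leq_maxl.
Qed.

(** The indices and codes of orders that [small_eps] will test, obtained from the exponents before
    any coefficient is known. *)
Definition suppcodes (G : seq (nat * seq nat)) : seq (nat * nat) :=
  [seq (p.1, j) | p <- G, j <- iota 0 (enc p.2).+1].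

Section Stages.
Variables (R : realType) (Sg : nat -> bool) (et : nat -> nat) (rh : nat -> seq rat).
Variable D : nat -> seq nat -> (nat -> R) -> R.
Variables (ca : nat) (pb : prog) (eps : nat -> seq nat -> rat).
Implicit Types (L : seq term) (x y z : nat -> R).
Hypothesis Dlip : lipschitz_family Sg et D (dbox et rh).
Hypothesis Dalg : queries_decide Sg et D (dbox et rh) ca.
Hypothesis Heps : forall s al, Sg s -> size al = et s ->
  0 < eps s al /\ evaluates pb (cpair s (enc al)) (code_rat (eps s al)).
Let cb := code_prog pb.

(* An invalid or non-expanding condition is certified with an empty batch. *)
Lemma stage_trivial k (H : hist) (z z' : seq rat) : (forall r, r \in H -> 0 < r.2) ->
  (~~ valid Sg et rh (dec k) \/ nonexpanding (dec k) z z') ->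
  exists w, stage_ok Sg et rh ca cb k H (dec w).
Proof.
move=> H0 hz.
pose w : stage_cert := ([::], (frq 1, (0%N, (0%N, (0%N, ([::], (map frq z, map frq z'))))))).
have K s : map q2 (map frq s) = s.
  by rewrite -map_comp -[RHS]map_id; apply: eq_map => q /=; rewrite frqK.
have w0 : wt rh k [::] = 0 by [].
have Kz : map q2 w.2.2.2.2.2.2.1 = z by exact: K.
have Kz' : map q2 w.2.2.2.2.2.2.2 = z' by exact: K.
have K1 : q2 w.2.1 = 1 by exact: frqK.
exists (enc w); rewrite encK; apply/and5P; rewrite K1 Kz Kz' [map tq _]/= w0 !mul0r.
split => //; first by apply/allP => r /H0 /ltW.
by case: hz => ->; rewrite ?orbT.
Qed.

Lemma run_eps s al : Sg s -> size al = et s -> exists fuel, forall f, (fuel <= f)%N ->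
  run f cb (cpair s (enc al)) = (code_rat (eps s al)).+1.
Proof.
move=> sS sal; have [_ /evaluates_run [fuel hf]] := Heps sS sal.
by exists fuel => f h; exact: run_mono h hf.
Qed.

(** The case distinction is classical: only the existence of a certificate is at stake, and the
    search finds one without knowing its kind. *)
Lemma stage_exists k (H : hist) : (forall r, r \in H -> 0 < r.2) ->
  exists w, stage_ok Sg et rh ca cb k H (dec w).
Proof.
move=> H0; have [vc|nv] := boolP (valid Sg et rh (dec k : cond)); last first.
  by apply: (@stage_trivial _ _ [::] [::]) => //; left.
case: (pselect (expanding R (dec k : cond))) => [xc|/(nonexpanding_cert vc) [z [z' hz]]]; last first.
  by apply: (@stage_trivial _ _ z z') => //; right.
have [Ga gG hGa] := dense_avoid Dlip vc xc.
have [e1 e10 he1] : exists2 e : R, 0 < e & forall r, r \in H -> e * (2 ^ k.+1)%N%:R <= ratr r.2.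
  apply: seq_pos => [r e e' h _ le|r rH].
    by apply: le_trans h; rewrite ler_wpM2r.
  exists (ratr r.2 / (2 ^ k.+1)%N%:R).
    by rewrite divr_gt0 ?ltr0n ?expn_gt0 // ltr0q H0.
  by rewrite divfK // pnatr_eq0 -lt0n expn_gt0.
pose rng := suppcodes Ga.
have rngP p j : p \in Ga -> (j <= enc p.2)%N -> (p.1, j) \in rng.
  by move=> pG hx; apply/allpairsPdep; exists p, j; split => //; rewrite mem_iota.
have rngS q : q \in rng -> Sg q.1.
  by move=> /allpairsPdep [p [x [pG _ ->]]] /=; have /andP[] := allP gG _ pG.
have [e2 e20 he2] : exists2 e : R, 0 < e & forall q, q \in rng ->
    size (dec q.2 : seq nat) = et q.1 ->
    e * (afact (dec q.2) * 2 ^ k.+2)%N%:R <= ratr (eps q.1 (dec q.2)).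
  apply: seq_pos => [q e e' h e'0 le sz|q qr].
    by apply: le_trans (h sz); rewrite ler_wpM2r.
  have [sz|ns] := eqVneq (size (dec q.2 : seq nat)) (et q.1); last first.
    by exists 1 => // sz; rewrite sz eqxx in ns.
  have [ep _] := Heps (rngS q qr) sz.
  have nz : (0 < afact (dec q.2) * 2 ^ k.+2)%N by rewrite muln_gt0 afact_gt0 expn_gt0.
  exists (ratr (eps q.1 (dec q.2)) / (afact (dec q.2) * 2 ^ k.+2)%N%:R).
    by rewrite divr_gt0 ?ltr0q // ltr0n.
  by move=> _; rewrite divfK // pnatr_eq0 -lt0n.
have [f1 hf1] : exists f1, forall q, q \in rng -> size (dec q.2 : seq nat) = et q.1 ->
    forall f, (f1 <= f)%N -> run f cb (cpair q.1 q.2) = (code_rat (eps q.1 (dec q.2))).+1.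
  apply: seq_max => [q a b h ab sz f bf|q qr]; first by apply: h => //; exact: leq_trans bf.
  have [sz|ns] := eqVneq (size (dec q.2 : seq nat)) (et q.1); last first.
    by exists 0%N => sz; rewrite sz eqxx in ns.
  have [f hf] := run_eps (rngS q qr) sz; exists f => _ f' h.
  by have := hf f' h; rewrite decK.
pose e3 : R := ((2 ^ k)%N%:R)^-1.
have e30 : 0 < e3 by rewrite invr_gt0 ltr0n expn_gt0.
(* e1 protects the margins of the earlier stages, e2 the tolerance and e3 the convergence. *)
pose om := Num.min e1 (Num.min e2 e3).
have om0 : 0 < om by rewrite !lt_min e10 e20 e30.
have [L [sL wL [kap k0 hk]]] := hGa k (allL H) om om0.
have om1 : ratr (wt rh k L) <= e1 by apply: le_trans wL _; rewrite ge_min lexx.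
have om2 : ratr (wt rh k L) <= e2 by apply: le_trans wL _; rewrite !ge_min lexx orbT.
have om3 : ratr (wt rh k L) <= e3 by apply: le_trans wL _; rewrite !ge_min lexx !orbT.
have [th [th0 [f2 [W [N [cert hc]]]]]] := cert_complete Dlip Dalg vc k0 hk.
pose L' : seq pterm := [seq (t.1, (t.2.1, frq t.2.2)) | t <- L].
have LL : map tq L' = L.
  rewrite -map_comp -[RHS]map_id; apply: eq_map => -[s [be q]].
  by rewrite /= /tq /= frqK.
pose w : stage_cert := (L', (th, (maxn f1 f2, (W, (N, (cert, ([::], [::]))))))).
exists (enc w); rewrite encK /stage_ok LL /= th0 /=.
have pk n : 0 < (2 ^ n)%N%:R :> R by rewrite ltr0n expn_gt0.
apply/and4P; split.
- rewrite -(ler_rat R) rmorphM /= ratr_nat rmorph1.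
  by move: om3; rewrite /e3 -[leRHS]mul1r ler_pdivlMr.
- apply/allP => r rH; rewrite -(ler_rat R) rmorphM /= ratr_nat.
  by apply: le_trans (he1 r rH); rewrite ler_wpM2r.
- apply/allP => t tL; have tG := allP sL _ tL.
  have /andP[h1 h2] := allP gG _ tG; apply/and3P; split => //.
  apply/allP => x; rewrite mem_iota leq0n add0n ltnS => hx; apply/implyP => /eqP sz.
  have qr := rngP _ _ tG hx; rewrite (hf1 _ qr sz) ?leq_maxl //= frcK.
  rewrite -(ler_rat R) rmorphM /= ratr_nat.
  by apply: le_trans (he2 _ qr sz); rewrite ler_wpM2r.
apply/orP; right; apply/orP; right.
apply/allP => j hj; have := allP hc j hj; by apply: cell_ok_mono; exact: leq_maxr.
Qed.

Definition hs k := hseq Sg et rh ca cb k.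

Lemma hs_pos k r : r \in hs k -> 0 < r.2.
Proof.
elim: k r => // k IH r; rewrite /hs /= /next_hist.
case: pselect => [ex|_]; last exact: IH.
rewrite inE => /predU1P [->|]; last exact: IH.
by case: ex_minnP => m /andP[h _] _.
Qed.

Lemma stages_total : search_total Sg et rh ca cb.
Proof. by move=> k; apply: stage_exists => r; exact: hs_pos. Qed.

Lemma hs_step k : exists w, stage_ok Sg et rh ca cb k (hs k) w /\
  hs k.+1 = stage_rec w :: hs k.
Proof.
rewrite /hs /= /next_hist; case: pselect => [ex|]; last by have := stages_total k.
by exists (dec (ex_minn ex)); split => //; case: ex_minnP.
Qed.

Definition Lk k : seq term := if hs k.+1 is r :: _ then r.1 else [::].
Definition thk k : rat := if hs k.+1 is r :: _ then r.2 else 0.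

Lemma hsS k : hs k.+1 = (Lk k, thk k) :: hs k.
Proof. by have [w [_ e]] := hs_step k; rewrite /Lk /thk e; case: (stage_rec w). Qed.

Lemma mem_hs j k : (j < k)%N -> (Lk j, thk j) \in hs k.
Proof.
elim: k => // k IH; rewrite ltnS leq_eqVlt => /predU1P [->|h]; rewrite hsS inE ?eqxx //.
by rewrite IH ?orbT.
Qed.

Lemma allL_S k : allL (hs k.+1) = Lk k ++ allL (hs k).
Proof. by rewrite hsS. Qed.

Lemma wtk_le k : ratr (wt rh k (Lk k)) <= ((2 ^ k)%N%:R)^-1 :> R.
Proof.
have [w [/and5P[_ h _ _ _] e]] := hs_step k.
have -> : Lk k = map tq w.1 by rewrite /Lk e.
rewrite -[leRHS]mul1r ler_pdivlMr ?ltr0n ?expn_gt0 //.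
by rewrite -(ratr_nat R) -rmorphM -(rmorph1 (@ratr R)) ler_rat.
Qed.

Lemma wtk_th j k : (j < k)%N -> ratr (wt rh k (Lk k)) <= ratr (thk j) / (2 ^ k.+1)%N%:R :> R.
Proof.
move=> jk; have [w [/and5P[_ _ /allP h _ _] e]] := hs_step k.
have -> : Lk k = map tq w.1 by rewrite /Lk e.
rewrite ler_pdivlMr ?ltr0n ?expn_gt0 //.
by rewrite -(ratr_nat R) -rmorphM ler_rat; exact: (h _ (mem_hs jk)).
Qed.

Lemma deg_enc (al be : seq nat) : size al = size be ->
  (forall i, (nth 0%N al i <= nth 0%N be i)%N) -> (enc al <= enc be)%N.
Proof.
elim: al be => [|a al IH] [|b be] //= [sz] h.
rewrite !enc_cons ltnS; apply: leq_cpair; first exact: (h 0%N).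
by apply: IH => // i; exact: (h i.+1).
Qed.

(** If the derivative is not zero, some term of the batch has exponents above [al]; then the code of
    [al] is among those that [small_eps] tested for this term. *)
Lemma devalk_eps k s al x : Sg s -> size al = et s -> dbox et rh s x ->
  `|devalR (et s) al (Lk k) s x| <= ratr (eps s al) / (2 ^ k.+2)%N%:R.
Proof.
move=> sS sal dx; have [e0 _] := Heps sS sal.
have [nz|z] := eqVneq (devalR (et s) al (Lk k) s x) 0.
  by rewrite nz normr0 divr_ge0 // ler0q ltW.
have [w [/and5P[_ _ _ /allP h _] e]] := hs_step k.
have LE : Lk k = map tq w.1 by rewrite /Lk e.
have [t [tL ts hle]] : exists t, [/\ t \in Lk k, t.1 = s &
    forall i, (i < et s)%N -> (nth 0%N al i <= nth 0%N t.2.1 i)%N].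
  apply: contrapT => H; case/eqP: z; rewrite /devalR big_seq big1 // => t tL.
  case: eqP => // ts.
  have [i hi lt] : exists2 i, (i < et s)%N & (nth 0%N t.2.1 i < nth 0%N al i)%N.
    apply: contrapT => H'; apply: H; exists t; split => // i hi.
    by rewrite leqNgt; apply/negP => lt; apply: H'; exists i.
  by rewrite /monoR big_mkord (bigD1 (Ordinal hi)) //= ffact_small // !mul0r mulr0.
rewrite LE in tL; have /and3P[h1 /eqP h2 /allP h3] := h _ tL; rewrite ts in h2.
have len : (enc al <= enc t.2.1)%N.
  apply: deg_enc => [|i]; first by rewrite h2.
  have [hi|hi] := ltnP i (et s); first exact: hle.
  by rewrite nth_default // sal.
have h3' : enc al \in iota 0 (enc t.2.1).+1 by rewrite mem_iota leq0n add0n ltnS len.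
have := h3 _ h3'; cbv beta zeta.
have ea : dec (enc al) = al by exact: encK.
rewrite ea ts sal eqxx implyTb => /andP[h4 h5].
have [fuel hf] := run_eps sS sal.
have ev : (run w.2.2.1 cb (cpair s (enc al))).-1 = code_rat (eps s al).
  case E: (run w.2.2.1 cb _) h4 => [|v] // _.
  have := run_mono (leq_maxl w.2.2.1 fuel) E; rewrite hf ?leq_maxr // => -[].
  by move=> ->.
rewrite ev frcK in h5; rewrite -LE in h5.
have h6 : `|devalR (et s) al (Lk k) s x| <= (afact al)%:R * ratr (wt rh k (Lk k)).
  apply: devalR_wt => [|i hi]; first by rewrite sal.
  by apply: (le_trans (dx i hi)); apply: (le_trans (rat_le_enc _ _ _)); rewrite ler_nat leq_addl.
apply: (le_trans h6); rewrite ler_pdivlMr ?ltr0n ?expn_gt0 //.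
rewrite mulrAC -natrM mulrC -(ratr_nat R) -rmorphM ler_rat.
exact: h5.
Qed.

End Stages.

Lemma telescope_le (R : realType) (u : nat -> R) (A : R) k : 0 <= A ->
  (forall j, (k <= j)%N -> `|u j.+1 - u j| <= A / (2 ^ j)%N%:R) ->
  forall j, (k <= j)%N -> `|u j - u k| <= A * (2 / (2 ^ k)%N%:R).
Proof.
move=> A0 h j kj.
have p2 i : (2 ^ i)%N%:R != 0 :> R by rewrite pnatr_eq0 -lt0n expn_gt0.
(* The bound is strengthened by the part of the geometric series not yet used, which makes the
   induction go through. *)
suff : `|u j - u k| <= A * (2 / (2 ^ k)%N%:R) - A * (2 / (2 ^ j)%N%:R).
  by move/le_trans; apply; rewrite gerBl mulr_ge0 // divr_ge0.
rewrite -(subnKC kj); elim: (j - k)%N => [|i IH]; first by rewrite addn0 !subrr normr0.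
rewrite addnS; set l := (k + i)%N in IH *.
have e : u l.+1 - u k = (u l.+1 - u l) + (u l - u k) by ring.
rewrite e; apply: (le_trans (ler_normD _ _)).
apply: (le_trans (lerD (h l (leq_addr _ _)) IH)).
have -> : A * (2 / (2 ^ l.+1)%N%:R) = A / (2 ^ l)%N%:R.
  by rewrite expnS natrM; field; rewrite p2.
by rewrite le_eqVlt; apply/orP; left; apply/eqP; field; rewrite !p2.
Qed.

Lemma geometric_cvg (R : realType) (u : nat -> R) (A : R) k : 0 <= A ->
  (forall j, (k <= j)%N -> `|u j.+1 - u j| <= A / (2 ^ j)%N%:R) ->
  cvg (u @ \oo).
Proof.
move=> A0 h; apply/cauchy_cvgP; apply: cauchy_exP => e e0.
have e1 : 0 < e / (2 * A + 1) by rewrite divr_gt0 // ltr_wpDl // mulr_ge0.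
have [i hi] := pow2_small e1; exists (u (maxn k i)).
suff H : \forall j \near \oo, ball (u (maxn k i)) e (u j) by exact: H.
near=> j; rewrite /ball /= distrC.
have kj : (maxn k i <= j)%N by near: j; exact: nbhs_infty_ge.
have h' l : (maxn k i <= l)%N -> `|u l.+1 - u l| <= A / (2 ^ l)%N%:R.
  by move=> hl; apply: h; exact: leq_trans (leq_maxl _ _) hl.
apply: (le_lt_trans (telescope_le A0 h' kj)).
have le2 : ((2 ^ maxn k i)%N%:R)^-1 <= ((2 ^ i)%N%:R)^-1 :> R.
  by rewrite lef_pV2 ?posrE ?ltr0n ?expn_gt0 // ler_nat leq_exp2l // leq_maxr.
have := le_lt_trans le2 hi; rewrite ltr_pdivlMr ?ltr_wpDl ?mulr_ge0 //.
set t := (_^-1); have t0 : 0 <= t by rewrite invr_ge0.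
by move: t0; clra.
Unshelve. all: by end_near. Qed.

Lemma lim_dist (R : realType) (u : nat -> R) (c B : R) k : cvg (u @ \oo) ->
  (forall j, (k <= j)%N -> `|u j - c| <= B) -> `|limn u - c| <= B.
Proof.
move=> cu h.
have c1 : (fun j => `|u j - c|) @ \oo --> `|limn u - c|.
  by apply: cvg_norm; apply: cvgB => //; exact: cvg_cst.
rewrite -(cvg_lim _ c1) //; apply: limr_le; first by apply/cvg_ex; exists `|limn u - c|.
by near=> j; apply: h; near: j; exact: nbhs_infty_ge.
Unshelve. all: by end_near. Qed.

(** * The limit of the batches and what it inherits from each stage *)

Section Limit.
Variables (R : realType) (Sg : nat -> bool) (et : nat -> nat) (rh : nat -> seq rat).
Variable D : nat -> seq nat -> (nat -> R) -> R.
Variables (ca : nat) (pb : prog) (eps : nat -> seq nat -> rat).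
Implicit Types (L : seq term) (x y z : nat -> R).
Hypothesis Dlip : lipschitz_family Sg et D (dbox et rh).
Hypothesis Dalg : queries_decide Sg et D (dbox et rh) ca.
Hypothesis Heps : forall s al, Sg s -> size al = et s ->
  0 < eps s al /\ evaluates pb (cpair s (enc al)) (code_rat (eps s al)).
Let hq := hs Sg et rh ca pb.
Let Lq := Lk Sg et rh ca pb.
Let tk := thk Sg et rh ca pb.

(** A limit of derivatives of partial sums, one for each order; that they are the derivatives of the
    limit is shown by [hd_dquot]. *)
Definition hd s al x : R := limn (fun k => devalR (et s) al (allL (hq k)) s x).

Lemma dev_step s al x k : devalR (et s) al (allL (hq k.+1)) s x
  - devalR (et s) al (allL (hq k)) s x = devalR (et s) al (Lq k) s x.
Proof. by rewrite /hq (allL_S Dlip Dalg Heps) devalR_cat addrK. Qed.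

Lemma dev_step_le s al x k j : size al = et s -> (k <= j)%N ->
  (forall i, (i < et s)%N -> `|x i| <= (k.+1 + enc (rh s))%:R) ->
  `|devalR (et s) al (Lq j) s x| <= (afact al)%:R * ratr (wt rh j (Lq j)).
Proof.
move=> sal kj hx; apply: devalR_wt => [|i hi]; first by rewrite sal.
by apply: (le_trans (hx i hi)); rewrite ler_nat leq_add2r.
Qed.

Lemma dev_geo s al x k j : size al = et s -> (k <= j)%N ->
  (forall i, (i < et s)%N -> `|x i| <= (k.+1 + enc (rh s))%:R) ->
  `|devalR (et s) al (allL (hq j.+1)) s x - devalR (et s) al (allL (hq j)) s x|
    <= (afact al)%:R / (2 ^ j)%N%:R.
Proof.
move=> sal kj hx; rewrite dev_step; apply: (le_trans (dev_step_le sal kj hx)).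
by rewrite ler_wpM2l // (wtk_le Dlip Dalg Heps).
Qed.

Lemma hd_cvg s al x : size al = et s ->
  cvg ((fun k => devalR (et s) al (allL (hq k)) s x) @ \oo).
Proof.
move=> sal.
have [k hk] : exists k, forall i, (i < et s)%N -> `|x i| <= k%:R.
  exists (Num.bound (\sum_(i < et s) `|x i|)) => i hi.
  apply: ltW; apply: le_lt_trans (archi_boundP _); last exact: sumr_ge0.
  by rewrite (bigD1 (Ordinal hi)) //= lerDl sumr_ge0.
apply: (@geometric_cvg _ _ (afact al)%:R k) => // j kj; apply: (dev_geo sal kj) => i hi.
by apply: (le_trans (hk i hi)); rewrite ler_nat addSnnS leq_addr.
Qed.

Lemma hd_tail : tail_bound Sg et rh hq hd.
Proof.
move=> s al x k _ sal hx; rewrite /hd; apply: (lim_dist (k := k) (hd_cvg sal)) => j kj.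
apply: (telescope_le (u := fun k => devalR (et s) al (allL (hq k)) s x)) kj => //.
by move=> i ki; exact: dev_geo ki hx.
Qed.

Lemma dbox_le s x k : dbox et rh s x ->
  forall i, (i < et s)%N -> `|x i| <= (k.+1 + enc (rh s))%:R.
Proof.
move=> dx i hi; apply: (le_trans (dx i hi)).
by apply: (le_trans (rat_le_enc _ _ _)); rewrite ler_nat leq_addl.
Qed.

Lemma thk_pos k : 0 < tk k.
Proof.
apply: (@hs_pos Sg et rh ca pb k.+1 (Lq k, tk k)).
by rewrite (hsS Dlip Dalg Heps) inE eqxx.
Qed.

(** Each batch i > k weighs at most the margin of stage k divided by 2^(i + 1), and these bounds sum
    to at most the margin. *)
Lemma hd_margin s al x k : size al = et s -> dbox et rh s x ->
  `|hd s al x - devalR (et s) al (allL (hq k.+1)) s x| <= (afact al)%:R * ratr (tk k).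
Proof.
move=> sal dx; have t0 : 0 <= ratr (tk k) :> R by rewrite ler0q ltW // thk_pos.
have A0 : 0 <= (afact al)%:R * (ratr (tk k) / 2) :> R by rewrite mulr_ge0 // divr_ge0.
rewrite /hd; apply: (lim_dist (k := k.+1) (hd_cvg sal)) => j kj.
have h i : (k.+1 <= i)%N -> `|devalR (et s) al (allL (hq i.+1)) s x
    - devalR (et s) al (allL (hq i)) s x| <= (afact al)%:R * (ratr (tk k) / 2) / (2 ^ i)%N%:R.
  move=> ki; rewrite dev_step.
  apply: (le_trans (@dev_step_le s al x 0 i sal (leq0n i) (@dbox_le s x 0 dx))).
  rewrite -mulrA ler_wpM2l //; apply: (le_trans (wtk_th Dlip Dalg Heps ki)).
  by rewrite -mulrA -invfM -natrM -expnS.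
apply: (le_trans (telescope_le (u := fun k => devalR (et s) al (allL (hq k)) s x) A0 h kj)).
rewrite -mulrA ler_wpM2l // -mulrA ler_piMr // mulrA mulVf ?pnatr_eq0 // mul1r.
by rewrite invf_le1 ?ltr0n ?expn_gt0 // ler1n expn_gt0.
Qed.

(** The batches use at most half of the tolerance in all, whence the strict inequality. *)
Lemma hd_eps s al x : Sg s -> size al = et s -> dbox et rh s x ->
  `|hd s al x| < ratr (eps s al).
Proof.
move=> sS sal dx; have [e0 _] := Heps sS sal.
have e1 : 0 < ratr (eps s al) :> R by rewrite ltr0q.
have A0 : 0 <= ratr (eps s al) / 4 :> R by rewrite divr_ge0 // ltW.
have h i : (0 <= i)%N -> `|devalR (et s) al (allL (hq i.+1)) s x
    - devalR (et s) al (allL (hq i)) s x| <= ratr (eps s al) / 4 / (2 ^ i)%N%:R.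
  move=> ki; rewrite dev_step; apply: (le_trans (devalk_eps Dlip Dalg Heps i sS sal dx)).
  by rewrite -mulrA -invfM -natrM !expnS mulnA.
have := @lim_dist _ _ (devalR (et s) al (allL (hq 0)) s x) _ 0 (hd_cvg sal)
  (telescope_le (u := fun k => devalR (et s) al (allL (hq k)) s x) A0 h).
have -> : devalR (et s) al (allL (hq 0)) s x = 0 by rewrite /devalR big_nil.
rewrite subr0 -/(hd s al x) expn0 divr1 => /le_lt_trans; apply.
by lra.
Qed.

Definition zlim c x : nat -> R := fun l => if (l < c.1)%N then x l else
  let I := cnd_item c (l - c.1) in D I.1 I.2.1 (px I.2.2 x) + hd I.1 I.2.1 (px I.2.2 x).

(** Soundness of the second kind of evidence: a stage with a valid expanding condition can only have
    been passed by a certificate of avoidance. *)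
Lemma nonexpandingN c (z z' : seq rat) : valid Sg et rh c -> expanding R c -> ~~ nonexpanding c z z'.
Proof.
move=> vc xc; apply/negP => /and3P[zB zB' /hasP [i]].
rewrite mem_iota leq0n add0n => hi /allP h.
have [sB sP n0 oB] := valid_sizes vc.
have inb (v : seq rat) : inbox (cnd_box c) v -> inR (cnd_box c) (rpt R v).
  move=> /allP hv l hl; have := hv l; rewrite mem_iota leq0n add0n hl => /(_ isT) /andP[a b].
  by rewrite /rpt !ler_rat a b.
have [l hl] := xc _ _ (inb _ zB) (inb _ zB') i hi.
rewrite -sP in hl; have := h _ (mem_nth [::] hl).
rewrite /pR !ratr_devalR /rpt -!rmorphB /= -!ratr_norm ler_rat /peval => a.
by rewrite leNgt a.
Qed.

(** The certificate of stage k speaks of the finished family and not only of a partial sum: its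
    enclosures were widened by the margin of that stage, which all later batches respect. *)
Lemma avoidance k x : valid Sg et rh (dec k) -> expanding R (dec k) ->
  inR (Kc (dec k)) x -> inR (cnd_box (dec k)) (zlim (dec k) x) ->
  ~ (forall l, (l <= (dec k : cond).1)%N -> pR (dec k) l (zlim (dec k) x) = 0).
Proof.
set c : cond := dec k => vc xc Kx zB z0.
have [w [/and5P[_ _ _ _ h5] e]] := hs_step Dlip Dalg Heps k.
have LE : Lq k = map tq w.1 by rewrite /Lq /Lk e.
have TE : tk k = q2 w.2.1 by rewrite /tk /thk e.
move: h5; rewrite -/c vc /= (negbTE (nonexpandingN _ _ vc xc)) /=.
have -> : map tq w.1 ++ allL (hs Sg et rh ca pb k) = allL (hq k.+1).
  by rewrite -LE /hq (allL_S Dlip Dalg Heps).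
rewrite -TE; set L := allL _; set f := w.2.2.1; set W := w.2.2.2.1; set N := w.2.2.2.2.1.
set cert := map _ _ => /allP hc.
have [sB sP n0 oB] := valid_sizes vc; have sK := size_Kc vc; have oK := ordered_Kc vc.
have [X Xg Xx] := grid_cover N oK Kx.
have [sX oX subX wX] := grid_cell oK Xg; rewrite sK in sX subX.
have /(hc _) : index X (grid N (take c.1 (cnd_box c))) \in
    iota 0 (size (grid N (take c.1 (cnd_box c)))).
  by rewrite mem_iota leq0n add0n index_mem.
rewrite nth_index //; set uvs := nth _ _ _ => /and3P[bX /allP hqh].
set Y := [seq _ | i <- iota 0 _]; set Z := X ++ Y => hav.
have sY : size Y = cnd_n c by rewrite size_map size_iota.
have sZ : size Z = (c.1 + cnd_n c)%N by rewrite size_cat sX sY.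
have zZ : inR Z (zlim c x).
  move=> l; rewrite sZ => hl; rewrite /Z nth_cat sX /zlim; case: ltnP => hlm.
    by apply: Xx; rewrite sX.
  have hi : (l - c.1 < cnd_n c)%N by rewrite ltn_subLR.
  rewrite /Y (nth_map 0%N) ?size_iota // nth_iota // add0n.
  have [Si sal sxi ml db] := valid_item R vc hi.
  have := hqh (l - c.1)%N; rewrite mem_iota leq0n add0n hi => /(_ isT).
  set I := cnd_item c _ in Si sal sxi ml db * => q.
  have mlX : all (fun l => l < size X)%N I.2.2 by rewrite sX.
  have := encl_sound Dalg Si sal (L := L) (uv := nth (0, 0) uvs (l - c.1)) (W := W)
    (th := tk k) (X := proj I.2.2 X) (E := hd I.1 I.2.1 (px I.2.2 x)) (x := px I.2.2 x)
    (fuel := f) _ (ordered_proj _ oX) _ (bnd_proj _ bX) (inR_proj mlX Xx) q.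
  rewrite size_map => /(_ sxi); rewrite /= => H.
  have /andP[h1 h2] := H (fun y => @proj_dbox R Sg et rh c X _ y vc hi sX subX) (hd_margin k sal (db _ Kx)).
  by rewrite (ltW h1) (ltW h2).
have oZ : ordered Z.
  apply/allP => p /(nthP (0, 0)) [l hl <-].
  by have /andP[a b] := zZ l hl; rewrite -(ler_rat R) (le_trans a b).
move: hav => /orP[/hasP [l]|/andP[bZ /hasP [l]]]; rewrite mem_iota leq0n add0n => hl.
  have := zB l; have := zZ l; rewrite sB sZ => /(_ hl) /andP[a b] /(_ hl) /andP[c1 c2].
  case/orP => h.
    by have := le_trans c1 b; rewrite ler_rat leNgt h.
  by have := le_trans a c2; rewrite ler_rat leNgt h.
have cZ := @inR_corner R _ oZ.
have := @devalR_lip R (size Z) [::] (nth [::] (cnd_poly c) l) 0 (zlim c x)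
  (rpt R (corner Z)) W (ratr (wid Z)) (leq0n _) _ (fun i hi => bnd_le bZ zZ hi)
  (fun i hi => bnd_le bZ cZ hi) (fun i hi => inR_dist oZ zZ cZ hi).
rewrite sZ ler0q wid_ge0 // => /(_ isT).
rewrite -/(pR c l (zlim c x)) z0 // sub0r normrN ratr_devalR -ratr_norm mul1r -rmorphM ler_rat.
by rewrite leNgt => /negP.
Qed.
End Limit.

(** * The limit as an entire function *)

Definition incr n (al : seq nat) (i : nat) : seq nat :=
  mkseq (fun j => nth 0%N al j + (j == i))%N n.

Definition upd (R : Type) (x : nat -> R) i t : nat -> R := fun j => if j == i then t else x j.

Lemma mvt (R : realType) (f df : R -> R) (a b : R) :
  (forall t : R, is_derive t 1 f (df t)) ->
  exists2 c, `|c - a| <= `|b - a| & f b - f a = df c * (b - a).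
Proof.
move=> h.
have cf (S : set R) : {within S, continuous f}.
  apply: continuous_subspaceT => x; apply: differentiable_continuous.
  by apply/derivable1_diffP; have := h x; case.
case: (leP a b) => [ab|/ltW ba].
  have [c cab e] := MVT_segment ab (fun x _ => h x) (cf _).
  exists c => //; move: cab; rewrite in_itv /= => /andP[h1 h2].
  by rewrite !ger0_norm ?subr_ge0 // lerD2r.
have [c cab e] := MVT_segment ba (fun x _ => h x) (cf _).
exists c; last by rewrite -(opprB (f a)) e -mulrN opprB.
move: cab; rewrite in_itv /= => /andP[h1 h2].
by rewrite !ler0_norm ?subr_le0 // lerN2 lerD2r.
Qed.

(* The bound on the second derivative is uniform over the partial sums of
   [hd], so this estimate survives the passage to the limit. *)
Lemma second_order (R : realType) (f f1 f2 : R -> R) (a h C : R) :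
  (forall t : R, is_derive t 1 f (f1 t)) -> (forall t : R, is_derive t 1 f1 (f2 t)) ->
  (forall t, `|t - a| <= `|h| -> `|f2 t| <= C) ->
  `|f (a + h) - f a - h * f1 a| <= C * `|h| ^+ 2.
Proof.
move=> d1 d2 b.
have [c c1 ->] := mvt a (a + h) d1; rewrite addrAC subrr add0r in c1 *.
have [e e1 eE] := mvt a c d2.
rewrite (mulrC h) -mulrBl eE normrM normrM expr2 mulrA ler_wpM2r //.
apply: ler_pM => //; apply: b; exact: le_trans c1.
Qed.

Section MonoDerive.
Variable R : realType.
Implicit Types (x : nat -> R) (al be : seq nat).

Lemma monoR_upd n al be x i (t : R) : (i < n)%N ->
  monoR n al be (upd x i t) = ((nth 0%N be i ^_ nth 0%N al i)%:R
    * t ^+ (nth 0%N be i - nth 0%N al i)) *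
   \prod_(0 <= j < n | j != i) ((nth 0%N be j ^_ nth 0%N al j)%:R
                      * x j ^+ (nth 0%N be j - nth 0%N al j)%N).
Proof.
move=> hi; rewrite /monoR (bigD1_seq i) ?mem_index_iota ?iota_uniq //= /upd eqxx.
by congr (_ * _); apply: eq_bigr => j /negbTE ->.
Qed.

Lemma monoR_incr n al be x i (t : R) : (i < n)%N ->
  monoR n (incr n al i) be (upd x i t) = ((nth 0%N be i ^_ (nth 0%N al i).+1)%:R
    * t ^+ (nth 0%N be i - nth 0%N al i).-1) *
   \prod_(0 <= j < n | j != i) ((nth 0%N be j ^_ nth 0%N al j)%:R
                      * x j ^+ (nth 0%N be j - nth 0%N al j)%N).
Proof.
move=> hi; rewrite monoR_upd // nth_mkseq // eqxx addn1 subnS; congr (_ * _).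
rewrite big_nat_cond [RHS]big_nat_cond; apply: eq_bigr => j /andP[/andP[_ hj] /negbTE ji].
by rewrite nth_mkseq // ji addn0.
Qed.

Lemma is_derive_monoR n al be x i (t : R) : (i < n)%N ->
  is_derive t 1 (fun t => monoR n al be (upd x i t)) (monoR n (incr n al i) be (upd x i t)).
Proof.
move=> hi; rewrite monoR_incr //.
set P := \prod_(_ <= _ < _ | _) _; set u := (nth 0%N be i - _)%N.
have -> : (fun t => monoR n al be (upd x i t)) =
    (P * (nth 0%N be i ^_ nth 0%N al i)%:R) *: (fun t : R => t ^+ u).
  by apply/funext => v; rewrite monoR_upd // -/P -/u mulrC mulrA.
have -> : (nth 0%N be i ^_ (nth 0%N al i).+1)%:R * t ^+ u.-1 * P =
    (P * (nth 0%N be i ^_ nth 0%N al i)%:R) *: (u%:R * t ^+ u.-1).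
  by rewrite ffactnSr natrM -/u /GRing.scale /=; ring.
apply: is_deriveZ.
have := is_deriveX u (is_derive_id t 1).
by rewrite exprfctE /GRing.scale /= mulr1.
Qed.

Lemma is_derive_devalR n al L s x i (t : R) : (i < n)%N ->
  is_derive t 1 (fun t => devalR n al L s (upd x i t)) (devalR n (incr n al i) L s (upd x i t)).
Proof.
move=> hi; elim: L => [|p L IH].
  rewrite /devalR !big_nil.
  by under eq_fun do rewrite big_nil; exact: is_derive_cst.
have E u al' : devalR n al' (p :: L) s u =
   (if p.1 == s then ratr p.2.2 else 0) * monoR n al' p.2.1 u + devalR n al' L s u.
  by rewrite /devalR big_cons; case: eqP => _; rewrite ?mul0r.
rewrite E; under eq_fun do rewrite E.
have h := is_derive_monoR al p.2.1 x t hi.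
exact: is_deriveD.
Qed.
End MonoDerive.

Section Tail.
Variables (R : realType) (Sg : nat -> bool) (et : nat -> nat) (rh : nat -> seq rat).
Variables (Hs : nat -> hist) (hd : nat -> seq nat -> (nat -> R) -> R).
Hypothesis Htail : tail_bound Sg et rh Hs hd.
Variable s : nat.
Hypothesis sS : Sg s.
Let n := et s.
Implicit Types (x : nat -> R) (al : seq nat).

(** M does not depend on [al]. Thus the Taylor coefficients at a point are bounded, which yields
    analyticity, and the second derivatives of the partial sums are bounded uniformly. *)
Lemma uniform_bound (V : nat) : exists2 M : R, 0 <= M & forall al x, size al = n ->
  (forall i, (i < n)%N -> `|x i| <= V%:R) ->
  `|hd s al x| <= (afact al)%:R * M /\
  forall k, (V <= k)%N -> `|devalR n al (allL (Hs k)) s x| <= (afact al)%:R * M.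
Proof.
pose M0 : R := ratr (wsum (2 * V.+1) (allL (Hs V))).
have M00 : 0 <= M0 by rewrite ler0q wsum_ge0.
exists (M0 + 4) => [|al x sal hx]; first by rewrite addr_ge0.
have hV k : (V <= k)%N -> forall i, (i < et s)%N -> `|x i| <= (k.+1 + enc (rh s))%:R.
  by move=> Vk i hi; apply: (le_trans (hx i hi)); rewrite ler_nat (leq_trans Vk) // addSnnS leq_addr.
have a0 : 0 <= (afact al)%:R :> R by [].
have p2 k : 2 / (2 ^ k)%N%:R <= 2 :> R.
  by rewrite ler_piMr // invf_le1 ?ltr0n ?expn_gt0 // ler1n expn_gt0.
have b1 : `|devalR n al (allL (Hs V)) s x| <= (afact al)%:R * M0.
  apply: devalR_bound => [//||i hi]; first by rewrite sal.
  by apply: (le_trans (hx i hi)); rewrite ler_nat.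
have t k (Vk : (V <= k)%N) : `|hd s al x - devalR n al (allL (Hs k)) s x| <= (afact al)%:R * 2.
  by apply: (le_trans (Htail sS sal (hV k Vk))); rewrite ler_wpM2l.
have b2 : `|hd s al x| <= (afact al)%:R * (M0 + 2).
  rewrite mulrDr -[hd s al x](subrK (devalR n al (allL (Hs V)) s x)) addrC.
  by apply: (le_trans (ler_normD _ _)); exact: lerD b1 (t V (leqnn _)).
split=> [|k Vk].
  by apply: (le_trans b2); rewrite ler_wpM2l // lerD2l ler_nat.
have -> : M0 + 4 = M0 + 2 + 2 by ring.
rewrite [leRHS]mulrDr -[devalR _ _ _ _ _](subrK (hd s al x)) addrC.
by apply: (le_trans (ler_normD _ _)); apply: lerD b2 _; rewrite distrC; exact: t.
Qed.

Lemma hd_lim al x : size al = n ->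
  (fun k => devalR n al (allL (Hs k)) s x) @ \oo --> hd s al x.
Proof.
move=> sal; apply/cvgrPdist_le => e e0.
have [V hV] : exists V : nat, forall i, (i < n)%N -> `|x i| <= V%:R.
  exists (Num.bound (\sum_(i < n) `|x i|)) => i hi.
  apply: ltW; apply: le_lt_trans (archi_boundP _); last exact: sumr_ge0.
  by rewrite (bigD1 (Ordinal hi)) //= lerDl sumr_ge0.
have a0 : 0 < (afact al)%:R :> R by rewrite ltr0n afact_gt0.
have [k [Vk hk]] := small_pow V a0 e0.
near=> j.
have kj : (k <= j)%N by near: j; exact: nbhs_infty_ge.
apply: le_trans (Htail sS sal _) _ => [i hi|].
  apply: (le_trans (hV i hi)); rewrite ler_nat.
  by apply: (leq_trans Vk); apply: (leq_trans kj); rewrite addSnnS leq_addr.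
apply: le_trans hk; rewrite ler_pM2l // ler_pM2l //.
by rewrite lef_pV2 ?posrE ?ltr0n ?expn_gt0 // ler_nat leq_exp2l.
Unshelve. all: by end_near. Qed.

Lemma hd_second_order al x i : size al = n -> (i < n)%N -> exists2 C : R, 0 <= C &
  forall h : R, `|h| <= 1 ->
  `|hd s al (upd x i (x i + h)) - hd s al x - h * hd s (incr n al i) x| <= C * `|h| ^+ 2.
Proof.
move=> sal hi.
(* One unit of room for the points between x_i and x_i + h. *)
have [V hV] : exists V : nat, forall j, (j < n)%N -> `|x j| + 1 <= V%:R.
  exists (Num.bound (\sum_(i < n) `|x i|)).+1 => j hj.
  rewrite -natr1 lerD2r.
  apply: ltW; apply: le_lt_trans (archi_boundP _); last exact: sumr_ge0.
  by rewrite (bigD1 (Ordinal hj)) //= lerDl sumr_ge0.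
have [M M0 hM] := uniform_bound V.
have si al' : size (incr n al' i) = n by rewrite size_mkseq.
set al2 := incr n (incr n al i) i.
exists ((afact al2)%:R * M) => [|h h1]; first by rewrite mulr_ge0.
have ux : x = upd x i (x i) by apply/funext => j; rewrite /upd; case: eqP => [->|].
pose g k (y : nat -> R) := devalR n al (allL (Hs k)) s y.
pose g1 k (y : nat -> R) := devalR n (incr n al i) (allL (Hs k)) s y.
have b k : (V <= k)%N -> `|g k (upd x i (x i + h)) - g k x - h * g1 k x|
    <= (afact al2)%:R * M * `|h| ^+ 2.
  move=> Vk; rewrite {3 4}ux.
  apply: (@second_order R (fun t => g k (upd x i t)) (fun t => g1 k (upd x i t))
    (fun t => devalR n al2 (allL (Hs k)) s (upd x i t)) (x i) h) => [t|t|t ht].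
  - exact: is_derive_devalR.
  - exact: is_derive_devalR.
  suff hu j : (j < n)%N -> `|upd x i t j| <= V%:R.
    by have [_ H] := hM al2 _ (si _) hu; exact: H.
  move=> hj; rewrite /upd.
  have := hV j hj; case: eqP => [->|_] hj1; last by apply: le_trans hj1; rewrite lerDl.
  apply: le_trans hj1; rewrite -[t](subrK (x i)) addrC.
  by apply: le_trans (ler_normD _ _) _; rewrite lerD2l; exact: le_trans h1.
have c : (fun k => `|g k (upd x i (x i + h)) - g k x - h * g1 k x|) @ \oo -->
    `|hd s al (upd x i (x i + h)) - hd s al x - h * hd s (incr n al i) x|.
  apply: cvg_norm; apply: cvgB; first by apply: cvgB; exact: hd_lim.
  by apply: cvgMr; apply: hd_lim.
rewrite -(cvg_lim _ c) //; apply: limr_le; first by apply/cvg_ex; eexists; exact: c.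
by near=> k; apply: b; near: k; exact: nbhs_infty_ge.
Unshelve. all: by end_near. Qed.

Lemma hd_continuous al : size al = n -> continuous (fun v : 'rV[R]_n => hd s al (vf v)).
Proof.
move=> sal v; apply/(@cvgrPdist_le _ _ _ (nbhs v) (nbhs_filter v)) => e e0.
have [V hV] : exists V : nat, forall j, (j < n)%N -> `|vf v j| + 1 <= V%:R.
  exists (Num.bound (\sum_(i < n) `|vf v i|)).+1 => j hj.
  rewrite -natr1 lerD2r.
  apply: ltW; apply: le_lt_trans (archi_boundP _); last exact: sumr_ge0.
  by rewrite (bigD1 (Ordinal hj)) //= lerDl sumr_ge0.
have a0 : 0 < (afact al)%:R :> R by rewrite ltr0n afact_gt0.
have e3 : 0 < e / 3 by rewrite divr_gt0.
have [k [Vk hk]] := small_pow V a0 e3.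
pose C : R := (afact al)%:R * ratr (wsum (2 * V.+1) (allL (Hs k))).
have C0 : 0 <= C by rewrite mulr_ge0 // ler0q wsum_ge0.
pose d := Num.min 1 (e / 3 / (C + 1)).
have d0 : 0 < d by rewrite lt_min ltr01 divr_gt0 // ltr_wpDl.
have Cd : C * d <= e / 3.
  apply: (@le_trans _ _ ((C + 1) * (e / 3 / (C + 1)))).
    by apply: ler_pM => //; [exact: ltW|rewrite lerDl|rewrite ge_min lexx orbT].
  by rewrite mulrC divfK // gt_eqF // ltr_wpDl.
have : \forall w \near v, ball v d w by exact: nbhsx_ballx.
apply: filterS => w [_ bw].
have dw j : (j < n)%N -> `|vf v j - vf w j| <= d.
  move=> hj; have := bw 0 (Ordinal hj); rewrite -!(vfE _ (Ordinal hj)) /=.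
  by rewrite /ball /=; exact: ltW.
have w1 j : (j < n)%N -> `|vf w j| <= V%:R.
  move=> hj; apply: le_trans (hV j hj); rewrite -[vf w j](subrK (vf v j)) addrC.
  apply: le_trans (ler_normD _ _) _; rewrite lerD2l distrC.
  by apply: le_trans (dw j hj) _; rewrite ge_min lexx.
have v1 j : (j < n)%N -> `|vf v j| <= V%:R.
  by move=> hj; apply: le_trans (hV j hj); rewrite lerDl.
have kV (x : nat -> R) : (forall j, (j < n)%N -> `|x j| <= V%:R) ->
    forall j, (j < n)%N -> `|x j| <= (k.+1 + enc (rh s))%:R.
  move=> h j hj; apply: (le_trans (h j hj)); rewrite ler_nat.
  by apply: (leq_trans Vk); rewrite addSnnS leq_addr.
have t1 := le_trans (Htail sS sal (kV _ v1)) hk.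
have t2 := le_trans (Htail sS sal (kV _ w1)) hk.
have := @devalR_lip R n al (allL (Hs k)) s _ _ V d _ (ltW d0) v1 w1 dw.
rewrite sal => /(_ (leqnn _)) t3; have {}t3 := le_trans t3 Cd.
set a := hd s al _ in t1 *; set b := hd s al _ in t2 *.
set a' := devalR _ _ _ _ _ in t1 t3; set b' := devalR _ _ _ _ _ in t2 t3.
have -> : a - b = (a - a') + (a' - b') - (b - b') by ring.
apply: le_trans (ler_normB _ _) _; apply: le_trans (lerD (ler_normD _ _) (lexx _)) _.
by move: t1 t2 t3; clear; lra.
Qed.

End Tail.

(** * Partial derivatives along a set, and those of the perturbation *)

Section PartialDerivatives.
Variables (R : realType) (n : nat).
Implicit Types (A : set 'rV[R]_n) (f g : 'rV[R]_n -> R).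

(** Properness makes limits along A unique, hence derivatives determined, also on the faces of a
    closed box. *)
Definition thick A := forall i x, A x -> ProperFilter (along A i x).

Lemma thick_near A : (forall i x (e : R), A x -> 0 < e ->
    exists h, [/\ h != 0, `|h| < e & A (x + h *: delta_mx 0 i)]) -> thick A.
Proof.
move=> H i x Ax; apply: Build_ProperFilter_ex => P.
move=> [e /= e0 he]; have [h [h0 hle hA]] := H i x e Ax e0; exists h.
by apply: he => //=; rewrite sub0r normrN.
Qed.

Lemma thickT : thick setT.
Proof.
apply: thick_near => i x e _ e0; exists (e / 2); split => //; first by rewrite gt_eqF // divr_gt0.
by rewrite gtr0_norm ?divr_gt0 //; lra.
Qed.

(** From any point one can move towards the centre of the box, that is, against the sign of the
    coordinate. *)
Lemma thick_cbox (r : n.-tuple rat) : posq r -> thick (cbox r).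
Proof.
move=> r0; apply: thick_near => i x e Ax e0.
have ri : 0 < ratr (tnth r i) :> R by rewrite ltr0q.
pose t := Num.min (e / 2) (ratr (tnth r i)).
have t0 : 0 < t by rewrite lt_min ri divr_gt0.
have te : t < e by apply: (@le_lt_trans _ _ (e / 2)); [rewrite ge_min lexx|lra].
have tr : t <= ratr (tnth r i) by rewrite ge_min lexx orbT.
have K (h : R) : `|x 0 i + h| <= ratr (tnth r i) -> cbox r (x + h *: delta_mx 0 i).
  move=> hh j; rewrite !mxE eqxx /=; case: eqP => [->|_]; rewrite ?mulr1 ?mulr0 ?addr0 //.
have := Ax i; rewrite ler_norml => /andP[a b].
case: (lerP 0 (x 0 i)) => hx.
  exists (- t); rewrite oppr_eq0 normrN gtr0_norm // gt_eqF //; split => //.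
  by apply: K; rewrite ler_norml; apply/andP; split; lra.
exists t; rewrite gtr0_norm // gt_eqF //; split => //.
by apply: K; rewrite ler_norml; apply/andP; split; lra.
Qed.

Lemma eq_dquot A i f g x : (forall y, A y -> f y = g y) -> A x ->
  dquot i f x h @[h --> along A i x] = dquot i g x h @[h --> along A i x].
Proof.
have K f' g' P : (forall y, A y -> f' y = g' y) -> A x ->
    (dquot i f' x h @[h --> along A i x]) P -> (dquot i g' x h @[h --> along A i x]) P.
  move=> e Ax H.
  have {}H : (0^' : set_system R) [set h | A (x + h *: delta_mx 0 i) -> P (dquot i f' x h)].
    exact: H.
  have : (0^' : set_system R) [set h | A (x + h *: delta_mx 0 i) -> P (dquot i g' x h)].
    by apply: filterS H => h /= H Ah; have := H Ah; rewrite /dquot !e.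
  exact.
move=> e Ax; apply/seteqP; split=> P; first exact: K.
by apply: K => // y Ay; rewrite e.
Qed.

Lemma eq_pderiv A i f g x : (forall y, A y -> f y = g y) -> A x ->
  pderiv A i f x = pderiv A i g x.
Proof. by move=> e Ax; rewrite /pderiv (eq_dquot _ e Ax). Qed.

Lemma pderivs_add A f g (sq : seq 'I_n) x : thick A -> smooth_on A f -> smooth_on A g -> A x ->
  pderivs A sq (fun y => f y + g y) x = pderivs A sq f x + pderivs A sq g x.
Proof.
move=> tA sf sg; elim: sq x => //= i sq IH x Ax.
have ff := tA i x Ax.
rewrite (eq_pderiv i IH Ax); apply: cvg_lim => //.
have -> : dquot i (fun y => pderivs A sq f y + pderivs A sq g y) x =
   (fun h => dquot i (pderivs A sq f) x h + dquot i (pderivs A sq g) x h).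
  by apply/funext => h; rewrite /dquot; ring.
by apply: cvgD; [have [_ /(_ i x Ax)] := sf sq|have [_ /(_ i x Ax)] := sg sq].
Qed.

Lemma dquot_second_order A i f x (d C : R) : 0 <= C -> 
  (forall h, `|h| <= 1 -> A (x + h *: delta_mx 0 i) ->
    `|f (x + h *: delta_mx 0 i) - f x - h * d| <= C * `|h| ^+ 2) ->
  dquot i f x h @[h --> along A i x] --> d.
Proof.
move=> C0 H; apply/(@cvgrPdist_le _ _ _ (along A i x) _) => e e0.
pose t := Num.min 1 (e / (C + 1)).
have C1 : 0 < C + 1 by rewrite ltr_wpDl.
have t0 : 0 < t by rewrite lt_min ltr01 divr_gt0.
exists t => //= h; rewrite /= sub0r normrN => ht h0 Ah.
have h1 : `|h| <= 1 by rewrite ltW // (lt_le_trans ht) // ge_min lexx.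
have h2 : `|h| <= e / (C + 1) by rewrite ltW // (lt_le_trans ht) // ge_min lexx orbT.
have hp : 0 < `|h| by rewrite normr_gt0.
have -> : d - dquot i f x h = - (h^-1 * (f (x + h *: delta_mx 0 i) - f x - h * d)).
  by rewrite /dquot; field.
rewrite normrN normrM normfV mulrC ler_pdivrMr //.
apply: le_trans (H h h1 Ah) _; rewrite expr2 mulrA ler_pM2r //.
apply: (@le_trans _ _ ((C + 1) * (e / (C + 1)))).
  by apply: ler_pM => //; rewrite lerDl.
by rewrite mulrC divfK // gt_eqF.
Qed.

(** The multi-index of a sequence of differentiations; for [hfun] the result depends on the sequence
    only through it. *)
Definition counts (sq : seq 'I_n) : seq nat :=
  mkseq (fun j => count (fun i : 'I_n => val i == j) sq) n.

Lemma counts_cons i sq : counts (i :: sq) = incr n (counts sq) i.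
Proof.
rewrite /incr /counts; apply/eq_in_map => j; rewrite mem_iota leq0n add0n => hj /=.
by rewrite nth_mkseq // addnC eq_sym.
Qed.

Lemma counts_mpderiv (alpha : n.-tuple nat) :
  counts (flatten [seq nseq (tnth alpha i) i | i <- enum 'I_n]) = alpha.
Proof.
apply: (@eq_from_nth _ 0%N); rewrite size_mkseq ?size_tuple // => j hj.
rewrite nth_mkseq // count_flatten -map_comp sumnE big_map big_enum /=.
rewrite (bigD1 (Ordinal hj)) //= big1 ?addn0 => [|i ij].
  by rewrite count_nseq eqxx mul1n (tnth_nth 0%N).
by rewrite count_nseq; case: eqP => // e; case/eqP: ij; apply: val_inj.
Qed.

Lemma vf_shift (x : 'rV[R]_n) i h :
  vf (x + h *: delta_mx 0 i) = upd (vf x) i (vf x i + h).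
Proof.
apply/funext => j; rewrite /upd.
have [jn|jn] := ltnP j n.
  rewrite (vfE _ (Ordinal jn)) !mxE eqxx /=.
  have [<-|ne] := eqVneq (Ordinal jn) i; first by rewrite eqxx mulr1 (vfE x (Ordinal jn)).
  rewrite (vfE x (Ordinal jn)) ifN ?mulr0 ?addr0 //.
rewrite ifN; first by rewrite /vf !insubN -?leqNgt.
by rewrite neq_ltn (leq_trans (ltn_ord i) jn) orbT.
Qed.
End PartialDerivatives.

Section Entire.
Variables (R : realType) (Sg : nat -> bool) (et : nat -> nat) (rh : nat -> seq rat).
Variables (Hs : nat -> hist) (hd : nat -> seq nat -> (nat -> R) -> R).
Hypothesis Htail : tail_bound Sg et rh Hs hd.
Variables (s n : nat).
Hypotheses (sS : Sg s) (nE : et s = n).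

Definition hfun (v : 'rV[R]_n) : R := hd s (nseq n 0%N) (vf v).

Lemma counts_nil : counts (n := n) [::] = nseq n 0%N.
Proof. by apply: (@eq_from_nth _ 0%N); rewrite ?size_mkseq ?size_nseq // => j hj; rewrite nth_mkseq // nth_nseq hj. Qed.

Lemma hd_dquot (A : set 'rV[R]_n) al i x : size al = n ->
  dquot i (fun v => hd s al (vf v)) x h @[h --> along A i x] --> hd s (incr n al i) (vf x).
Proof.
move=> sal; rewrite -nE in sal.
have hi : (i < et s)%N by rewrite nE.
have [C C0 hC] := hd_second_order Htail sS (vf x) sal hi.
apply: (dquot_second_order C0) => h h1 _.
by rewrite vf_shift; have := hC h h1; rewrite nE.
Qed.

Lemma pderivs_hfun (A : set 'rV[R]_n) sq x : thick A -> A x ->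
  pderivs A sq hfun x = hd s (counts sq) (vf x).
Proof.
move=> tA; elim: sq x => [|i sq IH] x Ax; first by rewrite counts_nil.
rewrite /= (eq_pderiv i IH Ax) counts_cons; have ff := tA i x Ax.
by apply: cvg_lim => //; apply: hd_dquot; rewrite size_mkseq.
Qed.

Lemma smooth_hfun (A : set 'rV[R]_n) : thick A -> smooth_on A hfun.
Proof.
move=> tA sq; split.
  apply: (@subspace_eq_continuous _ A _ (fun v => hd s (counts sq) (vf v))).
    by move=> x; rewrite inE => Ax; symmetry; exact: pderivs_hfun.
  apply: continuous_subspaceT.
  have := @hd_continuous _ _ _ _ _ _ Htail _ sS (counts sq).
  by rewrite nE size_mkseq; exact.
move=> i x Ax; rewrite /pderivable (@eq_dquot _ _ A i _ (fun v => hd s (counts sq) (vf v))) //.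
  by apply/cvg_ex; eexists; apply: hd_dquot; rewrite size_mkseq.
by move=> y Ay; rewrite pderivs_hfun.
Qed.

Lemma mpderiv_hfun (A : set 'rV[R]_n) (alpha : n.-tuple nat) x : thick A -> A x ->
  mpderiv A alpha hfun x = hd s alpha (vf x).
Proof. by move=> tA Ax; rewrite /mpderiv pderivs_hfun // counts_mpderiv. Qed.

End Entire.

(** * Taylor series and analyticity of the perturbation *)

Lemma ler_sum_sub (R : numDomainType) (T : eqType) (r E : seq T) (f : T -> R) :
  uniq r -> uniq E -> {subset r <= E} -> (forall x, 0 <= f x) ->
  \sum_(x <- r) f x <= \sum_(x <- E) f x.
Proof.
move=> ur uE sub f0; rewrite (perm_big [seq x <- E | x \in r]) /=.
  rewrite big_filter big_mkcond; apply: ler_sum => x _; case: ifP => // _.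
apply: uniq_perm => //; first exact: filter_uniq.
by move=> x; rewrite mem_filter; case: (boolP (x \in r)) => //= /sub.
Qed.

Lemma sum_tuple_prod (R : comPzSemiRingType) n N (F : 'I_n -> 'I_N -> R) :
  \sum_(b : n.-tuple 'I_N) \prod_(i < n) F i (tnth b i) = \prod_(i < n) \sum_(j < N) F i j.
Proof.
rewrite bigA_distr_bigA /= (reindex (@tuple_of_finfun 'I_N n)) /=; last first.
  by exists (@finfun_of_tuple 'I_N n) => t _; rewrite ?finfun_of_tupleK ?tuple_of_finfunK.
by apply: eq_bigr => f _; apply: eq_bigr => i _; rewrite tnth_mktuple.
Qed.

Lemma half_geometric (R : realFieldType) N : \sum_(j < N) (2^-1 : R) ^+ j <= 2.
Proof.
suff -> : \sum_(j < N) (2^-1 : R) ^+ j = 2 - 2 * 2^-1 ^+ N.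
  by rewrite gerBl mulr_ge0 // exprn_ge0.
elim: N => [|N IH]; first by rewrite big_ord0 expr0 mulr1 subrr.
by rewrite big_ord_recr /= IH exprS; field.
Qed.

Lemma cube_geometric (R : realFieldType) n N :
  \sum_(b : n.-tuple 'I_N) \prod_(i < n) (2^-1 : R) ^+ tnth b i <= 2 ^+ n.
Proof.
rewrite (sum_tuple_prod (fun (i : 'I_n) (j : 'I_N) => (2^-1 : R) ^+ j)).
have -> : (2 : R) ^+ n = \prod_(i < n) 2 by rewrite prodr_const card_ord.
apply: ler_prod => i _; rewrite half_geometric andbT.
by rewrite sumr_ge0 // => j _; rewrite exprn_ge0.
Qed.

(** A finite set of multi-indices lies in a cube, over which a sum of products is a product of n
    geometric sums, each at most 2. *)
Lemma summable_geometric (R : realType) n (f : n.-tuple nat -> R) (M : R) :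
  (forall al, `|f al| <= M * \prod_(i < n) 2^-1 ^+ tnth al i) ->
  summable [set: n.-tuple nat] (fun al => (f al)%:E).
Proof.
move=> H; rewrite /summable; apply: (@le_lt_trans _ _ (M * 2 ^+ n)%:E); last exact: ltry.
apply: ge_ereal_sup => _ [A [fA _]] <-.
rewrite fsbig_finite //=; set r := (X in \sum_(_ <- X) _).
have ur : uniq r by exact: finmap.fset_uniq.
have [N hN] : exists N, forall al, al \in (r : seq _) -> forall i, (tnth al i < N)%N.
  apply: (@seq_max _ r (fun al N => forall i, (tnth al i < N)%N)) => [t a b h ab i|t _].
    exact: leq_trans (h i) ab.
  exists (\sum_(i < n) tnth t i).+1%N => i; rewrite ltnS (bigD1 i) //=; exact: leq_addr.
have M0 : 0 <= M.
  have := le_trans (normr_ge0 _) (H [tuple 0%N | i < n]).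
  by rewrite big1 ?mulr1 // => i _; rewrite tnth_mktuple.
rewrite sumEFin lee_fin.
apply: (@le_trans _ _ (\sum_(al <- r) M * \prod_(i < n) 2^-1 ^+ tnth al i)).
  by apply: ler_sum => al _; exact: H.
rewrite -mulr_sumr ler_wpM2l //.
pose E := [seq map_tuple val b | b : n.-tuple 'I_N].
apply: (@le_trans _ _ (\sum_(al <- E) \prod_(i < n) (2^-1 : R) ^+ tnth al i)).
  apply: ler_sum_sub => //.
  - rewrite map_inj_uniq ?enum_uniq // => b b' e; apply: eq_from_tnth => i.
    by apply: val_inj; have := congr1 (fun t => tnth t i) e; rewrite !tnth_map.
  - move=> al /hN h; apply/fintype.imageP; exists [tuple Ordinal (h i) | i < n] => //.
    by apply: eq_from_tnth => i; rewrite tnth_map tnth_mktuple.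
  - by move=> al; apply: prodr_ge0 => i _; rewrite exprn_ge0.
rewrite big_image /=.
by under eq_bigr do under eq_bigr do rewrite tnth_map; exact: cube_geometric.
Qed.

Lemma taylor1 (R : comPzRingType) b N (a y : R) : (b < N)%N ->
  \sum_(j < N) ('C(b, j))%:R * a ^+ (b - j) * y ^+ j = (a + y) ^+ b.
Proof.
move=> bN; rewrite exprDn (big_ord_widen N (fun i => a ^+ (b - i) * y ^+ i *+ 'C(b, i))) //.
rewrite [RHS]big_mkcond; apply: eq_bigr => j _; rewrite ltnS; case: leqP => h.
  by rewrite -mulrA mulr_natl.
by rewrite bin_small // !mul0r.
Qed.

(** The binomial theorem in each variable. Over a cube larger than the exponents the Taylor sum is
    exact, the additional orders contributing 0. *)
Lemma taylor_monoR (R : realType) n N be (a x : 'rV[R]_n) :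
  (forall i, (i < n)%N -> (nth 0%N be i < N)%N) ->
  \sum_(b : n.-tuple 'I_N) monoR n (map_tuple val b) be (vf a)
     / (afact (map_tuple val b))%:R * monomial (map_tuple val b) (x - a)
  = monoR n (nseq n 0%N) be (vf x).
Proof.
move=> hN.
have -> : monoR n (nseq n 0%N) be (vf x) = \prod_(i < n) (a 0 i + (x - a) 0 i) ^+ nth 0%N be i.
  rewrite /monoR big_mkord; apply: eq_bigr => i _.
  by rewrite nth_nseq ltn_ord ffactn0 mul1r subn0 vfE; congr (_ ^+ _); rewrite !mxE; ring.
under [RHS]eq_bigr => i _ do rewrite -(taylor1 (a 0 i) ((x - a) 0 i) (hN i (ltn_ord i))).
rewrite -(sum_tuple_prod (fun (i : 'I_n) (j : 'I_N) =>
   ('C(nth 0%N be i, j))%:R * a 0 i ^+ (nth 0%N be i - j) * (x - a) 0 i ^+ j)).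
apply: eq_bigr => b _; rewrite (@afactE n) ?size_tuple // !big_mkord natr_prod.
rewrite /monoR /monomial big_mkord -prodf_div -big_split /=; apply: eq_bigr => i _.
have -> : nth 0%N (map val b) i = tnth b i by rewrite -tnth_nth tnth_map.
rewrite tnth_map vfE -bin_ffact natrM; congr (_ * _).
by rewrite mulrAC mulfK // pnatr_eq0 -lt0n fact_gt0.
Qed.

Lemma taylor_devalR (R : realType) n N L s (a x : 'rV[R]_n) :
  (forall t, t \in L -> forall i, (i < n)%N -> (nth 0%N t.2.1 i < N)%N) ->
  \sum_(b : n.-tuple 'I_N) devalR n (map_tuple val b) L s (vf a)
     / (afact (map_tuple val b))%:R * monomial (map_tuple val b) (x - a)
  = devalR n (nseq n 0%N) L s (vf x).
Proof.
move=> hN; rewrite /devalR.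
under eq_bigr => b _ do rewrite 2!mulr_suml.
rewrite exchange_big /= big_seq [RHS]big_seq; apply: eq_bigr => t tL.
case: eqP => _; last by rewrite big1 // => b _; rewrite !mul0r.
by rewrite -(taylor_monoR a x (hN t tL)) mulr_sumr; apply: eq_bigr => b _; rewrite !mulrA.
Qed.

Section Analytic.
Variables (R : realType) (Sg : nat -> bool) (et : nat -> nat) (rh : nat -> seq rat).
Variables (Hs : nat -> hist) (hd : nat -> seq nat -> (nat -> R) -> R).
Hypothesis Htail : tail_bound Sg et rh Hs hd.
Variables (s n : nat).
Hypotheses (sS : Sg s) (nE : et s = n).

Lemma hd_ext al x y : size al = n -> (forall i, (i < n)%N -> x i = y i) ->
  hd s al x = hd s al y.
Proof.
move=> sal xy; rewrite -nE in sal xy.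
have h1 := hd_lim Htail sS (x := x) sal; have h2 := hd_lim Htail sS (x := y) sal.
suff E : (fun k => devalR (et s) al (allL (Hs k)) s x) =
    (fun k => devalR (et s) al (allL (Hs k)) s y) by rewrite E in h1; exact: (cvg_unique _ h1 h2).
by apply/funext => k; exact: devalR_ext.
Qed.

Lemma analytic_hfun : analytic_on setT (hfun hd s (n := n)).
Proof.
move=> a _.
have [V hV] : exists V : nat, forall j, (j < n)%N -> `|vf a j| + 1 <= V%:R.
  exists (Num.bound (\sum_(i < n) `|vf a i|)).+1 => j hj.
  rewrite -natr1 lerD2r.
  apply: ltW; apply: le_lt_trans (archi_boundP _); last exact: sumr_ge0.
  by rewrite (bigD1 (Ordinal hj)) //= lerDl sumr_ge0.
have aV j : (j < n)%N -> `|vf a j| <= V%:R.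
  by move=> hj; apply: le_trans (hV j hj); rewrite lerDl.
have [M M0 hM] := uniform_bound Htail sS V; rewrite nE in hM.
pose c (al : n.-tuple nat) : R := hd s al (vf a) / (afact al)%:R.
have af0 (al : seq nat) : 0 < (afact al)%:R :> R by rewrite ltr0n afact_gt0.
(* The coefficients are bounded by M, so the series is dominated by a geometric one of ratio 1/2 in
   each variable. *)
exists c; have : \forall x \near a, ball a (2^-1) x by apply: nbhsx_ballx; rewrite invr_gt0.
apply: filterS => x [_ bx].
have dx i : `|(x - a) 0 i| <= 2^-1.
  by rewrite !mxE -normrN opprB; have := bx 0 i; rewrite /ball /=; exact: ltW.
have mon (al : n.-tuple nat) : `|monomial al (x - a)| <= \prod_(i < n) 2^-1 ^+ tnth al i.
  rewrite /monomial normr_prod; apply: ler_prod => i _; rewrite normr_ge0 /= normrX.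
  by apply: lerXn2r; rewrite ?nnegrE.
split.
  apply: (@summable_geometric _ _ _ M) => al; rewrite normrM; apply: ler_pM => //.
  rewrite /c normrM normfV (gtr0_norm (af0 _)) ler_pdivrMr // mulrC.
  by have [] := hM al (vf a) (size_tuple _) aV.
have xV j : (j < n)%N -> `|vf x j| <= V%:R.
  move=> hj; apply: le_trans (hV j hj); rewrite -[vf x j](subrK (vf a j)) addrC.
  apply: le_trans (ler_normD _ _) _; rewrite lerD2l !(vfE _ (Ordinal hj)).
  by have := dx (Ordinal hj); rewrite !mxE => /le_trans; apply; rewrite invf_le1 // ler1n.
apply/cvgrPdist_le => e e0.
(* 2^n for replacing the Taylor coefficients of the limit by those of a partial sum, 1 for replacing
   the limit at x. *)
have A0 : 0 < 2 ^+ n + 1 :> R by rewrite ltr_wpDl // exprn_ge0.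
have [k [Vk hk]] := small_pow V A0 e0.
have kV (y : nat -> R) : (forall j, (j < n)%N -> `|y j| <= V%:R) ->
    forall i, (i < n)%N -> `|y i| <= (k.+1 + enc (rh s))%:R.
  move=> hy i hi; apply: (le_trans (hy i hi)); rewrite ler_nat.
  by apply: (leq_trans Vk); rewrite addSnnS leq_addr.
have [N0 hN0] : exists N, forall t, t \in allL (Hs k) -> forall i, (i < n)%N -> (nth 0%N t.2.1 i < N)%N.
  apply: (seq_max (P := fun (t : term) N => forall i, (i < n)%N -> (nth 0%N t.2.1 i < N)%N))
    => [t p q h pq i hi|t _]; first exact: leq_trans (h i hi) pq.
  exists (\sum_(i < n) nth 0%N t.2.1 i).+1%N => i hi.
  by rewrite ltnS (bigD1 (Ordinal hi)) //=; exact: leq_addr.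
near=> N.
have NN : (N0 <= N)%N by near: N; exact: nbhs_infty_ge.
pose d (b : n.-tuple 'I_N) : R := devalR n (map_tuple val b) (allL (Hs k)) s (vf a)
     / (afact (map_tuple val b))%:R.
have T := @taylor_devalR R n N (allL (Hs k)) s a x
  (fun t tL i hi => leq_trans (hN0 t tL i hi) NN).
set S := \sum_(beta : n.-tuple 'I_N) _.
have e1 : `|S - devalR n (nseq n 0%N) (allL (Hs k)) s (vf x)| <= 2 / (2 ^ k)%N%:R * 2 ^+ n.
  rewrite -T -sumrB.
  apply: (le_trans (ler_norm_sum _ _ _)).
  apply: (@le_trans _ _ (\sum_(b : n.-tuple 'I_N) 2 / (2 ^ k)%N%:R * \prod_(i < n) 2^-1 ^+ tnth b i)).
    apply: ler_sum => b _; rewrite -mulrBl normrM; apply: ler_pM => //; last first.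
      apply: (le_trans (mon _)).
      by under eq_bigr do rewrite tnth_map.
    rewrite /c -mulrBl normrM normfV (gtr0_norm (af0 _)) ler_pdivrMr // mulrC.
    by have := Htail sS (al := map_tuple val b) (x := vf a) (k := k); rewrite nE; apply;
      [rewrite size_tuple|exact: kV].
  rewrite -mulr_sumr ler_wpM2l ?divr_ge0 //; exact: cube_geometric.
have e2 : `|hfun hd s x - devalR n (nseq n 0%N) (allL (Hs k)) s (vf x)| <= 2 / (2 ^ k)%N%:R.
  have := Htail sS (al := nseq n 0%N) (x := vf x) (k := k).
  rewrite nE size_nseq => /(_ erefl (kV _ xV)).
  suff -> : afact (nseq n 0%N) = 1%N by rewrite mul1r.
  by elim: (n) => //= i ->.
apply: le_trans hk; rewrite -[leLHS]normrN opprB mulrC mulrDr mulr1.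
have -> : S - hfun hd s x = (S - devalR n (nseq n 0%N) (allL (Hs k)) s (vf x))
  - (hfun hd s x - devalR n (nseq n 0%N) (allL (Hs k)) s (vf x)) by ring.
by apply: le_trans (ler_normB _ _) _; exact: lerD.
Unshelve. all: by end_near. Qed.
End Analytic.

(** * The perturbed family *)

Lemma within_continuousP (R : realType) (T : topologicalType) (A : set T) (f : T -> R) :
  {within A, continuous f} <-> forall x, A x -> forall e : R, 0 < e ->
    \forall y \near x, A y -> `|f x - f y| <= e.
Proof.
rewrite subspace_continuousP; split => H x Ax.
  by move=> e e0; have /cvgrPdist_le /(_ e e0) := H x Ax.
by apply/cvgrPdist_le => e e0; exact: H.
Qed.

Section Lipschitz.
Variables (R : realType) (n : nat) (r : n.-tuple rat).
Hypothesis r0 : posq r.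
Let A : set 'rV[R]_n := cbox r.
Implicit Types G : 'rV[R]_n -> R.

Lemma cbox_bounded G : {within A, continuous G} ->
  exists2 M : R, 0 <= M & forall x, A x -> `|G x| <= M.
Proof.
move=> /within_continuousP cG.
pose B : seq (rat * rat) := [seq (- q, q) | q <- r].
have sB : size B = n by rewrite size_map size_tuple.
pose row (x : nat -> R) : 'rV[R]_n := \row_i x i.
have BA x : inR B x -> A (row x).
  move=> h i; rewrite mxE ler_norml; have := h i; rewrite sB => /(_ (ltn_ord i)).
  by rewrite (nth_map 0) ?size_tuple //= -tnth_nth rmorphN.
have [a aB|l [h1 h2]] := @box_cover R B
    (fun a d => forall y, inR B y -> near_pt (size B) d a y -> `|G (row y)| <= `|G (row a)| + 1).
  have /nbhs_ballP [d /= d0 hd] := cG _ (BA _ aB) 1 ltr01.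
  exists d => // y yB ny; rewrite -lerBlDl; apply: (le_trans (lerB_dist _ _)).
  rewrite distrC; apply: hd; last exact: BA.
  split => // i j; rewrite !mxE /ball /= distrC; apply: ny; by rewrite sB.
exists (\sum_(p <- l) (`|G (row (vf p.1))| + 1)) => [|x Ax].
  by apply: sumr_ge0 => p _; rewrite addr_ge0.
have xB : inR B (vf x).
  move=> i; rewrite sB => hi; rewrite (nth_map 0) ?size_tuple //=.
  rewrite (vfE x (Ordinal hi)) rmorphN /= -ler_norml.
  by have := Ax (Ordinal hi); rewrite (tnth_nth 0).
have rx : row (vf x) = x by apply/rowP => i; rewrite mxE vfE.
have [p pl np] := h2 _ xB; have [_ _ h] := h1 p pl.
have := h _ xB np; rewrite rx => /le_trans; apply.
by rewrite (big_rem p) //= lerDl sumr_ge0 // => q _; rewrite addr_ge0.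
Qed.

Definition setc (x : 'rV[R]_n) (i : 'I_n) (t : R) : 'rV[R]_n :=
  \row_j (if j == i then t else x 0 j).

Lemma setc_shift x i t h : setc x i (t + h) = setc x i t + h *: delta_mx 0 i.
Proof.
apply/rowP => j; rewrite !mxE eqxx /=; case: eqP => _; rewrite ?mulr1 //.
by rewrite mulr0 addr0.
Qed.

Lemma setc_cbox x i t : A x -> `|t| <= ratr (tnth r i) -> A (setc x i t).
Proof. by move=> Ax h j; rewrite mxE; case: eqP => [->|]. Qed.

(** At an interior point of the segment small steps stay in the box, so the derivative along the box
    is two-sided there and the mean value theorem applies. *)
Lemma coord_lip G i (M : R) x (a b : R) : {within A, continuous G} ->
  (forall x, A x -> pderivable A i G x) -> (forall x, A x -> `|pderiv A i G x| <= M) ->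
  A x -> a <= b -> `|a| <= ratr (tnth r i) -> `|b| <= ratr (tnth r i) ->
  `|G (setc x i b) - G (setc x i a)| <= M * (b - a).
Proof.
move=> /within_continuousP cG dG bM Ax ab ha hb.
have [e|ne] := eqVneq a b; first by rewrite e !subrr normr0 mulr0.
have lt : a < b by rewrite lt_neqAle ne.
have itv t : t \in `[a, b] -> `|t| <= ratr (tnth r i).
  rewrite in_itv /= => /andP[h1 h2]; move: ha hb; rewrite !ler_norml => /andP[a1 a2] /andP[b1 b2].
  by rewrite (le_trans a1 h1) (le_trans h2 b2).
have cA t : t \in `[a, b] -> A (setc x i t) by move=> /itv; exact: setc_cbox.
have [c||c cab e] := @MVT R (fun t => G (setc x i t)) (fun t => pderiv A i G (setc x i t)) a b lt.
- rewrite in_itv /= => /andP[h1 h2].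
  have cI : c \in `[a, b] by rewrite in_itv /= !ltW.
  have Ac := cA c cI; have ff := thick_cbox r0 i Ac.
  have dc : dquot i G (setc x i c) h @[h --> along A i (setc x i c)] -->
     pderiv A i G (setc x i c) by exact: dG.
  suff H : h^-1 *: (((fun t => G (setc x i t)) \o shift c) (h *: (1 : R)) - G (setc x i c))
      @[h --> 0^'] --> pderiv A i G (setc x i c).
    apply: DeriveDef; first by apply/cvg_ex; eexists; exact: H.
    by apply: cvg_lim => //; exact: H.
  apply/cvgrPdist_le => e e0.
  have /(@cvgrPdist_le _ _ _ (along A i (setc x i c)) _) /(_ e e0) dc' := dc.
  have {}dc' : (0^' : set_system R) [set h | A (setc x i c + h *: delta_mx 0 i) ->
     `|pderiv A i G (setc x i c) - dquot i G (setc x i c) h| <= e] by exact: dc'.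
  have nA : \forall h \near (0 : R)^', A (setc x i c + h *: delta_mx 0 i).
    exists (Num.min (c - a) (b - c)); first by rewrite /= lt_min !subr_gt0 h1 h2.
    move=> h /=; rewrite sub0r normrN lt_min => /andP[k1 k2] _.
    rewrite -setc_shift; apply: cA; rewrite in_itv /=.
    by move: k1 k2; rewrite !ltr_norml => /andP[? ?] /andP[? ?]; apply/andP; split; lra.
  near=> h.
  have Ah : A (setc x i c + h *: delta_mx 0 i) by near: h.
  have : `|pderiv A i G (setc x i c) - dquot i G (setc x i c) h| <= e.
    have : A (setc x i c + h *: delta_mx 0 i) ->
      `|pderiv A i G (setc x i c) - dquot i G (setc x i c) h| <= e by near: h.
    exact.
  rewrite /dquot /= /shift /= -setc_shift.
  by rewrite [h *: 1]mulr1 [h + c]addrC.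
- apply/within_continuousP => t; rewrite /= => tab e e0.
  have /nbhs_ballP [d /= d0 hd] := cG _ (cA t tab) e e0.
  exists d => //= u du uab; apply: hd; last exact: cA.
  split => // i0 j; rewrite !mxE; case: eqP => _ //.
  exact: ballxx.
rewrite e normrM (ger0_norm (_ : 0 <= b - a)) ?subr_ge0 // ler_wpM2r ?subr_ge0 //.
by apply: bM; apply: cA; move: cab; rewrite !in_itv /= => /andP[h1 h2]; rewrite !ltW.
Unshelve. all: by end_near. Qed.

(** The coordinates are exchanged one at a time; the intermediate points remain in the box because
    it is a product. *)
Lemma cbox_lip G : {within A, continuous G} ->
  (forall i x, A x -> pderivable A i G x) -> (forall i, {within A, continuous (pderiv A i G)}) ->
  exists2 C : R, 0 <= C & forall x y (d : R), A x -> A y ->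
    (forall i, `|x 0 i - y 0 i| <= d) -> `|G x - G y| <= C * d.
Proof.
move=> cG dG c1.
have /choice [M hM] : forall i, exists M : R, 0 <= M /\ forall x, A x -> `|pderiv A i G x| <= M.
  by move=> i; have [M M0 h] := cbox_bounded (c1 i); exists M.
exists (\sum_i M i) => [|x y d Ax Ay hd]; first by apply: sumr_ge0 => i _; have [] := hM i.
pose p (k : nat) : 'rV[R]_n := \row_j (if (j < k)%N then y 0 j else x 0 j).
have pA k : A (p k) by move=> j; rewrite mxE; case: ifP => _; [exact: Ay|exact: Ax].
have p0 : p 0%N = x by apply/rowP => j; rewrite mxE.
have pn : p n = y by apply/rowP => j; rewrite mxE ltn_ord.
have step (k : 'I_n) : `|G (p k) - G (p k.+1)| <= M k * d.
  have e1 : p k.+1 = setc (p k) k (y 0 k).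
    apply/rowP => j; rewrite !mxE ltnS leq_eqVlt; case: (eqVneq j k) => [->|jk].
      by rewrite eqxx.
    by rewrite (inj_eq val_inj) (negbTE jk).
  have e0 : p k = setc (p k) k (x 0 k).
    by apply/rowP => j; rewrite !mxE; case: (eqVneq j k) => [->|//]; rewrite ltnn.
  have [M0 bM] := hM k.
  rewrite {1}e0 e1; case: (leP (x 0 k) (y 0 k)) => [xy|/ltW xy].
    rewrite distrC; apply: (le_trans (coord_lip cG (dG k) bM (pA k) xy (Ax k) (Ay k))).
    rewrite ler_wpM2l // -(ger0_norm (_ : 0 <= y 0 k - x 0 k)) ?subr_ge0 //.
    by rewrite distrC.
  apply: (le_trans (coord_lip cG (dG k) bM (pA k) xy (Ay k) (Ax k))).
  by rewrite ler_wpM2l // -(ger0_norm (_ : 0 <= x 0 k - y 0 k)) ?subr_ge0.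
have tele m : (m <= n)%N -> `|G x - G (p m)| <= \sum_(i < n | (i < m)%N) M i * d.
  elim: m => [_|m IH mn]; first by rewrite p0 subrr normr0 big_pred0.
  rewrite (bigD1 (Ordinal mn)) //= addrC.
  have -> : G x - G (p m.+1) = (G x - G (p m)) + (G (p m) - G (p m.+1)) by ring.
  apply: (le_trans (ler_normD _ _)); apply: lerD; last exact: (step (Ordinal mn)).
  apply: (le_trans (IH (ltnW mn))); rewrite le_eqVlt; apply/orP; left; apply/eqP.
  by apply: eq_bigl => i; rewrite -val_eqE /= ltnS; case: ltngtP.
have := tele n (leqnn n); rewrite pn => /le_trans; apply.
by rewrite mulr_suml; under eq_bigl do rewrite ltn_ord.
Qed.

Lemma pderivs_lip f sq : smooth_on A f -> exists2 C : R, 0 <= C &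
  forall x y (d : R), A x -> A y -> (forall i, `|x 0 i - y 0 i| <= d) ->
    `|pderivs A sq f x - pderivs A sq f y| <= C * d.
Proof.
move=> sf; have [cG dG] := sf sq; apply: cbox_lip => // i.
by have [] := sf (i :: sq).
Qed.
End Lipschitz.

Lemma semidecidable (T : Type) (cT : coded T) (P : T -> bool) : cf P ->
  exists e, forall x, halts e (enc x) <-> P x.
Proof.
move=> HP; have [d Hd] : cf (fun x => nat_of_bool (~~ P x)).
  by apply: (@cf_enc _ _ _ coded_bool); apply: cf_neg.
exists (Mu (Comp d Fst)) => x.
have E j : evaluates (Comp d Fst) (cpair (enc x) j) (~~ P x).
  by apply: evaluates_Comp (Hd x); exact: evaluates_Fst.
split=> [[v H]|Px].
  apply/negPn/negP => h; have := E v; rewrite h /=.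
  inv_eval H; match goal with h' : evaluates _ (cpair (enc x) v) 0%N |- _ =>
    by move/(evaluates_fun h') end.
exists 0%N; apply: (@evaluates_Mu _ (enc x) 0 (fun => 0%N)) => //.
by have := E 0%N; rewrite Px.
Qed.

(** For the zero function a query compares the endpoints with 0. This stands in for the algorithm of
    S when the perturbation alone is approximated. *)
Lemma zero_decider (R : realType) Sg et Dom : exists e,
  queries_decide (R := R) Sg et (fun _ _ _ => 0) Dom (code_prog e).
Proof.
have [e He] := semidecidable
  (P := fun q : nat * (seq nat * (seq (rat * rat) * (nat * nat))) =>
     lo_ok q.2.2.2.1 0 && hi_ok q.2.2.2.2 0)
  (ltac:(have h1 := cf_lo_ok; have h2 := cf_hi_ok; apply: cf_and;
    [refine (cf_comp (f := fun q => (q.2.2.2.1, 0)) h1 _)|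
     refine (cf_comp (f := fun q => (q.2.2.2.2, 0)) h2 _)]; cfa)).
exists e => s al X uv _ _ sX oX _ uv12.
have key : halts e (enc (s, (al, (X, ((enc uv.1).+2, (enc uv.2).+2))))) <-> uv.1 < 0 < uv.2.
  rewrite He /lo_ok /hi_ok /= !subSS !subn0 /enc /coded_rat !frcK.
  by [].
rewrite /qhalt uv12 /=; split=> [[f hf] x Xx|H].
  have /key /andP[h1 h2] : halts e (enc (s, (al, (X, ((enc uv.1).+2, (enc uv.2).+2))))).
    by apply/halts_run; exists f.
  by rewrite ltrq0 ltr0q h1.
have /halts_run [f hf] : halts e (enc (s, (al, (X, ((enc uv.1).+2, (enc uv.2).+2))))).
  by apply/key; have := H _ (@inR_corner R _ oX); rewrite ltrq0 ltr0q.
by exists f.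
Qed.

Lemma itv_memE (R : realType) (I : \bar rat * \bar rat) (y : R) : (I.1 < I.2)%E ->
  itv_mem (code_erat I.1, code_erat I.2) y <-> open_itv I y.
Proof.
case: I => [[a||] [b||]] //= lt; rewrite /itv_mem /open_itv /= ?subSS ?subn0 ?frcK ?ltry ?ltNyr
  ?lte_fin; split=> // H; try (by case: H => [[] // [_ h1] [] // [_ h2]]).
all: try (by case: H => [[] // [_ ->]] [] // [_ ->]).
all: try (by case: H => _ [] // [_ ->]).
all: try (by case: H => [[] // [_ ->]] _).
all: try (by move: H => /andP[h1 h2]; split; right).
all: try (by split; [left|right]).
all: try (by split; [right|left]; move: H; rewrite ?andbT).
all: try (by split; left).
Qed.

Lemma box_itv_iff (R : realType) n (B : n.-tuple (rat * rat)) (I : \bar rat * \bar rat)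
  (F : (nat -> R) -> R) : (forall x y, (forall i, (i < n)%N -> x i = y i) -> F x = F y) ->
  (I.1 < I.2)%E ->
  (forall x, inR B x -> itv_mem (code_erat I.1, code_erat I.2) (F x)) <->
  (fun v : 'rV[R]_n => F (vf v)) @` compact_box B `<=` open_itv I.
Proof.
move=> eF lt; split=> [H _ [v vB <-]|H x xB].
  apply/itv_memE => //; apply: H => i; rewrite size_tuple => hi.
  by have := vB (Ordinal hi); rewrite !(tnth_nth (0, 0)) (vfE v (Ordinal hi)).
apply/itv_memE => //.
rewrite (eF x (vf (\row_(i < n) x i))) => [|i hi].
  apply: H; exists (\row_(i < n) x i) => // i; rewrite mxE !(tnth_nth (0, 0)).
  by apply: xB; rewrite size_tuple.
by rewrite (vfE _ (Ordinal hi)) mxE.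
Qed.

Lemma ordered_tuple n (B : n.-tuple (rat * rat)) : nonempty_box B -> ordered B.
Proof.
by move=> h; apply/allP => p /tnthP [i ->]; exact: h.
Qed.

Lemma row_vf (R : realType) n (v : 'rV[R]_n) : \row_(i < n) vf v i = v.
Proof. by apply/rowP => i; rewrite mxE vfE. Qed.

Section Realization.
Variables (R : realType) (C : func_system R).
Hypothesis CI : quasianalytic_IF_system C.
Variables (Sigma : pred nat) (eta : idx Sigma -> nat) (rho : forall s, (eta s).-tuple rat).
Hypothesis idxD : computable_index_data rho.
Hypothesis CA : forall n (r : n.-tuple rat), posq r -> @comp_analytic R n r `<=` @C n r.

(** The dependent index data become functions on nat by default values off [Sigma]; as [Sigma] is
    decidable, they are computable. *)
Definition et (x : nat) : nat := if insub x is Some s then eta s else 0%N.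
Definition rh (x : nat) : seq rat := if insub x is Some s then tval (rho s) else [::].

Lemma insub_idx (s : idx Sigma) : insub (val s) = Some s.
Proof. exact: valK. Qed.

Lemma etE s : et (val s) = eta s.
Proof. by rewrite /et insub_idx. Qed.

Lemma rhE s : rh (val s) = rho s.
Proof. by rewrite /rh insub_idx. Qed.

Lemma idxP x : Sigma x -> exists s : idx Sigma, val s = x.
Proof. by move=> h; exists (exist _ x h). Qed.

Lemma cf_Sigma : cf (Sigma : nat -> bool).
Proof. by have [[e he] _ _ _] := idxD; exists e. Qed.

Lemma cf_et : cf et.
Proof.
have [_ [e he] _ _] := idxD.
apply: cf_ext (cf_guard (f := et) (e := e) cf_Sigma _) => [x|x /idxP [s <-]].
  by rewrite /et; case: insubP => [s -> _|/negbTE ->].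
by rewrite etE.
Qed.

Lemma cf_rh : cf rh.
Proof.
have [_ _ [e he] _] := idxD.
have [d hd] : cf (fun x => if Sigma x then enc (rh x) else 0%N).
  apply: (cf_guard (e := e) cf_Sigma) => x /idxP [s <-].
  by rewrite rhE.
exists d => x; have := hd x.
by rewrite /rh; case: insubP => [s -> _|/negbTE ->].
Qed.

Lemma posq_rho s : posq (rho s).
Proof. by have [_ _ _ H] := idxD; exact: H. Qed.

Variables (S : fun_family R eta) (e pe : prog) (eps : tolerance eta).
Hypothesis SC : is_family C rho S.
Hypothesis Se : approx_algorithm rho S e.
Hypotheses (eps0 : tol_pos eps) (epe : tol_computed_by eps pe).

Definition tal s (al : seq nat) : (eta s).-tuple nat := [tuple nth 0%N al i | i < eta s].

Lemma talE s (al : seq nat) : size al = eta s -> tal s al = al :> seq nat.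
Proof.
move=> sal; apply: (@eq_from_nth _ 0%N); rewrite size_tuple // => i hi.
by rewrite -[i]/(val (Ordinal hi)) -tnth_nth tnth_mktuple.
Qed.

Lemma tal_tuple s (al : (eta s).-tuple nat) : tal s al = al.
Proof. by apply: val_inj; rewrite /= talE ?size_tuple. Qed.

Definition DS (s : nat) (al : seq nat) (x : nat -> R) : R :=
  if insub s is Some t then mpderiv (cbox (rho t)) (tal t al) (@S t) (\row_i x i) else 0.

Lemma DSE (s : idx Sigma) (al : (eta s).-tuple nat) x :
  DS (val s) al x = mpderiv (cbox (rho s)) al (@S s) (\row_i x i).
Proof. by rewrite /DS insub_idx tal_tuple. Qed.

Definition epss (s : nat) (al : seq nat) : rat :=
  if insub s is Some t then eps (tal t al) else 0.

Lemma dboxE s x : dbox et rh (val s) x <-> cbox (R := R) (rho s) (\row_i x i).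
Proof.
rewrite /dbox etE rhE; split=> [h i|h i hi]; first by rewrite mxE (tnth_nth 0); exact: h.
by have := h (Ordinal hi); rewrite mxE (tnth_nth 0).
Qed.

Lemma epss_ok s al : Sigma s -> size al = et s ->
  0 < epss s al /\ evaluates pe (cpair s (enc al)) (code_rat (epss s al)).
Proof.
move=> /idxP [t <-]; rewrite etE /epss insub_idx => sal; split; first exact: eps0.
by rewrite -{1}(talE sal); exact: epe.
Qed.

Lemma smoothS s : smooth_on (cbox (rho s)) (@S s).
Proof. exact: (ifs_smooth CI (@posq_rho s) (SC s)). Qed.

Lemma DS_lip : lipschitz_family Sigma et DS (dbox et rh).
Proof.
move=> s al /idxP [t <-]; rewrite etE => sal.
have [L L0 hL] := pderivs_lip (@posq_rho t)
  (flatten [seq nseq (tnth (tal t al) i) i | i <- enum 'I_(eta t)]) (@smoothS t).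
exists L => // x y d /dboxE dx /dboxE dy d0 hd; rewrite /DS insub_idx.
by apply: hL => // i; rewrite !mxE; exact: hd.
Qed.

Lemma tupleP n (T : Type) (X : seq T) : size X = n -> exists B : n.-tuple T, X = B.
Proof. by move=> <-; exists (in_tuple X). Qed.

Lemma DS_alg : queries_decide Sigma et DS (dbox et rh) (code_prog e).
Proof.
move=> s al X uv /idxP [t <-]; rewrite etE => /tupleP [{}al ->] /tupleP [{}X ->] oX dX uv12.
have nB : nonempty_box X by move=> i; apply: (allP oX); exact: mem_tnth.
have rB (v : 'rV[R]_(eta t)) : compact_box X v -> inR X (vf v).
  move=> vB i; rewrite size_tuple => hi.
  by have := vB (Ordinal hi); rewrite !(tnth_nth (0, 0)) (vfE v (Ordinal hi)).
have sub : compact_box X `<=` cbox (R := R) (rho t).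
  by move=> v /rB /dX /dboxE; rewrite row_vf.
pose I : \bar rat * \bar rat := ((uv.1)%:E, (uv.2)%:E)%E.
have I12 : (I.1 < I.2)%E by rewrite lte_fin.
rewrite /qhalt uv12 /=.
have := Se al nB sub I12; rewrite halts_run => -> {sub}; split.
  move=> H x Xx; rewrite DSE.
  have := H _ (ex_intro2 _ _ (\row_i x i) _ erefl).
  rewrite /open_itv /= !lte_fin; apply => i; rewrite mxE !(tnth_nth (0, 0)).
  by apply: Xx; rewrite size_tuple.
move=> H _ [v vB <-]; rewrite /open_itv /= !lte_fin.
by have := H _ (rB v vB); rewrite DSE row_vf.
Qed.

Let h := hd (R := R) Sigma et rh (code_prog e) pe.

Definition perturbed : fun_family R eta := fun s v => @S s v + hfun h (val s) v.

Lemma h_tail : tail_bound Sigma et rh (hs Sigma et rh (code_prog e) pe) h.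
Proof. exact: hd_tail DS_lip DS_alg epss_ok. Qed.

Lemma mpderiv_perturbed s (al : (eta s).-tuple nat) x : cbox (rho s) x ->
  mpderiv (cbox (rho s)) al (perturbed (s := s)) x = DS (val s) al (vf x) + h (val s) al (vf x).
Proof.
move=> Ax; have tA := thick_cbox (R := R) (@posq_rho s).
have sm := smooth_hfun h_tail (valP s) (etE s) tA.
rewrite {1}/mpderiv (pderivs_add _ tA (@smoothS s) sm Ax) DSE row_vf; congr (_ + _).
exact: (mpderiv_hfun h_tail (valP s) (etE s) al tA Ax).
Qed.

Lemma DS_ext s al x y : (forall i, (i < et s)%N -> x i = y i) -> DS s al x = DS s al y.
Proof.
rewrite /DS /et; case: insub => // t xy; congr (mpderiv _ _ _ _).
by apply/rowP => i; rewrite !mxE xy.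
Qed.

Lemma image_eq (T U : Type) (A : set T) (f g : T -> U) : (forall x, A x -> f x = g x) ->
  f @` A = g @` A.
Proof.
by move=> fg; apply/seteqP; split=> _ [x Ax <-]; exists x => //; rewrite fg.
Qed.

Variable TP : nat -> nat -> nat -> prog.
Hypothesis HTP : forall ca' ca cb, search_total Sigma et rh ca cb -> forall x : query,
    halts (TP ca' ca cb) (enc x) <->
    exists w : query_cert, query_ok et rh ca' x w (hseq Sigma et rh ca cb w.1).

(** [D] is arbitrary because the lemma is applied both to the derivatives of S and to the zero
    function, with the same history. *)
Lemma TP_query ca' D Dom s (al : (eta s).-tuple nat) (B : (eta s).-tuple (rat * rat))
    (I : \bar rat * \bar rat) :
  lipschitz_family (R := R) Sigma et D Dom -> queries_decide Sigma et D Dom ca' ->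
  (forall x y, (forall i, (i < eta s)%N -> x i = y i) -> D (val s) al x = D (val s) al y) ->
  nonempty_box B -> (forall x, inR B x -> Dom (val s) x) -> (I.1 < I.2)%E ->
  halts (TP ca' (code_prog e) (code_prog pe))
    (cpair (val s) (cpair (code_seq id al)
               (cpair (code_seq (code_pair code_rat code_rat) B)
                      (code_pair code_erat code_erat I)))) <->
  (fun v => D (val s) al (vf v) + h (val s) al (vf v)) @` compact_box B `<=` open_itv I.
Proof.
move=> Dlip Dalg Dext nB dB I12.
have T := stages_total DS_lip DS_alg epss_ok.
have := HTP ca' T (val s, (al : seq nat, (B : seq _, (code_erat I.1, code_erat I.2)))).
rewrite [enc _](_ : _ = cpair (val s) (cpair (code_seq id al)
               (cpair (code_seq (code_pair code_rat code_rat) B)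
                      (code_pair code_erat code_erat I)))) // => ->.
have := query_iff Dlip Dalg h_tail (s := val s) (al := al) (B := B) (code_erat I.1, code_erat I.2)
  (valP s).
rewrite etE !size_tuple => /(_ erefl erefl (ordered_tuple nB) dB) => H.
apply: (iff_trans H); apply: (@box_itv_iff R _ B I (fun x => D (val s) al x + h (val s) al x)) => // x y xy.
by rewrite (Dext x y xy) (hd_ext h_tail (valP s) (etE s) (size_tuple al) xy).
Qed.

(** The perturbation is entire, so the neighbourhood is the whole space. The index s, fixed here, is
    compiled into the query program as a constant. *)
Lemma h_comp_analytic s : comp_analytic (rho s) (hfun h (val s) (n := eta s)).
Proof.
have [a0 Ha0] := @zero_decider R Sigma et (fun _ _ => True).
exists setT, (hfun h (val s) (n := eta s)); split => //; first exact: openT.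
  exact: (analytic_hfun h_tail (valP s) (etE s)).
have tT := @thickT R (eta s).
split; first exact: (smooth_hfun h_tail (valP s) (etE s) tT).
exists (Comp (TP (code_prog a0) (code_prog e) (code_prog pe)) (Pair (Const (val s)) Id)).
move=> al B I nB I12.
set x := cpair (code_seq id al) _.
have -> : halts (Comp (TP (code_prog a0) (code_prog e) (code_prog pe)) (Pair (Const (val s)) Id)) x
    <-> halts (TP (code_prog a0) (code_prog e) (code_prog pe)) (cpair (val s) x).
  split=> [[v H]|[v H]]; last first.
    exists v; apply: evaluates_Comp H; apply: evaluates_Pair; last exact: evaluates_Id.
    exact: evaluates_Const.
  have E : evaluates (Pair (Const (val s)) Id) x (cpair (val s) x).
    by apply: evaluates_Pair; [exact: evaluates_Const|exact: evaluates_Id].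
  inversion H; subst; exists v; rewrite -(evaluates_fun H2 E); by [].
have L0 : lipschitz_family Sigma et (fun _ _ _ => 0 : R) (fun _ _ => True).
  by move=> s' al' _ _; exists 0 => // y z d _ _ _ _; rewrite subrr normr0 mul0r.
rewrite (@TP_query (code_prog a0) _ _ s al B I L0 Ha0 (fun _ _ _ => erefl) nB (fun _ _ => Logic.I) I12).
rewrite (image_eq (f := mpderiv _ _ _) (g := fun v => 0 + h (val s) al (vf v))).
  by split=> [|[]].
by move=> v _; rewrite add0r; exact: (mpderiv_hfun h_tail (valP s) (etE s) al tT).
Qed.

(** The ring structure is given through differences, so the sum is written S - ((S - S) - h). *)
Lemma perturbed_in s : @C (eta s) (rho s) (perturbed (s := s)).
Proof.
have r0 := @posq_rho s; have hC := CA r0 (@h_comp_analytic s).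
have z := ifs_sub CI r0 (SC s) (SC s).
have z' := ifs_sub CI r0 z hC.
apply: (ifs_restr CI r0 (ifs_sub CI r0 (SC s) z')) => x _.
by rewrite /perturbed; ring.
Qed.

Lemma perturbed_alg : approx_algorithm rho perturbed (TP (code_prog e) (code_prog e) (code_prog pe)).
Proof.
move=> s al B I nB sub I12.
have dB x : inR B x -> dbox (R := R) et rh (val s) x.
  move=> xB; apply/dboxE; apply: sub => i; rewrite mxE !(tnth_nth (0, 0)).
  by apply: xB; rewrite size_tuple.
have ext x y : (forall i, (i < eta s)%N -> x i = y i) -> DS (val s) al x = DS (val s) al y.
  by move=> xy; apply: DS_ext; rewrite etE.
rewrite (@TP_query (code_prog e) _ _ s al B I DS_lip DS_alg ext nB dB I12).
by rewrite (image_eq (g := mpderiv (cbox (rho s)) al (perturbed (s := s)))) // => v /sub vA;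
  rewrite mpderiv_perturbed.
Qed.

Lemma perturbed_close s (al : (eta s).-tuple nat) x : cbox (rho s) x ->
  `|mpderiv (cbox (rho s)) al (perturbed (s := s)) x - mpderiv (cbox (rho s)) al (@S s) x|
    < ratr (eps al).
Proof.
move=> Ax; rewrite mpderiv_perturbed // DSE row_vf addrAC subrr add0r.
have -> : eps al = epss (val s) al by rewrite /epss insub_idx tal_tuple.
apply: (hd_eps DS_lip DS_alg epss_ok (valP s)); first by rewrite etE size_tuple.
by apply/dboxE; rewrite row_vf.
Qed.

Lemma perturbed_ball : BallC C rho S eps perturbed.
Proof.
split; last exact: perturbed_close.
by split; [exact: perturbed_in|eexists; exact: perturbed_alg].
Qed.
End Realization.

(** * Derivations and algebraic dependence *)

Section MpolyClosure.
Variables (k : nat) (K : comNzRingType).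
Local Notation mp := (mpoly.mpoly k K).

(** Induction on the construction of a polynomial; it proves the identities below by comparing
    constants, variables, sums and products. *)
Lemma mpoly_closed (P : mp -> Prop) :
  (forall c, P (mpoly.mpolyC k c)) -> (forall i, P (mpoly.mpolyX K (mpoly.mnm1 i))) ->
  (forall p q, P p -> P q -> P (p + q)) -> (forall p q, P p -> P q -> P (p * q)) ->
  forall p, P p.
Proof.
move=> hC hX hD hM p; rewrite (mpoly.mpolyE p).
apply: (big_ind P) => [||m _]; [by have := hC 0; rewrite mpoly.mpolyC0|exact: hD|].
rewrite -mpoly.mul_mpolyC; apply: (hM _ _ (hC _)); rewrite mpoly.mpolyXE_id.
apply: (big_ind P) => [||i _]; [by have := hC 1; rewrite mpoly.mpolyC1|exact: hM|].
elim: (X in _ ^+ X) => [|e IH]; first by have := hC 1; rewrite mpoly.mpolyC1 expr0.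
by rewrite exprS; exact: hM.
Qed.
End MpolyClosure.

Section ExtendDerivation.
Variables (R : realType) (A : comNzRingType) (ev : {rmorphism A -> R}) (dl : A -> R).
Hypotheses (dlD : forall a b, dl (a + b) = dl a + dl b)
  (dlM : forall a b, dl (a * b) = ev a * dl b + ev b * dl a)
  (dl0 : forall a, ev a = 0 -> dl a = 0).
Variable y : R.
Implicit Types P Q : {poly A}.

Definition evy P : R := (map_poly ev P).[y].
(** The extension of the derivation [dl] to polynomials in one more variable that is evaluated at y,
    with v as the derivative of y. *)
Definition dly (v : R) P : R := (map_poly dl P).[y] + v * evy P^`().

Let d00 : dl 0 = 0.
Proof. by apply: (addIr (dl 0)); rewrite -dlD addr0 add0r. Qed.

Lemma map_dlD P Q : map_poly dl (P + Q) = map_poly dl P + map_poly dl Q.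
Proof. by apply/polyP => i; rewrite coefD !coef_map_id0 // coefD. Qed.

Lemma map_dlM P Q :
  map_poly dl (P * Q) = map_poly ev P * map_poly dl Q + map_poly ev Q * map_poly dl P.
Proof.
apply/polyP => i; rewrite coefD coef_map_id0 // coefM.
have dls (I : Type) (s : seq I) (F : I -> A) : dl (\sum_(j <- s) F j) = \sum_(j <- s) dl (F j).
  by elim: s => [|j s IH]; rewrite ?big_nil // !big_cons dlD IH.
rewrite dls (mulrC (map_poly ev Q)) !coefM -big_split /=; apply: eq_bigr => j _.
by rewrite !coef_map_id0 ?rmorph0 // dlM [ev Q`_ _ * _]mulrC.
Qed.

Lemma evyD P Q : evy (P + Q) = evy P + evy Q.
Proof. by rewrite /evy rmorphD hornerD. Qed.

Lemma evyM P Q : evy (P * Q) = evy P * evy Q.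
Proof. by rewrite /evy rmorphM hornerM. Qed.

Lemma dlyD v P Q : dly v (P + Q) = dly v P + dly v Q.
Proof. by rewrite /dly map_dlD hornerD derivD evyD; ring. Qed.

Lemma dlyM v P Q : dly v (P * Q) = evy P * dly v Q + evy Q * dly v P.
Proof. by rewrite /dly map_dlM hornerD !hornerM derivM evyD !evyM -!/(evy _); ring. Qed.

Lemma dly_vanish v P : map_poly ev P = 0 -> dly v P = 0.
Proof.
move=> P0.
have c0 i : ev P`_i = 0 by rewrite -coef_map P0 coef0.
rewrite /dly /evy -deriv_map P0 deriv0 horner0 mulr0 addr0.
have -> : map_poly dl P = 0 by apply/polyP => i; rewrite coef_map_id0 // coef0 dl0.
exact: horner0.
Qed.

(** Take Q of least size. Its leading coefficient survives [ev], as it could be dropped otherwise,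
    and its formal derivative is shorter, so it can vanish at y only if its coefficients do, which
    characteristic 0 forbids. *)
Lemma minimal_separable : (exists P, evy P = 0 /\ map_poly ev P != 0) ->
  exists Q, [/\ evy Q = 0, ev (lead_coef Q) != 0, evy Q^`() != 0 &
    forall P, (size P < size Q)%N -> evy P = 0 -> map_poly ev P = 0].
Proof.
move=> ex.
pose p k := `[< exists P, [/\ size P = k, evy P = 0 & map_poly ev P != 0] >].
have exk : exists k, p k by have [P [h1 h2]] := ex; exists (size P); apply/asboolP; exists P.
case: (ex_minnP exk) => k /asboolP [Q [sQ Q0 Qn]] km.
have min P : (size P < size Q)%N -> evy P = 0 -> map_poly ev P = 0.
  rewrite sQ => sP P0; apply/eqP/negPn/negP => Pn.
  suff /km : p (size P) by rewrite leqNgt sP.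
  by apply/asboolP; exists P.
have Q00 : Q != 0 by apply: contraNneq Qn => ->; rewrite rmorph0.
have lQ : ev (lead_coef Q) != 0.
  apply/negP => /eqP l0; pose Q' := Q - lead_coef Q *: 'X^((size Q).-1).
  have mE : map_poly ev Q' = map_poly ev Q.
    rewrite /Q' rmorphB /= -mul_polyC rmorphM /= map_polyC /= l0 polyC0 mul0r subr0 //.
  have sQ' : (size Q' < size Q)%N.
    rewrite -[X in (_ < X)%N]prednK ?size_poly_gt0 // ltnS; apply/leq_sizeP => j hj.
    rewrite coefB coefZ coefXn.
    have [->|ne] := eqVneq j (size Q).-1; first by rewrite mulr1 subrr.
    rewrite mulr0 subr0 nth_default // -[size Q]prednK ?size_poly_gt0 // ltn_neqAle hj andbT.
    by rewrite eq_sym.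
  by move: Qn; rewrite -mE min ?eqxx // /evy mE.
exists Q; split => //; apply/negP => /eqP d0.
have sQ1 : (1 < size Q)%N.
  rewrite ltnNge; apply/negP => /size1_polyC QC.
  move: Q0 Qn; rewrite QC /evy map_polyC /= hornerC => ->.
  by rewrite polyC0 eqxx.
have := min Q^`() (lt_size_deriv Q00) d0.
move/(congr1 (fun q : {poly R} => q`_(size Q).-2)).
rewrite coef_map coef_deriv coef0 -[(size Q).-2.+1]/((size Q).-2.+1).
have -> : ((size Q).-2.+1 = (size Q).-1)%N by case: (size Q) sQ1 => [|[]].
rewrite raddfMn /= -/(lead_coef Q) => /eqP; rewrite mulrn_eq0 (negbTE lQ) orbF.
by case: (size Q) sQ1 => [|[]].
Qed.

(** For y transcendental over the image every v will do. Otherwise v is forced by the minimal Q, and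
    pseudo-division by Q, whose leading coefficient is not killed, reduces any other relation to
    shorter ones. *)
Lemma extend_derivation : exists v, forall P, evy P = 0 -> dly v P = 0.
Proof.
case: (pselect (exists P, evy P = 0 /\ map_poly ev P != 0)) => [ex|nex]; last first.
  exists 0 => P P0; apply: dly_vanish; apply/eqP/negPn/negP => Pn; apply: nex; by exists P.
have [Q [Q0 lQ dQ min]] := minimal_separable ex.
exists (- (map_poly dl Q).[y] / evy Q^`()).
set v := _ / _ => P; have vQ : dly v Q = 0 by rewrite /dly /v divfK // addrN.
have Qn : Q != 0 by apply: contraNneq lQ => ->; rewrite lead_coef0 rmorph0.
have [k] := ubnP (size P); elim: k P => // k IH P; rewrite ltnS => sP P0.
have [sPQ|sPQ] := ltnP (size P) (size Q); first exact: dly_vanish (min _ sPQ P0).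
pose M : {poly A} := lead_coef P *: 'X^(size P - size Q).
pose P1 := (lead_coef Q)%:P * P + (- M) * Q.
have P10 : evy P1 = 0 by rewrite /P1 evyD !evyM P0 Q0 !mulr0 addr0.
have sPp : (0 < size P)%N by apply: leq_trans sPQ; rewrite size_poly_gt0.
have sP1 : (size P1 < k)%N.
  apply: leq_trans sP; rewrite -[X in (_ < X)%N]prednK // ltnS; apply/leq_sizeP => j hj.
  rewrite /P1 mulNr coefB coefCM /M -scalerAl coefZ coefXnM.
  rewrite ifN; last first.
    rewrite -leqNgt; apply: leq_trans hj; rewrite -ltnS prednK // ltn_subrL sPp andbT.
    by rewrite size_poly_gt0.
  have [->|ne] := eqVneq j (size P).-1.
    have -> : ((size P).-1 - (size P - size Q) = (size Q).-1)%N.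
      have : (0 < size Q)%N by rewrite size_poly_gt0.
      by move: sPQ sPp; clear; lia.
    by rewrite -!/(lead_coef _) mulrC subrr.
  have jP : (size P <= j)%N by rewrite -[size P]prednK // ltn_neqAle hj andbT eq_sym.
  have jQ : (size Q <= j - (size P - size Q))%N by move: sPQ jP; clear; lia.
  by rewrite [P`_j]nth_default // [Q`_ _]nth_default // !mulr0 subr0.
have := IH _ sP1 P10; rewrite /P1 dlyD !dlyM P0 Q0 vQ !(mul0r, mulr0, addr0).
rewrite {1}/evy map_polyC hornerC => /eqP; rewrite mulf_eq0 => /orP[/eqP l|/eqP //].
by move: lQ; rewrite l eqxx.
Qed.
End ExtendDerivation.

Section MuniLemmas.
Variables (k : nat) (K : comNzRingType).

Lemma muni_max : mpoly.muni (mpoly.mpolyX K (mpoly.mnm1 (@ord_max k))) = 'X.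
Proof.
rewrite mpoly.muniE mpoly.msuppX big_seq1 mpoly.mcoeffX eqxx scale1r mpoly.mnm1E eqxx expr1.
set mm := mpoly.Multinom _; have -> : mm = mpoly.mnm0 (n := k).
  2: by rewrite mpoly.mpolyX0 scale1r.
apply/mpoly.mnmP => i; rewrite mpoly.mnmE mpoly.mnm1E mpoly.mnmE -val_eqE /=.
by have := ltn_ord i; case: ltngtP.
Qed.

Lemma muni_widen (i : 'I_k) :
  mpoly.muni (mpoly.mpolyX K (mpoly.mnm1 (widen_ord (leqnSn k) i)))
  = (mpoly.mpolyX K (mpoly.mnm1 i))%:P.
Proof.
rewrite mpoly.muniE mpoly.msuppX big_seq1 mpoly.mcoeffX eqxx scale1r mpoly.mnm1E.
rewrite -val_eqE /= ltn_eqF // expr0 -mul_polyC mulr1; congr (mpoly.mpolyX K _)%:P.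
by apply/mpoly.mnmP => j; rewrite mpoly.mnmE !mpoly.mnm1E.
Qed.

Lemma muni_inj (p : mpoly.mpoly k.+1 K) : mpoly.muni p = 0 -> p = 0.
Proof.
pose g (P : {poly mpoly.mpoly k K}) : mpoly.mpoly k.+1 K :=
  (map_poly (@mpoly.mwiden k K) P).[mpoly.mpolyX K (mpoly.mnm1 (@ord_max k))].
have gK : forall q, g (mpoly.muni q) = q.
  apply: mpoly_closed => [c|i|q q' h h'|q q' h h'].
  - by rewrite mpoly.muniC /g map_polyC hornerC /= mpoly.mwidenC.
  - have [->|ik] := eqVneq i ord_max; first by rewrite muni_max /g map_polyX hornerX.
    have hi : (i < k)%N by rewrite ltn_neqAle -ltnS ltn_ord andbT; move: ik; rewrite -val_eqE.
    have -> : i = widen_ord (leqnSn k) (Ordinal hi) by exact: val_inj.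
    by rewrite muni_widen /g map_polyC hornerC /= mpoly.mwidenX mpoly.mnmwiden1.
  - by rewrite -{2}h -{2}h' mpoly.muniD /g rmorphD hornerD.
  - by rewrite -{2}h -{2}h' mpoly.muniM /g rmorphM hornerM.
by move=> p0; rewrite -(gK p) p0 /g rmorph0 horner0.
Qed.
End MuniLemmas.

Section Tangent.
Variable R : realType.
Local Notation mp k := (mpoly.mpoly k rat).
Local Notation mev x := (mpoly.mmap (@ratr R) x).

Definition dmev k (x v : 'I_k -> R) (p : mp k) : R :=
  \sum_(i < k) mev x (mpoly.mderiv i p) * v i.

Lemma mevD k (x : 'I_k -> R) p q : mev x (p + q) = mev x p + mev x q.
Proof. exact: (rmorphD (mev x)). Qed.

Lemma mevM k (x : 'I_k -> R) p q : mev x (p * q) = mev x p * mev x q.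
Proof. exact: (rmorphM (mev x)). Qed.

Lemma mevX k (x : 'I_k -> R) i : mev x (mpoly.mpolyX rat (mpoly.mnm1 i)) = x i.
Proof. by rewrite mpoly.mmapX mpoly.mmap1U. Qed.

Lemma dmevD k (x v : 'I_k -> R) p q : dmev x v (p + q) = dmev x v p + dmev x v q.
Proof.
by rewrite /dmev -big_split; apply: eq_bigr => i _; rewrite mpoly.mderivD rmorphD mulrDl.
Qed.

Lemma mevB k (x : 'I_k -> R) p q : mev x (p - q) = mev x p - mev x q.
Proof. exact: (rmorphB (mev x)). Qed.

Lemma dmevB k (x v : 'I_k -> R) p q : dmev x v (p - q) = dmev x v p - dmev x v q.
Proof.
by rewrite /dmev -sumrB; apply: eq_bigr => i _; rewrite mpoly.mderivB mevB mulrBl.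
Qed.

Lemma dmevM k (x v : 'I_k -> R) p q :
  dmev x v (p * q) = mev x p * dmev x v q + mev x q * dmev x v p.
Proof.
rewrite /dmev !mulr_sumr -big_split; apply: eq_bigr => i _.
by rewrite mpoly.mderivM mevD !mevM mulrDl addrC !mulrA; congr (_ + _ * _); exact: mulrC.
Qed.

Lemma dmevC k (x v : 'I_k -> R) c : dmev x v (mpoly.mpolyC k c) = 0.
Proof. by rewrite /dmev big1 // => i _; rewrite mpoly.mderivC rmorph0 mul0r. Qed.

Lemma dmevX k (x v : 'I_k -> R) i : dmev x v (mpoly.mpolyX rat (mpoly.mnm1 i)) = v i.
Proof.
rewrite /dmev (bigD1 i) //= big1 => [|j ji].
  rewrite mpoly.mderivX mpoly.mnm1E eqxx scale1r addr0.
  have -> : mpoly.mnm_sub (mpoly.mnm1 i) (mpoly.mnm1 i) = mpoly.mnm0 (n := k).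
    by apply/mpoly.mnmP => j; rewrite mpoly.mnmBE subnn mpoly.mnm0E.
  by rewrite mpoly.mpolyX0 rmorph1 mul1r.
by rewrite mpoly.mderivX mpoly.mnm1E eq_sym (negbTE ji) scale0r rmorph0 mul0r.
Qed.

Lemma widen_or_max k (i : 'I_k.+1) :
  i = ord_max \/ exists j : 'I_k, i = widen_ord (leqnSn k) j.
Proof.
have [->|ik] := eqVneq i ord_max; [by left|right].
have hi : (i < k)%N by rewrite ltn_neqAle -ltnS ltn_ord andbT; move: ik; rewrite -val_eqE.
by exists (Ordinal hi); exact: val_inj.
Qed.

Lemma mev_muni k (x : nat -> R) (p : mp k.+1) :
  mev (fun i : 'I_k.+1 => x i) p = evy (mev (fun i : 'I_k => x i)) (x k) (mpoly.muni p).
Proof.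
move: p; apply: mpoly_closed => [c|i|p q hp hq|p q hp hq].
- by rewrite mpoly.mmapC mpoly.muniC /evy map_polyC hornerC /= mpoly.mmapC.
- rewrite mevX; have [->|[j ->]] := widen_or_max i.
    by rewrite muni_max /evy map_polyX hornerX.
  by rewrite muni_widen /evy map_polyC hornerC /= mevX.
- by rewrite mevD mpoly.muniD evyD hp hq.
- by rewrite mevM mpoly.muniM evyM hp hq.
Qed.

Lemma dmev_muni k (x v : nat -> R) (p : mp k.+1) :
  dmev (fun i : 'I_k.+1 => x i) (fun i => v i) p =
  dly (mev (fun i : 'I_k => x i)) (dmev (fun i : 'I_k => x i) (fun i => v i)) (x k) (v k)
    (mpoly.muni p).
Proof.
set ev := mev (fun i : 'I_k => x i); set dl := dmev (fun i : 'I_k => x i) _.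
have d0 : dl 0 = 0 by rewrite -(mpoly.mpolyC0 k rat) /dl dmevC.
have dD := @dmevD k (fun i : 'I_k => x i) (fun i => v i).
have dM := @dmevM k (fun i : 'I_k => x i) (fun i => v i).
move: p; apply: mpoly_closed => [c|i|p q hp hq|p q hp hq].
- rewrite dmevC mpoly.muniC /dly derivC /evy rmorph0 horner0 mulr0 addr0.
  have -> : map_poly dl (mpoly.mpolyC k c)%:P = 0.
    apply/polyP => i; rewrite coef_map_id0 // coefC coef0; case: eqP => // _.
    by rewrite /dl dmevC.
  by rewrite horner0.
- rewrite dmevX; have [->|[j ->]] := widen_or_max i.
    rewrite muni_max /dly derivX /evy rmorph1 hornerC mulr1.
    have -> : map_poly dl 'X = 0.
      apply/polyP => l; rewrite coef_map_id0 // coefX coef0; case: eqP => //= _.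
      by rewrite -(mpoly.mpolyC1 k rat) /dl dmevC.
    by rewrite horner0 add0r.
  rewrite muni_widen /dly derivC /evy rmorph0 horner0 mulr0 addr0.
  have -> : map_poly dl (mpoly.mpolyX rat (mpoly.mnm1 j))%:P = (v j)%:P.
    apply/polyP => l; rewrite coef_map_id0 // !coefC; case: eqP => // _.
    by rewrite /dl dmevX.
  by rewrite hornerC.
- by rewrite dmevD mpoly.muniD dlyD // hp hq.
- by rewrite dmevM mpoly.muniM dlyM // hp hq !mev_muni.
Qed.

(** Vectors annihilated by the differentials of all rational relations of x are derivations of the
    field that x generates. On independent coordinates they may be prescribed; each further
    coordinate is one application of [extend_derivation]. *)
Lemma tangent_prefix (x w : nat -> R) r k : (r <= k)%N ->
  (forall p : mp r, mev (fun i : 'I_r => x i) p = 0 -> p = 0) ->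
  exists v : nat -> R, (forall i, (i < r)%N -> v i = w i) /\
    forall p : mp k, mev (fun i : 'I_k => x i) p = 0 ->
      dmev (fun i : 'I_k => x i) (fun i => v i) p = 0.
Proof.
move=> rk ind; elim: k rk => [|k IH].
  rewrite leqn0 => /eqP r0; exists w; split=> // p p0.
  by rewrite /dmev big_ord0.
rewrite leq_eqVlt => /predU1P [e|rk].
  by subst r; exists w; split=> // p /ind ->; rewrite -(mpoly.mpolyC0 _ rat) dmevC.
have [v [vw hv]] := IH rk.
have [vk hk] := extend_derivation (dmevD (fun i : 'I_k => x i) (fun i => v i))
  (dmevM (fun i : 'I_k => x i) (fun i => v i)) hv (x k).
pose v' i := if i == k then vk else v i.
have v'k : v' k = vk by rewrite /v' eqxx.
exists v'; split=> [i ir|p p0].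
  by rewrite /v' ltn_eqF ?vw // (leq_trans ir).
rewrite dmev_muni v'k.
have -> : dmev (fun i : 'I_k => x i) (fun i => v' i) = dmev (fun i : 'I_k => x i) (fun i => v i).
  by apply/funext => q; apply: eq_bigr => i _; rewrite /v' ltn_eqF.
by apply: hk; rewrite -mev_muni.
Qed.

Definition rename k l (f : 'I_k -> 'I_l) (p : mp k) : mp l :=
  mpoly.mmap (@mpoly.mpolyC l rat) (fun i => mpoly.mpolyX rat (mpoly.mnm1 (f i))) p.

Lemma renameD k l (f : 'I_k -> 'I_l) p q : rename f (p + q) = rename f p + rename f q.
Proof. exact: (rmorphD (mpoly.mmap (@mpoly.mpolyC l rat) _)). Qed.

Lemma renameM k l (f : 'I_k -> 'I_l) p q : rename f (p * q) = rename f p * rename f q.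
Proof. exact: (rmorphM (mpoly.mmap (@mpoly.mpolyC l rat) _)). Qed.

Lemma mev_rename k l (f : 'I_k -> 'I_l) (x : 'I_l -> R) p :
  mev x (rename f p) = mev (fun i => x (f i)) p.
Proof.
move: p; apply: mpoly_closed => [c|i|p q hp hq|p q hp hq].
- by rewrite /rename !mpoly.mmapC.
- by rewrite /rename !mevX mpoly.mmapX mpoly.mmap1U mevX.
- by rewrite renameD !mevD hp hq.
- by rewrite renameM !mevM hp hq.
Qed.

Lemma dmev_rename k l (f : 'I_k -> 'I_l) (x v : 'I_l -> R) p :
  dmev x v (rename f p) = dmev (fun i => x (f i)) (fun i => v (f i)) p.
Proof.
move: p; apply: mpoly_closed => [c|i|p q hp hq|p q hp hq].
- by rewrite /rename mpoly.mmapC !dmevC.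
- by rewrite /rename dmevX mpoly.mmapX mpoly.mmap1U dmevX.
- by rewrite renameD !dmevD hp hq.
- by rewrite renameM !dmevM hp hq !mev_rename.
Qed.

(* The coordinates are duplicated, as (b o f, b), so that the independent ones
   come first; the duplicates are tied by the vanishing of X_(r + f i) - X_i. *)
Lemma tangent_vectors M r (b : 'I_M -> R) (f : 'I_r -> 'I_M) (w : 'I_r -> R) :
  (forall p : mp r, mev (fun i => b (f i)) p = 0 -> p = 0) ->
  exists v : 'I_M -> R, (forall i, v (f i) = w i) /\
    forall p : mp M, mev b p = 0 -> dmev b v p = 0.
Proof.
move=> ind.
pose xx (i : 'I_(r + M)) := match fintype.split i with inl j => b (f j) | inr j => b j end.
pose ext (y : 'I_(r + M) -> R) (i : nat) := if insub i is Some j then y j else 0.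
have extE y (i : 'I_(r + M)) : ext y i = y i by rewrite /ext valK.
have xl j : xx (lshift M j) = b (f j) by rewrite /xx (unsplitK (inl j)).
have xr j : xx (rshift r j) = b j by rewrite /xx (unsplitK (inr j)).
pose ww i := if insub i is Some j then w j else 0.
have [p|v [vw hv]] := @tangent_prefix (ext xx) ww r (r + M) (leq_addr _ _).
  rewrite (_ : (fun i : 'I_r => ext xx i) = (fun i => b (f i))); first exact: ind.
  by apply/funext => i; rewrite -(xl i) -extE.
have xE : (fun i : 'I_(r + M) => ext xx i) = xx by apply/funext => i; rewrite extE.
rewrite xE in hv.
exists (fun j => v (rshift r j)); split=> [i|p p0].
  have := vw i (ltn_ord i); rewrite /ww valK => <-.
  pose q : mp (r + M) := mpoly.mpolyX rat (mpoly.mnm1 (rshift r (f i)))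
    - mpoly.mpolyX rat (mpoly.mnm1 (lshift M i)).
  have : mev xx q = 0 by rewrite mevB !mevX xl xr subrr.
  by move/hv; rewrite /q dmevB !dmevX => /eqP; rewrite subr_eq0 => /eqP.
have := hv (rename (@rshift r M) p); rewrite mev_rename dmev_rename.
by rewrite (_ : (fun i => xx (rshift r i)) = b); [apply|apply/funext => i; rewrite xr].
Qed.
End Tangent.

(** * Genericity *)

Section ChainRule.
Variables (R : realType) (m : nat) (D : set 'rV[R]_m) (l : 'I_m) (a : 'rV[R]_m).
Hypothesis Da : ProperFilter (along D l a).

Lemma along_nonzero : \forall h \near along D l a, h != 0.
Proof.
suff : (0^' : set_system R) [set h | D (a + h *: delta_mx 0 l) -> h != 0] by exact.
by exists 1 => //= h _ h0 _.
Qed.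

Lemma along_small : (h : R) @[h --> along D l a] --> (0 : R).
Proof.
apply/(@cvgrPdist_le _ _ _ (along D l a) _) => e e0.
suff : (0^' : set_system R) [set h | D (a + h *: delta_mx 0 l) -> `|0 - h| <= e] by exact.
exists e => //= h he _ _; exact: ltW.
Qed.

Lemma dquot_continuous (F : 'rV[R]_m -> R) (y : R) :
  dquot l F a h @[h --> along D l a] --> y ->
  F (a + h *: delta_mx 0 l) @[h --> along D l a] --> F a.
Proof.
move=> dF.
have c : (F a + h * dquot l F a h) @[h --> along D l a] --> F a + 0 * y.
  by apply: cvgD; [exact: cvg_cst|apply: cvgM => //; exact: along_small].
rewrite mul0r addr0 in c; apply: cvg_trans c; apply: near_eq_cvg.
near=> h; have h0 : h != 0 by near: h; exact: along_nonzero.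
by rewrite /dquot mulrA mulfV // mul1r addrC subrK.
Unshelve. all: by end_near. Qed.

(** Induction on p. The product rule needs one factor to be continuous along D at [a], which its
    difference quotients provide ([dquot_continuous]). *)
Lemma chain_rule k (F : 'I_k -> 'rV[R]_m -> R) (y : 'I_k -> R) (p : mpoly.mpoly k rat) :
  (forall i, dquot l (F i) a h @[h --> along D l a] --> y i) ->
  dquot l (fun x => mpoly.mmap ratr (fun i => F i x) p) a h @[h --> along D l a]
    --> dmev (fun i => F i a) y p.
Proof.
move=> dF; move: p; apply: mpoly_closed => [c|i|p q hp hq|p q hp hq].
- rewrite dmevC (_ : dquot _ _ _ = fun _ => 0); first exact: cvg_cst.
  by apply/funext => h; rewrite /dquot !mpoly.mmapC subrr mulr0.
- rewrite dmevX (_ : (fun x => _) = F i); first exact: dF.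
  by apply/funext => x; rewrite mevX.
- rewrite dmevD (_ : dquot _ _ _ = (fun h =>
    dquot l (fun x => mpoly.mmap ratr (fun i => F i x) p) a h +
    dquot l (fun x => mpoly.mmap ratr (fun i => F i x) q) a h)); first exact: cvgD.
  by apply/funext => h; rewrite /dquot !mevD; ring.
rewrite dmevM (_ : dquot _ _ _ = (fun h =>
    mpoly.mmap ratr (fun i => F i a) p * dquot l (fun x => mpoly.mmap ratr (fun i => F i x) q) a h
    + mpoly.mmap ratr (fun i => F i (a + h *: delta_mx 0 l)) q *
       dquot l (fun x => mpoly.mmap ratr (fun i => F i x) p) a h)); last first.
  by apply/funext => h; rewrite /dquot !mevM; ring.
apply: cvgD; first by apply: cvgM => //; exact: cvg_cst.
apply: cvgM => //.
exact: (@dquot_continuous (fun x => mpoly.mmap ratr (fun i => F i x) q) _ hq).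
Qed.
End ChainRule.

Lemma open_itv_near (R : realType) (I : \bar rat * \bar rat) (t : R) : open_itv I t ->
  exists2 e, 0 < e & forall h, `|h| < e -> open_itv I (t + h).
Proof.
case: I => [u v]; rewrite /open_itv /= => /andP[h1 h2].
have [e1 e10 H1] : exists2 e, 0 < e & forall h, `|h| < e -> (er_map ratr u < (t + h)%:E)%E.
  case: u h1 => [q||] //=; rewrite ?lte_fin => h1; last first.
    by exists 1 => // h _; rewrite ltNyr.
  exists (t - ratr q); rewrite ?subr_gt0 // => h; rewrite lte_fin ltr_norml => /andP[a _].
  by move: a; clear; lra.
have [e2 e20 H2] : exists2 e, 0 < e & forall h, `|h| < e -> ((t + h)%:E < er_map ratr v)%E.
  case: v h2 => [q||] //=; rewrite ?lte_fin => h2; first last.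
    by exists 1 => // h _; rewrite ltry.
  exists (ratr q - t); rewrite ?subr_gt0 // => h; rewrite lte_fin ltr_norml => /andP[_ a].
  by move: a; clear; lra.
exists (Num.min e1 e2); rewrite ?lt_min ?e10 // => h; rewrite lt_min => /andP[a b].
by rewrite H1 ?H2.
Qed.

(** * Upper bound for the transcendence degree at a nonsingular zero *)

Section UpperBound.
Variables (R : realType) (Sigma : pred nat) (eta : idx Sigma -> nat).
Variables (rho : forall s : idx Sigma, (eta s).-tuple rat) (T : fun_family R eta).
Arguments T : clear implicits.
Hypothesis smT : forall s, smooth_on (cbox (rho s)) (T s).
Variables (m n : nat) (N : raw_name eta m n) (a : 'rV[R]_m).
Hypothesis isN : is_name R rho N.
Let D := bm_set (R := R) (nm_mfd N).
Let E := bm_free (nm_mfd N).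
Let sg i := nm_sigma N i.
Let b : 'I_(m + n) -> R := fun i => nameF rho T N a 0 i.
Let Gf i : 'rV[R]_(eta (sg i)) -> R := mpderiv (cbox (rho (sg i))) (nm_alpha N i) (T (sg i)).

Lemma name_box x : D x -> forall i, cbox (rho (sg i)) (name_proj N i x).
Proof.
have [_ _ _ [B [B1 _ [Q [J [hJ QE]] [W _ DE]]]]] := isN; rewrite {}QE in DE.
rewrite /D DE => -[Jx _] i k; rewrite mxE.
have JB l t : J l t -> t \in B l.
  case: (hJ l) => [[_ ->]|[e [eB _ ->]]]; last by move=> ->.
  by move=> /interior_subset.
by have := JB _ _ (Jx (nm_xi N i k)); rewrite B1 in_itv /= ler_norml.
Qed.

Lemma xi_inj i : injective (nm_xi N i).
Proof.
have [mono _ _ _] := isN => k k' e; apply: val_inj => /=.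
by case: (ltngtP (k : nat) (k' : nat)) => // /mono; rewrite e ltnn.
Qed.

Lemma bm_thick l : D a -> l \in E -> ProperFilter (along D l a).
Proof.
move=> aD lE.
have := aD l; rewrite -/E lE => /open_itv_near [e e0 he].
apply: Build_ProperFilter_ex => P [e' /= e'0 he'].
pose t := Num.min e e' / 2.
have m0 : 0 < Num.min e e' by rewrite lt_min e0.
have t0 : 0 < t by rewrite divr_gt0.
have tm : `|t| < Num.min e e' by rewrite gtr0_norm // /t; lra.
exists t; apply: he'.
- by rewrite /= sub0r normrN (lt_le_trans tm) // ge_min lexx orbT.
- by rewrite gt_eqF.
move=> j; have := aD j; rewrite -/E !mxE eqxx /=.
have [->|jl] := eqVneq j l; last by rewrite mulr0 addr0.
by rewrite lE mulr1 => _; apply: he; rewrite (lt_le_trans tm) // ge_min lexx.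
Qed.

(** The derivative of F at [a] in the direction l. A variable occurs at most once in a projection
    since [nm_xi N i] is injective, so at most one [kk] can be picked. *)
Definition ydir (l : 'I_m) (k : 'I_(m + n)) : R :=
  match fintype.split k with
  | inl l' => (l' == l)%:R
  | inr i => if [pick kk | nm_xi N i kk == l] is Some kk
             then pderiv (cbox (rho (sg i))) kk (Gf (i := i)) (name_proj N i a) else 0
  end.

(** T is differentiated along its closed box and F along D. As D projects into that box, a quotient
    along D is one along the box, also when D lies in a face. *)
Lemma ydirP l k : D a -> l \in E ->
  dquot l (fun x => nameF rho T N x 0 k) a h @[h --> along D l a] --> ydir l k.
Proof.
move=> aD lE; have pf := bm_thick aD lE.
rewrite /ydir /nameF; case: (splitP k) => [l' e|i e].
  have -> : k = lshift n l' by exact: val_inj.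
  apply: (@cvg_trans _ ((fun _ : R => (l' == l)%:R : R) @ along D l a)); last exact: cvg_cst.
  apply: near_eq_cvg; near=> h.
  have h0 : h != 0 by near: h; exact: along_nonzero.
  rewrite /dquot !row_mxEl !mxE eqxx /= addrAC subrr add0r mulrA mulVf // mul1r.
  by rewrite eq_sym.
have -> : k = rshift m i by exact: val_inj.
case: pickP => [kk /eqP kl|none]; last first.
  rewrite (_ : dquot _ _ _ = fun _ => 0); first exact: cvg_cst.
  apply/funext => h; rewrite /dquot !row_mxEr !mxE.
  suff -> : name_proj N i (a + h *: delta_mx 0 l) = name_proj N i a by rewrite subrr mulr0.
  by apply/rowP => kk; rewrite !mxE eqxx none mulr0 addr0.
have pE h : name_proj N i (a + h *: delta_mx 0 l) = name_proj N i a + h *: delta_mx 0 kk.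
  by apply/rowP => j; rewrite !mxE eqxx -kl (inj_eq (@xi_inj i)).
have pa : cbox (rho (sg i)) (name_proj N i a) by exact: name_box.
have [_ dG] := smT (s := sg i) (flatten [seq nseq (tnth (nm_alpha N i) j) j | j <- enum 'I_(eta (sg i))]).
have c : dquot kk (Gf (i := i)) (name_proj N i a) h
   @[h --> along (cbox (rho (sg i))) kk (name_proj N i a)] -->
   pderiv (cbox (rho (sg i))) kk (Gf (i := i)) (name_proj N i a) by exact: dG.
apply/(@cvgrPdist_le _ _ _ (along D l a) _) => e0 e00.
have {}c : (0^' : set_system R) [set h | cbox (rho (sg i)) (name_proj N i a + h *: delta_mx 0 kk) ->
   `|pderiv (cbox (rho (sg i))) kk (Gf (i := i)) (name_proj N i a)
     - dquot kk (Gf (i := i)) (name_proj N i a) h| <= e0].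
  by have /(@cvgrPdist_le _ _ _ (along _ kk _) _) /(_ e0 e00) := c.
suff : (0^' : set_system R) [set h | D (a + h *: delta_mx 0 l) ->
   `|pderiv (cbox (rho (sg i))) kk (Gf (i := i)) (name_proj N i a)
     - dquot l (fun x => row_mx x (\row_i0 mpderiv (cbox (rho (nm_sigma N i0))) (nm_alpha N i0)
         (T (nm_sigma N i0)) (name_proj N i0 x)) 0 (rshift m i)) a h| <= e0] by exact.
apply: filterS c => h /= H Dh.
have pD : cbox (rho (sg i)) (name_proj N i (a + h *: delta_mx 0 l)) by exact: name_box.
have := H; rewrite -pE => /(_ pD).
by rewrite /dquot !row_mxEr !mxE -pE.
Unshelve. all: by end_near. Qed.

Lemma pderiv_nameP (j : 'I_(bm_dim (nm_mfd N))) l : D a -> l \in E ->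
  pderiv D l (fun x => nameP rho T N x 0 j) a = dmev b (ydir l) (nm_poly N j).
Proof.
move=> aD lE; have pf := bm_thick aD lE.
have c : dquot l (fun x => mpoly.mmap ratr (fun i => nameF rho T N x 0 i) (nm_poly N j)) a h
    @[h --> along D l a] --> dmev b (ydir l) (nm_poly N j).
  by apply: (chain_rule (F := fun k x => nameF rho T N x 0 k)) => k; exact: ydirP.
apply: cvg_lim => //; rewrite (_ : (fun x => nameP rho T N x 0 j) =
  (fun x => mpoly.mmap ratr (fun i => nameF rho T N x 0 i) (nm_poly N j))) //.
by apply/funext => x; rewrite mxE.
Qed.

Lemma nonsingular_bound r (f : 'I_r -> 'I_(m + n)) : nonsingular_zero rho T N a ->
  (forall p : mpoly.mpoly r rat, mpoly.mmap (@ratr R) (fun i => b (f i)) p = 0 -> p = 0) ->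
  (r <= n)%N.
Proof.
move=> [aD aP aJ] ind.
have /choice [v hv] : forall i : 'I_r, exists v : 'I_(m + n) -> R,
    (forall j, v (f j) = (i == j)%:R) /\
    forall p : mpoly.mpoly (m + n) rat, mpoly.mmap (@ratr R) b p = 0 -> dmev b v p = 0.
  by move=> i; exact: tangent_vectors.
have pj j : mpoly.mmap (@ratr R) b (nm_poly N j) = 0.
  by have /rowP /(_ j) := aP; rewrite !mxE.
pose d := bm_dim (nm_mfd N).
pose ej (j : 'I_d) : 'I_m := enum_val j.
have ejE j : ej j \in E by exact: enum_valP.
have ej_inj : injective ej by exact: enum_val_inj.
(* Row l is the differential of the component of p attached to l if l is free, and of the equation
   fixing x_l otherwise. *)
pose G := \matrix_(l < m, k < m + n) (if [pick j | ej j == l] is Some j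
   then mpoly.mmap (@ratr R) b (mpoly.mderiv k (nm_poly N j)) else (k == lshift n l)%:R).
pose X := \matrix_(i < r, k < m + n) v i k.
pose Y := \matrix_(k < m + n, l < m) ydir l k.
pose S := \matrix_(k < m + n, j < r) ((k == f j)%:R : R).
have pick_ej j : [pick j' | ej j' == ej j] = Some j.
  by case: pickP => [j' /eqP /ej_inj ->|/(_ j)]; rewrite ?eqxx.
have pick_no l : l \notin E -> [pick j | ej j == l] = None.
  by move=> lE; case: pickP => // j /eqP e; move: lE; rewrite -e ejE.
have XG : X *m G^T = 0.
  apply/matrixP => i l; rewrite !mxE.
  case: (boolP (l \in E)) => lE.
    have [j <-] : exists j, ej j = l by exists (enum_rank_in lE l); exact: enum_rankK_in.
    transitivity (dmev b (v i) (nm_poly N j)); last by have [_ h] := hv i; exact: h.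
    by apply: eq_bigr => k _; rewrite !mxE pick_ej mulrC.
  have [_ h] := hv i.
  pose q : mpoly.mpoly (m + n) rat := mpoly.mpolyX rat (mpoly.mnm1 (lshift n l))
    - mpoly.mpolyC _ (bm_pt (nm_mfd N) l).
  have q0 : mpoly.mmap (@ratr R) b q = 0.
    rewrite mevB mevX mpoly.mmapC /b /nameF row_mxEl.
    by have := aD l; rewrite -/E (negbTE lE) => ->; rewrite subrr.
  have := h q q0; rewrite /q dmevB dmevX dmevC subr0 => vl.
  rewrite (bigD1 (lshift n l)) //= big1 => [|k kl]; rewrite !mxE pick_no //.
    by rewrite vl mul0r addr0.
  by rewrite (negbTE kl) mulr0.
have rX : (r <= \rank X)%N.
  have XS : X *m S = 1%:M.
    apply/matrixP => i j; rewrite !mxE (bigD1 (f j)) //= big1 => [|k kf]; rewrite !mxE.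
      by rewrite eqxx mulr1 addr0; have [-> _] := hv i.
    by rewrite (negbTE kf) mulr0.
  by rewrite -{1}(mxrank1 R r) -XS mxrankM_maxl.
have yl l l' : ydir l' (lshift n l) = (l == l')%:R by rewrite /ydir (unsplitK (inl l)).
have GYE j l : (G *m Y) (ej j) l = dmev b (ydir l) (nm_poly N j).
  by rewrite mxE; apply: eq_bigr => k _; rewrite !mxE pick_ej.
have GYN l' l : l' \notin E -> (G *m Y) l' l = (l' == l)%:R.
  move=> lE; rewrite mxE (bigD1 (lshift n l')) //= big1 => [|k kl]; rewrite !mxE pick_no //.
    by rewrite eqxx mul1r addr0 yl.
  by rewrite (negbTE kl) mul0r.
(* In G Y the rows of fixed coordinates are unit vectors and the block of free ones is the Jacobian
   of P; a vector in the left kernel vanishes first on the free part and then altogether. *)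
have rG : (m <= \rank G)%N.
  suff rf : row_free (G *m Y) by have := mxrankM_maxl G Y; rewrite (eqP rf).
  apply: inj_row_free => w w0.
  have col l : \sum_l' w 0 l' * (G *m Y) l' l = 0 by have /rowP /(_ l) := w0; rewrite mxE mxE.
  have wE : \row_j w 0 (ej j) = 0.
    set J := (X in \det X) in aJ.
    have JU : J \in unitmx by rewrite unitmxE unitfE.
    rewrite -[LHS](mulmxK JU); suff -> : (\row_j w 0 (ej j)) *m J = 0 by rewrite mul0mx.
    apply/rowP => j; rewrite !mxE; have := col (ej j).
    rewrite (bigID (mem E)) /= [X in _ + X]big1 ?addr0 => [c|l' lE]; last first.
      rewrite GYN //; case: eqP => [e|_]; rewrite ?mulr0 //.
      by move: lE; rewrite e ejE.
    etransitivity; last exact: c.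
    rewrite (big_enum_val (fun l => w 0 l * (G *m Y) l (ej j))) /=.
    apply: eq_bigr => i _; rewrite mxE -[enum_val i]/(ej i) GYE; congr (_ * _).
    by rewrite mxE -pderiv_nameP // ejE.
  apply/rowP => l; rewrite mxE; case: (boolP (l \in E)) => lE.
    have [j <-] : exists j, ej j = l by exists (enum_rank_in lE l); exact: enum_rankK_in.
    by have /rowP /(_ j) := wE; rewrite !mxE.
  have := col l; rewrite (bigD1 l) //= big1 ?addr0 => [|l' ll]; first by rewrite GYN // eqxx mulr1.
  case: (boolP (l' \in E)) => l'E; last by rewrite GYN // (negbTE ll) mulr0.
  have [j <-] : exists j, ej j = l' by exists (enum_rank_in l'E l'); exact: enum_rankK_in.
  by have /rowP /(_ j) := wE; rewrite !mxE => ->; rewrite mul0r.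
have := mulmx0_rank_max XG; rewrite mxrank_tr => h.
have : (r + m <= m + n)%N by apply: leq_trans h; exact: leq_add.
by rewrite addnC leq_add2l.
Qed.
End UpperBound.

(** * Transcendence bases and expanding systems *)

Section Basis.
Variable R : realType.
Local Notation mp k := (mpoly.mpoly k rat).
Local Notation mev x := (mpoly.mmap (@ratr R) x).

Definition indep r (x : 'I_r -> R) := forall p : mp r, mev x p = 0 -> p = 0.

Lemma indep_inj r (x : 'I_r -> R) : indep x -> injective x.
Proof.
move=> h i j e; apply/eqP; apply/negPn/negP => ij.
have := h (mpoly.mpolyX rat (mpoly.mnm1 i) - mpoly.mpolyX rat (mpoly.mnm1 j)).
rewrite mevB !mevX e subrr => /(_ erefl) /(congr1 (mpoly.mcoeff (mpoly.mnm1 i))).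
rewrite mpoly.mcoeffB !mpoly.mcoeffX eqxx mpoly.mcoeff0.
have -> : (mpoly.mnm1 j == mpoly.mnm1 i) = false.
  apply/eqP => /(congr1 (fun mm => mpoly.fun_of_multinom mm i)).
  by rewrite !mpoly.mnm1E eqxx eq_sym (negbTE ij).
by rewrite subr0 => /eqP; rewrite oner_eq0.
Qed.

Lemma transcendence_basis M (b : 'I_M -> R) : exists r (f : 'I_r -> 'I_M),
  indep (fun i => b (f i)) /\ forall j, exists P : {poly mp r},
    evy (mev (fun i => b (f i))) (b j) P = 0 /\ map_poly (mev (fun i => b (f i))) P != 0.
Proof.
pose Pr r := `[< exists f : 'I_r -> 'I_M, indep (fun i => b (f i)) >].
have ex : exists r, Pr r.
  exists 0%N; apply/asboolP.
  have f0 : 'I_0 -> 'I_M by case.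
  exists f0; move=> p; have [c ->] : exists c, p = mpoly.mpolyC 0 c.
    move: p; apply: mpoly_closed => [c|[]//|p q [c ->] [d ->]|p q [c ->] [d ->]].
    - by exists c.
    - by exists (c + d); rewrite mpoly.mpolyCD.
    - by exists (c * d); rewrite mpoly.mpolyCM.
  by rewrite mpoly.mmapC => /eqP; rewrite fmorph_eq0 => /eqP ->; rewrite mpoly.mpolyC0.
have bd r : Pr r -> (r <= M)%N.
  move=> /asboolP [f /indep_inj fi].
  rewrite -(card_ord r) -(card_ord M); apply: (@leq_card _ _ f) => i j e.
  by apply: fi; rewrite e.
case: (ex_maxnP ex bd) => r /asboolP [f ind] rmax.
exists r, f; split=> // j.
pose x (k : nat) : R := if insub k is Some i then b (f i) else b j.
pose f' (k : 'I_r.+1) : 'I_M := if insub (val k) is Some i then f i else j.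
have xf (k : 'I_r.+1) : x k = b (f' k) by rewrite /x /f'; case: insub.
have xi : (fun i : 'I_r => x i) = (fun i => b (f i)) by apply/funext => i; rewrite /x valK.
have xr : x r = b j by rewrite /x insubN // ltnn.
have : ~ indep (fun k => b (f' k)).
  move=> h; have /rmax : Pr r.+1 by apply/asboolP; exists f'.
  by rewrite ltnn.
move=> /existsNP [p /not_implyP [p0 pn]].
exists (mpoly.muni p); split.
  rewrite -xi -xr -mev_muni (_ : (fun i : 'I_r.+1 => x i) = (fun i => b (f' i))) //.
  by apply/funext => i; rewrite xf.
apply/negP => /eqP m0; apply: pn; apply: muni_inj; apply/polyP => i; rewrite coef0.
by apply: ind; rewrite -coef_map m0 coef0.
Qed.

Definition exps M r (f : 'I_r -> 'I_M) (j : 'I_M) (mm : mpoly.multinom r) (k : nat) : seq nat :=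
  mkseq (fun l => (\sum_(i < r | f i == l :> nat) mpoly.fun_of_multinom mm i) + (l == j) * k)%N M.

(** P as a polynomial in all M coordinates, in the list form used by conditions: the variables of
    its coefficients are placed at the f i, the main variable at j. *)
Definition toL M r (f : 'I_r -> 'I_M) (j : 'I_M) (P : {poly mp r}) : seq term :=
  flatten [seq [seq (0%N, (exps f j mm k, mpoly.mcoeff mm P`_k)) | mm <- mpoly.msupp P`_k]
          | k <- iota 0 (size P)].

Lemma toLE M r (f : 'I_r -> 'I_M) (j : 'I_M) (P : {poly mp r}) (z : nat -> R) :
  devalR M [::] (toL f j P) 0 z = evy (mev (fun i => z (f i))) (z j) P.
Proof.
rewrite /devalR /toL big_flatten /= big_map /evy /map_poly horner_poly.
rewrite -(big_mkord xpredT (fun k => mev (fun i => z (f i)) P`_k * z j ^+ k)).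
rewrite /index_iota subn0; apply: eq_bigr => k _.
rewrite big_map /mpoly.mmap mulr_suml; apply: eq_bigr => mm _ /=.
rewrite -mulrA; congr (_ * _).
rewrite /monoR /mpoly.mmap1 big_mkord.
rewrite (eq_bigr (fun l : 'I_M => (\prod_(i < r | f i == l) z (f i) ^+ mpoly.fun_of_multinom mm i)
    * z l ^+ ((l == j) * k)%N)) => [|l _].
  rewrite big_split /=; congr (_ * _).
    by rewrite (partition_big f xpredT).
  rewrite (bigD1 j) //= eqxx mul1n big1 ?mulr1 // => l /negbTE ->.
  by rewrite mul0n expr0.
rewrite nth_nil ffactn0 mul1r subn0 nth_mkseq // exprD val_eqE; congr (_ * _).
rewrite -prodrXr; apply: eq_big => [i|i /eqP <-] //.
Qed.

(** The minimal polynomial of b_j has a nonzero derivative in its main variable at b, so near b its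
    values control z_j - z'_j, up to the motion d of the independent coordinates. *)
Lemma expand_one M r (f : 'I_r -> 'I_M) (b : 'I_M -> R) (j : 'I_M) (P : {poly mp r}) :
  j \notin codom f ->
  evy (mev (fun i => b (f i))) (b j) P = 0 -> map_poly (mev (fun i => b (f i))) P != 0 ->
  exists L (e dl K : R), [/\ 0 < e, 0 < dl, 0 <= K,
    forall z : nat -> R, (forall i : 'I_M, z i = b i) -> devalR M [::] L 0 z = 0 &
    forall (z z' : nat -> R) (d : R), (forall i : 'I_M, `|z i - b i| <= e) ->
      (forall i : 'I_M, `|z' i - b i| <= e) -> 0 <= d ->
      (forall i, `|z (f i) - z' (f i)| <= d) ->
      dl * `|z j - z' j| <= `|devalR M [::] L 0 z - devalR M [::] L 0 z'| + K * d].
Proof.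
move=> jf P0 Pn; pose ev := mev (fun i => b (f i)).
have dM := @dmevM R r (fun i => b (f i)) (fun _ => 0).
have [Q [Q0 lQ dQ _]] := minimal_separable (ev := ev) (y := b j) (ex_intro _ P (conj P0 Pn)).
pose L := toL f j Q; pose L' := toL f j Q^`().
pose bb (i : nat) : R := if insub i is Some l then b l else 0.
have bbE (l : 'I_M) : bb l = b l by rewrite /bb valK.
have fun_bb : (fun i => bb (f i)) = (fun i => b (f i)) by apply/funext => i; rewrite bbE.
have g'b : devalR M [::] L' 0 bb = evy ev (b j) Q^`() by rewrite toLE bbE fun_bb.
pose dl0 : R := `|evy ev (b j) Q^`()|; have dl00 : 0 < dl0 by rewrite normr_gt0.
have [V hV] : exists V : nat, forall l : 'I_M, `|b l| + 4 <= V%:R.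
  exists (Num.bound (\sum_(i < M) `|b i|) + 4)%N => l; rewrite natrD lerD2r.
  apply: ltW; apply: le_lt_trans (archi_boundP _); last exact: sumr_ge0.
  by rewrite (bigD1 l) //= lerDl sumr_ge0.
pose K : R := ratr (wsum (2 * V.+1) L); pose K' : R := ratr (wsum (2 * V.+1) L').
have K0 : 0 <= K by rewrite ler0q wsum_ge0.
have K'0 : 0 <= K' by rewrite ler0q wsum_ge0.
have bV (z : nat -> R) : (forall l : 'I_M, `|z l - b l| <= 4) -> forall l, (l < M)%N -> `|z l| <= V%:R.
  move=> h l hl; have := h (Ordinal hl); have := hV (Ordinal hl) => /= h1 h2.
  apply: le_trans h1; rewrite -[z l](subrK (b (Ordinal hl))) addrC.
  by apply: le_trans (ler_normD _ _) _; rewrite lerD2l.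
have lip (L1 : seq term) (z z' : nat -> R) (d : R) : (forall l : 'I_M, `|z l - b l| <= 4) ->
   (forall l : 'I_M, `|z' l - b l| <= 4) -> 0 <= d -> (forall l : 'I_M, `|z l - z' l| <= d) ->
   `|devalR M [::] L1 0 z - devalR M [::] L1 0 z'| <= ratr (wsum (2 * V.+1) L1) * d.
  move=> hz hz' d0 hd; have := @devalR_lip R M [::] L1 0 z z' V d (leq0n _) d0 (bV z hz) (bV z' hz')
    (fun i hi => hd (Ordinal hi)); by rewrite mul1r.
(* Within 3e of b the derivative keeps at least half of its absolute value at b; the mean value
   point c is that close, since it is within 2e of z'_j. *)
pose e := Num.min 1 (dl0 / 2 / (3 * (K' + 1))).
have K'1 : 0 < 3 * (K' + 1) by rewrite mulr_gt0 // ltr_wpDl.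
have e0 : 0 < e by rewrite lt_min ltr01 !divr_gt0.
have e1 : e <= 1 by rewrite ge_min lexx.
have eK : K' * (3 * e) <= dl0 / 2.
  have : e <= dl0 / 2 / (3 * (K' + 1)) by rewrite ge_min lexx orbT.
  rewrite ler_pdivlMr // => h; apply: le_trans h.
  by rewrite mulrCA mulrA [e * _]mulrC ler_wpM2r ?(ltW e0) // ler_wpM2l // lerDl.
exists L, e, (dl0 / 2), K; split => //; first by rewrite divr_gt0.
  move=> z zb; rewrite toLE zb (_ : (fun i => z (f i)) = (fun i => b (f i))) //.
  by apply/funext => i; rewrite zb.
move=> z z' d hz hz' d0 hd.
(* From z' to w only independent coordinates change; from w to z, as far as the polynomial can see,
   only the coordinate j. *)
pose w l : R := if [exists i, f i == l :> nat] then z l else z' l.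
have wf i : w (f i) = z (f i) by rewrite /w ifT //; apply/existsP; exists i.
have wj : w j = z' j.
  rewrite /w ifN //; apply/existsP => -[i /eqP e2]; move: jf.
  by rewrite (_ : j = f i) ?codom_f //; apply: val_inj.
have wb (l : 'I_M) : `|w l - b l| <= e by rewrite /w; case: ifP.
have e4 : e <= 4 by apply: le_trans e1 _; rewrite ler1n.
have h1 : `|devalR M [::] L 0 w - devalR M [::] L 0 z'| <= K * d.
  apply: lip => // [l|l|l]; [exact: le_trans (wb l) e4|exact: le_trans (hz' l) e4|].
  rewrite /w; case: ifP => [/existsP [i /eqP <-]|_]; [exact: hd|by rewrite subrr normr0].
pose p := map_poly (mev (fun i => z (f i))) Q.
have gz : devalR M [::] L 0 z = p.[z j] by rewrite toLE.
have gw : devalR M [::] L 0 w = p.[z' j].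
  by rewrite toLE wj (_ : (fun i => w (f i)) = (fun i => z (f i))) //; apply/funext => i; rewrite wf.
have dp (t : R) : is_derive t 1 (horner p) p^`().[t] by exact: is_derive_poly.
have [c c1 cE] := mvt (z' j) (z j) dp.
have zz : `|z j - z' j| <= 2 * e.
  have -> : z j - z' j = (z j - b j) - (z' j - b j) by ring.
  by apply: le_trans (ler_normB _ _) _; rewrite mulr_natl mulr2n lerD.
pose u := upd z j c.
have ub (l : 'I_M) : `|u l - b l| <= 3 * e.
  rewrite /u /upd; case: eqP => [/val_inj ->|_].
    have -> : c - b j = (c - z' j) + (z' j - b j) by ring.
    apply: le_trans (ler_normD _ _) _.
    have -> : 3 * e = 2 * e + e by ring.
    by rewrite lerD // (le_trans c1).
  by apply: le_trans (hz l) _; move: e0; clear; lra.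
have gu : p^`().[c] = devalR M [::] L' 0 u.
  rewrite toLE /p deriv_map /evy /u /upd eqxx; congr (map_poly (mev _) _).[_].
  apply/funext => i; rewrite ifN //; apply/negP => /eqP e2; move: jf.
  by rewrite (_ : j = f i) ?codom_f //; apply: val_inj.
have h2 : dl0 / 2 <= `|p^`().[c]|.
  have : `|devalR M [::] L' 0 u - devalR M [::] L' 0 bb| <= K' * (3 * e).
    have u4 (l : 'I_M) : `|u l - b l| <= 4.
      by apply: le_trans (ub l) _; move: e1; clear; lra.
    have b4 (l : 'I_M) : `|bb l - b l| <= 4 by rewrite bbE subrr normr0.
    have ubb (l : 'I_M) : `|u l - bb l| <= 3 * e by rewrite bbE.
    by apply: (lip _ _ _ _ u4 b4 _ ubb); rewrite mulr_ge0 // ltW.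
  rewrite g'b -gu => h; have := le_trans h eK; rewrite distrC => {}h.
  have := lerB_dist (evy ev (b j) Q^`()) p^`().[c].
  by rewrite -/dl0; move: h; clear; lra.
apply: (@le_trans _ _ `|p.[z j] - p.[z' j]|).
  by rewrite cE normrM ler_wpM2r.
rewrite -gz -gw -[X in `|X|](_ : (devalR M [::] L 0 z - devalR M [::] L 0 z')
   - (devalR M [::] L 0 w - devalR M [::] L 0 z') = _); last by ring.
by apply: le_trans (ler_normB _ _) _; rewrite lerD2l.
Qed.

Definition scaleL (C : nat) (L : seq term) : seq term :=
  [seq (t.1, (t.2.1, C%:R * t.2.2)) | t <- L].

Lemma scaleLE M C L (z : nat -> R) : devalR M [::] (scaleL C L) 0 z = C%:R * devalR M [::] L 0 z.
Proof.
rewrite /devalR big_map mulr_sumr; apply: eq_bigr => t _ /=.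
case: eqP => _; last by rewrite mulr0.
by rewrite rmorphM /= ratr_nat -mulrA.
Qed.

(** If some independent coordinate moves by at least 1/C of the difference at i, its C-fold detects
    this. Otherwise C times the minimal polynomial does, its error term being absorbed by the choice
    of C. *)
Lemma expanding_system m n r (f : 'I_r -> 'I_(m + n)) (b : 'I_(m + n) -> R) : (r < n)%N ->
  indep (fun i => b (f i)) ->
  (forall j, exists P : {poly mp r},
    evy (mev (fun i => b (f i))) (b j) P = 0 /\ map_poly (mev (fun i => b (f i))) P != 0) ->
  exists (Psi : seq (seq term)) (e : R), [/\ size Psi = (m + n)%N, 0 < e,
    forall z : nat -> R, (forall i : 'I_(m + n), z i = b i) -> forall l, (l <= m)%N ->
      devalR (m + n) [::] (nth [::] Psi l) 0 z = 0 &
    forall z z' : nat -> R, (forall i : 'I_(m + n), `|z i - b i| <= e) ->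
      (forall i : 'I_(m + n), `|z' i - b i| <= e) ->
      forall i, (i < m + n)%N -> exists2 l, (l < m + n)%N & `|z i - z' i| <=
        `|devalR (m + n) [::] (nth [::] Psi l) 0 z - devalR (m + n) [::] (nth [::] Psi l) 0 z'|].
Proof.
move=> rn ind alg; set M := (m + n)%N.
have fi : injective f by move=> i j e; apply: (indep_inj ind); rewrite e.
pose J := enum [predC codom f].
have JP j : (j \in J) = (j \notin codom f) by rewrite mem_enum.
have rM : (r <= M)%N by apply: leq_trans (ltnW rn) _; exact: leq_addl.
have sJ : size J = (M - r)%N.
  have := cardC (mem (codom f)); rewrite card_codom // card_ord => cM.
  by rewrite -cardE; apply: (@addnI r); rewrite subnKC // cM card_ord.
have /choice [D hD] : forall j : 'I_M, exists D : (seq term * R) * (R * R), j \in J ->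
   [/\ 0 < D.1.2, 0 < D.2.1, 0 <= D.2.2,
    forall z : nat -> R, (forall i : 'I_M, z i = b i) -> devalR M [::] D.1.1 0 z = 0 &
    forall (z z' : nat -> R) (d : R), (forall i : 'I_M, `|z i - b i| <= D.1.2) ->
      (forall i : 'I_M, `|z' i - b i| <= D.1.2) -> 0 <= d ->
      (forall i, `|z (f i) - z' (f i)| <= d) ->
      D.2.1 * `|z j - z' j| <= `|devalR M [::] D.1.1 0 z - devalR M [::] D.1.1 0 z'| + D.2.2 * d].
  move=> j; case: (boolP (j \in J)) => jJ; last by exists (([::], 0), (0, 0)).
  have [P [P0 Pn]] := alg j; rewrite JP in jJ.
  by have [L [e [dl [K H]]]] := expand_one jJ P0 Pn; exists ((L, e), (dl, K)).
have [e e0 he] : exists2 e : R, 0 < e & forall j, j \in J -> e <= (D j).1.2.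
  apply: seq_pos => [j x y h _ yx|j jJ]; first exact: le_trans yx h.
  by exists (D j).1.2 => //; have [] := hD j jJ.
have [C0 hC0] : exists C : nat, forall j, j \in J -> (2 + 2 * (D j).2.2) / (D j).2.1 <= C%:R.
  apply: (seq_max (P := fun j (C : nat) => (2 + 2 * (D j).2.2) / (D j).2.1 <= C%:R))
    => [j x y h xy|j jJ]; first by apply: le_trans h _; rewrite ler_nat.
  have [_ h2 h3 _ _] := hD j jJ.
  exists (Num.bound ((2 + 2 * (D j).2.2) / (D j).2.1)); apply: ltW; apply: archi_boundP.
  by rewrite divr_ge0 ?(ltW h2) // addr_ge0 // mulr_ge0.
pose C := C0.+1.
have C1 : 1 <= C%:R :> R by rewrite ler1n.
have Cp : 0 < C%:R :> R by rewrite ltr0n.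
have hC j : j \in J -> 2 <= C%:R * (D j).2.1 /\ 2 * (D j).2.2 <= C%:R * (D j).2.1.
  move=> jJ; have [_ h2 h3 _ _] := hD j jJ.
  have : (2 + 2 * (D j).2.2) / (D j).2.1 <= C%:R.
    by apply: le_trans (hC0 j jJ) _; rewrite ler_nat.
  by rewrite ler_pdivrMr // => h; move: h3 h; clear; split; lra.
pose Psi := [seq scaleL C (D j).1.1 | j <- J] ++ [seq scaleL C (toL f (f i) 'X) | i <- enum 'I_r].
have sPsi : size Psi = M by rewrite size_cat size_map sJ size_map size_enum_ord subnK.
have PJ j : j \in J -> exists2 l, (l < M)%N & nth [::] Psi l = scaleL C (D j).1.1.
  move=> jJ; have hl : (index j J < size J)%N by rewrite index_mem.
  exists (index j J); first by apply: leq_trans hl _; rewrite sJ leq_subr.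
  by rewrite nth_cat size_map hl (nth_map j) // nth_index.
have Pf i : exists2 l, (l < M)%N & nth [::] Psi l = scaleL C (toL f (f i) 'X).
  exists (size J + i)%N; first by rewrite sJ -ltn_subRL subKn.
  rewrite nth_cat size_map ltnNge leq_addr /= addKn (nth_map i) ?size_enum_ord //.
  by rewrite nth_ord_enum.
have valf i (z : nat -> R) : devalR M [::] (scaleL C (toL f (f i) 'X)) 0 z = C%:R * z (f i).
  by rewrite scaleLE toLE /evy map_polyX hornerX.
exists Psi, e; split => //.
  move=> z zb l lm.
  have hl : (l < size J)%N by rewrite sJ ltn_subRL /M; move: rn lm; clear; lia.
  rewrite nth_cat size_map hl.
  have [j0 _] : exists j, j \in J by exists (tnth (in_tuple J) (Ordinal hl)); exact: mem_tnth.
  rewrite (nth_map j0) // scaleLE.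
  have [_ _ _ h _] := hD _ (mem_nth j0 hl).
  by rewrite h ?mulr0.
move=> z z' hz hz' i hi.
pose j := Ordinal hi; case: (boolP (j \in J)) => jJ; last first.
  move: jJ; rewrite JP negbK => /codomP [k jk].
  have [l hl E] := Pf k; exists l => //; rewrite E !valf -mulrBr normrM gtr0_norm // -jk.
  by rewrite ler_peMl.
have [_ h2 h3 _ h5] := hD j jJ; have [k1 k2] := hC j jJ.
case: (pselect (exists k, `|z i - z' i| <= C%:R * `|z (f k) - z' (f k)|)) => [[k hk]|nk].
  by have [l hl E] := Pf k; exists l => //; rewrite E !valf -mulrBr normrM gtr0_norm.
have [l hl E] := PJ j jJ; exists l => //; rewrite E !scaleLE -mulrBr normrM gtr0_norm //.
have d0 : 0 <= `|z i - z' i| / C%:R by rewrite divr_ge0 // ltW.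
have hd k : `|z (f k) - z' (f k)| <= `|z i - z' i| / C%:R.
  rewrite ler_pdivlMr // leNgt; apply/negP => lt; apply: nk; exists k.
  by rewrite mulrC ltW.
have := h5 z z' _ (fun l => le_trans (hz l) (he j jJ)) (fun l => le_trans (hz' l) (he j jJ)) d0 hd.
set g := `|_ - devalR _ _ _ _ z'|; rewrite -[(j : nat)]/i.
set t := `|z i - z' i|; have t0 : 0 <= t by exact: normr_ge0.
move=> h.
have {}h : C%:R * (D j).2.1 * t <= C%:R * g + (D j).2.2 * t.
  have : C%:R * ((D j).2.1 * t) <= C%:R * (g + (D j).2.2 * (t / C%:R)) by rewrite ler_pM2l.
  have -> : C%:R * (g + (D j).2.2 * (t / C%:R)) = C%:R * g + (D j).2.2 * t.
    by field; rewrite gt_eqF.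
  by rewrite mulrA.
have k1' : 2 * t <= C%:R * (D j).2.1 * t by rewrite ler_wpM2r.
have k2' : 2 * ((D j).2.2 * t) <= C%:R * (D j).2.1 * t by rewrite mulrA ler_wpM2r.
move: h k1' k2'; move: (C%:R * _ * t) ((D j).2.2 * t) (C%:R * g) => u w v h a1 a2.
by apply: (@le_trans _ _ (u - w)); [move: a1 a2|move: h]; clear; lra.
Qed.
End Basis.

(** Close to a face the face itself is taken as endpoint, so that the interval stays in the domain
    even if x is an endpoint of it. *)
Lemma rat_box1 (R : realType) (x e : R) (lo0 hi0 : rat) : 0 < e ->
  ratr lo0 <= x <= ratr hi0 -> exists p : rat * rat,
  [/\ ratr p.1 <= x <= ratr p.2, x - e < ratr p.1, ratr p.2 < x + e, lo0 <= p.1 & p.2 <= hi0].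
Proof.
move=> e0 /andP[h1 h2].
have [lo [l1 l2 l3]] : exists lo : rat, [/\ ratr lo <= x, x - e < ratr lo & lo0 <= lo].
  case: (ltP (x - e) (ratr lo0)) => h; first by exists lo0.
  have [q q1 q2] : exists2 q : rat, x - e < ratr q & ratr q < x by apply: rat_between; rewrite gtrBl.
  exists q; split => //; first exact: ltW.
  by rewrite -(ler_rat R) ltW // (le_lt_trans h).
have [hi [k1 k2 k3]] : exists hi : rat, [/\ x <= ratr hi, ratr hi < x + e & hi <= hi0].
  case: (ltP (ratr hi0) (x + e)) => h; first by exists hi0.
  have [q q1 q2] : exists2 q : rat, x < ratr q & ratr q < x + e by apply: rat_between; rewrite ltrDl.
  exists q; split => //; first exact: ltW.
  by rewrite -(ler_rat R) ltW // (lt_le_trans q2).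
by exists (lo, hi); rewrite l1.
Qed.

Definition mkcond (m : nat) (its : seq item) (B : seq (rat * rat)) (Psi : seq (seq term)) : cond :=
  (m, (its, ([seq (frq p.1, frq p.2) | p <- B],
             [seq [seq (t.1, (t.2.1, frq t.2.2)) | t <- L] | L <- Psi]))).

Lemma mkcond_box m its B Psi : cnd_box (mkcond m its B Psi) = B.
Proof.
rewrite /cnd_box /= -map_comp -[RHS]map_id; apply: eq_map => -[p q].
by rewrite /= /pq /= !frqK.
Qed.

Lemma mkcond_poly m its B Psi : cnd_poly (mkcond m its B Psi) = Psi.
Proof.
rewrite /cnd_poly /= -map_comp -[RHS]map_id; apply: eq_map => L /=.
rewrite -map_comp -[RHS]map_id; apply: eq_map => -[s [be q]].
by rewrite /= /tq /= frqK.
Qed.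

(** * Lower bound for the transcendence degree under distinctness *)

Section LowerBound.
Variables (R : realType) (C : func_system R).
Hypothesis CI : quasianalytic_IF_system C.
Variables (Sigma : pred nat) (eta : idx Sigma -> nat) (rho : forall s, (eta s).-tuple rat).
Hypothesis idxD : computable_index_data rho.
Variables (S : fun_family R eta) (e pe : prog) (eps : tolerance eta).
Hypothesis SC : is_family C rho S.
Hypothesis Se : approx_algorithm rho S e.
Hypotheses (eps0 : tol_pos eps) (epe : tol_computed_by eps pe).
Let T := perturbed rho S e pe.
Variables (m n : nat) (N : raw_name eta m n) (a : 'rV[R]_m).
Hypothesis isN : is_name R rho N.
Hypothesis aD : bm_set (nm_mfd N) a.
Hypothesis dist : distinctness N a.
Let b : 'I_(m + n) -> R := fun i => nameF rho T N a 0 i.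
Let sg i := nm_sigma N i.

Definition xis (i : 'I_n) : seq nat := [seq val (nm_xi N i k) | k <- enum 'I_(eta (sg i))].
Definition item_of (i : 'I_n) : item := (val (sg i), (tval (nm_alpha N i), xis i)).

Lemma size_xis i : size (xis i) = eta (sg i).
Proof. by rewrite size_map size_enum_ord. Qed.

Lemma nth_xis i (k : 'I_(eta (sg i))) : nth 0%N (xis i) k = nm_xi N i k.
Proof. by rewrite (nth_map k) ?size_enum_ord // nth_ord_enum. Qed.

Lemma vf_xis i k : (k < eta (sg i))%N -> vf a (nth 0%N (xis i) k) = vf (name_proj N i a) k.
Proof. by move=> hk; rewrite (nth_xis (Ordinal hk)) vfE (vfE _ (Ordinal hk)) mxE. Qed.

Lemma separation : exists2 e' : R, 0 < e' & forall i j, i != j ->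
  val (sg i) = val (sg j) -> tval (nm_alpha N i) = tval (nm_alpha N j) ->
  exists2 k, (k < eta (sg i))%N & e' <= `|vf a (nth 0%N (xis i) k) - vf a (nth 0%N (xis j) k)|.
Proof.
have [e' e'0 h] : exists2 e' : R, 0 < e' & forall p : 'I_n * 'I_n,
    p \in enum [set: 'I_n * 'I_n]%SET -> p.1 != p.2 -> val (sg p.1) = val (sg p.2) ->
    tval (nm_alpha N p.1) = tval (nm_alpha N p.2) ->
    exists2 k, (k < eta (sg p.1))%N &
      e' <= `|vf a (nth 0%N (xis p.1) k) - vf a (nth 0%N (xis p.2) k)|.
  apply: seq_pos => [p x y h _ yx h1 h2 h3|[i j] _ /=].
    by have [k hk le] := h h1 h2 h3; exists k => //; exact: le_trans yx le.
  have [->|ij] := eqVneq i j; first by exists 1 => //; rewrite eqxx.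
  case: (pselect (val (sg i) = val (sg j) /\ tval (nm_alpha N i) = tval (nm_alpha N j))) => [[h1 h2]|nh];
    last by exists 1 => // _ h1 h2; case: nh.
  have [k hk ne] : exists2 k, (k < eta (sg i))%N &
      vf a (nth 0%N (xis i) k) != vf a (nth 0%N (xis j) k).
    apply: contrapT => H; have /eqP ij' := ij; apply: (dist ij' (val_inj h1) h2).
    have cE i' : codom (name_proj N i' a 0) = map (vf a) (xis i').
      rewrite codomE /xis -map_comp; apply: eq_map => k /=.
      by rewrite mxE vfE.
    have sz : size (xis i) = size (xis j) by rewrite !size_xis (val_inj h1).
    rewrite !cE; apply: (@eq_from_nth _ 0); rewrite !(size_map (vf a)) // => k hk.
    rewrite !(nth_map 0%N) -?sz //; apply/eqP/negPn/negP => ne; apply: H.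
    by exists k => //; rewrite -size_xis.
  exists (`|vf a (nth 0%N (xis i) k) - vf a (nth 0%N (xis j) k)|).
    by rewrite normr_gt0 subr_eq0.
  by move=> _ _ _; exists k.
by exists e' => // i j; apply: (h (i, j)); rewrite mem_enum inE.
Qed.

(** A coordinate that feeds an item is confined to the domain of its function; by the disjointness
    of the images it feeds only one, so there is one constraint at most. *)
Lemma rat_box (e1 : R) : 0 < e1 -> exists q : 'I_(m + n) -> rat * rat, forall l,
  [/\ ratr (q l).1 <= b l <= ratr (q l).2, b l - e1 < ratr (q l).1, ratr (q l).2 < b l + e1 &
   forall i k, l = lshift n (nm_xi N i k) -> - tnth (rho (sg i)) k <= (q l).1 /\
     (q l).2 <= tnth (rho (sg i)) k].
Proof.
move=> e10; suff : forall l, exists q : rat * rat,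
  [/\ ratr q.1 <= b l <= ratr q.2, b l - e1 < ratr q.1, ratr q.2 < b l + e1 &
   forall i k, l = lshift n (nm_xi N i k) -> - tnth (rho (sg i)) k <= q.1 /\
     q.2 <= tnth (rho (sg i)) k] by move=> H; have [q hq] := choice H; exists q.
move=> l; case: (pselect (exists i (k : 'I_(eta (sg i))), l = lshift n (nm_xi N i k))) => [[i [k lE]]|no].
  have bx : ratr (- tnth (rho (sg i)) k) <= b l <= ratr (tnth (rho (sg i)) k).
    rewrite rmorphN /= -ler_norml lE /b /nameF row_mxEl.
    have : cbox (rho (sg i)) (name_proj N i a) by exact: name_box.
    by move/(_ k); rewrite mxE.
  have [q [q1 q2 q3 q4 q5]] := rat_box1 e10 bx.
  exists q; split => // i' k' lE'.
  have xe : nm_xi N i k = nm_xi N i' k' by apply: (@lshift_inj m n); rewrite -lE -lE'.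
  have [_ dj _ _] := isN.
  have ii : i = i' by apply: contrapT => ne; exact: (dj i i' k k' ne xe).
  move: k' xe {lE'}; rewrite -ii => k' /(xi_inj isN) <-; by [].
have [lo _ lo1] : exists2 q : rat, b l - 1 < ratr q & ratr q < b l by apply: rat_between; rewrite gtrBl.
have [hi hi1 _] : exists2 q : rat, b l < ratr q & ratr q < b l + 1 by apply: rat_between; rewrite ltrDl.
have bx : ratr lo <= b l <= ratr hi by rewrite !ltW.
have [q [q1 q2 q3 _ _]] := rat_box1 e10 bx.
by exists q; split => // i k lE; case: no; exists i, k.
Qed.

Lemma lower_bound r (f : 'I_r -> 'I_(m + n)) : indep (fun i => b (f i)) ->
  (forall j, exists P : {poly mpoly.mpoly r rat},
    evy (mpoly.mmap (@ratr R) (fun i => b (f i))) (b j) P = 0 /\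
    map_poly (mpoly.mmap (@ratr R) (fun i => b (f i))) P != 0) -> (n <= r)%N.
Proof.
move=> ind alg; rewrite leqNgt; apply/negP => rn.
have [Psi [e1 [sPsi e10 Psi0 Psix]]] := expanding_system rn ind alg.
have [e2 e20 sep] := separation.
(* e1 is the range in which Psi expands; intervals reaching less than e2 / 2 from points that are e2
   apart are disjoint. *)
pose ee := Num.min e1 (e2 / 2).
have ee0 : 0 < ee by rewrite lt_min e10 divr_gt0.
have ee1 : ee <= e1 by rewrite ge_min lexx.
have ee2 : ee <= e2 / 2 by rewrite ge_min lexx orbT.
have [q hq] := rat_box ee0.
pose qq (l : nat) : rat * rat := if insub l is Some l' then q l' else (0, 0).
have qqE (l : 'I_(m + n)) : qq l = q l by rewrite /qq valK.
pose B := mkseq qq (m + n).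
have nB (l : 'I_(m + n)) : nth (0, 0) B l = q l by rewrite nth_mkseq // qqE.
pose c := mkcond m [seq item_of i | i <- enum 'I_n] B Psi.
have cB : cnd_box c = B by exact: mkcond_box.
have cP : cnd_poly c = Psi by exact: mkcond_poly.
have cn : cnd_n c = n by rewrite /cnd_n /= size_map size_enum_ord.
have cm : c.1 = m by [].
have cI (i : 'I_n) : cnd_item c i = item_of i.
  by rewrite /cnd_item /cnd_items /= (nth_map i) ?size_enum_ord // nth_ord_enum.
have sB : size B = (m + n)%N by rewrite size_mkseq.
have pj i (k : 'I_(eta (sg i))) : nth (0, 0) (proj (xis i) B) k = q (lshift n (nm_xi N i k)).
  rewrite /proj (nth_map 0%N) ?size_xis // nth_xis.
  by rewrite -(nB (lshift n _)).
have blE (l : 'I_m) : b (lshift n l) = a 0 l by rewrite /b /nameF row_mxEl.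
have qb (l : 'I_(m + n)) : ratr (q l).1 <= b l <= ratr (q l).2 by have [] := hq l.
have vc : valid Sigma (et eta) (rh rho) c.
  rewrite /valid cB cP cn cm sB sPsi !eqxx /=; apply/and4P; split.
  - exact: leq_ltn_trans rn.
  - apply/allP => _ /mapP [i _ ->]; rewrite /item_of /= etE size_tuple size_xis !eqxx (valP (sg i)) /=.
    apply/andP; split; first by apply/allP => _ /mapP [k _ ->] /=.
    apply/allP => k; rewrite mem_iota add0n => /andP[_ hk].
    rewrite (pj i (Ordinal hk)) rhE.
    have [_ _ _ /(_ i (Ordinal hk) erefl)] := hq (lshift n (nm_xi N i (Ordinal hk))).
    by rewrite (tnth_nth 0) => -[-> ->].
  - apply/allP => p /(nthP (0, 0)) [l]; rewrite sB => hl <-.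
    rewrite (nB (Ordinal hl)); have /andP[h1 h2] := qb (Ordinal hl).
    by rewrite -(ler_rat R) (le_trans h1 h2).
  apply/allP => i; rewrite mem_iota add0n => /andP[_ hi].
  apply/allP => j; rewrite mem_iota add0n => /andP[_ hj].
  rewrite (cI (Ordinal hi)) (cI (Ordinal hj)) /item_of /=.
  have [//|ij] := eqVneq i j; rewrite /=.
  case: eqP => //= h1; case: eqP => //= h2.
  have ij' : Ordinal hi != Ordinal hj by rewrite -val_eqE.
  have [k hk sp] := sep _ _ ij' h1 h2.
  apply/hasP; exists k; first by rewrite mem_iota add0n etE.
  have hk' : (k < eta (sg (Ordinal hj)))%N by rewrite -(val_inj h1).
  rewrite (pj _ (Ordinal hk)) (pj _ (Ordinal hk')).
  rewrite (nth_xis (Ordinal hk)) (nth_xis (Ordinal hk')) !vfE -!blE in sp.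
  set u := lshift n _ in sp *; set v := lshift n (nm_xi N (Ordinal hj) _) in sp *.
  have [_ u1 u2 _] := hq u; have [_ v1 v2 _] := hq v.
  rewrite /apart -!(ltr_rat R); apply/orP.
  case: (lerP (b u) (b v)) => buv.
    left; have : e2 <= b v - b u by move: sp; rewrite distrC ger0_norm ?subr_ge0.
    by move: u2 v1 ee2; clear; lra.
  right; have : e2 <= b u - b v by move: sp; rewrite gtr0_norm ?subr_gt0.
  by move: u1 v2 ee2; clear; lra.
have inB z : inR B z -> forall l : 'I_(m + n), `|z l - b l| <= e1.
  move=> zB l; have := zB l; rewrite sB nB => /(_ (ltn_ord l)) /andP[h1 h2].
  have [_ u1 u2 _] := hq l; rewrite ler_norml; apply/andP.
  by move: h1 h2 u1 u2 ee1; clear; split; lra.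
have xc : expanding R c.
  move=> z z'; rewrite cB => /inB hz /inB hz' i; rewrite cm cn => hi.
  have [l hl H] := Psix z z' hz hz' i hi.
  by exists l; rewrite /pR ?cm ?cn ?cP.
have DSl := DS_lip CI idxD SC; have DSa := DS_alg Se.
(* Every condition is met at some stage, namely at its own code. *)
have [k dc] : exists k, dec k = c by exists (enc c); exact: encK.
have av := avoidance DSl DSa (epss_ok eps0 epe) (k := k) (x := vf a).
rewrite dc in av; set zl := zlim _ _ _ _ _ _ _ _ in av.
have zE (l : 'I_(m + n)) : zl l = b l.
  rewrite /zl /zlim cm; case: (ltnP l m) => hl.
    have -> : l = lshift n (Ordinal hl) by exact: val_inj.
    by rewrite blE (vfE _ (Ordinal hl)).
  have hi : (l - m < n)%N by rewrite ltn_subLR.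
  rewrite (cI (Ordinal hi)) /=; set i := Ordinal hi.
  have -> : l = rshift m i by apply: val_inj; rewrite /= subnKC.
  rewrite /b /nameF row_mxEr mxE.
  have bx : cbox (rho (sg i)) (name_proj N i a) by exact: name_box.
  rewrite (mpderiv_perturbed CI idxD SC Se eps0 epe _ bx).
  have ex k' : (k' < eta (sg i))%N -> px (xis i) (vf a) k' = vf (name_proj N i a) k'.
    by move=> hk; rewrite /px vf_xis.
  congr (_ + _); first by apply: DS_ext => k'; rewrite etE; exact: ex.
  exact: (hd_ext (h_tail CI idxD SC Se eps0 epe) (valP (sg i)) (etE eta (sg i)) (size_tuple (nm_alpha N i)) ex).
apply: (av vc xc).
- move=> l; rewrite (size_Kc vc) => hl; rewrite /Kc cB nth_take // (nB (lshift n (Ordinal hl))).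
  by rewrite (vfE _ (Ordinal hl)) -blE.
- by move=> l; rewrite cB sB => hl; rewrite (nB (Ordinal hl)) (zE (Ordinal hl)).
by move=> l lm; rewrite /pR cn cP; apply: Psi0.
Qed.
End LowerBound.

(** * Subfields of the reals and the transcendence degree *)

Section Subfields.
Variables (R : realType) (K : set R).
Hypothesis HK : is_subfield K.

Lemma subfieldB x y : K x -> K y -> K (x - y). Proof. by case: HK => _ h _; exact: h. Qed.
Lemma subfield_div x y : K x -> K y -> K (x / y). Proof. by case: HK => _ _ h; exact: h. Qed.
Lemma subfield1 : K 1. Proof. by case: HK. Qed.
Lemma subfield0 : K 0. Proof. by rewrite -(subrr 1); apply: subfieldB; exact: subfield1. Qed.
Lemma subfieldD x y : K x -> K y -> K (x + y).
Proof.
move=> Kx Ky; rewrite -[y]opprK; apply: subfieldB => //.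
by rewrite -[- y]add0r; apply: subfieldB => //; exact: subfield0.
Qed.
Lemma subfieldM x y : K x -> K y -> K (x * y).
Proof.
move=> Kx Ky; rewrite -[y]invrK; apply: subfield_div => //.
by rewrite -[y^-1]mul1r; apply: subfield_div => //; exact: subfield1.
Qed.
Lemma subfield_nat n : K n%:R.
Proof.
elim: n => [|n IH]; first exact: subfield0.
by rewrite -natr1; apply: subfieldD => //; exact: subfield1.
Qed.
Lemma subfield_rat q : K (ratr q).
Proof.
have Ki (z : int) : K z%:~R.
  case: z => n; first exact: subfield_nat.
  by rewrite NegzE rmorphN /= -sub0r; apply: subfieldB; [exact: subfield0|exact: subfield_nat].
by rewrite /ratr; apply: subfield_div.
Qed.

Lemma subfield_mev k (x : 'I_k -> R) p : (forall i, K (x i)) -> K (mpoly.mmap (@ratr R) x p).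
Proof.
move=> Kx; move: p; apply: mpoly_closed => [c|i|p q hp hq|p q hp hq].
- by rewrite mpoly.mmapC; exact: subfield_rat.
- by rewrite mevX.
- by rewrite mevD; exact: subfieldD.
- by rewrite mevM; exact: subfieldM.
Qed.

Definition inK : {pred R} := fun x => `[< K x >].

Lemma inKE x : (x \in inK) = `[< K x >]. Proof. by []. Qed.

Lemma inK_closed : divring_closed inK.
Proof.
split=> [|x y|x y]; rewrite ?inKE.
- by apply/asboolP; exact: subfield1.
- by move=> /asboolP Kx /asboolP Ky; apply/asboolP; exact: subfieldB.
- by move=> /asboolP Kx /asboolP Ky; apply/asboolP; exact: subfield_div.
Qed.

HB.instance Definition _ := GRing.isDivringClosed.Build R inK inK_closed.

(** K as a field type, so that the known closure of algebraic elements under field operations can be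
    transported to [alg_over]. *)
Record subfield_type := SubfieldType { sfval :> R; sfP : sfval \in inK }.

HB.instance Definition _ := [isSub for sfval].
HB.instance Definition _ := [Choice of subfield_type by <:].
HB.instance Definition _ := [SubChoice_isSubIntegralDomain of subfield_type by <:].
HB.instance Definition _ := [SubIntegralDomain_isSubField of subfield_type by <:].

Lemma alg_overP x : alg_over K x <-> algebraicOver (val : subfield_type -> R) x.
Proof.
split=> [[p [pn Kp px]]|[q qn qx]].
  have Kc i : p`_i \in inK by rewrite inKE; apply/asboolP; exact: Kp.
  pose q := \poly_(i < size p) (SubfieldType (Kc i)).
  have qE : map_poly (val : subfield_type -> R) q = p.
    apply/polyP => i; rewrite coef_map coef_poly; case: ltnP => //= h.
    by rewrite nth_default.
  exists q; last by rewrite qE.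
  by apply: contra_neq pn => q0; rewrite -qE q0 rmorph0.
exists (map_poly (val : subfield_type -> R) q); split => //.
  by rewrite map_poly_eq0.
by move=> i; rewrite coef_map; apply/asboolP; exact: (sfP q`_i).
Qed.

Lemma alg_over_subfield : is_subfield (alg_over K).
Proof.
split=> [|x y|x y]; rewrite ?alg_overP.
- exact: algebraic1.
- exact: algebraic_sub.
- exact: algebraic_div.
Qed.
End Subfields.

Section TranscendenceDegree.
Variable R : realType.

Lemma field_gen_subfield (X : set R) : is_subfield (field_gen X).
Proof.
split=> [M [HM _]|x y hx hy M HM|x y hx hy M HM]; first by case: HM.
  by have [_ h _] := HM.1; apply: h; [exact: hx|exact: hy].
by have [_ _ h] := HM.1; apply: h; [exact: hx|exact: hy].
Qed.

Lemma field_gen_mem (X : set R) x : X x -> field_gen X x.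
Proof. by move=> Xx M [_ sub]; exact: sub. Qed.

Lemma field_gen_min (X M : set R) : is_subfield M -> X `<=` M -> field_gen X `<=` M.
Proof. by move=> HM sub x; apply. Qed.

(** The reals algebraic over the field of the independent coordinates form a field that contains all
    coordinates, hence everything they generate. *)
Lemma trdeg_basis M r (b : 'I_M -> R) (f : 'I_r -> 'I_M) :
  indep (fun i => b (f i)) ->
  (forall j, exists P : {poly mpoly.mpoly r rat},
    evy (mpoly.mmap (@ratr R) (fun i => b (f i))) (b j) P = 0 /\
    map_poly (mpoly.mmap (@ratr R) (fun i => b (f i))) P != 0) ->
  trdeg (field_gen (range b)) r.
Proof.
move=> ind alg; exists (fun i => b (f i)); split=> [i|p|].
- by apply: field_gen_mem; exists (f i).
- rewrite /qpoly_eval => h; apply: ind; rewrite -[RHS]h; congr (mpoly.mmap _ _ _).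
  by apply/funext => i; rewrite mxE.
have sf := field_gen_subfield (range (fun i => b (f i))).
apply: field_gen_min; first exact: alg_over_subfield.
move=> _ [j _ <-]; have [P [P0 Pn]] := alg j.
exists (map_poly (mpoly.mmap (@ratr R) (fun i => b (f i))) P); split => //.
  move=> i; rewrite coef_map; apply: subfield_mev => // l.
  by apply: field_gen_mem; exists l.
by rewrite /root; apply/eqP.
Qed.
End TranscendenceDegree.

Lemma perturbed_generic (R : realType) (C : func_system R)
    (Sigma : pred nat) (eta : idx Sigma -> nat)
    (rho : forall s : idx Sigma, (eta s).-tuple rat)
    (S : fun_family R eta) (e pe : prog) (eps : tolerance eta) :
  quasianalytic_IF_system C -> computable_index_data rho ->
  is_family C rho S -> approx_algorithm rho S e ->
  tol_pos eps -> tol_computed_by eps pe ->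
  (forall s, C (eta s) (rho s) (perturbed rho S e pe (s := s))) ->
  generic rho (perturbed rho S e pe).
Proof.
move=> CI idxD SC Se eps0 epe TC m n N a _ isN ns dist.
set b := nameF rho _ N a 0.
have [r [f [ind alg]]] := transcendence_basis b.
have aD : bm_set (nm_mfd N) a by case: ns.
have nr : (n <= r)%N := lower_bound CI idxD SC Se eps0 epe isN aD dist ind alg.
have sm s : smooth_on (cbox (rho s)) (perturbed rho S e pe (s := s)).
  by apply: (ifs_smooth CI _ (TC s)); case: idxD => _ _ _ h; exact: h.
have rn : (r <= n)%N := nonsingular_bound sm isN ns ind.
have H := trdeg_basis ind alg.
suff rE : r = n by rewrite rE in H.
by apply/eqP; rewrite eqn_leq rn.
Qed.

Theorem theorem2 (R : realType) (C : func_system R)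
    (Sigma : pred nat) (eta : idx Sigma -> nat)
    (rho : forall s : idx Sigma, (eta s).-tuple rat) :
  quasianalytic_IF_system C ->
  computable_index_data rho ->
  (forall (n : nat) (r : n.-tuple rat), posq r ->
     @comp_analytic R n r `<=` C n r) ->
  CompC_dense C rho (CompC C rho `&` GenC C rho) /\
  exists A : prog,
    forall (a b : prog) (S : fun_family R eta) (eps : tolerance eta),
      CompC C rho S -> approx_algorithm rho S a ->
      tol_pos eps -> tol_computed_by eps b ->
      exists (t : prog) (T : fun_family R eta),
        [/\ evaluates A (cpair (code_prog a) (code_prog b)) (code_prog t),
            approx_algorithm rho T t
          & (GenC C rho `&` BallC C rho S eps) T].
Proof.
move=> CI idxD CA.
have [TP [[A HA] HTP]] := query_program (cf_Sigma idxD) (cf_et idxD) (cf_rh idxD).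
have main (a b : prog) (S : fun_family R eta) (eps : tolerance eta) :
    CompC C rho S -> approx_algorithm rho S a -> tol_pos eps -> tol_computed_by eps b ->
    exists (t : prog) (T : fun_family R eta),
      [/\ evaluates A (cpair (code_prog a) (code_prog b)) (code_prog t),
          approx_algorithm rho T t
        & (GenC C rho `&` BallC C rho S eps) T].
  move=> [SC _] Sa eps0 epb.
  have TC s : C (eta s) (rho s) (perturbed rho S a b (s := s)).
    exact: (perturbed_in CI idxD CA SC Sa eps0 epb HTP).
  exists (TP (code_prog a) (code_prog a) (code_prog b)), (perturbed rho S a b); split.
  - exact: (HA (code_prog a, code_prog b)).
  - exact: (perturbed_alg CI idxD SC Sa eps0 epb HTP).
  split; last exact: (perturbed_ball CI idxD CA SC Sa eps0 epb HTP).
  by split; [exact: TC|exact: (perturbed_generic CI idxD SC Sa eps0 epb TC)].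
split; last by exists A.
split=> [T [] //|O [T OT] [F FB OE]].
(* A nonempty open set contains a basic ball; its centre and its radius come with programs, to which
   [main] applies. *)
have [V FV VT] : exists2 V, F V & V T by move: OT; rewrite OE => -[V FV VT]; exists V.
have [S [eps [SC eps0 [b epb] VE]]] := FB V FV.
have [a Sa] := SC.2.
have [t [T' [_ _ [gT bT]]]] := main a b S eps SC Sa eps0 epb.
exists T'; split; first by rewrite OE; exists V => //; rewrite VE.
by split => //; case: bT.
Qed.
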